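(* Let $0<R_1<R_2$ and $P=\prod_{p\text{ odd}}\left(1-6p^{-2}+8p^{-3}-3p^{-4}\right)$. (1) The number of $V_4$-quartic fields $K$ in which $2$ is ramified, with $\Delta_K<X$ and $\mathrm{sh}(K)\in W_{oC}(R_1,R_2)$, is $\frac{5}{48}P\,X^{1/2}\mu_{oC}(W_{oC}(R_1,R_2))+o(X^{1/2})$. (2) Assume moreover $R_2<1$. The number of $V_4$-quartic fields $K$ in which $2$ is unramified, with $\Delta_K<X$ and $\mathrm{sh}(K)\in W_{oI}(R_1,R_2)$, is $\frac{1}{6}P\,X^{1/2}\mu_{oI}(W_{oI}(R_1,R_2))+o(X^{1/2})$.
   Context: A $V_4$-quartic field is a Galois quartic field over $\mathbf{Q}$ with group $C_2\times C_2$ (counted up to isomorphism). Shape of a number field $K$ of degree $n$: the class, under orthogonal transformations and scalings by nonzero reals, of the lattice $j(\mathcal{O}_K^\perp)$, where $j$ is the Minkowski embedding with inner product $\sum x_i\overline{y_i}$ and $\mathcal{O}_K^\perp=\{n\alpha-\mathrm{tr}(\alpha):\alpha\in\mathcal{O}_K\}$. For $x,y>0$, $\mathrm{sh}_{oC}(x,y)$ is the shape of $\mathbf{Z}(x,0,0)+\mathbf{Z}(0,y,0)+\mathbf{Z}(0,0,1)+\mathbf{Z}(x/2,y/2,0)$ and $\mathrm{sh}_{oI}(x,y)$ the shape of $\mathbf{Z}(x,0,0)+\mathbf{Z}(0,y,0)+\mathbf{Z}(0,0,1)+\mathbf{Z}(x/2,y/2,1/2)$; $\mathcal{S}_{oC}=\{\mathrm{sh}_{oC}(x,y):0<x\le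 y\}$ and $\mathcal{S}_{oI}=\{\mathrm{sh}_{oI}(x,y):0<x<y<1\}$ are parametrized bijectively by these coordinates, with measures $d\mu_{oC}=d\mu_{oI}=dx\,dy/(xy)$. Define $W_{oC}(R_1,R_2)=\{\mathrm{sh}_{oC}(x,y):R_1\le x\le y<R_2\}$ and, for $R_1<R_2$ in $(0,1)$, $W_{oI}(R_1,R_2)=\{\mathrm{sh}_{oI}(x,y):R_1\le x<y<R_2\}$. *)

(* Defs.v *)
From HB Require Import structures.
From mathcomp Require Import all_boot all_order all_algebra.
From mathcomp Require Import all_fingroup all_solvable all_field.
From mathcomp Require Import complex.
From mathcomp Require Import all_classical all_reals all_analysis.

Set Implicit Arguments.
Unset Strict Implicit.
Unset Printing Implicit Defensive.

Import Order.TTheory GRing.Theory Num.Theory.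
Import numFieldNormedType.Exports.

Local Open Scope classical_set_scope.
Local Open Scope ring_scope.

Section NumberFields.
Variable K : fieldExtType rat.

Definition field_trace (a : K) : rat :=
  \tr (\matrix_(i < \dim {:K}, j < \dim {:K})
         coord (vbasis {:K}) j ((vbasis {:K})`_i * a)).

Definition ring_of_integers : set K :=
  [set a | integralOver (intr : int -> K) a].

Definition integral_basis (w : (\dim {:K}).-tuple K) : Prop :=
  basis_of {:K} w /\ forall a, ring_of_integers a <-> inIntSpan w a.

(* The determinant does not depend on the integral basis. The default value 0
   is never used, since every number field has an integral basis. *)
Definition discriminant : rat :=
  xget 0 [set d | exists2 w, integral_basis w &
    d = \det (\matrix_(i < \dim {:K}, j < \dim {:K})
                field_trace (w`_i * w`_j))].

Definition is_ideal (I : set K) : Prop :=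
  [/\ I `<=` ring_of_integers, I 0, forall a b, I a -> I b -> I (a + b)
    & forall r a, ring_of_integers r -> I a -> I (r * a)].

Definition is_prime_ideal (P : set K) : Prop :=
  [/\ is_ideal P, ~ P 1
    & forall a b, ring_of_integers a -> ring_of_integers b ->
        P (a * b) -> P a \/ P b].

Definition ideal_mul (I J : set K) : set K :=
  [set x | exists n (a b : 'I_n -> K),
     [/\ forall i, I (a i), forall i, J (b i) & x = \sum_(i < n) a i * b i]].

(* Some prime ideal occurs with exponent at least 2 in the factorization of
   the ideal generated by p; such an ideal is nonzero when p is. *)
Definition ramified (p : nat) : Prop :=
  exists P J, [/\ is_prime_ideal P, is_ideal J
    & ideal_mul (ideal_mul P P) J = [set p%:R * a | a in ring_of_integers]].

Definition O_perp : set K :=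
  [set (\dim {:K})%:R * a - (field_trace a)%:A | a in ring_of_integers].

End NumberFields.

Definition is_V4_quartic (K : splittingFieldType rat) : Prop :=
  [/\ \dim {:K} = 4%N, galois 1 {:K}
    & ('Gal({:K} / 1) \isog (finset.setT : {set 'Z_2 * 'Z_2}))%g].

Definition field_iso (K L : splittingFieldType rat) : Prop :=
  exists f : {rmorphism K -> L}, bijective f.

(* There are exactly n isomorphism classes of fields satisfying Q. *)
Definition num_iso_classes (Q : splittingFieldType rat -> Prop) (n : nat) : Prop :=
  exists F : 'I_n -> splittingFieldType rat,
    [/\ forall i, Q (F i), forall i j, field_iso (F i) (F j) -> i = j
      & forall K, Q K -> exists i, field_iso K (F i)].

Section Shapes.
Variable R : realType.

(* A shape of rank n is an equivalence class of lattices in R^n (row vectors),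
   hence a set of subsets of R^n. *)
Definition shape_class n := set (set 'rV[R]_n).

Definition shape_of_lattice n (L : set 'rV[R]_n) : shape_class n :=
  [set L' | exists (c : R) (O : 'M[R]_n),
     [/\ c != 0, O *m O^T = 1%:M & L' = [set c *: (v *m O) | v in L]]].

Definition is_enum_of_embeddings (K : fieldExtType rat) n
    (s : 'I_n -> {rmorphism K -> R[i]}) : Prop :=
  (forall i j, s i =1 s j -> i = j) /\
  (forall t : {rmorphism K -> R[i]}, exists i, t =1 s i).

Definition minkowski_embedding (K : fieldExtType rat) n
    (s : 'I_n -> {rmorphism K -> R[i]}) (a : K) : 'rV[R[i]]_n :=
  \row_(i < n) s i a.

(* For K of degree n + 1. The lattice j(O_K^perp) has rank n inside C^(n+1); its
   real span is identified with R^n through a real-linear isometric embedding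
   v |-> v *m B of R^n into C^(n+1), where "unitarymx" for the rectangular
   matrix B means that its rows are orthonormal for \sum_i x_i * (y_i)^*. *)
Definition shape_of_field n (K : fieldExtType rat) : shape_class n :=
  [set L | exists (s : 'I_n.+1 -> {rmorphism K -> R[i]})
             (B : 'M[R[i]]_(n, n.+1)) (c : R),
     [/\ is_enum_of_embeddings s, B \is unitarymx, c != 0
       & [set map_mx (real_complex R) v *m B | v in L] =
         [set real_complex R c *: minkowski_embedding s a | a in @O_perp K]]].

Definition vec3 (x y z : R) : 'rV[R]_3 := \row_(i < 3) [:: x; y; z]`_i.

Definition lattice_oC (x y : R) : set 'rV[R]_3 :=
  [set v | inIntSpan [tuple vec3 x 0 0; vec3 0 y 0; vec3 0 0 1;
                            vec3 (x / 2) (y / 2) 0] v].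

Definition lattice_oI (x y : R) : set 'rV[R]_3 :=
  [set v | inIntSpan [tuple vec3 x 0 0; vec3 0 y 0; vec3 0 0 1;
                            vec3 (x / 2) (y / 2) (1 / 2)] v].

Definition sh_oC (x y : R) : shape_class 3 := shape_of_lattice (lattice_oC x y).
Definition sh_oI (x y : R) : shape_class 3 := shape_of_lattice (lattice_oI x y).

(* The measures dx dy / (x y) on the spaces of shapes
   {sh_oC x y | 0 < x <= y} and {sh_oI x y | 0 < x < y < 1}, transported
   through the parametrizations. *)
Definition mu_oC (W : set (shape_class 3)) : \bar R :=
  (\int[lebesgue_measure \x lebesgue_measure]_(p in
      [set p : R * R | (0 < p.1 <= p.2)%R /\ W (sh_oC p.1 p.2)])
    ((p.1 * p.2)^-1)%R%:E)%E.

Definition mu_oI (W : set (shape_class 3)) : \bar R :=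
  (\int[lebesgue_measure \x lebesgue_measure]_(p in
      [set p : R * R | (0 < p.1 < p.2)%R /\ (p.2 < 1)%R /\
                       W (sh_oI p.1 p.2)])
    ((p.1 * p.2)^-1)%R%:E)%E.

Definition W_oC (R1 R2 : R) : set (shape_class 3) :=
  [set S | exists x y, R1 <= x <= y /\ y < R2 /\ S = sh_oC x y].

Definition W_oI (R1 R2 : R) : set (shape_class 3) :=
  [set S | exists x y, R1 <= x < y /\ y < R2 /\ S = sh_oI x y].

Definition P_const : R :=
  limn (fun n => \prod_(p < n | prime p && odd p)
     (1 - 6 * p%:R ^- 2 + 8 * p%:R ^- 3 - 3 * p%:R ^- 4) : R).

End Shapes.

Arguments shape_of_field R n K : clear implicits.

(* Lets the "=o_" notation be used with the filter of neighborhoods of +oo. *)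
Canonical pinfty_filter_on (R : numFieldType) : filter_on R :=
  FilterType (pinfty_nbhs R) (@filter_filter R _ proper_pinfty_nbhs).

(* Main.v *)
(* A V_4-quartic field has a basis 1, a, b, c with a^2 = BC, b^2 = AC, c^2 = AB for
   pairwise coprime squarefree integers A, B, C, unique up to order and a common
   sign.  Normalizing residues modulo 4 leaves three types: typeU (2 unramified),
   typeR2 and typeR1 (2 ramified).  Explicit integral bases give the discriminants
   (ABC)^2, 16 (ABC)^2, 64 (ABC)^2 and the shapes sh_oI(x, y), sh_oC(2x, 2y),
   sh_oC(x, y), where x = sqrt|A/B| and y = sqrt|A/C|; the coordinates are recovered
   from a shape through reflection vectors and orthogonal summands of the lattice.
   Hence fields correspond, up to boundedly many exceptions, to triples (a, b, c) of
   natural numbers in a region r1 b <= a, c <= b, a < r2 c, abc < T, subject to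
   congruences modulo 4 and to being squarefree and pairwise coprime.  Sieving by
   the odd primes p, with local densities (1 - 1/p)^3 (1 + 3/p), gives the density of
   such triples in boxes, and a multiplicative grid of ratio tending to 1 exhausts
   the region, whose volume is T ln(r2/r1)^2 / 6. *)

Require Import Defs.
From HB Require Import structures.
From mathcomp Require Import all_boot all_order all_algebra.
From mathcomp Require Import all_fingroup all_solvable all_field.
From mathcomp Require Import complex.
From mathcomp Require Import all_classical all_reals all_analysis.
From mathcomp Require Import measurable_realfun.
From mathcomp Require Import ring lra zify.
Set Implicit Arguments.
Unset Strict Implicit.
Unset Printing Implicit Defensive.
Import Order.TTheory GRing.Theory Num.Theory.
Import numFieldNormedType.Exports.
Local Open Scope classical_set_scope.
Local Open Scope ring_scope.

(** * Biquadratic bases *)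

(** The window bounds a/b from below and a/c from above while c <= b, so a, b and c stay comparable:
    the region lies in a cube of side O(T^(1/3)) and there is no cusp to estimate. The obstacle is
    the sieve by infinitely many primes. Finitely many conditions are periodic and equidistribute in
    boxes; the primes beyond z spoil at most O(t^3 / z) + O(t^2) points of a cube of side t,
    uniformly, so z can go to infinity after t. Since abc < T is not a product condition, boxes have
    to exhaust the region. Ramification is defined through a factorization of ideals. For the
    ramified types a prime P and a cofactor J are therefore exhibited: J is the quotient of (2) by
    P^2, and it is enough that P^2 J contain some 2 + 4h with h integral. For the unramified type it
    is enough that O / 2O is reduced. *)

Record biq (L : comNzRingType) (A B C : int) (a b c : L) : Prop := Biq {
  biq_aa : a * a = (B * C)%:~R;
  biq_bb : b * b = (A * C)%:~R;
  biq_cc : c * c = (A * B)%:~R;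
  biq_ab : a * b = C%:~R * c;
  biq_ac : a * c = B%:~R * b;
  biq_bc : b * c = A%:~R * a }.

(** The coefficients pass through a morphism [f], so that one formula serves number fields
    ([in_alg]) and the complex numbers ([ratr]). *)
Definition lin4 (L : comNzRingType) (f : rat -> L) (a b c : L) w x y z :=
  f w + f x * a + f y * b + f z * c.

Lemma lin4_mul (L : comNzRingType) (f : {rmorphism rat -> L}) A B C (a b c : L)
    w x y z w' x' y' z' : biq A B C a b c ->
  lin4 f a b c w x y z * lin4 f a b c w' x' y' z' =
  lin4 f a b c
   (w * w' + B%:~R * C%:~R * x * x' + A%:~R * C%:~R * y * y' + A%:~R * B%:~R * z * z')
   (w * x' + x * w' + A%:~R * (y * z' + z * y'))
   (w * y' + y * w' + B%:~R * (x * z' + z * x'))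
   (w * z' + z * w' + C%:~R * (x * y' + y * x')).
Proof.
move=> [aa bb cc ab ac bc]; rewrite /lin4.
have E : forall (p0 p1 p2 p3 q0 q1 q2 q3 : L),
  (p0 + p1 * a + p2 * b + p3 * c) * (q0 + q1 * a + q2 * b + q3 * c) =
  p0 * q0 + p0 * q1 * a + p0 * q2 * b + p0 * q3 * c + p1 * q0 * a + p2 * q0 * b
  + p3 * q0 * c + p1 * q1 * (a * a) + p2 * q2 * (b * b) + p3 * q3 * (c * c)
  + (p1 * q2 + p2 * q1) * (a * b) + (p1 * q3 + p3 * q1) * (a * c)
  + (p2 * q3 + p3 * q2) * (b * c) by move=> *; ring.
rewrite E aa bb cc ab ac bc; ring.
Qed.

Lemma lin4D (L : comNzRingType) (f : {rmorphism rat -> L}) (a b c : L)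
    w x y z w' x' y' z' :
  lin4 f a b c w x y z + lin4 f a b c w' x' y' z' =
  lin4 f a b c (w + w') (x + x') (y + y') (z + z').
Proof. by rewrite /lin4; ring. Qed.

(** The sign changes that preserve the table form a Klein four-group; through [biq_extend] they
    become the Galois group and relate the complex embeddings. *)
Lemma biq_conj (L : comNzRingType) A B C (a b c : L) (s t : bool) :
  biq A B C a b c ->
  biq A B C ((-1) ^+ s * a) ((-1) ^+ t * b) ((-1) ^+ (s (+) t) * c).
Proof.
move=> [aa bb cc ab ac bc].
by case: s; case: t; split; rewrite /= ?expr0 ?expr1 ?mul1r ?mulN1r ?mulrNN ?mulrN ?mulNr
  ?opprK ?aa ?bb ?cc ?ab ?ac ?bc.
Qed.

Lemma biq_rmorph (L M : comNzRingType) (f : {rmorphism L -> M}) A B C (a b c : L) :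
  biq A B C a b c -> biq A B C (f a) (f b) (f c).
Proof.
move=> [aa bb cc ab ac bc]; split; rewrite -rmorphM ?aa ?bb ?cc ?ab ?ac ?bc;
by rewrite ?rmorphM ?rmorph_int.
Qed.

Definition biq_field (K : fieldExtType rat) A B C (a b c : K) :=
  biq A B C a b c /\ basis_of {:K} [:: 1; a; b; c].

Notation lin4K := (lin4 (in_alg _)).

Section BiquadField.
Variables (K : fieldExtType rat) (A B C : int) (a b c : K).
Hypothesis hK : biq_field A B C a b c.
Let E := [tuple 1; a; b; c].

Lemma biq_sum (e : 'I_4 -> rat) :
  \sum_(i < 4) e i *: E`_i =
  lin4K a b c (e 0) (e 1) (e 2) (e 3).
Proof.
rewrite !big_ord_recl big_ord0 addr0 /lin4 /= !mulr_algl !addrA.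
by congr (_ + _ *: _ + _ *: _ + _ *: _); congr (e _); apply: val_inj.
Qed.

Lemma biq_span v : exists w x y z, v = lin4K a b c w x y z.
Proof.
have [_ bE] := hK.
have := @coord_basis _ _ _ _ E v bE (memvf v); rewrite biq_sum => ->.
by do 4!eexists.
Qed.

Lemma biq_coord w x y z : 
  [/\ coord E 0 (lin4K a b c w x y z) = w, coord E 1 (lin4K a b c w x y z) = x,
      coord E 2 (lin4K a b c w x y z) = y & coord E 3 (lin4K a b c w x y z) = z].
Proof.
have [_ bE] := hK; have fE : free E := basis_free bE.
pose e (i : 'I_4) := [:: w; x; y; z]`_i.
have <- : \sum_(i < 4) e i *: E`_i = lin4K a b c w x y z by rewrite biq_sum.
by rewrite !coord_sum_free.
Qed.

Lemma biq_inj w x y z w' x' y' z' :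
  lin4K a b c w x y z = lin4K a b c w' x' y' z' ->
  [/\ w = w', x = x', y = y' & z = z'].
Proof.
move=> e; have [e0 e1 e2 e3] := biq_coord w x y z.
have [f0 f1 f2 f3] := biq_coord w' x' y' z'.
by split; [rewrite -e0 -f0|rewrite -e1 -f1|rewrite -e2 -f2|rewrite -e3 -f3]; rewrite e.
Qed.

(** The table of [biq] determines all products of basis elements, so every solution of it in [L] is
    the image of (a, b, c) under a morphism. Conjugations, complex embeddings and isomorphisms are
    all obtained in this way. *)
Lemma biq_extend (L : comNzRingType) (g : {rmorphism rat -> L}) (a' b' c' : L) :
  biq A B C a' b' c' ->
  exists phi : {rmorphism K -> L}, forall w x y z,
    phi (lin4K a b c w x y z) = lin4 g a' b' c' w x y z.
Proof.
move=> h'.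
pose h v := lin4 g a' b' c' (coord E 0 v) (coord E 1 v) (coord E 2 v) (coord E 3 v).
have hE w x y z : h (lin4K a b c w x y z) = lin4 g a' b' c' w x y z.
  by rewrite /h; case: (biq_coord w x y z) => -> -> -> ->.
have h1 : h 1 = 1.
  have -> : 1 = lin4K a b c 1 0 0 0 by rewrite /lin4 !rmorph1 !rmorph0; ring.
  by rewrite hE /lin4 !rmorph1 !rmorph0; ring.
have hA : zmod_morphism h.
  move=> u v; have [w [x [y [z ->]]]] := biq_span u.
  have [w' [x' [y' [z' ->]]]] := biq_span v.
  have -> : lin4K a b c w x y z - lin4K a b c w' x' y' z' =
    lin4K a b c (w - w') (x - x') (y - y') (z - z') by rewrite /lin4; ring.
  by rewrite !hE /lin4; ring.
have hM : monoid_morphism h.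
  split=> // u v; have [w [x [y [z ->]]]] := biq_span u.
  have [w' [x' [y' [z' ->]]]] := biq_span v.
  by rewrite (lin4_mul _ _ _ _ _ _ _ _ _ hK.1) !hE (lin4_mul _ _ _ _ _ _ _ _ _ h').
pose phi : {rmorphism K -> L} := HB.pack h
  (GRing.isZmodMorphism.Build K L h hA) (GRing.isMonoidMorphism.Build K L h hM).
by exists phi; exact: hE.
Qed.

Lemma biq_rmorph_lin (L : fieldType) (g : {rmorphism rat -> L})
    (phi : {rmorphism K -> L}) w x y z :
  phi (lin4K a b c w x y z) = lin4 g (phi a) (phi b) (phi c) w x y z.
Proof.
have e q : phi (in_alg K q) = g q.
  by rewrite (fmorph_eq_rat g) -(fmorph_eq_rat (phi \o in_alg K)).
by rewrite /lin4 !rmorphD !rmorphM !e.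
Qed.

End BiquadField.

Lemma biq_field_swap12 (K : fieldExtType rat) A B C (a b c : K) :
  biq_field A B C a b c -> biq_field B A C b a c.
Proof.
move=> [[aa bb cc ab ac bc] h]; split.
  by split; rewrite // ?[b * a]mulrC // cc mulrC.
rewrite -(perm_basis (X := [:: 1; a; b; c])) //; apply/seq.permP => P /=; lia.
Qed.

Lemma biq_field_swap23 (K : fieldExtType rat) A B C (a b c : K) :
  biq_field A B C a b c -> biq_field A C B a c b.
Proof.
move=> [[aa bb cc ab ac bc] h]; split.
  by split; rewrite // ?[c * b]mulrC // aa mulrC.
rewrite -(perm_basis (X := [:: 1; a; b; c])) //; apply/seq.permP => P /=; lia.
Qed.

Lemma biq_fieldN (K : fieldExtType rat) A B C (a b c : K) :
  biq_field A B C a b c -> biq_field (- A) (- B) (- C) (- a) (- b) (- c).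
Proof.
move=> [[aa bb cc ab ac bc] h]; split.
  by split; rewrite ?mulrNN //; rewrite rmorphN /= mulrNN.
move: h; rewrite !basisEdim !size_tuple => /andP[h ->]; rewrite andbT.
apply: (subv_trans h); apply/span_subvP => v; rewrite !inE.
case/or4P => /eqP ->; first by rewrite memv_span ?inE ?eqxx.
all: by rewrite -memvN memv_span // !inE eqxx ?orbT.
Qed.

(** * Squarefree integers and admissible triples *)

Definition sqf (n : nat) : bool :=
  (0 < n)%N && all (fun p => ~~ (p ^ 2 %| n)%N) (primes n).

Lemma sqfP n : reflect ((0 < n)%N /\ forall p, prime p -> ~~ (p ^ 2 %| n)%N) (sqf n).
Proof.
apply: (iffP andP) => -[n0 h]; split => //.
  move=> p pp; apply/negP => pn; move: (allP h p).
  by rewrite mem_primes pp n0 (dvdn_trans _ pn) ?dvdn_exp // pn => /(_ isT).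
by apply/allP => p; rewrite mem_primes => /and3P[pp _ _]; exact: h.
Qed.

Lemma sqf_gt0 n : sqf n -> (0 < n)%N. Proof. by case/andP. Qed.

Lemma sqfP_sq n d : sqf n -> (d ^ 2 %| n)%N -> d = 1%N.
Proof.
move=> /sqfP[n0 h] dn; apply/eqP; rewrite eqn_leq; apply/andP; split; last first.
  by rewrite lt0n; apply/eqP => d0; move: dn n0; rewrite d0 dvd0n => /eqP ->.
rewrite leqNgt; apply/negP => d1; have := h _ (pdiv_prime d1).
by rewrite (dvdn_trans _ dn) // dvdn_exp2r // pdiv_dvd.
Qed.

Lemma sqf_dvd m n : (m %| n)%N -> sqf n -> sqf m.
Proof.
move=> mn /sqfP[n0 h]; apply/sqfP; split; first exact: dvdn_gt0 mn.
by move=> p pp; apply: contra (h p pp) => pm; apply: dvdn_trans mn.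
Qed.

Lemma sqfM m n : coprime m n -> sqf m -> sqf n -> sqf (m * n).
Proof.
move=> co /sqfP[m0 hm] /sqfP[n0 hn]; apply/sqfP; split; first by rewrite muln_gt0 m0.
move=> p pp; apply/negP => pmn.
have [pm|pm] := boolP (p %| m)%N.
  have pn : coprime (p ^ 2) n.
    by rewrite coprimeXl // prime_coprime //; apply/negP => pn;
      have := dvdn_gcd p m n; rewrite pm pn (eqP co) dvdn1 => /eqP p1; move: pp; rewrite p1.
  by move: pmn; rewrite Gauss_dvdl // (negbTE (hm _ pp)).
have pm' : coprime (p ^ 2) m by rewrite coprimeXl // prime_coprime.
by move: pmn; rewrite Gauss_dvdr // (negbTE (hn _ pp)).
Qed.

(** The square of the denominator of r is coprime to that of the numerator, so it divides m and must
    be 1. *)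
Lemma sqf_rat_int (m : int) (r : rat) : sqf `|m|%N -> r * r * m%:~R \is a Num.int ->
  r \is a Num.int.
Proof.
move=> sm /intrP[k e].
have qn0 : (denq r)%:~R != 0 :> rat by rewrite intr_eq0 denq_eq0.
have e2 : numq r * numq r * m = k * (denq r * denq r).
  apply: (@intr_inj rat); rewrite !rmorphM /= -e.
  by rewrite numqE; ring.
have : (`|denq r| ^ 2 %| `|m|)%N.
  have co : coprime (`|denq r| ^ 2) (`|numq r| ^ 2).
    by rewrite coprimeXl // coprimeXr // coprime_sym coprime_num_den.
  rewrite -(Gauss_dvdr _ co); have -> : (`|numq r| ^ 2 * `|m|)%N = absz (numq r * numq r * m)
    by rewrite !abszM; lia.
  by rewrite e2 abszM !abszM mulnC dvdn_mulr.
move/(sqfP_sq sm) => d1; have dq : denq r = 1.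
  by have := denq_gt0 r; lia.
by apply/intrP; exists (numq r); rewrite -[LHS]divq_num_den dq divr1.
Qed.

(** Both r and 1/r are integers by [sqf_rat_int], so r is a sign. Thus squarefree integers represent
    the rationals modulo squares without repetition. *)
Lemma sqf_eq (m n : int) (r : rat) : sqf `|m|%N -> sqf `|n|%N ->
  m%:~R = r * r * n%:~R -> m = n.
Proof.
move=> sm sn e.
have r0 : r != 0.
  apply/eqP => r0; move: e; rewrite r0 !mul0r => /eqP; rewrite intr_eq0 => /eqP m0.
  by move: (sqf_gt0 sm); rewrite m0.
have /intrP[k hk] : r \is a Num.int by apply: (sqf_rat_int sn); rewrite -e; apply: intr_int.
have /intrP[l hl] : r^-1 \is a Num.int.
  apply: (sqf_rat_int sm); rewrite e.
  have -> : r^-1 / r * (r * r * n%:~R) = n%:~R by field.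
  exact: intr_int.
have kl : k * l = 1 by apply: (@intr_inj rat); rewrite rmorphM /= -hk -hl mulfV.
have kk : k * k = 1.
  have : (absz k * absz l = 1)%N by rewrite -abszM kl.
  by move=> /eqP; rewrite muln_eq1 => /andP[/eqP k1 _]; lia.
by apply: (@intr_inj rat); rewrite e hk -rmorphM /= kk mul1r.
Qed.

(** As BC, AC and AB are squarefree, being different from 1 means not being a square; this is what
    makes 1, a, b, c independent over Q. *)
Record admissible (A B C : int) : Prop := Admissible {
  adm_A : sqf `|A|%N; adm_B : sqf `|B|%N; adm_C : sqf `|C|%N;
  adm_AB : coprime `|A| `|B|; adm_AC : coprime `|A| `|C|; adm_BC : coprime `|B| `|C|;
  adm_BC1 : B * C != 1; adm_AC1 : A * C != 1; adm_AB1 : A * B != 1 }.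

Lemma admissible_swap12 A B C : admissible A B C -> admissible B A C.
Proof. by case=> *; split=> //; rewrite 1?coprime_sym // mulrC. Qed.

Lemma admissible_swap23 A B C : admissible A B C -> admissible A C B.
Proof. by case=> *; split=> //; rewrite 1?coprime_sym // mulrC. Qed.

Lemma admissibleN A B C : admissible A B C -> admissible (- A) (- B) (- C).
Proof. by case=> *; split; rewrite ?abszN ?mulrNN. Qed.

Lemma admissible_sqfBC A B C : admissible A B C -> sqf (absz (B * C)).
Proof. by case=> *; rewrite abszM sqfM. Qed.

Section Integers.
Variable K : fieldExtType rat.
Local Notation O := (@ring_of_integers K).

Lemma int_add (u v : K) : O u -> O v -> O (u + v).
Proof. exact: integral_add. Qed.
Lemma int_sub (u v : K) : O u -> O v -> O (u - v).
Proof. exact: integral_sub. Qed.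
Lemma int_mul (u v : K) : O u -> O v -> O (u * v).
Proof. exact: integral_mul. Qed.
Lemma int_intr (n : int) : O n%:~R.
Proof. exact: integral_id. Qed.
Lemma int_natr (n : nat) : O n%:R.
Proof. exact: integral_nat. Qed.
Lemma int_quadratic (u s t : K) : O s -> O t -> u * u = s * u + t -> O u.
Proof.
move=> hs ht e.
apply: (@integral_root_monic _ _ _ u ('X^2 - s *: 'X - t%:P)).
- rewrite monicE lead_coefE; have -> : size ('X^2 - s *: 'X - t%:P) = 3%N.
    rewrite -addrA size_polyDl ?size_polyXn //.
    rewrite (leq_ltn_trans (size_polyD _ _)) // gtn_max !size_polyN.
    rewrite (leq_ltn_trans (size_scale_leq _ _)) ?size_polyX //.
    by rewrite (leq_ltn_trans (size_polyC_leq1 _)).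
  by rewrite !coefE /= !mulr0 !subr0.
- by rewrite rootE !hornerE ?expr2 e; apply/eqP; ring.
- apply/integral_poly => i; rewrite !coefE.
  apply: int_sub; last by case: ifP => _ //; apply: (int_intr 0).
  by apply: int_sub; [exact: int_natr|apply: int_mul => //; exact: int_natr].
Qed.

Lemma int_rmorph (phi : {rmorphism K -> K}) u : O u -> O (phi u).
Proof.
move=> /(integral_rmorph phi).
rewrite /ring_of_integers /=; have -> // : phi \o intr = intr.
by apply/funext => n /=; rewrite rmorph_int.
Qed.

(** The monic equation is carried to the algebraic numbers, where a rational algebraic integer is an
    integer. *)
Lemma int_rat (q : rat) : O (in_alg K q) -> q \is a Num.int.
Proof.
move=> [p pm pr].
have pq : root (map_poly intr p) q.
  rewrite -(fmorph_root (in_alg K)) -map_poly_comp.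
  congr (root _ _): pr; apply: eq_map_poly => n /=.
  by rewrite /= -[RHS]/(in_alg K n%:~R) rmorph_int.
have : (ratr q : algC) \in Num.int.
  apply: Cint_rat_Aint; first exact: Crat_rat.
  apply: (@root_monic_Aint (map_poly intr p)).
  - by rewrite -(fmorph_root (@ratr algC)) -map_poly_comp in pq;
    congr (root _ _): pq; apply: eq_map_poly => n /=; rewrite ratr_int.
  - by rewrite monic_map.
  - by apply/polyOverP => i; rewrite coef_map /=; apply: intr_int.
by move=> /intrP[k]; rewrite -(ratr_int _ k) => /fmorph_inj ->; apply: intr_int.
Qed.

End Integers.

(** * Integral bases *)

(** Over 1, a, b, c the integers of the field have denominator dividing 4 ([int_quarters]), so four
    integers describe each of them. *)
Definition quarter (K : fieldExtType rat) (a b c : K) (W X Y Z : int) : K :=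
  lin4K a b c (W%:~R / 4) (X%:~R / 4) (Y%:~R / 4) (Z%:~R / 4).

Lemma quarterE (K : fieldExtType rat) (a b c : K) (W X Y Z : int) :
  4 * quarter a b c W X Y Z = W%:~R + X%:~R * a + Y%:~R * b + Z%:~R * c.
Proof.
have e (n : int) : 4 * in_alg K (n%:~R / 4) = n%:~R.
  by rewrite -(rmorph_nat (in_alg K)) -rmorphM /= mulrCA mulfV // mulr1 -[LHS]/(in_alg K n%:~R) rmorph_int.
by rewrite /quarter /lin4 !mulrDr !mulrA !e.
Qed.

Lemma four_neq0 (K : fieldExtType rat) : (4 : K) != 0.
Proof. by rewrite -(rmorph_nat (in_alg K)) fmorph_eq0. Qed.

Lemma quarterP (K : fieldExtType rat) (a b c : K) (W X Y Z : int) u :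
  4 * u = W%:~R + X%:~R * a + Y%:~R * b + Z%:~R * c -> u = quarter a b c W X Y Z.
Proof. by move=> h; apply: (mulfI (four_neq0 K)); rewrite h quarterE. Qed.

Lemma quarter_swap12 (K : fieldExtType rat) (a b c : K) W X Y Z :
  quarter a b c W X Y Z = quarter b a c W Y X Z.
Proof. by apply: quarterP; rewrite quarterE; ring. Qed.

Lemma quarterB (K : fieldExtType rat) (a b c : K) W X Y Z W' X' Y' Z' :
  quarter a b c W X Y Z - quarter a b c W' X' Y' Z' =
  quarter a b c (W - W') (X - X') (Y - Y') (Z - Z').
Proof. by apply: quarterP; rewrite mulrBr !quarterE; ring. Qed.

Lemma intr_quarter_int (n : int) : (n%:~R / 4 : rat) \is a Num.int -> exists k, n = 4 * k.
Proof.
by move=> /intrP[k e]; exists k; apply: (@intr_inj rat); rewrite rmorphM /= -e; field.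
Qed.

Lemma int_parity (n : int) : exists m, n = 2 * m \/ n = 2 * m + 1.
Proof. by exists (n %/ 2)%Z; lia. Qed.

Section BiquadIntegers.
Variables (K : fieldExtType rat) (A B C : int) (a b c : K).
Hypothesis hK : biq_field A B C a b c.
Local Notation O := (@ring_of_integers K).
Local Notation lin := (lin4K a b c).
Local Notation qt := (quarter a b c).

Lemma int_conj (s t : bool) w x y z : O (lin w x y z) ->
  O (lin w ((-1) ^+ s * x) ((-1) ^+ t * y) ((-1) ^+ (s (+) t) * z)).
Proof.
have [phi hphi] := biq_extend hK (in_alg K) (biq_conj s t hK.1).
move=> /(int_rmorph phi); rewrite hphi.
have e (u : bool) (q : rat) (v : K) :
    in_alg K ((-1) ^+ u * q) * v = in_alg K q * ((-1) ^+ u * v).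
  by case: u; rewrite ?expr0 ?expr1 ?mul1r ?mulN1r ?rmorphN //= mulNr mulrN.
by rewrite /lin4 -!e.
Qed.

(** These are the trace and the norm of w + x a from Q(a) to Q. *)
Lemma int_quad w x : O (lin w x 0 0) ->
  2 * w \is a Num.int /\ w * w - B%:~R * C%:~R * x * x \is a Num.int.
Proof.
move=> h; have := int_conj true false h.
rewrite /= expr0 expr1 !mulr0 mulN1r => h'.
have e : lin w x 0 0 + lin w (- x) 0 0 = in_alg K (2 * w).
  by rewrite lin4D /lin4; ring.
have f : lin w x 0 0 * lin w (- x) 0 0 = in_alg K (w * w - B%:~R * C%:~R * x * x).
  by rewrite (lin4_mul _ _ _ _ _ _ _ _ _ hK.1) /lin4; ring.
by split; apply: (@int_rat K); [rewrite -e; apply: int_add|rewrite -f; apply: int_mul].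
Qed.

(** Adding the conjugate that fixes a leaves 2w + 2x a in Q(a). Its trace is 4w, and its norm makes
    (4x)^2 BC an integer, so 4x is one because BC is squarefree. *)
Lemma int_quarter_x w x y z : sqf (absz (B * C)) -> O (lin w x y z) ->
  exists W X k : int, [/\ w = W%:~R / 4, x = X%:~R / 4 & W * W - B * C * X * X = 4 * k].
Proof.
move=> sBC h; have := int_add h (int_conj false true h).
rewrite lin4D /= !expr0 !expr1 !mul1r !mulN1r !subrr => /int_quad[/intrP[W hW] /intrP[k hk]].
have /intrP[X hX] : 4 * x \is a Num.int.
  apply: (sqf_rat_int sBC); rewrite rmorphM /=.
  have -> : 4 * x * (4 * x) * (B%:~R * C%:~R) = (W * W - 4 * k)%:~R.
    by rewrite rmorphB !rmorphM /= -hW -hk; ring.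
  exact: intr_int.
exists W, X, k; split.
- by rewrite -hW; field.
- by rewrite -hX; field.
- by apply: (@intr_inj rat); rewrite rmorphB !rmorphM /= -hW -hX -hk; ring.
Qed.

(** The relative norm of the element to Q(a) is (N + M a) / 16; the two conclusions are the
    integrality of the trace and of the norm of that element. *)
Lemma int_relnorm (W X Y Z : int) : O (qt W X Y Z) ->
  let N := W * W + B * C * X * X - A * C * Y * Y - A * B * Z * Z in
  let M := 2 * (W * X - A * Y * Z) in
  exists k l, N = 8 * k /\ N * N - B * C * M * M = 256 * l.
Proof.
move=> h N M; have := int_mul h (int_conj false true h).
rewrite /= !expr0 !expr1 !mul1r !mulN1r (lin4_mul _ _ _ _ _ _ _ _ _ hK.1).
rewrite /N /M; set u := lin _ _ _ _.
have {u} -> : u = lin (N%:~R / 16) (M%:~R / 16) 0 0.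
  rewrite /u /N /M; congr (lin4K a b c); by rewrite ?(rmorphB, rmorphD, rmorphM) /=; field.
rewrite -/N -/M => /int_quad[/intrP[k hk] /intrP[l hl]]; exists k, l; split.
  by apply: (@intr_inj rat); rewrite rmorphM /= -hk -/N; field.
apply: (@intr_inj rat); rewrite -/N -/M [in RHS]rmorphM /= -hl !(rmorphB, rmorphM) /=; by field.
Qed.

End BiquadIntegers.

Lemma int_quarters (K : fieldExtType rat) A B C (a b c : K) v :
  biq_field A B C a b c -> admissible A B C -> ring_of_integers v ->
  exists W X Y Z : int, [/\ v = quarter a b c W X Y Z,
     exists k, W * W - B * C * X * X = 4 * k, exists k, W * W - A * C * Y * Y = 4 * k
    & exists k, W * W - A * B * Z * Z = 4 * k].
Proof.
move=> hK hA; have [w [x [y [z ->]]]] := biq_span hK v; move=> hv.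
have [W [X [k [hW hX hk]]]] := int_quarter_x hK (admissible_sqfBC hA) hv.
have hv2 : ring_of_integers (lin4K b a c w y x z) by congr ring_of_integers: hv; rewrite /lin4; ring.
have [W2 [Y [k2 [hW2 hY hk2]]]] :=
  int_quarter_x (biq_field_swap12 hK) (admissible_sqfBC (admissible_swap12 hA)) hv2.
have hv3 : ring_of_integers (lin4K c a b w z x y) by congr ring_of_integers: hv; rewrite /lin4; ring.
have [W3 [Z [k3 [hW3 hZ hk3]]]] := int_quarter_x (biq_field_swap12 (biq_field_swap23 hK))
  (admissible_sqfBC (admissible_swap12 (admissible_swap23 hA))) hv3.
have inj (m n : int) : w = m%:~R / 4 -> w = n%:~R / 4 -> m = n.
  move=> -> e; apply: (@intr_inj rat); apply: (mulIf (_ : 4^-1 != 0)) => //.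
rewrite -(inj _ _ hW hW2) in hk2; rewrite -(inj _ _ hW hW3) in hk3.
exists W, X, Y, Z; split; [by rewrite /quarter hW hX hY hZ | by exists k | by exists k2 | by exists k3].
Qed.

Definition int_span4 (K : fieldExtType rat) (e1 e2 e3 v : K) : Prop :=
  exists i j k l : int, v = i%:~R + j%:~R * e1 + k%:~R * e2 + l%:~R * e3.

Lemma int_span4_int (K : fieldExtType rat) (e1 e2 e3 v : K) :
  ring_of_integers e1 -> ring_of_integers e2 -> ring_of_integers e3 ->
  int_span4 e1 e2 e3 v -> ring_of_integers v.
Proof.
move=> h1 h2 h3 [i [j [k [l ->]]]].
have hm n (u : K) : ring_of_integers u -> ring_of_integers (n%:~R * u).
  by move=> hu; apply: int_mul => //; apply: int_intr.
by do 3!(apply: int_add; last exact: hm); exact: int_intr.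
Qed.

Lemma mul4I (K : fieldExtType rat) (u v : K) : 4 * u * 4 = 4 * v * 4 -> u = v.
Proof. by move=> /(mulIf (four_neq0 K)) /(mulfI (four_neq0 K)). Qed.

Section Generators.
Variables (K : fieldExtType rat) (A B C : int) (a b c : K).
Hypothesis hK : biq_field A B C a b c.
Local Notation O := (@ring_of_integers K).

Lemma int_a : O a.
Proof.
apply: (@int_quadratic _ _ 0 ((B * C)%:~R)); [exact: (int_natr K 0)|exact: int_intr|].
by rewrite (biq_aa hK.1); ring.
Qed.

(** BC is 1 modulo 4, so (1 + a)/2 satisfies X^2 = X + (BC - 1)/4. *)
Lemma int_half_a (B' C' : int) : B = 4 * B' + 1 -> C = 4 * C' + 1 -> O (quarter a b c 2 2 0 0).
Proof.
move=> hB hC.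
apply: (@int_quadratic _ _ 1 ((4 * B' * C' + B' + C')%:~R)); [exact: (int_natr K 1)|exact: int_intr|].
apply: mul4I; have -> (u : K) : 4 * (u * u) * 4 = (4 * u) * (4 * u) by ring.
have -> (u w : K) : 4 * (1 * u + w) * 4 = 4 * (4 * u) + 16 * w by ring.
rewrite !quarterE; have := biq_aa hK.1; rewrite hB hC => e; ring: e.
Qed.

(** The square of (b + c)/2 is A (B + C + 2a)/4, which is A (B' + C') + A (1 + a)/2 here. *)
Lemma int_eta_odd (B' C' : int) : B = 4 * B' + 1 -> C = 4 * C' + 1 -> O (quarter a b c 0 0 2 2).
Proof.
move=> hB hC.
apply: (@int_quadratic _ _ 0 ((A * (B' + C'))%:~R + A%:~R * quarter a b c 2 2 0 0)).
- exact: (int_natr K 0).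
- apply: int_add; first exact: int_intr.
  by apply: int_mul; [exact: int_intr|exact: int_half_a hB hC].
apply: mul4I; have -> (u : K) : 4 * (u * u) * 4 = (4 * u) * (4 * u) by ring.
have -> : 4 * (0 * quarter a b c 0 0 2 2 + ((A * (B' + C'))%:~R + A%:~R * quarter a b c 2 2 0 0)) * 4
  = 16 * (A * (B' + C'))%:~R + 4 * A%:~R * (4 * quarter a b c 2 2 0 0) by ring.
rewrite !quarterE; have [_ bb cc _ _ bc] := hK.1; rewrite hB hC in bb cc bc *.
transitivity (4 * (b * b) + 4 * (c * c) + 8 * (b * c)); first by ring.
by rewrite bb cc bc; ring.
Qed.

(** The square of (b + c)/2 is A (B + C + 2a)/4 again; now B + C is divisible by 4 and A is even, so
    it lies in Z + Za. *)
Lemma int_eta_even (A' B' C' : int) : A = 4 * A' + 2 -> B = 4 * B' + 1 -> C = 4 * C' + 3 ->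
  O (quarter a b c 0 0 2 2).
Proof.
move=> hA hB hC.
apply: (@int_quadratic _ _ 0 ((A * (B' + C' + 1))%:~R + (2 * A' + 1)%:~R * a)).
- exact: (int_natr K 0).
- apply: int_add; first exact: int_intr.
  by apply: int_mul; [exact: int_intr|exact: int_a].
apply: mul4I; have -> (u : K) : 4 * (u * u) * 4 = (4 * u) * (4 * u) by ring.
rewrite !quarterE; have [_ bb cc _ _ bc] := hK.1; rewrite hA hB hC in bb cc bc *.
transitivity (4 * (b * b) + 4 * (c * c) + 8 * (b * c)); first by ring.
by rewrite bb cc bc; ring.
Qed.

End Generators.

Lemma int_b (K : fieldExtType rat) A B C (a b c : K) :
  biq_field A B C a b c -> ring_of_integers b.
Proof. by move=> /biq_field_swap12 /int_a. Qed.

Lemma int_c (K : fieldExtType rat) A B C (a b c : K) :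
  biq_field A B C a b c -> ring_of_integers c.
Proof. by move=> /biq_field_swap23 /int_b. Qed.

Lemma int_span4_quarter (K : fieldExtType rat) (a b c e1 e2 e3 : K)
  (W1 X1 Y1 Z1 W2 X2 Y2 Z2 W3 X3 Y3 Z3 : int) (i j k l : int) :
  e1 = quarter a b c W1 X1 Y1 Z1 -> e2 = quarter a b c W2 X2 Y2 Z2 ->
  e3 = quarter a b c W3 X3 Y3 Z3 ->
  i%:~R + j%:~R * e1 + k%:~R * e2 + l%:~R * e3 =
  quarter a b c (4 * i + j * W1 + k * W2 + l * W3) (j * X1 + k * X2 + l * X3)
    (j * Y1 + k * Y2 + l * Y3) (j * Z1 + k * Z2 + l * Z3).
Proof.
move=> h1 h2 h3; apply: quarterP.
have -> (u v w x y z p : K) : 4 * (u + v * w + x * y + z * p) =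
  4 * u + v * (4 * w) + x * (4 * y) + z * (4 * p) by ring.
rewrite h1 h2 h3 !quarterE; ring.
Qed.

Lemma int_quarter_rat (K : fieldExtType rat) (a b c : K) (W : int) :
  ring_of_integers (quarter a b c W 0 0 0) -> exists k, W = 4 * k.
Proof.
rewrite /quarter /lin4 => h; apply: intr_quarter_int; apply: (@int_rat K).
by congr ring_of_integers: h; ring.
Qed.

(** All three products are 1 modulo 4, so W, X, Y and Z have the same parity. Subtracting multiples
    of (1 + a + b + c)/4, (1 + a)/2 and (1 + b)/2 then leaves a rational number, which is
    integral. *)
Lemma integersU (K : fieldExtType rat) (A B C A' B' C' : int) (a b c v : K) :
  biq_field A B C a b c -> admissible A B C ->
  A = 4 * A' + 1 -> B = 4 * B' + 1 -> C = 4 * C' + 1 ->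
  (ring_of_integers v <->
   int_span4 (quarter a b c 2 2 0 0) (quarter a b c 2 0 2 0) (quarter a b c 1 1 1 1) v).
Proof.
move=> hK adm hA hB hC.
have h1 := int_half_a hK hB hC.
have h2 : ring_of_integers (quarter a b c 2 0 2 0).
  by rewrite quarter_swap12; apply: (int_half_a (biq_field_swap12 hK) hA hC).
have h3 : ring_of_integers (quarter a b c 1 1 1 1).
  (* The product of (1 + a)/2 and (1 + b)/2 is (1 + a + b + C c)/4, and C = 4 C' + 1. *)
  have -> : quarter a b c 1 1 1 1 = quarter a b c 2 2 0 0 * quarter a b c 2 0 2 0 - C'%:~R * c.
    apply: mul4I; have -> (s t w : K) : 4 * (s * t - w) * 4 = (4 * s) * (4 * t) - 16 * w by ring.
    by rewrite !quarterE; have := biq_ab hK.1; rewrite hC => e; ring: e.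
  apply: int_sub; first exact: int_mul.
  by apply: int_mul; [exact: int_intr|exact: int_c hK].
split; last exact: int_span4_int.
move=> hv; have [W [X [Y [Z [vE [k1 hk1] [k2 hk2] [k3 hk3]]]]]] := int_quarters hK adm hv.
have [j hj] : exists j, X = 2 * j + Z.
  have [x [ex|ex]] := int_parity X; have [z [ez|ez]] := int_parity Z;
  have [w [ew|ew]] := int_parity W; subst; first [by exists (x - z); lia | exfalso; lia].
have [k hk] : exists k, Y = 2 * k + Z.
  have [x [ex|ex]] := int_parity Y; have [z [ez|ez]] := int_parity Z;
  have [w [ew|ew]] := int_parity W; subst; first [by exists (x - z); lia | exfalso; lia].
have [i hi] : exists i, W - 2 * j - 2 * k - Z = 4 * i.
  apply: (@int_quarter_rat K a b c).
  have -> : quarter a b c (W - 2 * j - 2 * k - Z) 0 0 0 =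
    v - (0%:~R + j%:~R * quarter a b c 2 2 0 0 + k%:~R * quarter a b c 2 0 2 0 +
      Z%:~R * quarter a b c 1 1 1 1).
    rewrite (int_span4_quarter _ _ _ _ (erefl _) (erefl _) (erefl _)) vE quarterB.
    by congr quarter; lia.
  apply: int_sub => //; apply: (int_span4_int h1 h2 h3); by do 4!eexists.
exists i, j, k, Z; rewrite (int_span4_quarter _ _ _ _ (erefl _) (erefl _) (erefl _)) vE.
by congr quarter; lia.
Qed.

Lemma int_quarter_quad (K : fieldExtType rat) A B C (a b c : K) (W Y : int) :
  biq_field A B C a b c -> ring_of_integers (quarter a b c W 0 Y 0) ->
  exists k, W * W - A * C * Y * Y = 16 * k.
Proof.
move=> /biq_field_swap12 hK; rewrite quarter_swap12 => /(int_quad hK)[_ /intrP[k hk]].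
exists k; apply: (@intr_inj rat); rewrite [in RHS]rmorphM /= -hk !(rmorphB, rmorphM) /=.
by field.
Qed.

(** AC and AB are 2 or 3 modulo 4, so the congruences between squares force all four coordinates to
    be even. Subtracting multiples of (1 + a)/2 and (b + c)/2 leaves an integer of Q(b), whose ring
    of integers is Z[b] because AC is 2 or 3 modulo 4. *)
Lemma integersR2 (K : fieldExtType rat) (A B C A' B' C' r : int) (a b c v : K) :
  biq_field A B C a b c -> admissible A B C ->
  A = 4 * A' + r -> B = 4 * B' + 1 -> C = 4 * C' + 1 -> r = 2 \/ r = 3 ->
  (ring_of_integers v <->
   int_span4 (quarter a b c 2 2 0 0) b (quarter a b c 0 0 2 2) v).
Proof.
move=> hK adm hA hB hC hr.
have h1 := int_half_a hK hB hC.
have h2 := int_b hK.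
have h3 := int_eta_odd hK hB hC.
have be : b = quarter a b c 0 0 4 0 by apply: quarterP; ring.
split; last exact: int_span4_int.
move=> hv; have [W [X [Y [Z [vE [k1 hk1] [k2 hk2] [k3 hk3]]]]]] := int_quarters hK adm hv.
have [w hw] : exists w, W = 2 * w.
  have [x [ex|ex]] := int_parity W; first by exists x.
  have [z [ez|ez]] := int_parity Y; subst; case: hr => hr; subst; exfalso; lia.
have [j hj] : exists j, X = 2 * j.
  have [x [ex|ex]] := int_parity X; first by exists x.
  by subst; exfalso; lia.
have [y hy] : exists j, Y = 2 * j.
  have [x [ex|ex]] := int_parity Y; first by exists x.
  by subst; case: hr => hr; subst; exfalso; lia.
have [l hl] : exists j, Z = 2 * j.
  have [x [ex|ex]] := int_parity Z; first by exists x.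
  by subst; case: hr => hr; subst; exfalso; lia.
have [k4 hk4] : exists k4, (W - 2 * j) * (W - 2 * j) - A * C * (Y - Z) * (Y - Z) = 16 * k4.
  apply: (int_quarter_quad hK).
  have -> : quarter a b c (W - 2 * j) 0 (Y - Z) 0 =
    v - (0%:~R + j%:~R * quarter a b c 2 2 0 0 + 0%:~R * b +
      l%:~R * quarter a b c 0 0 2 2).
    rewrite (int_span4_quarter _ _ _ _ (erefl _) be (erefl _)) vE quarterB.
    by congr quarter; lia.
  apply: int_sub => //; apply: (int_span4_int h1 h2 h3); by do 4!eexists.
have [p hp] : exists p, w - j = 2 * p.
  have [p [ep|ep]] := int_parity (w - j); first by exists p.
  have [q [eq|eq]] := int_parity (y - l); exfalso.
  - have e1 : W - 2 * j = 2 * (2 * p + 1) by lia.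
    have e2 : Y - Z = 2 * (2 * q) by lia.
    by move: hk4; rewrite e1 e2; lia.
  - have e1 : W - 2 * j = 2 * (2 * p + 1) by lia.
    have e2 : Y - Z = 2 * (2 * q + 1) by lia.
    by move: hk4; rewrite e1 e2 hA hC; case: hr => ->; lia.
have [q hq] : exists q, y - l = 2 * q.
  have [q [eq|eq]] := int_parity (y - l); first by exists q.
  exfalso; have e1 : W - 2 * j = 2 * (2 * p) by lia.
  have e2 : Y - Z = 2 * (2 * q + 1) by lia.
  by move: hk4; rewrite e1 e2 hA hC; case: hr => ->; lia.
exists p, j, q, l; rewrite (int_span4_quarter _ _ _ _ (erefl _) be (erefl _)) vE.
by congr quarter; lia.
Qed.

(** None of the products is 1 modulo 4, so all coordinates are even. Once (b + c)/2 has been used to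
    clear c, the remainder still involves both a and b, and the congruences from the quadratic
    subfields no longer suffice: the relative norm of [int_relnorm] supplies the missing
    parities. *)
Lemma integersR1 (K : fieldExtType rat) (A B C A' B' C' : int) (a b c v : K) :
  biq_field A B C a b c -> admissible A B C ->
  A = 4 * A' + 2 -> B = 4 * B' + 1 -> C = 4 * C' + 3 ->
  (ring_of_integers v <->
   int_span4 a b (quarter a b c 0 0 2 2) v).
Proof.
move=> hK adm hA hB hC.
have h1 := int_a hK.
have h2 := int_b hK.
have h3 := int_eta_even hK hA hB hC.
have ae : a = quarter a b c 0 4 0 0 by apply: quarterP; ring.
have be : b = quarter a b c 0 0 4 0 by apply: quarterP; ring.
split; last exact: int_span4_int.
move=> hv; have [W [X [Y [Z [vE [k1 hk1] [k2 hk2] [k3 hk3]]]]]] := int_quarters hK adm hv.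
have [w hw] : exists w, W = 2 * w.
  have [x [ex|ex]] := int_parity W; first by exists x.
  by have [z [ez|ez]] := int_parity Y; subst; exfalso; lia.
have [x hx] : exists j, X = 2 * j.
  have [x [ex|ex]] := int_parity X; first by exists x.
  by subst; exfalso; lia.
have [y hy] : exists j, Y = 2 * j.
  have [y [ex|ex]] := int_parity Y; first by exists y.
  by subst; exfalso; lia.
have [l hl] : exists j, Z = 2 * j.
  have [z [ex|ex]] := int_parity Z; first by exists z.
  by subst; exfalso; lia.
have hu : ring_of_integers (quarter a b c W X (Y - Z) 0).
  have -> : quarter a b c W X (Y - Z) 0 =
    v - (0%:~R + 0%:~R * a + 0%:~R * b + l%:~R * quarter a b c 0 0 2 2).
    rewrite (int_span4_quarter _ _ _ _ ae be (erefl _)) vE quarterB.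
    by congr quarter; lia.
  apply: int_sub => //; apply: (int_span4_int h1 h2 h3); by do 4!eexists.
have [n [m [hn hm]]] := int_relnorm hK hu.
have hYZ : Y - Z = 2 * (y - l) by lia.
move: hn hm; rewrite hYZ hw hx; set d := y - l => hn hm.
have hn' : w * w + B * C * x * x - A * C * d * d = 2 * n by lia.
have hm' : n * n - B * C * (w * x) * (w * x) = 4 * m.
  have e : 2 * w * (2 * w) + B * C * (2 * x) * (2 * x) - A * C * (2 * d) * (2 * d)
     - A * B * 0 * 0 = 8 * n by lia.
  by rewrite e in hm; lia.
have [n' en] : exists n', n = 2 * n'.
  have [n' [e|e]] := int_parity n; first by exists n'.
  by exfalso; have [p [ep|ep]] := int_parity (w * x); rewrite ep in hm'; subst; lia.
have [d' ed] : exists d', d = 2 * d'.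
  have [d' [e|e]] := int_parity d; first by exists d'.
  exfalso; rewrite en e in hn'; have [w' [ew|ew]] := int_parity w;
  have [x' [ex|ex]] := int_parity x; rewrite ew ex in hn' hm'; subst; lia.
rewrite ed in hn'.
have [w' ew] : exists w', w = 2 * w'.
  have [w' [e|e]] := int_parity w; first by exists w'.
  exfalso; have [x' [ex|ex]] := int_parity x; rewrite e ex in hn' hm'; subst; lia.
have [x' ex] : exists x', x = 2 * x'.
  have [x' [e|e]] := int_parity x; first by exists x'.
  exfalso; rewrite ew e in hn' hm'; subst; lia.
exists w', x', d', l; rewrite (int_span4_quarter _ _ _ _ ae be (erefl _)) vE.
by congr quarter; lia.
Qed.

(** * Discriminants and ramification *)

Section TraceDisc.
Variable K : fieldExtType rat.
Local Notation n := (\dim {:K}).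

Lemma coord_span_full m (e : m.-tuple K) v : basis_of {:K} e ->
  v = \sum_(i < m) coord e i v *: e`_i.
Proof. by move=> be; apply: (coord_basis be); apply: memvf. Qed.

Lemma field_trace_basis m (e : m.-tuple K) a : basis_of {:K} e ->
  field_trace a = \sum_(i < m) coord e i (e`_i * a).
Proof.
move=> be; have hm : m = n by rewrite -(size_basis be).
subst m; rewrite /field_trace; set vb := vbasis {:K}.
have bv : basis_of {:K} vb := vbasisP _.
pose M := \matrix_(i < n, j < n) coord vb j (vb`_i * a).
pose N := \matrix_(i < n, j < n) coord e j (e`_i * a).
pose P := \matrix_(i < n, j < n) coord e j vb`_i.
pose Q := \matrix_(i < n, j < n) coord vb j e`_i.
have QP : Q *m P = 1%:M.
  apply/matrixP => i j; rewrite !mxE.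
  have -> : (i == j)%:R = coord e j e`_i by rewrite coord_free ?(basis_free be) // eq_sym.
  rewrite [in RHS](coord_span_full e`_i bv) linear_sum; apply: eq_bigr => k _.
  by rewrite !mxE linearZ.
have MP : M = P *m N *m Q.
  apply/matrixP => i j; rewrite !mxE.
  rewrite [in LHS](coord_span_full vb`_i be) mulr_suml.
  under eq_bigr do rewrite -scalerAl [X in _ *: X](coord_span_full _ be).
  rewrite linear_sum.
  under [RHS]eq_bigr do rewrite !mxE mulr_suml.
  rewrite exchange_big; apply: eq_bigr => k _ /=.
  rewrite linearZ /= linear_sum mulr_sumr; apply: eq_bigr => l _.
  by rewrite !mxE linearZ /= mulrA.
rewrite -/M MP -mulmxA mxtrace_mulC -mulmxA QP mulmx1.
by apply: eq_bigr => i _; rewrite mxE.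
Qed.

Lemma field_traceD (u v : K) : field_trace (u + v) = field_trace u + field_trace v.
Proof.
rewrite !(field_trace_basis _ (vbasisP {:K})) -big_split; apply: eq_bigr => i _.
by rewrite mulrDr linearD.
Qed.

Lemma field_traceZ q (u : K) : field_trace (q *: u) = q * field_trace u.
Proof.
rewrite !(field_trace_basis _ (vbasisP {:K})) mulr_sumr; apply: eq_bigr => i _.
by rewrite -scalerAr linearZ.
Qed.

Lemma field_trace0 : field_trace (0 : K) = 0.
Proof. by have := field_traceZ 0 0; rewrite scale0r mul0r. Qed.

Lemma field_trace_sum m (F : 'I_m -> K) :
  field_trace (\sum_(i < m) F i) = \sum_(i < m) field_trace (F i).
Proof.
by elim/big_rec2: _ => [|i y x _ <-]; rewrite ?field_trace0 ?field_traceD.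
Qed.

Definition gram m (e : m.-tuple K) : 'M[rat]_m :=
  \matrix_(i, j) field_trace (e`_i * e`_j).

Lemma gram_change m p (e : m.-tuple K) (f : p.-tuple K) (P : 'M[rat]_(p, m)) :
  (forall i : 'I_p, f`_i = \sum_(j < m) P i j *: e`_j) ->
  gram f = P *m gram e *m P^T.
Proof.
move=> hf; apply/matrixP => i j; rewrite !mxE !hf mulr_suml field_trace_sum.
under [RHS]eq_bigr do rewrite !mxE mulr_suml.
rewrite [RHS]exchange_big; apply: eq_bigr => k _ /=.
rewrite -scalerAl field_traceZ [e`_k * _]mulr_sumr field_trace_sum mulr_sumr.
apply: eq_bigr => l _; rewrite !mxE -scalerAr field_traceZ; ring.
Qed.

(** The two change of basis matrices are integral and inverse to each other, so their determinants
    are signs, and the Gram determinant changes by the square of a sign. *)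
Lemma integral_basis_gram (w e : n.-tuple K) : integral_basis w -> integral_basis e ->
  \det (gram w) = \det (gram e).
Proof.
move=> [bw hw] [be he].
have key (x y : n.-tuple K) : basis_of {:K} x -> (forall a, ring_of_integers a <-> inIntSpan x a) ->
    (forall a, ring_of_integers a <-> inIntSpan y a) ->
    exists P : 'M[int]_n, forall i : 'I_n, y`_i = \sum_(j < n) (map_mx intr P : 'M[rat]_n) i j *: x`_j.
  move=> bx hx hy.
  have h (i : 'I_n) : exists f : {ffun 'I_n -> int}, y`_i = \sum_(j < n) x`_j *~ f j.
    apply/hx/hy; exists [ffun j => (i == j)%:Z].
    rewrite (bigD1 i) //= ffunE eqxx big1 ?addr0 // => j ji.
    by rewrite ffunE eq_sym (negbTE ji).
  have [F hF] := boolp.choice h.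
  exists (\matrix_(i, j) F i j) => i; rewrite hF; apply: eq_bigr => j _.
  by rewrite !mxE scaler_int.
have [P hP] := key e w be he hw; have [Q hQ] := key w e bw hw he.
have PQ : map_mx intr P *m map_mx intr Q = 1%:M :> 'M[rat]_n.
  apply/matrixP => i j; rewrite !mxE.
  have -> : (i == j)%:R = coord w j w`_i by rewrite coord_free ?(basis_free bw) // eq_sym.
  rewrite [in RHS]hP linear_sum; apply: eq_bigr => k _; rewrite linearZ /= hQ; congr (_ * _).
  by rewrite coord_sum_free ?(basis_free bw).
have dPQ : \det P * \det Q = 1.
  apply: (@intr_inj rat); rewrite rmorphM /= -!det_map_mx -det_mulmx PQ det1 //.
have dP : \det P * \det P = 1.
  have : (absz (\det P) * absz (\det Q) = 1)%N by rewrite -abszM dPQ.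
  by move=> /eqP; rewrite muln_eq1 => /andP[/eqP k1 _]; lia.
rewrite (gram_change hP) !det_mulmx det_tr mulrAC (det_map_mx intr) -rmorphM /= dP mul1r //.
Qed.

Lemma discriminantE (e : 4.-tuple K) : basis_of {:K} e ->
  (forall v, ring_of_integers v <-> inIntSpan e v) ->
  discriminant K = \det (gram e).
Proof.
move=> be he; have dim4 : n = 4%N by rewrite (size_basis be).
(* [discriminant] ranges over tuples of length [\dim {:K}], which is not convertible to 4; the cast
   and the elimination of [E] bridge this. *)
pose w := tcast (esym dim4) e.
have wE : w = e :> seq K by rewrite val_tcast.
have hw : integral_basis w.
  split; first by rewrite wE.
  move=> v; apply: (iff_trans (he v)); rewrite /w; move: (esym dim4) => E.
  by case: _ / E.
have detE : \det (gram w) = \det (gram e).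
  rewrite /w; move: (esym dim4) => E.
  by case: _ / E.
rewrite /discriminant; case: xgetP => [d _ [x hx ->]|].
  by rewrite -detE -(integral_basis_gram hx hw).
by move=> /(_ (\det (gram w)))[]; exists w.
Qed.

End TraceDisc.

Lemma biq_trace (K : fieldExtType rat) A B C (a b c : K) w x y z :
  biq_field A B C a b c -> field_trace (lin4K a b c w x y z) = 4 * w.
Proof.
move=> hK; rewrite (@field_trace_basis _ _ [tuple 1; a; b; c] _ hK.2).
rewrite !big_ord_recl big_ord0 /=.
have e0 : (1 : K) = lin4K a b c 1 0 0 0 by rewrite /lin4; ring.
have e1 : a = lin4K a b c 0 1 0 0 by rewrite /lin4; ring.
have e2 : b = lin4K a b c 0 0 1 0 by rewrite /lin4; ring.
have e3 : c = lin4K a b c 0 0 0 1 by rewrite /lin4; ring.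
pose E := [tuple 1; a; b; c].
have c0 w' x' y' z' : coord E 0 (lin4K a b c w' x' y' z') = w' by case: (biq_coord hK w' x' y' z').
have c1 w' x' y' z' : coord E 1 (lin4K a b c w' x' y' z') = x' by case: (biq_coord hK w' x' y' z').
have c2 w' x' y' z' : coord E 2 (lin4K a b c w' x' y' z') = y' by case: (biq_coord hK w' x' y' z').
have c3 w' x' y' z' : coord E 3 (lin4K a b c w' x' y' z') = z' by case: (biq_coord hK w' x' y' z').
set u := lin4K a b c w x y z.
have m1 : 1 * u = lin4K a b c w x y z by rewrite mul1r.
have m2 := lin4_mul (in_alg K) 0 1 0 0 w x y z hK.1; rewrite -e1 -/u in m2.
have m3 := lin4_mul (in_alg K) 0 0 1 0 w x y z hK.1; rewrite -e2 -/u in m3.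
have m4 := lin4_mul (in_alg K) 0 0 0 1 w x y z hK.1; rewrite -e3 -/u in m4.
rewrite m1 m2 m3 m4.
have -> : lift ord0 ord0 = 1 :> 'I_4 by apply: val_inj.
have -> : lift ord0 (lift ord0 ord0) = 2 :> 'I_4 by apply: val_inj.
have -> : lift ord0 (lift ord0 (lift ord0 ord0)) = 3 :> 'I_4 by apply: val_inj.
rewrite -/E c0 c1 c2 c3; ring.
Qed.

(** All of a, b, c and their mixed products have trace 0, so the trace form is diagonal with entries
    4, 4BC, 4AC and 4AB. *)
Lemma biq_gram (K : fieldExtType rat) A B C (a b c : K) :
  biq_field A B C a b c ->
  \det (gram [tuple 1; a; b; c]) = 256 * (A * B * C)%:~R ^+ 2.
Proof.
move=> hK.
have -> : gram [tuple 1; a; b; c] =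
    diag_mx (\row_(i < 4) [:: 4; 4 * (B * C)%:~R; 4 * (A * C)%:~R; 4 * (A * B)%:~R]`_i).
  have [aa bb cc ab ac bc] := hK.1.
  have tr w x y z u : u = lin4K a b c w x y z -> field_trace u = 4 * w.
    by move=> ->; apply: (biq_trace _ _ _ _ hK).
  have e q (v : K) : in_alg K q%:~R * v = q%:~R * v.
    by congr (_ * _); rewrite -[LHS]/(in_alg K q%:~R) rmorph_int.
  have e' q : in_alg K q%:~R = q%:~R by have := e q 1; rewrite !mulr1.
  have ba : b * a = C%:~R * c by rewrite mulrC.
  have ca : c * a = B%:~R * b by rewrite mulrC.
  have cb : c * b = A%:~R * a by rewrite mulrC.
  have L q1 q2 q3 q4 : lin4K a b c q1%:~R q2%:~R q3%:~R q4%:~R =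
    q1%:~R + q2%:~R * a + q3%:~R * b + q4%:~R * c by rewrite /lin4 !e e'.
  apply/matrixP => i j; rewrite !mxE.
  case: i => [[|[|[|[|i]]]] hi] //; case: j => [[|[|[|[|j]]]] hj] //=;
   rewrite ?mulr1n ?mulr0n ?mul1r ?mulr1 ?aa ?bb ?cc ?ab ?ac ?bc ?ba ?ca ?cb.
  - by rewrite (tr 1%:~R 0%:~R 0%:~R 0%:~R) ?mulr1 // L; ring.
  - by rewrite (tr 0%:~R 1%:~R 0%:~R 0%:~R) ?mulr0 // L; ring.
  - by rewrite (tr 0%:~R 0%:~R 1%:~R 0%:~R) ?mulr0 // L; ring.
  - by rewrite (tr 0%:~R 0%:~R 0%:~R 1%:~R) ?mulr0 // L; ring.
  - by rewrite (tr 0%:~R 1%:~R 0%:~R 0%:~R) ?mulr0 // L; ring.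
  - by rewrite (tr (B * C)%:~R 0%:~R 0%:~R 0%:~R) ?mulr0 // L; ring.
  - by rewrite (tr 0%:~R 0%:~R 0%:~R C%:~R) ?mulr0 // L; ring.
  - by rewrite (tr 0%:~R 0%:~R B%:~R 0%:~R) ?mulr0 // L; ring.
  - by rewrite (tr 0%:~R 0%:~R 1%:~R 0%:~R) ?mulr0 // L; ring.
  - by rewrite (tr 0%:~R 0%:~R 0%:~R C%:~R) ?mulr0 // L; ring.
  - by rewrite (tr (A * C)%:~R 0%:~R 0%:~R 0%:~R) ?mulr0 // L; ring.
  - by rewrite (tr 0%:~R A%:~R 0%:~R 0%:~R) ?mulr0 // L; ring.
  - by rewrite (tr 0%:~R 0%:~R 0%:~R 1%:~R) ?mulr0 // L; ring.
  - by rewrite (tr 0%:~R 0%:~R B%:~R 0%:~R) ?mulr0 // L; ring.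
  - by rewrite (tr 0%:~R A%:~R 0%:~R 0%:~R) ?mulr0 // L; ring.
  - by rewrite (tr (A * B)%:~R 0%:~R 0%:~R 0%:~R) ?mulr0 // L; ring.
rewrite det_diag !big_ord_recl big_ord0 !mxE /=; ring.
Qed.

Lemma int_span4P (K : fieldExtType rat) (e1 e2 e3 v : K) :
  int_span4 e1 e2 e3 v <-> inIntSpan [tuple 1; e1; e2; e3] v.
Proof.
split=> [[i [j [k [l ->]]]]|[f ->]].
  exists [ffun t : 'I_4 => [:: i; j; k; l]`_t].
  by rewrite !big_ord_recl big_ord0 !ffunE /= addr0 !addrA !mulrzl.
exists (f 0), (f 1), (f 2), (f 3).
rewrite !big_ord_recl big_ord0 /= addr0 !addrA !mulrzl.
by congr (_ *~ _ + _ *~ _ + _ *~ _ + _ *~ _); congr (f _); apply: val_inj.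
Qed.

Lemma basis_change_inv (F : fieldType) (V : lmodType F) m (e f : m.-tuple V) (P : 'M[F]_m) :
  P \in unitmx -> (forall i : 'I_m, f`_i = \sum_(j < m) P i j *: e`_j) ->
  forall i : 'I_m, e`_i = \sum_(j < m) (invmx P) i j *: f`_j.
Proof.
move=> uP hf i; under eq_bigr do rewrite hf scaler_sumr.
rewrite exchange_big /=.
under eq_bigr do [under eq_bigr do rewrite scalerA; rewrite -scaler_suml].
have h j : \sum_(k < m) invmx P i k * P k j = (i == j)%:R.
  by have := mulVmx uP => /matrixP/(_ i j); rewrite !mxE.
under eq_bigr do rewrite h.
rewrite (bigD1 i) //= eqxx scale1r big1 ?addr0 // => j ji.
by rewrite eq_sym (negbTE ji) scale0r.
Qed.

(* The change of basis from (1, a, b, c) is lower triangular in all three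
   types of integral bases. *)
Lemma biq_discriminant (K : fieldExtType rat) A B C (a b c e1 e2 e3 : K)
    (w1 x1 w2 x2 y2 w3 x3 y3 z3 : rat) :
  biq_field A B C a b c ->
  e1 = lin4K a b c w1 x1 0 0 -> e2 = lin4K a b c w2 x2 y2 0 ->
  e3 = lin4K a b c w3 x3 y3 z3 -> x1 * y2 * z3 != 0 ->
  (forall v, ring_of_integers v <-> int_span4 e1 e2 e3 v) ->
  discriminant K = 256 * (x1 * y2 * z3) ^+ 2 * (A * B * C)%:~R ^+ 2.
Proof.
move=> hK h1 h2 h3 hn hO.
pose E := [tuple 1; a; b; c]; pose F := [tuple 1; e1; e2; e3].
pose P : 'M[rat]_4 := \matrix_(i < 4, j < 4) (nth [::] [:: [:: 1; 0; 0; 0];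
   [:: w1; x1; 0; 0]; [:: w2; x2; y2; 0]; [:: w3; x3; y3; z3]] i)`_j.
have lE w x y z : lin4K a b c w x y z = w%:A + x *: a + y *: b + z *: c.
  by rewrite /lin4 /= !mulr_algl.
have hF (i : 'I_4) : F`_i = \sum_(j < 4) P i j *: E`_j.
  rewrite !big_ord_recl big_ord0 !mxE /= addr0 !addrA.
  by case: i => [[|[|[|[|i]]]] hi] //=; rewrite ?h1 ?h2 ?h3 ?lE ?scale0r ?addr0 ?scale1r.
have dP : \det P = x1 * y2 * z3.
  rewrite det_trig; first by rewrite !big_ord_recl big_ord0 !mxE /= mul1r mulr1 mulrA.
  apply/is_trig_mxP => i j; rewrite mxE.
  by case: i => [[|[|[|[|i]]]] hi] //; case: j => [[|[|[|[|j]]]] hj].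
have uP : P \in unitmx by rewrite unitmxE dP unitfE.
have bF : basis_of {:K} F.
  have sF : size F = 4%N by [].
  rewrite basisEdim; have -> : \dim {:K} = 4%N by rewrite (size_basis (X := E) hK.2).
  rewrite sF andbT.
  rewrite -(span_basis hK.2); apply/span_subvP => v /(nthP 0)[i hi <-].
  rewrite [X in X \in _](basis_change_inv uP hF (Ordinal hi)).
  by apply: memv_suml => j _; apply/memvZ/memv_span/mem_nth.
rewrite (discriminantE bF); last by move=> v; rewrite hO int_span4P.
rewrite (gram_change hF) !det_mulmx det_tr dP (biq_gram hK); ring.
Qed.

Lemma int_opp (K : fieldExtType rat) (u : K) : ring_of_integers u -> ring_of_integers (- u).
Proof. exact: integral_opp. Qed.
Lemma int_one (K : fieldExtType rat) : ring_of_integers (1 : K).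
Proof. exact: (int_natr K 1). Qed.
Lemma int_zero (K : fieldExtType rat) : ring_of_integers (0 : K).
Proof. exact: (int_natr K 0). Qed.

Ltac int_closed :=
  repeat first [assumption | apply: int_intr | apply: int_natr | apply: int_one
    | apply: int_zero | apply: int_opp | apply: int_add | apply: int_mul].

(** * Criteria for the ramification of 2 *)

Section Ramification.
Variable K : fieldExtType rat.
Local Notation O := (@ring_of_integers K).

(** Membership in 2O: congruences modulo 2 are expressed with it instead of a quotient ring. *)
Definition twice (u : K) : Prop := exists2 y, O y & u = 2 * y.

Lemma twiceD u v : twice u -> twice v -> twice (u + v).
Proof. by move=> [y hy ->] [z hz ->]; exists (y + z); [int_closed|ring]. Qed.

Lemma twiceM u v : twice u -> O v -> twice (u * v).
Proof. by move=> [y hy ->] hz; exists (y * v); [int_closed|ring]. Qed.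

Lemma twice0 : twice 0.
Proof. by exists 0; [int_closed|ring]. Qed.

Lemma twice_mul2 u : O u -> twice (2 * u).
Proof. by exists u. Qed.

Lemma twice_sum n (F : 'I_n -> K) : (forall i, twice (F i)) -> twice (\sum_(i < n) F i).
Proof. by move=> h; elim/big_ind: _ => //; [exact: twice0|exact: twiceD]. Qed.

Lemma ideal_sum (I : set K) n (F : 'I_n -> K) : is_ideal I -> (forall i, I (F i)) ->
  I (\sum_(i < n) F i).
Proof. by move=> [_ h0 hD _] h; elim/big_ind: _. Qed.

Lemma ideal_mul1 (I J : set K) x y : I x -> J y -> ideal_mul I J (x * y).
Proof.
by move=> hx hy; exists 1%N, (fun=> x), (fun=> y); split=> //; rewrite big_ord1.
Qed.

Lemma ideal_mulD (I J : set K) x y : ideal_mul I J x -> ideal_mul I J y ->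
  ideal_mul I J (x + y).
Proof.
move=> [n [a [b [ha hb ->]]]] [m [c [d [hc hd ->]]]].
exists (n + m)%N, (fun i => match fintype.split i with inl j => a j | inr j => c j end),
  (fun i => match fintype.split i with inl j => b j | inr j => d j end).
split=> [i|i|]; try by case: (fintype.split i).
rewrite big_split_ord /=; congr (_ + _); apply: eq_bigr => i _.
  by rewrite (unsplitK (inl i)).
by rewrite (unsplitK (inr i)).
Qed.

Lemma ideal_mulM (I J : set K) x y : is_ideal J -> O x -> ideal_mul I J y ->
  ideal_mul I J (x * y).
Proof.
move=> [_ _ _ hJ] hx [n [a [b [ha hb ->]]]].
exists n, a, (fun i => x * b i); split=> // [i|]; first exact: hJ.
by rewrite mulr_sumr; apply: eq_bigr => i _; ring.
Qed.

(** The ideal quotient of (2) by P^2: the largest J with P^2 J inside (2), hence the only possible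
    cofactor up to the reverse inclusion. *)
Definition square_colon (P : set K) : set K :=
  [set x | O x /\ forall p q, P p -> P q -> twice (x * (p * q))].

(* Any witness 2 + 4h suffices, since 8 = 2.2.2 lies in P^2 J. *)
Lemma ramified_colon (P : set K) h : is_prime_ideal P -> P 2 -> O h ->
  ideal_mul (ideal_mul P P) (square_colon P) (2 + 4 * h) -> ramified K 2.
Proof.
move=> primeP P2 hh hw.
have [[PO P0 PD PM] P1 _] := primeP.
have iJ : is_ideal (square_colon P).
  split=> [x []//||x y [hx hx'] [hy hy']|r x hr [hx hx']].
  - by split=> [|p q _ _]; [int_closed|rewrite mul0r; exact: twice0].
  - by split=> [|p q hp hq]; [int_closed|rewrite mulrDl; apply: twiceD; auto].
  - split=> [|p q hp hq]; first by int_closed.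
    by rewrite -mulrA mulrC; apply: twiceM; auto.
exists P, (square_colon P); split=> //; apply/seteqP; split=> [x|x [y hy <-]].
  move=> [n [a [b [ha hb ->]]]].
  suff [y hy ->] : twice (\sum_(i < n) a i * b i) by exists y.
  apply: twice_sum => i; have [m [p [q [hp hq ->]]]] := ha i.
  rewrite mulr_suml; apply: twice_sum => j.
  by rewrite mulrC; have [_] := hb i; apply.
have J2 : square_colon P 2.
  by split=> [|p q /PO hp /PO hq]; [int_closed|apply: twice_mul2; int_closed].
have h8 : ideal_mul (ideal_mul P P) (square_colon P) (2 * 2 * 2).
  by apply: ideal_mul1 => //; apply: ideal_mul1.
have h4 : ideal_mul (ideal_mul P P) (square_colon P) (2 * (2 + 4 * h) + (- h) * (2 * 2 * 2)).
  by apply: ideal_mulD; apply: ideal_mulM => //; int_closed.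
have -> : 2%:R * y = y * ((2 + 4 * h) + (- h) * (2 * (2 + 4 * h) + (- h) * (2 * 2 * 2))).
  by ring.
apply: ideal_mulM => //; apply: ideal_mulD => //; apply: ideal_mulM => //; int_closed.
Qed.

(** Suppose P^2 J = (2). For q in P and b in J the square of q b is (q q b) b, which lies in 2O, so
    q b lies in 2O by hypothesis. Hence PJ is inside 2O, so 2 lies in P (PJ), which is inside 2P,
    and 1 lies in P. *)
Lemma unramified2 : (forall x, O x -> twice (x * x) -> twice x) -> ~ ramified K 2.
Proof.
move=> red [P [J [[iP P1 _] iJ E]]].
have [PO _ _ PM] := iP; have [JO _ _ JM] := iJ.
have : ideal_mul (ideal_mul P P) J 2 by rewrite E; exists 1; rewrite ?mulr1 //; exact: int_one.
move=> [n [a [b [ha hb e]]]].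
have key i : exists y, P y /\ a i * b i = 2 * y.
  have [m [p [q [hp hq ->]]]] := ha i.
  have h j : exists y, O y /\ q j * b i = 2 * y.
    suff [y hy ->] : twice (q j * b i) by exists y.
    apply: red; first by apply: int_mul; [exact: PO|exact: JO].
    have : ideal_mul (ideal_mul P P) J (q j * q j * b i).
      by apply: ideal_mul1 => //; apply: ideal_mul1.
    rewrite E => -[y hy e2].
    have -> : q j * b i * (q j * b i) = 2 * y * b i by rewrite e2; ring.
    by apply: twiceM; [exact: twice_mul2|exact: JO].
  have [y hy] := boolp.choice h.
  exists (\sum_(j < m) p j * y j); split.
    by apply: (ideal_sum iP) => j; rewrite mulrC; apply: PM => //; case: (hy j).
  rewrite mulr_suml mulr_sumr; apply: eq_bigr => j _.
  by rewrite -mulrA (hy j).2; ring.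
have [y hy] := boolp.choice key.
apply: P1; have -> : 1 = \sum_(i < n) y i.
  have n2 : (2 : K) != 0 by rewrite -(rmorph_nat (in_alg K)) fmorph_eq0.
  apply: (mulfI n2); rewrite mulr1 {1}e mulr_sumr; apply: eq_bigr => i _.
  exact: (hy i).2.
by apply: (ideal_sum iP) => i; case: (hy i).
Qed.

Lemma int_even (i : int) : (exists k, i = 2 * k) \/ (exists k, i = 2 * k + 1).
Proof. by have [k [e|e]] := int_parity i; [left|right]; exists k. Qed.

(* The prime (2, rho) has residue field F_2 and its fourth power is (2). *)
Lemma ramified_quartic (rho u h : K) : O rho -> O u -> O h ->
  rho ^+ 4 * u = 2 + 4 * h -> twice (rho ^+ 4) -> ~ twice 1 ->
  (forall x, O x -> exists (i : int) z z', [/\ O z, O z' & x = i%:~R + rho * z + 2 * z']) ->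
  ramified K 2.
Proof.
move=> hr hu hh E tr n1 span.
pose P : set K := [set x | exists z z', [/\ O z, O z' & x = rho * z + 2 * z']].
have iP : is_ideal P.
  split=> [x [z [z' [hz hz' ->]]]||x y|r x ho].
  - by int_closed.
  - by exists 0, 0; split; [int_closed|int_closed|ring].
  - move=> [z [z' [hz hz' ->]]] [t [t' [ht ht' ->]]].
    by exists (z + t), (z' + t'); split; [int_closed|int_closed|ring].
  - move=> [z [z' [hz hz' ->]]].
    by exists (r * z), (r * z'); split; [int_closed|int_closed|ring].
have [PO P0 PD PM] := iP.
have P2 : P 2 by exists 0, 1; split; [int_closed|int_closed|ring].
have Pr : P rho by exists 1, 0; split; [int_closed|int_closed|ring].
have primeP : is_prime_ideal P.
  split=> // [[z [z' [hz hz' e]]]|x y hx hy hxy].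
    (* The fourth power of an element of P lies in 2O, so 1 in P would put 1 in 2O. *)
    apply: n1; have -> : (1 : K) = rho ^+ 4 * z ^+ 4 +
       2 * (z' * (2 * z' + 2 * rho * z) * ((rho * z + 2 * z') ^+ 2 + (rho * z) ^+ 2)).
      have e4 : 1 = (rho * z + 2 * z') ^+ 4 by rewrite -e expr1n.
      by rewrite [LHS]e4; ring.
    apply: twiceD; last by apply: twice_mul2; rewrite !expr2; int_closed.
    by apply: twiceM => //; rewrite !exprS expr0; int_closed.
  have [i [z [z' [hz hz' e]]]] := span x hx.
  have [[k hk]|[k hk]] := int_even i; [left|right].
    by exists z, (k%:~R + z'); split; [int_closed|int_closed|rewrite e hk; ring].
  have -> : y = x * y + (- ((rho * z + 2 * z') + 2 * k%:~R)) * y by rewrite e hk; ring.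
  apply: PD => //; rewrite mulrC; apply: PM => //.
  by exists (- z), (- (z' + k%:~R)); split; [int_closed|int_closed|ring].
apply: (ramified_colon primeP P2 hh); rewrite -E.
have -> : rho ^+ 4 * u = rho * rho * (rho * rho * u) by ring.
apply: ideal_mul1; first exact: ideal_mul1.
split=> [|p q [z [z' [hz hz' ->]]] [t [t' [ht ht' ->]]]]; first by int_closed.
have -> : rho * rho * u * ((rho * z + 2 * z') * (rho * t + 2 * t')) = rho ^+ 4 * (u * z * t)
  + 2 * (rho * rho * u * (z' * (rho * t + 2 * t') + rho * z * t')) by ring.
by apply: twiceD; [apply: twiceM => //; int_closed|apply: twice_mul2; int_closed].
Qed.

(* Here (2, omega)^2 = (2), and O / (2, omega) = F_2[theta] / (theta^2 - theta - m)
   is F_4 or F_2 x F_2 according to the parity of m. *)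
Lemma ramified_quadratic (theta omega u h : K) (m : int) :
  O theta -> O omega -> O u -> O h ->
  theta * theta = theta + m%:~R -> twice (omega * omega) ->
  omega * omega * u = 2 + 4 * h ->
  (forall i j : int, twice (i%:~R + j%:~R * theta) ->
     (exists k, i = 2 * k) /\ (exists k, j = 2 * k)) ->
  (forall x, O x -> exists (i j : int) z z',
     [/\ O z, O z' & x = i%:~R + j%:~R * theta + omega * z + 2 * z']) ->
  ramified K 2.
Proof.
move=> hth hom hu hh Eth tom E par span.
have odd1 (k : int) : 1 <> 2 * k by lia.
have n1 : ~ twice 1.
  move=> t1; have [] := par 1 0; last by move=> [k /odd1].
  by rewrite mul0r addr0.
have [[k mk]|[k mk]] := int_even m.
(* For m even, theta (1 - theta) = - m lies in 2O, so theta and 1 - theta are orthogonal idempotents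
   modulo 2. P is the prime (2, omega, theta), and multiplication by 1 - theta brings its elements
   back into (2, omega). *)
- pose P : set K := [set x | exists y z z', [/\ O y, O z, O z' & x = theta * y + omega * z + 2 * z']].
  have iP : is_ideal P.
    split=> [x [y [z [z' [hy hz hz' ->]]]]||x x'|r x ho].
    - by int_closed.
    - by exists 0, 0, 0; split; [int_closed|int_closed|int_closed|ring].
    - move=> [y [z [z' [hy hz hz' ->]]]] [s [t [t' [hs ht ht' ->]]]].
      by exists (y + s), (z + t), (z' + t'); split; [int_closed|int_closed|int_closed|ring].
    - move=> [y [z [z' [hy hz hz' ->]]]].
      by exists (r * y), (r * z), (r * z'); split; [int_closed|int_closed|int_closed|ring].
  have [PO P0 PD PM] := iP.
  have P2 : P 2 by exists 0, 0, 1; split; [int_closed|int_closed|int_closed|ring].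
  have Pth : P theta by exists 1, 0, 0; split; [int_closed|int_closed|int_closed|ring].
  have Pom : P omega by exists 0, 1, 0; split; [int_closed|int_closed|int_closed|ring].
  have Ps p : P p -> exists z z', [/\ O z, O z' & p * (1 - theta) = omega * z + 2 * z'].
    move=> [y [z [z' [hy hz hz' ->]]]].
    exists (z * (1 - theta)), (z' * (1 - theta) - k%:~R * y); split; [int_closed|int_closed|].
    transitivity ((theta - theta * theta) * y + omega * (z * (1 - theta)) + 2 * (z' * (1 - theta))).
      by ring.
    by rewrite Eth mk; ring.
  have Pss p q : P p -> P q -> twice ((1 - theta) * (1 - theta) * (p * q)).
    move=> /Ps[z [z' [hz hz' e]]] /Ps[t [t' [ht ht' f]]].
    have -> : (1 - theta) * (1 - theta) * (p * q) = (p * (1 - theta)) * (q * (1 - theta)) by ring.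
    rewrite e f.
    have -> : (omega * z + 2 * z') * (omega * t + 2 * t') = omega * omega * (z * t) +
      2 * (z' * (omega * t + 2 * t') + omega * z * t') by ring.
    by apply: twiceD; [apply: twiceM => //; int_closed|apply: twice_mul2; int_closed].
  have primeP : is_prime_ideal P.
    split=> // [h1|x y hx hy hxy].
      have := Pss _ _ h1 h1; rewrite !mulr1.
      have -> : (1 - theta) * (1 - theta) = (1 + m)%:~R + (-1)%:~R * theta.
        transitivity (1 - 2 * theta + theta * theta); first by ring.
        by rewrite Eth; ring.
      by move=> /par[_ [l hl]]; apply: (odd1 (- l)); lia.
    have [i [j [z [z' [hz hz' e]]]]] := span x hx.
    have [[l hl]|[l hl]] := int_even i; [left|right].
      exists j%:~R, z, (l%:~R + z'); split; [int_closed|int_closed|int_closed|rewrite e hl; ring].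
    have -> : y = x * y + (- ((theta * j%:~R + omega * z + 2 * z') + 2 * l%:~R)) * y by rewrite e hl; ring.
    apply: PD => //; rewrite mulrC; apply: PM => //.
    by exists (- j%:~R), (- z), (- (z' + l%:~R)); split; [int_closed|int_closed|int_closed|ring].
  have hm : O (m%:~R + h * ((1 - theta) * (1 - theta))) by int_closed.
  apply: (ramified_colon primeP P2 hm).
  (* Both u (1 - theta)^2 and 2 belong to the cofactor, and (1 - theta)^2 + theta^2 = 1 + 2m is 1
     modulo 2, so the two products add up to 2 modulo 4. *)
  have -> : 2 + 4 * (m%:~R + h * ((1 - theta) * (1 - theta))) =
    omega * omega * (u * ((1 - theta) * (1 - theta))) + theta * theta * 2.
    rewrite [in RHS]mulrA E Eth.
    transitivity (2 + 4 * (theta * theta - theta) + 4 * h * ((1 - theta) * (1 - theta))).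
      by rewrite Eth; ring.
    transitivity (2 * (1 - 2 * theta + theta * theta) + 4 * h * ((1 - theta) * (1 - theta))
       + 2 * (theta * theta)); first by ring.
    transitivity (2 * ((1 - theta) * (1 - theta)) + 4 * h * ((1 - theta) * (1 - theta))
       + 2 * (theta * theta)); first by ring.
    by rewrite [in LHS]Eth; ring.
  apply: ideal_mulD; apply: ideal_mul1; try exact: ideal_mul1.
    split=> [|p q hp hq]; first by int_closed.
    by rewrite -mulrA mulrC; apply: twiceM => //; exact: Pss.
  by split=> [|p q /PO hp /PO hq]; [int_closed|apply: twice_mul2; int_closed].
pose P : set K := [set x | exists z z', [/\ O z, O z' & x = omega * z + 2 * z']].
have iP : is_ideal P.
  split=> [x [z [z' [hz hz' ->]]]||x y|r x ho].
  - by int_closed.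
  - by exists 0, 0; split; [int_closed|int_closed|ring].
  - move=> [z [z' [hz hz' ->]]] [t [t' [ht ht' ->]]].
    by exists (z + t), (z' + t'); split; [int_closed|int_closed|ring].
  - move=> [z [z' [hz hz' ->]]].
    by exists (r * z), (r * z'); split; [int_closed|int_closed|ring].
have [PO P0 PD PM] := iP.
have P2 : P 2 by exists 0, 1; split; [int_closed|int_closed|ring].
have Pom : P omega by exists 1, 0; split; [int_closed|int_closed|ring].
have PP p q : P p -> P q -> twice (p * q).
  move=> [z [z' [hz hz' ->]]] [t [t' [ht ht' ->]]].
  have -> : (omega * z + 2 * z') * (omega * t + 2 * t') = omega * omega * (z * t) +
      2 * (z' * (omega * t + 2 * t') + omega * z * t') by ring.
  by apply: twiceD; [apply: twiceM => //; int_closed|apply: twice_mul2; int_closed].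
have primeP : is_prime_ideal P.
  split=> // [h1|x y hx hy hxy]; first by apply: n1; rewrite -[1]mulr1; apply: PP.
  have [i [j [z [z' [hz hz' e]]]]] := span x hx.
  (* The norm of i + j theta is i^2 + i j - m j^2; for m odd it is odd unless i and j are both even.
     An odd norm makes the element invertible modulo P. *)
  have [[i' hi]|[N hN]] : (exists i' j', i = 2 * i' /\ j = 2 * j') \/
      exists N, i * i + i * j - j * j * m = 2 * N + 1.
    have [[i' hi]|[i' hi]] := int_even i; have [[j' hj]|[j' hj]] := int_even j; subst.
    - by left; exists i', j'.
    - by right; exists (2 * i' * i' + 2 * i' * j' + i' - (2 * j' * j' + 2 * j') * (2 * k + 1) - k - 1); ring.
    - by right; exists (2 * i' * i' + 2 * i' + (2 * i' + 1) * j' - 2 * j' * j' * (2 * k + 1)); ring.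
    - right; exists (2 * i' * i' + 2 * i' + 2 * i' * j' + i' + j' - (2 * j' * j' + 2 * j') * (2 * k + 1) - k); ring.
    left; have [j' [hi' hj']] := hi.
    exists z, (i'%:~R + j'%:~R * theta + z'); split; [int_closed|int_closed|].
    by rewrite e hi' hj'; ring.
  right; set x' := i%:~R + j%:~R * (1 - theta).
  have hx' : O x' by int_closed.
  have ex : x' * (i%:~R + j%:~R * theta) = (2 * N + 1)%:~R.
    rewrite -hN; transitivity ((i * i + i * j)%:~R + (j * j)%:~R * (theta - theta * theta)).
      by rewrite /x'; ring.
    by rewrite Eth; ring.
  have -> : y = x' * (x * y) + (- (x' * (omega * z + 2 * z') + 2 * N%:~R)) * y.
    transitivity ((x' * (i%:~R + j%:~R * theta)) * y - 2 * N%:~R * y); last by rewrite e; ring.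
    by rewrite ex; ring.
  apply: PD; first exact: PM.
  rewrite mulrC; apply: PM => //.
  by exists (- (x' * z)), (- (x' * z' + N%:~R)); split; [int_closed|int_closed|ring].
apply: (ramified_colon primeP P2 hh); rewrite -E.
apply: ideal_mul1; first exact: ideal_mul1.
by split=> // p q hp hq; rewrite mulrC; apply: twiceM => //; exact: PP.
Qed.

End Ramification.

(** * Discriminant, trace-zero projection and ramification for each type *)

Definition typeU (A B C : int) : Prop :=
  exists A' B' C' : int, [/\ A = 4 * A' + 1, B = 4 * B' + 1 & C = 4 * C' + 1].
Definition typeR1 (A B C : int) : Prop :=
  exists A' B' C' : int, [/\ A = 4 * A' + 2, B = 4 * B' + 1 & C = 4 * C' + 3].
Definition typeR2 (A B C : int) : Prop :=
  exists A' B' C' r : int, [/\ A = 4 * A' + r, B = 4 * B' + 1, C = 4 * C' + 1 & r = 2 \/ r = 3].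

Lemma quarter_inj (K : fieldExtType rat) A B C (a b c : K) W X Y Z W' X' Y' Z' :
  biq_field A B C a b c -> quarter a b c W X Y Z = quarter a b c W' X' Y' Z' ->
  [/\ W = W', X = X', Y = Y' & Z = Z'].
Proof.
move=> hK /(biq_inj hK)[e1 e2 e3 e4].
by split; apply: (@intr_inj rat); apply: (@mulIf _ 4^-1).
Qed.

Lemma quarter2 (K : fieldExtType rat) (a b c : K) W X Y Z :
  2 * quarter a b c W X Y Z = quarter a b c (2 * W) (2 * X) (2 * Y) (2 * Z).
Proof. by apply: quarterP; rewrite mulrCA quarterE; ring. Qed.

Section TypedFields.
Variables (K : fieldExtType rat) (A B C : int) (a b c : K).
Hypotheses (hK : biq_field A B C a b c) (adm : admissible A B C).
Local Notation O := (@ring_of_integers K).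
Local Notation qt := (quarter a b c).

Lemma a_lin : a = lin4K a b c 0 1 0 0. Proof. by rewrite /lin4; ring. Qed.
Lemma b_lin : b = lin4K a b c 0 0 1 0. Proof. by rewrite /lin4; ring. Qed.

Lemma quarter_trace W X Y Z : field_trace (qt W X Y Z) = W%:~R.
Proof. by rewrite /quarter (biq_trace _ _ _ _ hK); field. Qed.

Lemma discriminantU : typeU A B C -> discriminant K = (A * B * C)%:~R ^+ 2.
Proof.
move=> [A' [B' [C' [hA hB hC]]]].
rewrite (biq_discriminant hK (e1 := qt 2 2 0 0) (e2 := qt 2 0 2 0) (e3 := qt 1 1 1 1)
  (w1 := 2%:~R/4) (x1 := 2%:~R/4) (w2 := 2%:~R/4) (x2 := 0) (y2 := 2%:~R/4)
  (w3 := 1%:~R/4) (x3 := 1%:~R/4) (y3 := 1%:~R/4) (z3 := 1%:~R/4)) //.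
- by field.
- by move=> v; apply: (integersU v hK adm hA hB hC).
Qed.

Lemma discriminantR2 : typeR2 A B C -> discriminant K = 16 * (A * B * C)%:~R ^+ 2.
Proof.
move=> [A' [B' [C' [r [hA hB hC hr]]]]].
rewrite (biq_discriminant hK (e1 := qt 2 2 0 0) (e2 := b) (e3 := qt 0 0 2 2)
  (w1 := 2%:~R/4) (x1 := 2%:~R/4) (w2 := 0) (x2 := 0) (y2 := 1)
  (w3 := 0) (x3 := 0) (y3 := 2%:~R/4) (z3 := 2%:~R/4)) //.
- exact: b_lin.
- by move=> v; apply: (integersR2 v hK adm hA hB hC hr).
Qed.

Lemma discriminantR1 : typeR1 A B C -> discriminant K = 64 * (A * B * C)%:~R ^+ 2.
Proof.
move=> [A' [B' [C' [hA hB hC]]]].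
rewrite (biq_discriminant hK (e1 := a) (e2 := b) (e3 := qt 0 0 2 2)
  (w1 := 0) (x1 := 1) (w2 := 0) (x2 := 0) (y2 := 1)
  (w3 := 0) (x3 := 0) (y3 := 2%:~R/4) (z3 := 2%:~R/4)) //.
- exact: a_lin.
- exact: b_lin.
- by move=> v; apply: (integersR1 v hK adm hA hB hC).
Qed.

Lemma O_perpP (e1 e2 e3 : K) (W1 X1 Y1 Z1 W2 X2 Y2 Z2 W3 X3 Y3 Z3 : int) :
  e1 = qt W1 X1 Y1 Z1 -> e2 = qt W2 X2 Y2 Z2 -> e3 = qt W3 X3 Y3 Z3 ->
  (forall v, O v <-> int_span4 e1 e2 e3 v) ->
  forall u, O_perp u <-> exists j k l : int,
    u = (j * X1 + k * X2 + l * X3)%:~R * a + (j * Y1 + k * Y2 + l * Y3)%:~R * b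
      + (j * Z1 + k * Z2 + l * Z3)%:~R * c.
Proof.
move=> h1 h2 h3 hO u.
have dim4 : \dim {:K} = 4%N by rewrite (size_basis (X := [tuple 1; a; b; c]) hK.2).
have key i j k l : (\dim {:K})%:R * (i%:~R + j%:~R * e1 + k%:~R * e2 + l%:~R * e3)
    - (field_trace (i%:~R + j%:~R * e1 + k%:~R * e2 + l%:~R * e3))%:A =
    (j * X1 + k * X2 + l * X3)%:~R * a + (j * Y1 + k * Y2 + l * Y3)%:~R * b
      + (j * Z1 + k * Z2 + l * Z3)%:~R * c.
  rewrite (int_span4_quarter i j k l h1 h2 h3) quarter_trace dim4 quarterE.
  rewrite -[_%:A]/(in_alg K _) rmorph_int; ring.
split=> [[v /hO[i [j [k [l ->]]]] <-]|[j [k [l ->]]]].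
  by exists j, k, l; rewrite key.
exists (0%:~R + j%:~R * e1 + k%:~R * e2 + l%:~R * e3); last exact: key.
by apply/hO; do 4!eexists.
Qed.

Lemma O_perpU : typeU A B C -> forall u, O_perp u <-> exists j k l : int,
    u = (j * 2 + l)%:~R * a + (k * 2 + l)%:~R * b + l%:~R * c.
Proof.
move=> [A' [B' [C' [hA hB hC]]]] u.
rewrite (O_perpP (erefl _) (erefl _) (erefl _) (fun v => integersU v hK adm hA hB hC)).
by split=> -[j [k [l ->]]]; exists j, k, l;
  congr (_%:~R * _ + _%:~R * _ + _%:~R * _); ring.
Qed.

Lemma O_perpR2 : typeR2 A B C -> forall u, O_perp u <-> exists j k l : int,
    u = (j * 2)%:~R * a + (k * 4 + l * 2)%:~R * b + (l * 2)%:~R * c.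
Proof.
move=> [A' [B' [C' [r [hA hB hC hr]]]]] u.
have be : b = qt 0 0 4 0 by apply: quarterP; ring.
rewrite (O_perpP (erefl _) be (erefl _) (fun v => integersR2 v hK adm hA hB hC hr)).
by split=> -[j [k [l ->]]]; exists j, k, l;
  congr (_%:~R * _ + _%:~R * _ + _%:~R * _); ring.
Qed.

Lemma O_perpR1 : typeR1 A B C -> forall u, O_perp u <-> exists j k l : int,
    u = (j * 4)%:~R * a + (k * 4 + l * 2)%:~R * b + (l * 2)%:~R * c.
Proof.
move=> [A' [B' [C' [hA hB hC]]]] u.
have ae : a = qt 0 4 0 0 by apply: quarterP; ring.
have be : b = qt 0 0 4 0 by apply: quarterP; ring.
rewrite (O_perpP ae be (erefl _) (fun v => integersR1 v hK adm hA hB hC)).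
by split=> -[j [k [l ->]]]; exists j, k, l;
  congr (_%:~R * _ + _%:~R * _ + _%:~R * _); ring.
Qed.

(* Modulo 2 the Frobenius map x |-> x^2 of O is triangular with unit diagonal in
   the basis 1, (1+a)/2, (1+b)/2, (1+a+b+c)/4. *)
Lemma unramifiedU : typeU A B C -> ~ ramified K 2.
Proof.
move=> [A' [B' [C' [hA hB hC]]]].
have iO v := integersU v hK adm hA hB hC.
set e1 := qt 2 2 0 0 in iO; set e2 := qt 2 0 2 0 in iO; set e3 := qt 1 1 1 1 in iO.
have [aa bb cc ab ac bc] := hK.1.
have O1 : O e1 by apply/iO; exists 0, 1, 0, 0; ring.
have O2 : O e2 by apply/iO; exists 0, 0, 1, 0; ring.
have O3 : O e3 by apply/iO; exists 0, 0, 0, 1; ring.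
pose c1 := 4 * B' * C' + B' + C'; pose c2 := 4 * A' * C' + A' + C'.
pose w := 1 + 2 * (A' + B' + C') + 4 * (A' * B' + A' * C' + B' * C').
have E1 : e1 * e1 = qt (2 + 4 * c1) 2 0 0.
  apply: quarterP; apply: (mulfI (four_neq0 K)).
  have -> : 4 * (4 * (e1 * e1)) = (4 * e1) * (4 * e1) by ring.
  rewrite !quarterE /c1; transitivity (4 + 8 * a + 4 * (a * a)); first by ring.
  by rewrite aa hB hC; ring.
have E2 : e2 * e2 = qt (2 + 4 * c2) 0 2 0.
  apply: quarterP; apply: (mulfI (four_neq0 K)).
  have -> : 4 * (4 * (e2 * e2)) = (4 * e2) * (4 * e2) by ring.
  rewrite !quarterE /c2; transitivity (4 + 8 * b + 4 * (b * b)); first by ring.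
  by rewrite bb hA hC; ring.
have E3 : e3 * e3 = qt w (2 * A' + 1) (2 * B' + 1) (2 * C' + 1).
  apply: quarterP; apply: (mulfI (four_neq0 K)).
  have -> : 4 * (4 * (e3 * e3)) = (4 * e3) * (4 * e3) by ring.
  rewrite !quarterE /w; transitivity (1 + a * a + b * b + c * c +
    2 * a + 2 * b + 2 * c + 2 * (a * b) + 2 * (a * c) + 2 * (b * c)); first by ring.
  by rewrite aa bb cc ab ac bc hA hB hC; ring.
apply: unramified2 => x /iO[i [j [k [l ->]]]] tx.
have : twice (i%:~R * i%:~R + (j * j)%:~R * (e1 * e1) + (k * k)%:~R * (e2 * e2) +
    (l * l)%:~R * (e3 * e3)).
  have -> : i%:~R * i%:~R + (j * j)%:~R * (e1 * e1) + (k * k)%:~R * (e2 * e2) +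
    (l * l)%:~R * (e3 * e3) = (i%:~R + j%:~R * e1 + k%:~R * e2 + l%:~R * e3) *
      (i%:~R + j%:~R * e1 + k%:~R * e2 + l%:~R * e3) + 2 * (- (
      i%:~R * j%:~R * e1 + i%:~R * k%:~R * e2 + i%:~R * l%:~R * e3 +
      j%:~R * e1 * (k%:~R * e2) + j%:~R * e1 * (l%:~R * e3) + k%:~R * e2 * (l%:~R * e3))) by ring.
  apply: twiceD => //; apply: twice_mul2; int_closed.
rewrite E1 E2 E3 => -[y /iO[i' [j' [k' [l' ->]]]]].
have -> : i%:~R * i%:~R + (j * j)%:~R * qt (2 + 4 * c1) 2 0 0 + (k * k)%:~R * qt (2 + 4 * c2) 0 2 0
   + (l * l)%:~R * qt w (2 * A' + 1) (2 * B' + 1) (2 * C' + 1) =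
   qt (4 * (i * i) + (j * j) * (2 + 4 * c1) + (k * k) * (2 + 4 * c2) + (l * l) * w)
     (2 * (j * j) + l * l * (2 * A' + 1)) (2 * (k * k) + l * l * (2 * B' + 1))
     (l * l * (2 * C' + 1)).
  have -> : i%:~R * i%:~R = (i * i)%:~R :> K by ring.
  by rewrite (int_span4_quarter _ _ _ _ (erefl _) (erefl _) (erefl _)); congr quarter; ring.
rewrite (int_span4_quarter _ _ _ _ (erefl _) (erefl _) (erefl _)) quarter2.
move=> /(quarter_inj hK)[q1 q2 q3 q4].
have [m hl] : exists m, l = 2 * m.
  have [[m e]|[m e]] := int_even l; first by exists m.
  by exfalso; rewrite e in q4; lia.
have l'E : l' = 2 * (m * m) * (2 * C' + 1) by rewrite hl in q4; lia.
have [n hj] : exists m, j = 2 * m.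
  have [[n e]|[n e]] := int_even j; first by exists n.
  by exfalso; rewrite e hl l'E in q2; lia.
have [p hk] : exists m, k = 2 * m.
  have [[p e]|[p e]] := int_even k; first by exists p.
  by exfalso; rewrite e hl l'E in q3; lia.
have j'E : j' = 2 * (n * n) + m * m * (2 * A' + 1) - m * m * (2 * C' + 1).
  by rewrite hj hl l'E in q2; lia.
have k'E : k' = 2 * (p * p) + m * m * (2 * B' + 1) - m * m * (2 * C' + 1).
  by rewrite hk hl l'E in q3; lia.
have [q hi] : exists m, i = 2 * m.
  have [[q e]|[q e]] := int_even i; first by exists q.
  exfalso; rewrite e hj hk hl l'E j'E k'E /w in q1; lia.
exists (q%:~R + n%:~R * e1 + p%:~R * e2 + m%:~R * e3); first by int_closed.
by rewrite hi hj hk hl; ring.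
Qed.

Lemma twice_par (e1 e2 e3 : K) i j :
  (forall W X Y Z W' X' Y' Z' : int,
     W%:~R + X%:~R * e1 + Y%:~R * e2 + Z%:~R * e3 = W'%:~R + X'%:~R * e1 + Y'%:~R * e2 + Z'%:~R * e3 ->
     W = W' /\ X = X') ->
  (forall v, O v <-> int_span4 e1 e2 e3 v) ->
  twice (i%:~R + j%:~R * e1) -> (exists k, i = 2 * k) /\ (exists k, j = 2 * k).
Proof.
move=> inj hO [y /hO[i' [j' [k' [l' ->]]]]] e.
have [-> ->] : i = 2 * i' /\ j = 2 * j'.
  apply: (inj _ _ 0 0 _ _ (2 * k') (2 * l')).
  by transitivity (i%:~R + j%:~R * e1); [ring|rewrite e; ring].
by split; [exists i'|exists j'].
Qed.

Lemma ramifiedR2 : typeR2 A B C -> ramified K 2.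
Proof.
move=> [A' [B' [C' [r [hA hB hC hr]]]]].
have iO v := integersR2 v hK adm hA hB hC hr.
set th := qt 2 2 0 0 in iO; set eta := qt 0 0 2 2 in iO.
have [aa bb cc ab ac bc] := hK.1.
have be : b = qt 0 0 4 0 by apply: quarterP; ring.
have Oth : O th by apply/iO; exists 0, 1, 0, 0; ring.
have Ob : O b by apply/iO; exists 0, 0, 1, 0; ring.
have Oeta : O eta by apply/iO; exists 0, 0, 0, 1; ring.
have Eth : th * th = th + (4 * B' * C' + B' + C')%:~R.
  apply: mul4I; have -> (u : K) : 4 * (u * u) * 4 = (4 * u) * (4 * u) by ring.
  have -> (u v : K) : 4 * (u + v) * 4 = 4 * (4 * u) + 16 * v by ring.
  by rewrite !quarterE; transitivity (4 + 8 * a + 4 * (a * a)); [ring|rewrite aa hB hC; ring].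
(* Modulo 2 the generator (b + c)/2 is b theta, so 1, theta, b and b theta span O / 2O. *)
have Eeta : eta = b * th + 2 * (C'%:~R * b - 2 * C'%:~R * eta).
  have h : 4 * (eta + 4 * C'%:~R * eta) = 4 * (b * th + 2 * C'%:~R * b).
    have -> : 4 * (eta + 4 * C'%:~R * eta) = (1 + 4 * C'%:~R) * (4 * eta) by ring.
    have -> : 4 * (b * th + 2 * C'%:~R * b) = b * (4 * th) + 8 * C'%:~R * b by ring.
    rewrite !quarterE; transitivity (2 * (1 + 4 * C'%:~R) * b + 2 * (C%:~R * c)).
      by rewrite hC; ring.
    by rewrite -ab; ring.
  move/(mulfI (four_neq0 K)): h => h.
  have -> : b * th + 2 * (C'%:~R * b - 2 * C'%:~R * eta) =
    (b * th + 2 * C'%:~R * b) - 4 * C'%:~R * eta by ring.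
  by rewrite -h; ring.
have par i j : twice (i%:~R + j%:~R * th) -> (exists k, i = 2 * k) /\ (exists k, j = 2 * k).
  apply: twice_par iO => W X Y Z W' X' Y' Z'.
  rewrite !(int_span4_quarter _ _ _ _ (erefl _) be (erefl _)).
  by move=> /(quarter_inj hK)[q1 q2 q3 q4]; lia.
have span (eps : int) x : O x -> exists (i j : int) z z',
    [/\ O z, O z' & x = i%:~R + j%:~R * th + (b + eps%:~R) * z + 2 * z'].
  move=> /iO[i [j [k [l ->]]]].
  exists (i - eps * k), (j - eps * l), (k%:~R + l%:~R * th),
    (l%:~R * (C'%:~R * b - 2%:R * C'%:~R * eta)).
  split; [int_closed|int_closed|].
  by rewrite [X in _ + _ * X]Eeta; ring.
(* For r = 2 the square of b is 2 modulo 4, and omega = b works with u = 1. For r = 3 the square of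
   b is 3 modulo 4, so omega = b + 1 has an even square, and u = b brings (b + 1)^2 u to 2 modulo
   4. *)
case: hr => hr; subst r.
- apply: (@ramified_quadratic K th (b + 0%:~R) 1 (4 * A' * C' + A' + 2 * C')%:~R
    (4 * B' * C' + B' + C')) => //; try by int_closed.
  + exists (A' * 8 * C' + 2 * A' + 4 * C' + 1)%:~R; first by int_closed.
    by transitivity (b * b); [ring|rewrite bb hA hC; ring].
  + by transitivity (b * b); [ring|rewrite bb hA hC; ring].
  + by move=> x; apply: (span 0).
- pose g := 4 * A' * C' + A' + 3 * C'.
  have Eb : b * b = (4 * g + 3)%:~R by rewrite bb hA hC /g; ring.
  apply: (@ramified_quadratic K th (b + 1%:~R) b ((g + 1)%:~R * b + (2 * g + 1)%:~R)
    (4 * B' * C' + B' + C')) => //; try by int_closed.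
  + exists ((2 * (g + 1))%:~R + b); first by int_closed.
    by transitivity (b * b + 2 * b + 1); [ring|rewrite Eb; ring].
  + transitivity ((b * b + 1) * b + 2 * (b * b)); first by ring.
    by rewrite Eb; ring.
  + by move=> x; apply: (span 1).
Qed.

Lemma ramifiedR1 : typeR1 A B C -> ramified K 2.
Proof.
move=> [A' [B' [C' [hA hB hC]]]].
have iO v := integersR1 v hK adm hA hB hC.
set eta := qt 0 0 2 2 in iO.
have [aa bb cc ab ac bc] := hK.1.
have ae : a = qt 0 4 0 0 by apply: quarterP; ring.
have be : b = qt 0 0 4 0 by apply: quarterP; ring.
have Oa : O a by apply/iO; exists 0, 1, 0, 0; ring.
have Ob : O b by apply/iO; exists 0, 0, 1, 0; ring.
have Oeta : O eta by apply/iO; exists 0, 0, 0, 1; ring.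
pose r := A'%:~R * a + ((2 * A' + 1) * (B' + C' + 1))%:~R.
have Or : O r by rewrite /r; int_closed.
have Eeta : eta * eta = a + 2 * r.
  apply: mul4I; have -> (u : K) : 4 * (u * u) * 4 = (4 * u) * (4 * u) by ring.
  rewrite !quarterE; transitivity (4 * (b * b) + 4 * (c * c) + 8 * (b * c)); first by ring.
  by rewrite bb cc bc hA hB hC /r; ring.
have Eaeta : a * eta = C%:~R * eta + (2 * (B' - C') - 1)%:~R * b.
  apply: (mulfI (four_neq0 K)).
  have -> : 4 * (a * eta) = a * (4 * eta) by ring.
  have -> : 4 * (C%:~R * eta + (2 * (B' - C') - 1)%:~R * b) =
    C%:~R * (4 * eta) + 4 * (2 * (B' - C') - 1)%:~R * b by ring.
  rewrite !quarterE; transitivity (2 * (a * b) + 2 * (a * c)); first by ring.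
  by rewrite ab ac hB hC; ring.
(* Modulo 2 the square of eta is a, and a^2 = BC is odd, so eta is 1 modulo the prime above 2. With
   rho = eta - 1 one has rho^2 = 1 + a modulo 2 and rho^4 = 1 + 2a + BC = 2a modulo 4; the factor u
   = a turns this into 2 modulo 4. *)
pose rho := eta - 1.
have Erho : rho * rho = 1 + a + 2 * (r - eta).
  by transitivity (eta * eta - 2 * eta + 1); [rewrite /rho; ring|rewrite Eeta; ring].
pose t := 4 * B' * C' + 3 * B' + C' + 1.
pose t2 := (1 + a) * (r - eta) + (r - eta) * (r - eta).
have Ot2 : O t2 by rewrite /t2; int_closed.
have BC : (B * C = 4 * t - 1) by rewrite hB hC /t; ring.
have Erho4 : rho ^+ 4 = 2 * (a + 2 * (t%:~R + t2)).
  transitivity ((rho * rho) * (rho * rho)); first by ring.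
  rewrite Erho; transitivity (1 + 2 * a + a * a + 4 * t2); first by rewrite /t2; ring.
  by rewrite aa BC; ring.
apply: (@ramified_quartic K rho a ((2 * t - 1)%:~R + (t%:~R + t2) * a)).
- by rewrite /rho; int_closed.
- by [].
- by int_closed.
- rewrite Erho4; transitivity (2 * (a * a) + 4 * (t%:~R + t2) * a); first by ring.
  by rewrite aa BC; ring.
- by rewrite Erho4; apply: twice_mul2; int_closed.
- move=> h1; have [] : (exists k, 1 = 2 * k :> int) /\ (exists k, 0 = 2 * k :> int); last by move=> [k]; lia.
  apply: (twice_par (e1 := a) _ iO).
    move=> W X Y Z W' X' Y' Z'.
    rewrite !(int_span4_quarter _ _ _ _ ae be (erefl _)).
    by move=> /(quarter_inj hK)[q1 q2 q3 q4]; lia.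
  by have -> : 1%:~R + 0%:~R * a = 1 :> K by ring.
- move=> x /iO[i [j [k [l ->]]]].
  have ea : a = 1 + rho * (rho + 2) - 2 * r.
    by rewrite /rho; transitivity (eta * eta - 2 * r); [rewrite Eeta; ring|ring].
  have eb : b = rho * (- (rho + 2) * eta) +
     2 * ((B' - C')%:~R * b + (2 * C' + 1)%:~R * eta + r * eta).
    have h : b = (2 * (B' - C'))%:~R * b + C%:~R * eta - a * eta by rewrite Eaeta; ring.
    rewrite {1}h {1}ea hC; ring.
  exists (i + j + l), (j%:~R * (rho + 2%:R) - k%:~R * (rho + 2%:R) * eta + l%:~R),
    (- (j%:~R * r) + k%:~R * ((B' - C')%:~R * b + (2 * C' + 1)%:~R * eta + r * eta)).
  have Orho : O rho by rewrite /rho; int_closed.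
  split; [int_closed|int_closed|].
  rewrite {1}eb {1}ea.
  have -> : l%:~R * eta = l%:~R * (rho + 1) by rewrite /rho; ring.
  ring.
Qed.

End TypedFields.

(** * Normal forms of V_4-quartic fields *)

Lemma abelem_Z2Z2 : (2.-abelem (finset.setT : {set 'Z_2 * 'Z_2}))%g.
Proof.
apply: exponent2_abelem; apply/exponentP => -[x y] _; rewrite expgS expg1.
apply/eqP; rewrite -pair_eqE /=.
by case: x => -[|[|x]] hx; case: y => -[|[|y]] hy.
Qed.

Lemma card_Z2Z2 : #|(finset.setT : {set 'Z_2 * 'Z_2})| = 4%N.
Proof. by rewrite cardsT card_prod card_ord. Qed.

Lemma galois_rat (K : splittingFieldType rat) : galois 1 {:K}.
Proof.
apply/and3P; split; [exact: sub1v| |exact: normalFieldf].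
apply/separableP => u _; apply: pcharf0_separable => p.
rewrite !inE; apply/negbTE/negP => /andP[pp /eqP h].
have : in_alg K p%:R = 0 by rewrite rmorph_nat.
by move/eqP; rewrite fmorph_eq0 pnatr_eq0 => /eqP p0; rewrite p0 in pp.
Qed.

(** Every automorphism multiplies a, b and c by signs, so the Galois group has exponent 2; its order
    is 4. *)
Lemma biq_V4 (K : splittingFieldType rat) A B C (a b c : K) :
  biq_field A B C a b c -> is_V4_quartic K.
Proof.
move=> hK; have dim4 : \dim {:K} = 4%N by rewrite (size_basis (X := [tuple 1; a; b; c]) hK.2).
split; [exact: dim4|exact: galois_rat|].
rewrite isog_sym (isog_abelem_card _ abelem_Z2Z2) card_Z2Z2.
have cG : #|'Gal({:K} / 1)%g| = 4%N by rewrite -(galois_dim (galois_rat K)) dimv1 divn1.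
rewrite cG eqxx andbT; apply: exponent2_abelem; apply/exponentP => s _; rewrite expgS expg1.
apply/eqP/gal_eqP => v _; rewrite galM ?memvf // gal_id.
have sq (u : K) (n : int) : u * u = n%:~R -> s (s u) = u.
  move=> hu; have : (s u - u) * (s u + u) = 0.
    transitivity (s u * s u - u * u); first by ring.
    by rewrite -rmorphM hu rmorph_int subrr.
  move=> /eqP; rewrite mulf_eq0 => /orP[].
    by rewrite subr_eq0 => /eqP e; rewrite !e.
  by rewrite addr_eq0 => /eqP e; rewrite e rmorphN /= e opprK.
have [aa bb cc _ _ _] := hK.1.
have [w [x [y [z ->]]]] := biq_span hK v.
rewrite !(biq_rmorph_lin _ _ _ (in_alg K)) /=.
by rewrite (sq _ _ aa) (sq _ _ bb) (sq _ _ cc).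
Qed.

Lemma sqf_exists (n : nat) : (0 < n)%N -> exists d m, [/\ (0 < d)%N, sqf m & n = (d ^ 2 * m)%N].
Proof.
elim: n {-2}n (leqnn n) => [n hn n0|k IH n hn n0]; first by move: n0; rewrite ltnNge hn.
have [s|ns] := boolP (sqf n); first by exists 1%N, n; rewrite mul1n.
move: ns; rewrite /sqf n0 /= => /allPn[p]; rewrite mem_primes negbK => /and3P[pp _ _] /dvdnP[q hq].
have q0 : (0 < q)%N by move: n0; rewrite hq; case: (q).
have pp1 := prime_gt1 pp.
have qk : (q <= k)%N.
  rewrite -ltnS (leq_trans _ hn) // hq -{1}[q]muln1 ltn_pmul2l //.
  by rewrite (ltn_trans pp1) // -{1}[p]expn1 ltn_exp2l.
have [d [m [d0 hm e]]] := IH q qk q0.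
exists (d * p)%N, m; split=> //; first by rewrite muln_gt0 d0 ltnW.
by rewrite hq e expnMn; ring.
Qed.

Lemma rat_sqf (q : rat) : q != 0 -> exists (r : rat) (m : int),
  [/\ r != 0, sqf `|m|%N & r * r * q = m%:~R].
Proof.
move=> q0; set N := numq q * denq q.
have N0 : (0 < `|N|)%N by rewrite absz_gt0 mulf_neq0 ?numq_eq0 ?denq_eq0.
have [d [m [d0 hm e]]] := sqf_exists N0.
have dq0 : (denq q)%:~R != 0 :> rat by rewrite intr_eq0 denq_eq0.
have d1 : (d%:Z)%:~R != 0 :> rat by rewrite intr_eq0; lia.
exists ((denq q)%:~R / (d%:Z)%:~R), (sgz N * m%:Z); split.
- by rewrite mulf_neq0 // invr_eq0.
- rewrite abszM; have -> : `|sgz N|%N = 1%N by move: N0; rewrite absz_gt0 /sgz; case: (N) => [[|n]|n].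
  by rewrite mul1n.
- have hN : N = sgz N * m%:Z * d%:Z * d%:Z.
    rewrite {1}[N]intEsg; have -> : `|N|%N%:Z = d%:Z * d%:Z * m%:Z by rewrite e; lia.
    by rewrite /sgz; ring.
  have : N%:~R = (denq q)%:~R * (denq q)%:~R * q.
    by rewrite /N rmorphM /= numqE; ring.
  rewrite {1}hN => h; rewrite -mulrA.
  transitivity ((denq q)%:~R * (denq q)%:~R * q / ((d%:Z)%:~R * (d%:Z)%:~R)); first by field.
  by rewrite -h !rmorphM /=; field.
Qed.

Lemma sqf_coprime m n : sqf (m * n) -> coprime m n.
Proof.
move=> /sqfP[mn0 h]; have g0 : (0 < gcdn m n)%N.
  by move: mn0; rewrite muln_gt0 gcdn_gt0 => /andP[->].
rewrite /coprime eqn_leq g0 andbT leqNgt; apply/negP => g1.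
have := h _ (pdiv_prime g1); rewrite expnS expn1 dvdn_mul //.
  by rewrite (dvdn_trans (pdiv_dvd _)) // dvdn_gcdl.
by rewrite (dvdn_trans (pdiv_dvd _)) // dvdn_gcdr.
Qed.

Section Eigen.
Variables (K : splittingFieldType rat) (s t : {rmorphism K -> K}).
Hypotheses (ss : forall v, s (s v) = v) (tt : forall v, t (t v) = v)
  (st : forall v, s (t v) = t (s v))
  (fix1 : forall v, s v = v -> t v = v -> exists q, v = in_alg K q).

Definition eigen (i j : bool) (v : K) := s v = (-1) ^+ i * v /\ t v = (-1) ^+ j * v.

(** The quotient of two vectors with the same signs is fixed by s and t, hence rational. *)
Lemma eigen_ratio i j u v : u != 0 -> eigen i j u -> eigen i j v -> exists q, v = in_alg K q * u.
Proof.
move=> u0 [su tu] [sv tv].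
have [||q hq] := fix1 (v := v / u).
- by rewrite fmorph_div /= su sv -mulf_div divff ?mul1r // signr_eq0.
- by rewrite fmorph_div /= tu tv -mulf_div divff ?mul1r // signr_eq0.
by exists q; rewrite -hq divfK.
Qed.

(** The generator may be 0 at this stage; that each eigenspace is a line follows later from the
    degree. *)
Lemma eigen_generator i j : exists u, eigen i j u /\ forall v, eigen i j v -> exists q, v = in_alg K q * u.
Proof.
have [[u [u0 hu]]|h] := EM (exists u, u != 0 /\ eigen i j u).
  by exists u; split=> // v; apply: eigen_ratio.
exists 0; split; first by split; rewrite rmorph0 mulr0.
move=> v hv; exists 0; rewrite mulr0; apply/eqP/negPn/negP => v0.
by apply: h; exists v.
Qed.

(** The four summands are the projections onto the characters of the group generated by s and t. *)
Lemma eigen_decomp v : exists v0 v1 v2 v3,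
  [/\ eigen false false v0, eigen true false v1, eigen false true v2, eigen true true v3
    & v = v0 + v1 + v2 + v3].
Proof.
have n4 := four_neq0 K.
exists ((v + s v + t v + s (t v)) / 4), ((v - s v + t v - s (t v)) / 4),
  ((v + s v - t v - s (t v)) / 4), ((v - s v - t v + s (t v)) / 4).
have f4 (f : {rmorphism K -> K}) : f 4^-1 = 4^-1 by rewrite fmorphV rmorph_nat.
split; last by field.
all: split; rewrite rmorphM /= f4 !(rmorphB, rmorphD) /= ?ss ?tt ?st ?tt ?ss ?expr0 ?expr1 ; 
  by rewrite -?st ?ss ?tt; ring.
Qed.

End Eigen.

Lemma admissible_neq0 A B C : admissible A B C -> [/\ A != 0, B != 0 & C != 0].
Proof. by case=> /sqf_gt0 + /sqf_gt0 + /sqf_gt0; rewrite !absz_gt0. Qed.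

Lemma admissible_rat_sq A B C (q : rat) : admissible A B C ->
  [/\ q * q != (B * C)%:~R, q * q != (A * C)%:~R & q * q != (A * B)%:~R].
Proof.
have key A' B' C' : admissible A' B' C' -> q * q != (B' * C')%:~R.
  move=> h; apply/eqP => e; have /eqP[] := adm_BC1 h.
  by apply: (sqf_eq (admissible_sqfBC h) (isT : sqf `|1|) (r := q)); rewrite mulr1.
move=> h; split; [exact: key h|exact: key (admissible_swap12 h)|].
exact: key (admissible_swap12 (admissible_swap23 h)).
Qed.

Section BiqFree.
Variables (K : fieldExtType rat) (A B C : int) (a b c : K).
Hypotheses (hb : biq A B C a b c) (adm : admissible A B C).
Local Notation f := (in_alg K).

Lemma in_alg_int (n : int) : f n%:~R = n%:~R. Proof. exact: rmorph_int. Qed.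

Lemma biq_free2 w x : f w + f x * a = 0 -> w = 0 /\ x = 0.
Proof.
move=> e; have [x0|x0] := eqVneq x 0.
  by move: e; rewrite x0 rmorph0 mul0r addr0 => /eqP; rewrite fmorph_eq0 => /eqP.
exfalso; have ea : a = f (- w / x).
  have fx0 : f x != 0 by rewrite fmorph_eq0.
  rewrite rmorphM fmorphV rmorphN; apply: (mulIf fx0); rewrite divfK //.
  by apply/eqP; rewrite -addr_eq0 mulrC addrC e.
have [/eqP h _ _] := admissible_rat_sq (- w / x) adm; apply: h.
by have := biq_aa hb; rewrite ea -rmorphM -in_alg_int => /fmorph_inj.
Qed.

(** As c = ab / C, the claim is that 1 and b are independent over Q(a). Otherwise b = (u + v a) / N
    with N the norm of its coefficient; squaring gives u v = 0, and then AC is either BC times a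
    rational square or a rational square itself. *)
Lemma biq_free w x y z : lin4 f a b c w x y z = 0 -> [/\ w = 0, x = 0, y = 0 & z = 0].
Proof.
have [aa bb cc ab ac bc] := hb; move=> e; have [nA nB nC] := admissible_neq0 adm.
have C0 : (C%:~R : rat) != 0 by rewrite intr_eq0.
have fC0 : (C%:~R : K) != 0 by rewrite -in_alg_int fmorph_eq0.
pose z' := z / C%:~R.
have ez : z = z' * C%:~R by rewrite /z' divfK.
have e1 : (f w + f x * a) + (f y + f z' * a) * b = 0.
  transitivity (lin4 f a b c w x y (z' * C%:~R)); last by rewrite -ez.
  by rewrite /lin4; ring: ab.
pose N := y * y - (B * C)%:~R * z' * z'.
have eN : (f y + f z' * a) * (f y - f z' * a) = f N.
  by rewrite /N; ring: aa.
have [N0|N0] := eqVneq N 0.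
  have [y0 z0] : y = 0 /\ z' = 0.
    have [z0|z0] := eqVneq z' 0.
      by move: N0; rewrite /N z0 mulr0 subr0 => /eqP; rewrite mulf_eq0 orbb => /eqP.
    exfalso; have [/eqP h _ _] := admissible_rat_sq (y / z') adm; apply: h.
    have zz0 : z' * z' != 0 by rewrite mulf_neq0.
    rewrite mulf_div; apply: (mulIf zz0); rewrite divfK //.
    by apply/eqP; rewrite -subr_eq0 mulrA; apply/eqP.
  move: e1; rewrite y0 z0 rmorph0 mul0r addr0 mul0r addr0 => /biq_free2[-> ->].
  by split=> //; rewrite ez z0 mul0r.
exfalso.
pose u := - (w * y - x * z' * (B * C)%:~R); pose v := - (x * y - w * z').
have eb : f N * b = f u + f v * a.
  have -> : f N * b = ((f w + f x * a) + (f y + f z' * a) * b) * (f y - f z' * a)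
     - (f w + f x * a) * (f y - f z' * a) by rewrite -eN; ring.
  by rewrite e1 mul0r sub0r /u /v; ring: aa.
have e2 : f (N * N * (A * C)%:~R - u * u - v * v * (B * C)%:~R) + f (- (2 * u * v)) * a = 0.
  transitivity ((f N * b) * (f N * b) - (f u + f v * a) * (f u + f v * a)); last by rewrite eb subrr.
  ring: aa bb.
have [e3 /eqP] := biq_free2 e2; rewrite oppr_eq0 -mulrA mulf_eq0 pnatr_eq0 /= mulf_eq0.
case/orP => /eqP uv0; move: e3; rewrite uv0 !mul0r ?subr0 => /eqP; rewrite subr_eq0 => /eqP e3.
  have AB : A * C = B * C.
    apply: (sqf_eq (r := v / N)); first exact: (admissible_sqfBC (admissible_swap12 adm)).
      exact: (admissible_sqfBC adm).
    by rewrite mulf_div mulrAC -e3 [N * N * _]mulrC mulfK ?mulf_neq0.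
  have e4 : A = B by apply: (mulIf nC).
  have := adm_AB adm; rewrite e4 /coprime gcdnn => /eqP B1.
  by have /eqP[] := adm_AB1 adm; rewrite e4; lia.
have [_ /eqP h _] := admissible_rat_sq (u / N) adm; apply: h.
by rewrite mulf_div -e3 [N * N * _]mulrC mulfK ?mulf_neq0.
Qed.

Lemma biq_fieldP : (forall v, exists w x y z, v = lin4 f a b c w x y z) -> biq_field A B C a b c.
Proof.
move=> span; split=> //.
have lE w x y z : lin4 f a b c w x y z = w%:A + x *: a + y *: b + z *: c.
  by rewrite /lin4 /= !mulr_algl.
rewrite /basis_of; apply/andP; split.
  rewrite eqEsubv subvf /=; apply/subvP => v _; have [w [x [y [z ->]]]] := span v.
  by rewrite lE; do !apply: memvD; apply: memvZ; apply: memv_span; rewrite !inE eqxx ?orbT.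
apply/(@freeP _ _ _ [tuple 1; a; b; c]) => k.
rewrite !big_ord_recl big_ord0 /= addr0 !addrA -lE => /biq_free[k0 k1 k2 k3] i.
case: i => [[|[|[|[|i]]]] hi] //; [rewrite -{}k0|rewrite -{}k1|rewrite -{}k2|rewrite -{}k3];
by congr k; apply: val_inj.
Qed.

End BiqFree.

(** C is the gcd of m and n, so that ab / C is a square root of mn / C^2 = AB and the cofactors are
    coprime. *)
Lemma sqf_biq (K : fieldExtType rat) (m n : int) (a b : K) :
  sqf `|m| -> sqf `|n| -> a * a = m%:~R -> b * b = n%:~R ->
  exists A B C c, [/\ m = B * C, n = A * C, c * C%:~R = a * b, biq A B C a b c &
    [/\ sqf `|A|, sqf `|B| & sqf `|C|] /\
    [/\ coprime `|A| `|B|, coprime `|A| `|C| & coprime `|B| `|C|]].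
Proof.
move=> sm sn am bn; pose C := (gcdn `|m| `|n|)%:Z.
have C0 : (0 < gcdn `|m| `|n|)%N by rewrite gcdn_gt0 (sqf_gt0 sm).
have [B hB] : exists B, m = B * C.
  by apply/dvdzP; rewrite dvdzE /= dvdn_gcdl.
have [A hA] : exists A, n = A * C.
  by apply/dvdzP; rewrite dvdzE /= dvdn_gcdr.
have fC0 : (C%:~R : K) != 0.
  by rewrite -[C%:~R](rmorph_int (in_alg K)) fmorph_eq0 intr_eq0 /C; lia.
have aC : `|C|%N = gcdn `|m| `|n| by [].
have mE : `|m|%N = (`|B| * `|C|)%N by rewrite hB abszM.
have nE : `|n|%N = (`|A| * `|C|)%N by rewrite hA abszM.
exists A, B, C, (a * b / C%:~R); split=> //.
- by rewrite divfK.
- rewrite hB in am; rewrite hA in bn; split=> //.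
  + transitivity ((a * a) * (b * b) / (C%:~R * C%:~R)); first by field.
    by rewrite am bn; field.
  + by field.
  + by transitivity ((a * a) * b / C%:~R); [field|rewrite am; field].
  + by transitivity ((b * b) * a / C%:~R); [field|rewrite bn; field].
- split; split.
  + by apply: sqf_dvd sn; rewrite nE dvdn_mulr.
  + by apply: sqf_dvd sm; rewrite mE dvdn_mulr.
  + by apply: sqf_dvd sm; rewrite mE dvdn_mull.
  + have : (gcdn `|A| `|B| * `|C| = 1 * `|C|)%N.
      by rewrite mul1n muln_gcdl -mE -nE gcdnC aC.
    by move=> /eqP; rewrite eqn_mul2r aC -[_ == 0]leqn0 leqNgt C0 /=.
  + by apply: sqf_coprime; rewrite -nE.
  + by apply: sqf_coprime; rewrite -mE.
Qed.

(** K is the sum of the common eigenspaces of two generators s and t of its group. Generators of the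
    lines with signs (-, +) and (+, -), scaled so that their squares are squarefree integers, serve
    as a and b. *)
Lemma V4_biq (K : splittingFieldType rat) : is_V4_quartic K ->
  exists A B C (a b c : K), admissible A B C /\ biq_field A B C a b c.
Proof.
move=> [dim4 gal4]; rewrite isog_sym (isog_abelem_card _ abelem_Z2Z2) card_Z2Z2.
set G := 'Gal({:K} / 1)%g => /andP[/(abelemP (isT : prime 2))[abG expG] /eqP cG].
have [s [sG s1]] : exists s, s \in G /\ s != 1%g.
  have : ~~ (G \subset [set 1%g]%SET) by apply/negP => /subset_leq_card; rewrite cards1 cG.
  by case/subsetPn => s sG; rewrite inE => s1; exists s.
have [t [tG t1 ts]] : exists t, [/\ t \in G, t != 1%g & t != s].
  have : ~~ (G \subset [set 1%g; s]%SET).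
    by apply/negP => /subset_leq_card; rewrite cards2 cG; case: (_ != _).
  by case/subsetPn => t tG; rewrite !inE negb_or => /andP[]; exists t.
have all4 x : x \in G -> [|| x == 1, x == s, x == t | x == s * t]%g.
  move=> xG; pose l := [:: 1; s; t; s * t]%g.
  have ul : uniq l.
    have n1 : (s * t)%g != 1%g.
      apply: contra ts => /eqP e; rewrite -(inj_eq (mulgI s)) e.
      by have := expG _ sG; rewrite expgS expg1 => ->.
    have n2 : (s * t)%g != s by rewrite -{2}(mulg1 s) (inj_eq (mulgI s)).
    have n3 : (s * t)%g != t by rewrite -{2}(mul1g t) (inj_eq (mulIg t)).
    rewrite eq_sym in s1; rewrite eq_sym in t1; rewrite eq_sym in ts.
    rewrite eq_sym in n1; rewrite eq_sym in n2; rewrite eq_sym in n3.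
    by rewrite /= !inE !negb_or s1 t1 ts n1 n2 n3.
  have sl : {subset l <= enum G}.
    by move=> y; rewrite mem_enum !inE => /or4P[] /eqP ->; rewrite ?group1 ?groupM.
  have := uniq_min_size ul sl; rewrite -cardE cG => /(_ isT)[_ h].
  by move: (h x); rewrite mem_enum xG !inE.
have fix1 v : s v = v -> t v = v -> exists q, v = in_alg K q.
  move=> sv tv; have : v \in (1%VS : {vspace K}).
    have /galois_fixedField <- := gal4.
    apply/(fixedFieldP (memvf v)) => x /all4/or4P[] /eqP ->; rewrite ?gal_id //.
    by rewrite galM ?memvf // sv.
  by move=> /vlineP[q ->]; exists q.
have sq x : x \in G -> forall v, x (x v) = v.
  move=> xG v; rewrite -galM ?memvf //.
  by have := expG _ xG; rewrite expgS expg1 => ->; rewrite gal_id.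
have st v : s (t v) = t (s v).
  rewrite -!galM ?memvf //; congr (_ v); congr (fun_of_lfun (gal_repr _)).
  by apply/(centsP abG).
have [sr hs] : exists f : {rmorphism K -> K}, forall v, f v = s v.
  by exists (GRing.RMorphism.clone K K (s : K -> K) _).
have [tr ht] : exists f : {rmorphism K -> K}, forall v, f v = t v.
  by exists (GRing.RMorphism.clone K K (t : K -> K) _).
have ss v : sr (sr v) = v by rewrite !hs sq.
have tt v : tr (tr v) = v by rewrite !ht sq.
have st' v : sr (tr v) = tr (sr v) by rewrite !hs !ht st.
have fx v : sr v = v -> tr v = v -> exists q, v = in_alg K q by rewrite hs ht; apply: fix1.
clear all4 sq st fix1 hs ht.
have [u1 [e1 g1]] := eigen_generator fx true false.
have [u2 [e2 g2]] := eigen_generator fx false true.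
have [u3 [e3 g3]] := eigen_generator fx true true.
have span v : exists w x y z, v = in_alg K w + in_alg K x * u1 + in_alg K y * u2 + in_alg K z * u3.
  have [v0 [v1 [v2 [v3 [h0 h1 h2 h3 ->]]]]] := eigen_decomp ss tt st' v.
  have [w ->] : exists w, v0 = in_alg K w.
    by apply: fx; case: h0; rewrite !expr0 !mul1r.
  have [x ->] := g1 _ h1; have [y ->] := g2 _ h2; have [z ->] := g3 _ h3.
  by exists w, x, y, z.
(* Four elements that span a space of dimension 4 are independent, so none of the chosen generators
   is 0. *)
have bas : basis_of {:K} [:: 1; u1; u2; u3].
  rewrite basisEdim dim4 leqnn andbT; apply/subvP => v _.
  have [w [x [y [z ->]]]] := span v; rewrite /= !mulr_algl.
  by do !apply: memvD; apply: memvZ; apply: memv_span; rewrite !inE eqxx ?orbT.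
have nz u : u \in [:: 1; u1; u2; u3] -> u != 0.
  exact: (free_not0 (basis_free bas)).
have n2 : (2 : K) != 0 by rewrite -(rmorph_nat (in_alg K)) fmorph_eq0.
have sqrt_gen i j u : u != 0 -> eigen sr tr i j u -> exists (a : K) (m : int),
    [/\ a != 0, eigen sr tr i j a, sqf `|m| & a * a = m%:~R].
  move=> u0 [su tu].
  have [||q hq] := fx (u * u).
  - by rewrite rmorphM /= su mulrACA -expr2 sqrr_sign mul1r.
  - by rewrite rmorphM /= tu mulrACA -expr2 sqrr_sign mul1r.
  have q0 : q != 0.
    by apply/eqP => q0; move/eqP: hq; rewrite q0 rmorph0 mulf_eq0 orbb (negbTE u0).
  have [r [m [r0 sm e]]] := rat_sqf q0.
  have fr (f : {rmorphism K -> K}) : f (in_alg K r) = in_alg K r.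
    by rewrite -[LHS]/((f \o in_alg K) r) [LHS](fmorph_eq_rat (f \o in_alg K)) (fmorph_eq_rat (in_alg K)).
  exists (in_alg K r * u), m; split=> //.
  - by rewrite mulf_neq0 // fmorph_eq0.
  - by split; rewrite rmorphM fr ?su ?tu mulrCA.
  - by rewrite mulrACA hq -rmorphM -rmorphM e rmorph_int.
(* An element negated by an automorphism is neither 1 nor -1; this yields the three inequalities of
   [admissible]. *)
have sign_neq (f : {rmorphism K -> K}) (v : K) : v != 0 -> f v = - v -> v * v != 1.
  move=> v0 fv; apply/eqP => vv; have : (v - 1) * (v + 1) = 0.
    by transitivity (v * v - 1); [ring|rewrite vv subrr].
  move=> /eqP; rewrite mulf_eq0 subr_eq0 addr_eq0 => /orP[] /eqP ev; move: fv.
    by rewrite ev rmorph1 => /eqP; rewrite -addr_eq0 (negbTE n2).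
  rewrite ev rmorphN rmorph1 opprK => /esym/eqP; rewrite -addr_eq0.
  by rewrite (negbTE n2).
have u10 : u1 != 0 by apply: nz; rewrite !inE eqxx orbT.
have u20 : u2 != 0 by apply: nz; rewrite !inE eqxx !orbT.
have [a [m [a0 ea sm am]]] := sqrt_gen _ _ _ u10 e1.
have [b [n [b0 eb sn bn]]] := sqrt_gen _ _ _ u20 e2.
have [A [B [C [c [mE nE cE hb [[sA sB sC] [cAB cAC cBC]]]]]]] := sqf_biq sm sn am bn.
have C0 : (C%:~R : K) != 0.
  rewrite -[C%:~R](rmorph_int (in_alg K)) fmorph_eq0 intr_eq0.
  by apply/eqP => C0; move: (sqf_gt0 sC); rewrite C0.
have c0 : c != 0.
  by apply/eqP => c0; move/eqP: cE; rewrite c0 mul0r eq_sym mulf_eq0 (negbTE a0) (negbTE b0).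
have ec : eigen sr tr true true c.
  have [sa ta] := ea; have [sb tb] := eb.
  split; apply: (mulIf C0); rewrite -mulrA cE.
    transitivity (sr (c * C%:~R)); first by rewrite rmorphM rmorph_int.
    by rewrite cE rmorphM /= sa sb expr1 expr0; ring.
  transitivity (tr (c * C%:~R)); first by rewrite rmorphM rmorph_int.
  by rewrite cE rmorphM /= ta tb expr1 expr0; ring.
exists A, B, C, a, b, c.
have adm : admissible A B C.
  have [aa bb cc _ _ _] := hb.
  split=> //; apply/eqP => e; move: aa bb cc; rewrite e.
  - move=> /eqP; rewrite (negbTE (sign_neq sr a a0 _)) //.
    by case: ea => ->; rewrite expr1 mulN1r.
  - move=> _ /eqP; rewrite (negbTE (sign_neq tr b b0 _)) //.
    by case: eb => _ ->; rewrite expr1 mulN1r.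
  - move=> _ _ /eqP; rewrite (negbTE (sign_neq sr c c0 _)) //.
    by case: ec => ->; rewrite expr1 mulN1r.
split=> //; apply: biq_fieldP => // v.
have [v0 [v1 [v2 [v3 [h0 h1 h2 h3 ->]]]]] := eigen_decomp ss tt st' v.
have [w ->] : exists w, v0 = in_alg K w.
  by apply: fx; case: h0; rewrite !expr0 !mul1r.
have [x ->] := eigen_ratio fx a0 ea h1.
have [y ->] := eigen_ratio fx b0 eb h2.
have [z ->] := eigen_ratio fx c0 ec h3.
by exists w, x, y, z.
Qed.

Definition biquadratic (K : fieldExtType rat) (A B C : int) : Prop :=
  admissible A B C /\ exists a b c : K, biq_field A B C a b c.

Lemma biquadratic_swap12 (K : fieldExtType rat) A B C : biquadratic K A B C -> biquadratic K B A C.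
Proof.
move=> [h [a [b [c hK]]]]; split; first exact: admissible_swap12.
by exists b, a, c; apply: biq_field_swap12.
Qed.

Lemma biquadratic_swap23 (K : fieldExtType rat) A B C : biquadratic K A B C -> biquadratic K A C B.
Proof.
move=> [h [a [b [c hK]]]]; split; first exact: admissible_swap23.
by exists a, c, b; apply: biq_field_swap23.
Qed.

Lemma biquadraticN (K : fieldExtType rat) A B C :
  biquadratic K A B C -> biquadratic K (- A) (- B) (- C).
Proof.
move=> [h [a [b [c hK]]]]; split; first exact: admissibleN.
by exists (- a), (- b), (- c); apply: biq_fieldN.
Qed.

Lemma sqf_mod4 (n : int) : sqf `|n| -> (n %% 4)%Z != 0.
Proof.
move=> /sqfP[_ h]; apply/negP => /eqP e; have /negP[] := h 2%N isT.
by rewrite -[(2 ^ 2)%N]/(`|4%Z|%N) -dvdzE; apply/dvdz_mod0P.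
Qed.

Lemma coprime_even (m n : int) : coprime `|m| `|n| -> (m %% 2)%Z = 0 -> (n %% 2)%Z != 0.
Proof.
move=> co m0; apply/negP => /eqP n0.
have : (2 %| gcdn `|m| `|n|)%N.
  by rewrite dvdn_gcd; apply/andP; split; rewrite -[2%N]/(`|2%Z|%N) -dvdzE; apply/dvdz_mod0P.
by rewrite (eqP co).
Qed.

Lemma biquadratic_even (K : fieldExtType rat) A B C : biquadratic K A B C -> (A %% 2)%Z = 0 ->
  exists A B C, biquadratic K A B C /\ (typeR2 A B C \/ typeR1 A B C) /\ (`|C| <= `|B|)%N.
Proof.
move=> h A0; have [hA _] := h.
have A4 := sqf_mod4 (adm_A hA).
have B2 := coprime_even (adm_AB hA) A0; have C2 := coprime_even (adm_AC hA) A0.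
wlog B1 : A B C h hA A0 A4 B2 C2 / (B %% 4)%Z = 1.
  have [B1|B1] := eqVneq (B %% 4)%Z 1; first by move=> /(_ A B C); apply.
  move=> /(_ (- A) (- B) (- C)); apply; try lia; first exact: biquadraticN.
  exact: admissibleN.
have [C1|C3] := eqVneq (C %% 4)%Z 1.
  have R2 A' B' C' : (A' %% 2)%Z = 0 -> (A' %% 4)%Z != 0 -> (B' %% 4)%Z = 1 -> (C' %% 4)%Z = 1 ->
      typeR2 A' B' C'.
    move=> *; exists (A' %/ 4)%Z, (B' %/ 4)%Z, (C' %/ 4)%Z, 2.
    by split; [lia|lia|lia|left].
  have [le|le] := leqP `|C| `|B|.
    by exists A, B, C; split=> //; split=> //; left; apply: R2.
  exists A, C, B; split; first exact: biquadratic_swap23.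
  by split; [left; apply: R2|apply: ltnW].
have R1 A' B' C' : (A' %% 2)%Z = 0 -> (A' %% 4)%Z != 0 -> (B' %% 4)%Z = 1 -> (C' %% 4)%Z = 3 ->
    typeR1 A' B' C'.
  move=> *; exists (A' %/ 4)%Z, (B' %/ 4)%Z, (C' %/ 4)%Z.
  by split; lia.
have [le|le] := leqP `|C| `|B|.
  by exists A, B, C; split=> //; split=> //; right; apply: R1 => //; lia.
(* Exchanging B and C puts the residue 3 in the wrong place; the common sign exchanges the residues
   1 and 3 again. *)
exists (- A), (- C), (- B); split; first by apply/biquadraticN/biquadratic_swap23.
by split; [right; apply: R1; lia|rewrite !abszN; apply: ltnW].
Qed.

Lemma biquadratic_odd (K : fieldExtType rat) A B C : biquadratic K A B C ->
  (A %% 4)%Z = 3 -> (B %% 4)%Z = 1 -> (C %% 4)%Z = 1 ->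
  exists A B C, biquadratic K A B C /\ (typeR2 A B C \/ typeR1 A B C) /\ (`|C| <= `|B|)%N.
Proof.
move=> h A3 B1 C1.
have R2 A' B' C' : (A' %% 4)%Z = 3 -> (B' %% 4)%Z = 1 -> (C' %% 4)%Z = 1 -> typeR2 A' B' C'.
  move=> *; exists (A' %/ 4)%Z, (B' %/ 4)%Z, (C' %/ 4)%Z, 3.
  by split; [lia|lia|lia|right].
have [le|le] := leqP `|C| `|B|.
  by exists A, B, C; split=> //; split=> //; left; apply: R2.
exists A, C, B; split; first exact: biquadratic_swap23.
by split; [left; apply: R2|apply: ltnW].
Qed.

Lemma biquadratic_unram (K : fieldExtType rat) A B C : biquadratic K A B C ->
  (A %% 4)%Z = 1 -> (B %% 4)%Z = 1 -> (C %% 4)%Z = 1 ->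
  exists A B C, biquadratic K A B C /\ typeU A B C /\ (`|A| <= `|C| <= `|B|)%N.
Proof.
move=> h A1 B1 C1.
have U A' B' C' : (A' %% 4)%Z = 1 -> (B' %% 4)%Z = 1 -> (C' %% 4)%Z = 1 -> typeU A' B' C'.
  by move=> *; exists (A' %/ 4)%Z, (B' %/ 4)%Z, (C' %/ 4)%Z; split; lia.
have s12 := @biquadratic_swap12 K; have s23 := @biquadratic_swap23 K.
have [ab|ba] := leqP `|A| `|B|; have [bc|cb] := leqP `|B| `|C|; have [ac|ca] := leqP `|A| `|C|.
all: first
 [ by exists A, B, C; split; [|split; [exact: U|lia]]
 | by exists A, C, B; split; [exact: s23|split; [exact: U|lia]]
 | by exists B, A, C; split; [exact: s12|split; [exact: U|lia]]
 | by exists B, C, A; split; [exact/s23/s12|split; [exact: U|lia]]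
 | by exists C, A, B; split; [exact/s12/s23|split; [exact: U|lia]]
 | by exists C, B, A; split; [exact/s12/s23/s12|split; [exact: U|lia]]
 | by exfalso; lia ].
Qed.

(** At most one of A, B, C is even. If all are odd, a common sign leaves at most one of them
    congruent to 3 modulo 4. Permutations then put the distinguished entry first and order the
    others. *)
Lemma V4_normal_form (K : splittingFieldType rat) : is_V4_quartic K ->
  exists A B C, biquadratic K A B C /\
   ((typeU A B C /\ (`|A| <= `|C| <= `|B|)%N) \/
    ((typeR2 A B C \/ typeR1 A B C) /\ (`|C| <= `|B|)%N)).
Proof.
move=> /V4_biq[A [B [C [a [b [c [hA hK]]]]]]].
have h : biquadratic K A B C by split=> //; exists a, b, c.
clear hK a b c.
suff : (exists A B C, biquadratic K A B C /\ typeU A B C /\ (`|A| <= `|C| <= `|B|)%N) \/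
  (exists A B C, biquadratic K A B C /\ (typeR2 A B C \/ typeR1 A B C) /\ (`|C| <= `|B|)%N).
  by case=> -[A' [B' [C' [h1 h2]]]]; exists A', B', C'; split=> //; [left|right].
have s12 := @biquadratic_swap12 K; have s23 := @biquadratic_swap23 K.
have [A0|A1] := eqVneq (A %% 2)%Z 0; first by right; apply: biquadratic_even h A0.
have [B0|B1] := eqVneq (B %% 2)%Z 0; first by right; apply: biquadratic_even (s12 _ _ _ h) B0.
have [C0|C1] := eqVneq (C %% 2)%Z 0.
  by right; apply: biquadratic_even (s12 _ _ _ (s23 _ _ _ h)) C0.
wlog : A B C h hA A1 B1 C1 / ((A %% 4)%Z = 3 /\ (B %% 4)%Z = 1 /\ (C %% 4)%Z = 1) \/
  ((A %% 4)%Z = 1 /\ (B %% 4)%Z = 3 /\ (C %% 4)%Z = 1) \/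
  ((A %% 4)%Z = 1 /\ (B %% 4)%Z = 1 /\ (C %% 4)%Z = 3) \/
  ((A %% 4)%Z = 1 /\ (B %% 4)%Z = 1 /\ (C %% 4)%Z = 1).
  move=> H; have : (((A %% 4)%Z = 1 \/ (A %% 4)%Z = 3) /\ ((B %% 4)%Z = 1 \/ (B %% 4)%Z = 3) /\
    ((C %% 4)%Z = 1 \/ (C %% 4)%Z = 3)) by lia.
  have HN := H (- A) (- B) (- C) (biquadraticN h) (admissibleN hA).
  move=> [[a|a] [[b|b] [c|c]]];
    [apply: (H A B C h hA A1 B1 C1)|apply: (H A B C h hA A1 B1 C1)|apply: (H A B C h hA A1 B1 C1)|apply: HN
    |apply: (H A B C h hA A1 B1 C1)|apply: HN|apply: HN|apply: HN];
    move: a b c; clear; lia.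
case=> [[a [b c]]|[[a [b c]]|[[a [b c]]|[a [b c]]]]].
- by right; apply: biquadratic_odd h a b c.
- by right; apply: biquadratic_odd (s12 _ _ _ h) b a c.
- by right; apply: biquadratic_odd (s12 _ _ _ (s23 _ _ _ h)) c a b.
- by left; apply: biquadratic_unram h a b c.
Qed.

Lemma biq_iso (K L : splittingFieldType rat) A B C :
  biquadratic K A B C -> biquadratic L A B C -> field_iso K L.
Proof.
move=> [_ [a [b [c hK]]]] [_ [a' [b' [c' hL]]]].
have [f hf] := biq_extend hK (in_alg L) hL.1.
have [g hg] := biq_extend hL (in_alg K) hK.1.
exists f; exists g => v.
  by have [w [x [y [z ->]]]] := biq_span hK v; rewrite hf hg.
by have [w [x [y [z ->]]]] := biq_span hL v; rewrite hg hf.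
Qed.

Lemma biq_transport (K L : splittingFieldType rat) A B C :
  field_iso K L -> biquadratic K A B C -> biquadratic L A B C.
Proof.
move=> [f [g fg gf]] [adm [a [b [c hK]]]]; split=> //.
exists (f a), (f b), (f c); apply: biq_fieldP => //; first exact: (biq_rmorph f hK.1).
move=> v; have [w [x [y [z e]]]] := biq_span hK (g v).
by exists w, x, y, z; rewrite -(biq_rmorph_lin _ _ _ (in_alg L)) -e gf.
Qed.

(** An irrational element with rational square is a rational multiple of a, b or c: with a nonzero
    rational part, the vanishing of the other coordinates of the square would make the element
    rational or AB a square. The squarefree integers BC, AC, AB are thus determined by the field up
    to order. *)
Lemma biq_squares (K : fieldExtType rat) A B C A' B' C' :
  biquadratic K A B C -> biquadratic K A' B' C' -> 
  B' * C' = B * C \/ B' * C' = A * C \/ B' * C' = A * B.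
Proof.
move=> [adm [a [b [c hK]]]] [adm' [v [b' [c' hK']]]].
have [w [x [y [z ev]]]] := biq_span hK v.
have [nA nB nC] := admissible_neq0 adm.
have : v * v = in_alg K (B' * C')%:~R by rewrite (biq_aa hK'.1) in_alg_int.
rewrite ev (lin4_mul _ _ _ _ _ _ _ _ _ hK.1).
have -> : in_alg K (B' * C')%:~R = lin4K a b c (B' * C')%:~R 0 0 0 by rewrite /lin4; ring.
move=> /(biq_inj hK)[e0 e1 e2 e3].
have h1 : w * x = - (A%:~R * y * z) by lra.
have h2 : w * y = - (B%:~R * x * z) by lra.
have h3 : w * z = - (C%:~R * x * y) by lra.
have nA' : (A%:~R : rat) != 0 by rewrite intr_eq0.
have nB' : (B%:~R : rat) != 0 by rewrite intr_eq0.
have nC' : (C%:~R : rat) != 0 by rewrite intr_eq0.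
have s' := admissible_sqfBC adm'.
have sBC := admissible_sqfBC adm.
have sAC := admissible_sqfBC (admissible_swap12 adm).
have sAB : sqf (absz (A * B)) := admissible_sqfBC (admissible_swap12 (admissible_swap23 adm)).
have [w0|w0] := eqVneq w 0.
  move: h1 h2 h3; rewrite w0 !mul0r => /esym/eqP + /esym/eqP + /esym/eqP.
  rewrite !oppr_eq0 !mulf_eq0 (negbTE nA') (negbTE nB') (negbTE nC') /= => h1 h2 h3.
  have [x0|x0] := eqVneq x 0.
    have [y0|y0] := eqVneq y 0.
      right; right; apply: (sqf_eq (r := z) s' sAB).
      by rewrite -e0 w0 x0 y0 rmorphM /=; ring.
    rewrite (negbTE y0) /= in h1.
    right; left; apply: (sqf_eq (r := y) s' sAC).
    by rewrite -e0 w0 x0 (eqP h1) rmorphM /=; ring.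
  rewrite (negbTE x0) /= in h2 h3.
  left; apply: (sqf_eq (r := x) s' sBC).
  by rewrite -e0 w0 (eqP h2) (eqP h3) rmorphM /=; ring.
have [x0|x0] := eqVneq x 0.
  rewrite x0 !(mulr0, mul0r) oppr0 in h2 h3.
  move/eqP: h2; rewrite mulf_eq0 (negbTE w0) => /= /eqP y0.
  move/eqP: h3; rewrite mulf_eq0 (negbTE w0) => /= /eqP z0.
  exfalso; have [/eqP h _ _] := admissible_rat_sq w adm'; apply: h.
  by rewrite -e0 x0 y0 z0; ring.
exfalso; have y0 : y != 0.
  by apply/eqP => y0; move/eqP: h1; rewrite y0 mulr0 mul0r oppr0 mulf_eq0 (negbTE w0) (negbTE x0).
have [_ _ /eqP h] := admissible_rat_sq (w / z) adm; apply: h.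
have z0 : z != 0.
  by apply/eqP => z0; move/eqP: h1; rewrite z0 mulr0 oppr0 mulf_eq0 (negbTE w0) (negbTE x0).
have e : w * w * (x * y) = A%:~R * B%:~R * (z * z) * (x * y).
  transitivity ((w * x) * (w * y)); first by ring.
  by rewrite h1 h2; ring.
have {}e : w * w = A%:~R * B%:~R * (z * z).
  by apply: (mulIf _ e); rewrite mulf_neq0.
by rewrite mulf_div e mulfK ?mulf_neq0 // rmorphM.
Qed.

(** The field is generated inside the algebraic numbers by square roots of BC and AC. The span of 1,
    a, b, c is closed under products and contains both roots, so it is everything; the polynomial
    (X^2 - BC)(X^2 - AC) splits there. *)
Lemma biq_exists A B C : admissible A B C ->
  exists K : splittingFieldType rat, biquadratic K A B C.
Proof.
move=> adm; have [nA nB nC] := admissible_neq0 adm.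
have [K [f [l hl gen]]] :=
  num_field_exists [:: sqrtC (B * C)%:~R; sqrtC (A * C)%:~R].
case: l hl gen => [|a [|b [|]]] //= [fa fb] gen.
have am : a * a = (B * C)%:~R.
  by apply: (fmorph_inj f); rewrite rmorphM fa rmorph_int -expr2 sqrtCK.
have bn : b * b = (A * C)%:~R.
  by apply: (fmorph_inj f); rewrite rmorphM fb rmorph_int -expr2 sqrtCK.
have C0 : (C%:~R : K) != 0 by rewrite -in_alg_int fmorph_eq0 intr_eq0.
pose c := a * b / C%:~R.
have hb : biq A B C a b c.
  split=> //.
  - transitivity ((a * a) * (b * b) / (C%:~R * C%:~R)); first by rewrite /c; field.
    by rewrite am bn; field.
  - by rewrite /c; field.
  - by transitivity ((a * a) * b / C%:~R); [rewrite /c; field|rewrite am; field].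
  - by transitivity ((b * b) * a / C%:~R); [rewrite /c; field|rewrite bn; field].
pose U := <<[:: 1%R; a; b; c]>>%VS.
have lE w x y z : lin4K a b c w x y z = w%:A + x *: a + y *: b + z *: c.
  by rewrite /lin4 /= !mulr_algl.
have UP v : v \in U -> exists w x y z, v = lin4K a b c w x y z.
  move=> /(@coord_span _ _ _ [tuple 1; a; b; c]); rewrite !big_ord_recl big_ord0 /= addr0 !addrA => ->.
  by do 4!eexists; rewrite lE.
have PU w x y z : lin4K a b c w x y z \in U.
  by rewrite lE; do !apply: memvD; apply: memvZ; apply: memv_span; rewrite !inE eqxx ?orbT.
have aU : is_aspace U.
  rewrite /is_aspace has_algid1; last by apply: memv_span; rewrite inE eqxx.
  apply/prodvP => u v /UP[w [x [y [z ->]]]] /UP[w' [x' [y' [z' ->]]]].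
  by rewrite (lin4_mul _ _ _ _ _ _ _ _ _ hb); apply: PU.
have Ufull : U = fullv.
  apply/eqP; rewrite eqEsubv subvf -gen.
  apply/(@Fadjoin_seqP _ _ 1%AS _ (ASpace aU)); split; first exact: sub1v.
  by move=> v; rewrite !inE => /orP[] /eqP ->; apply: memv_span; rewrite !inE eqxx ?orbT.
have hK : biq_field A B C a b c.
  by apply: biq_fieldP => // v; apply: UP; rewrite Ufull memvf.
have split : splitting_field_axiom K.
  exists (('X^2 - (B * C)%:~R%:P) * ('X^2 - (A * C)%:~R%:P)).
    have h (n : int) : 'X^2 - n%:~R%:P \is a polyOver (1%VS : {vspace K}).
      rewrite rpredB ?rpredX ?polyOverX // polyOverC.
      by rewrite -in_alg_int; apply: memvZ; exact: memv_line.
    by rewrite rpredM.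
  exists [:: a; - a; b; - b].
    have -> : ('X^2 - (B * C)%:~R%:P) * ('X^2 - (A * C)%:~R%:P) =
        \prod_(z <- [:: a; - a; b; - b]) ('X - z%:P).
      rewrite !big_cons big_nil -am -bn !polyCM !polyCN; ring.
    exact: eqpxx.
  apply/eqP; rewrite eqEsubv subvf -gen.
  apply/Fadjoin_seqP; split; first exact: subv_adjoin_seq.
  by move=> v; rewrite !inE => /orP[] /eqP ->; apply: seqv_sub_adjoin; rewrite !inE eqxx ?orbT.
pose L : splittingFieldType rat := HB.pack K (FieldExt_isSplittingField.Build rat K split).
by exists L; split=> //; exists a, b, c.
Qed.

(** * Shapes *)

Section ShapeInjectivity.
Variable R : realType.
Implicit Types (L : set 'rV[R]_3) (x y z : R).

Definition dot (v w : 'rV[R]_3) : R := (v *m w^T) 0 0.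

Lemma dot_vec3 x y z x' y' z' :
  dot (vec3 x y z) (vec3 x' y' z') = x * x' + y * y' + z * z'.
Proof.
by rewrite /dot !mxE !big_ord_recl big_ord0 !mxE /= addr0 addrA.
Qed.

Lemma scale_vec3 k x y z : k *: vec3 x y z = vec3 (k * x) (k * y) (k * z).
Proof. by apply/rowP => i; rewrite !mxE; case: i => -[|[|[|i]]] hi. Qed.

Lemma add_vec3 x y z x' y' z' :
  vec3 x y z + vec3 x' y' z' = vec3 (x + x') (y + y') (z + z').
Proof. by apply/rowP => i; rewrite !mxE; case: i => -[|[|[|i]]] hi. Qed.

Lemma vec3_inj x y z x' y' z' : vec3 x y z = vec3 x' y' z' -> [/\ x = x', y = y' & z = z'].
Proof.
move=> /rowP e; split; [have := e 0|have := e 1|have := e 2]; by rewrite !mxE.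
Qed.

Lemma intspan_vec3 (v1 v2 v3 v4 w : 'rV[R]_3) :
  inIntSpan [tuple v1; v2; v3; v4] w <->
  exists i j k l : int, w = i%:~R *: v1 + j%:~R *: v2 + k%:~R *: v3 + l%:~R *: v4.
Proof.
split=> [[f ->]|[i [j [k [l ->]]]]].
  exists (f 0), (f 1), (f 2), (f 3).
  rewrite !big_ord_recl big_ord0 /= addr0 !addrA !scaler_int.
  by congr (_ *~ _ + _ *~ _ + _ *~ _ + _ *~ _); congr (f _); apply: val_inj.
exists [ffun t : 'I_4 => [:: i; j; k; l]`_t].
by rewrite !big_ord_recl big_ord0 !ffunE /= addr0 !addrA !scaler_int.
Qed.

Lemma lattice_oCP x y w : lattice_oC x y w <->
  exists p q r : int, (exists e, p = q + 2 * e) /\ w = vec3 (p%:~R / 2 * x) (q%:~R / 2 * y) r%:~R.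
Proof.
rewrite /lattice_oC /= intspan_vec3; split.
  move=> [i [j [k [l ->]]]]; exists (2 * i + l), (2 * j + l), k; split; first by exists (i - j); ring.
  rewrite !scale_vec3 !add_vec3; congr vec3; rewrite ?(rmorphD, rmorphM) /=; by field.
move=> [p [q [r [[e ->] ->]]]]; exists e, 0, r, q.
rewrite !scale_vec3 !add_vec3; congr vec3; rewrite ?(rmorphD, rmorphM) /=; by field.
Qed.

Lemma lattice_oIP x y w : lattice_oI x y w <->
  exists p q r : int, [/\ exists e, p = r + 2 * e, exists e, q = r + 2 * e &
   w = vec3 (p%:~R / 2 * x) (q%:~R / 2 * y) (r%:~R / 2)].
Proof.
rewrite /lattice_oI /= intspan_vec3; split.
  move=> [i [j [k [l ->]]]]; exists (2 * i + l), (2 * j + l), (2 * k + l).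
  split; [by exists (i - k); ring|by exists (j - k); ring|].
  rewrite !scale_vec3 !add_vec3; congr vec3; rewrite ?(rmorphD, rmorphM) /=; by field.
move=> [p [q [r [[e ->] [f ->] ->]]]]; exists e, f, 0, r.
rewrite !scale_vec3 !add_vec3; congr vec3; rewrite ?(rmorphD, rmorphM) /=; by field.
Qed.

(* Primitive v in L whose reflection w |-> w - 2 (v.w / v.v) v preserves L. *)
Definition root_vector L v := [/\ L v, dot v v != 0,
  forall w, L w -> exists k : int, 2 * dot v w = k%:~R * dot v v
  & forall (n : int) u, L u -> v = n%:~R *: u -> n = 1 \/ n = -1].

(* v spans an orthogonal direct summand of L. *)
Definition summand_vector L v := [/\ L v, dot v v != 0 &
  forall w, L w -> exists k : int, dot v w = k%:~R * dot v v].

Section Similarity.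
Variables (L L' : set 'rV[R]_3) (c : R) (O : 'M[R]_3).
Hypotheses (c0 : c != 0) (OO : O *m O^T = 1%:M)
  (LL : L' = [set c *: (v *m O) | v in L]).
Let T (v : 'rV[R]_3) : 'rV[R]_3 := c *: (v *m O).

Lemma sim_dot v w : dot (T v) (T w) = c * c * dot v w.
Proof.
rewrite /dot /T linearZ /= trmx_mul -scalemxAl -scalemxAr mulmxA -[v *m O *m O^T]mulmxA OO mulmx1.
by rewrite !mxE mulrA.
Qed.

Lemma sim_in v : L v -> L' (T v).
Proof. by move=> hv; rewrite LL; exists v. Qed.

Lemma sim_out w : L' w -> exists2 v, L v & w = T v.
Proof. by rewrite LL => -[v hv <-]; exists v. Qed.

Lemma sim_inj v w : T v = T w -> v = w.
Proof.
move=> /(scalerI c0) e; rewrite -[v]mulmx1 -[w]mulmx1 -OO !mulmxA.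
by rewrite e.
Qed.

Lemma sim_cc : c * c != 0. Proof. by rewrite mulf_neq0. Qed.

Lemma sim_root v : root_vector L v -> root_vector L' (T v).
Proof.
move=> [hv v0 hw hp]; split; first exact: sim_in.
- by rewrite sim_dot mulf_neq0 // sim_cc.
- move=> w /sim_out[u /hw[k hk] ->]; exists k; rewrite !sim_dot.
  by rewrite mulrCA hk mulrCA.
- move=> n w /sim_out[u hu ->] e; apply: (hp _ u) => //; apply: sim_inj.
  by rewrite e /T -scalemxAl scalerA [c * _]mulrC -scalerA.
Qed.

Lemma sim_summand v : L v -> summand_vector L v <-> summand_vector L' (T v).
Proof.
move=> Lv; split=> -[hv v0 hw]; split=> //.
- exact: sim_in.
- by rewrite sim_dot mulf_neq0 // sim_cc.
- move=> w /sim_out[u /hw[k hk] ->]; exists k; rewrite !sim_dot.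
  by rewrite hk mulrCA.
- by apply: contra v0 => /eqP e; rewrite sim_dot e mulr0.
- move=> w /sim_in/hw[k]; rewrite !sim_dot mulrCA => /(mulfI sim_cc) hk.
  by exists k.
Qed.

End Similarity.

(** Turns the real relation between a coordinate and the matching projection coefficient into
    conditions on integers, on which the case analyses below operate. *)
Lemma sign_int (p s : int) (X N : R) : 0 < X -> 0 < N -> p%:~R * X = s%:~R * N ->
  [/\ 0 <= p * s, p = 0 -> s = 0 & s = 0 -> p = 0].
Proof.
move=> X0 N0 e; split.
- have : 0 <= (p * s)%:~R * N.
    by rewrite rmorphM /= -mulrA -e mulrA mulr_ge0 ?(ltW X0) // -expr2 sqr_ge0.
  by rewrite pmulr_lge0 // ler0z.
- move=> p0; move/eqP: e; rewrite p0 mul0r eq_sym mulf_eq0 (gt_eqF N0) orbF intr_eq0.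
  by move/eqP.
- move=> s0; move/eqP: e; rewrite s0 mul0r mulf_eq0 (gt_eqF X0) orbF intr_eq0.
  by move/eqP.
Qed.

Lemma mul_eq1 (p s : int) : p * s = 1 -> p = s /\ p * p = 1.
Proof. by move=> h; have : (absz p * absz s = 1)%N; [rewrite -abszM h|move=> /eqP; rewrite muln_eq1; lia]. Qed.

Lemma unit_scale (p s : int) (X N : R) : p * s = 1 -> p%:~R * X = s%:~R * N -> X = N.
Proof.
move=> h; have [<- pp] := mul_eq1 h; move=> e; apply: (mulfI _ e).
by rewrite intr_eq0; apply/eqP => p0; rewrite p0 in pp.
Qed.

Lemma prod_pos (p s : int) : 0 <= p * s -> (p = 0 -> s = 0) -> (s = 0 -> p = 0) ->
  p = 0 /\ s = 0 \/ 1 <= p * s.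
Proof.
move=> h hp hs; have [p0|p0] := eqVneq p 0; first by left; split; auto.
have [s0|s0] := eqVneq s 0; first by left; split; auto.
by right; have : p * s != 0 by [rewrite mulf_neq0]; lia.
Qed.

(** p, q, r are the coordinates of a root in half units, s, t, u its reflection coefficients against
    the axes. The common parity of p, q, r decides: if odd, the three products are positive with sum
    4, so two of them are 1; if even, the products are even, so one is 4 or two are 2. Two equal
    products make two axes equally long. *)
Lemma oI_cases (p q r s t u : int) :
  (exists e, p = r + 2 * e) -> (exists f, q = r + 2 * f) ->
  [/\ 0 <= p * s, p = 0 -> s = 0 & s = 0 -> p = 0] ->
  [/\ 0 <= q * t, q = 0 -> t = 0 & t = 0 -> q = 0] ->
  [/\ 0 <= r * u, r = 0 -> u = 0 & u = 0 -> r = 0] ->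
  p * s + q * t + r * u = 4 ->
  [\/ q = 0 /\ r = 0, p = 0 /\ r = 0 | p = 0 /\ q = 0] \/
  [\/ [/\ p * p = q * q, p * s = q * t & p != 0], [/\ p * p = r * r, p * s = r * u & p != 0]
    | [/\ q * q = r * r, q * t = r * u & q != 0]].
Proof.
move=> [e pe] [f qf] [h1 h2 h3] [k1 k2 k3] [l1 l2 l3] sum.
have hs := prod_pos h1 h2 h3; have ht := prod_pos k1 k2 k3; have hu := prod_pos l1 l2 l3.
clear h1 h2 h3 k1 k2 k3 l1 l2 l3.
have sq1 (a b : int) : a * b = 1 -> a * a = 1 /\ a != 0.
  by move=> /mul_eq1[_ h]; split=> //; apply/eqP => a0; rewrite a0 in h.
have sq2 (a b : int) : (exists a', a = 2 * a') -> a * b = 2 -> a * a = 4 /\ a != 0.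
  move=> [a' ->] h; have /sq1[h' _] : a' * b = 1 by lia.
  by split; lia.
have [r' [er|er]] := int_parity r; last first.
  case: hs => [[p0 _]|hs]; first by exfalso; lia.
  case: ht => [[q0 _]|ht]; first by exfalso; lia.
  case: hu => [[r0 _]|hu]; first by exfalso; lia.
  right; clear pe qf er; have [ps2|ps2] := eqVneq (p * s) 1.
    have [qt2|qt2] := eqVneq (q * t) 1.
      by have [a1 a2] := sq1 _ _ ps2; have [a3 a4] := sq1 _ _ qt2; apply: Or31; split; lia.
    have ru2 : r * u = 1 by lia.
    by have [a1 a2] := sq1 _ _ ps2; have [a3 a4] := sq1 _ _ ru2; apply: Or32; split; lia.
  have qt2 : q * t = 1 by lia.
  have ru2 : r * u = 1 by lia.
  by have [a1 a2] := sq1 _ _ qt2; have [a3 a4] := sq1 _ _ ru2; apply: Or33; split; lia.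
have ep : exists p', p = 2 * p' by exists (r' + e); lia.
have eq : exists q', q = 2 * q' by exists (r' + f); lia.
have e2 : exists r', r = 2 * r' by exists r'.
have even (a b : int) : (exists a', a = 2 * a') -> exists m, a * b = 2 * m.
  by move=> [a' ->]; exists (a' * b); lia.
have [m1 hm1] := even p s ep; have [m2 hm2] := even q t eq; have [m3 hm3] := even r u e2.
clear pe qf er.
case: hs => [[p0 s0]|hs]; case: ht => [[q0 t0]|ht]; case: hu => [[r0 u0]|hu].
- by exfalso; move: sum; rewrite p0 q0 r0 !mul0r.
- by left; apply: Or33.
- by left; apply: Or32.
- right; have a : q * t = 2 by move: sum; rewrite p0 mul0r; lia.
  have b : r * u = 2 by move: sum; rewrite p0 mul0r; lia.
  by have [a1 a2] := sq2 _ _ eq a; have [a3 a4] := sq2 _ _ e2 b; apply: Or33; split; lia.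
- by left; apply: Or31.
- right; have a : p * s = 2 by move: sum; rewrite q0 mul0r; lia.
  have b : r * u = 2 by move: sum; rewrite q0 mul0r; lia.
  by have [a1 a2] := sq2 _ _ ep a; have [a3 a4] := sq2 _ _ e2 b; apply: Or32; split; lia.
- right; have a : p * s = 2 by move: sum; rewrite r0 mul0r; lia.
  have b : q * t = 2 by move: sum; rewrite r0 mul0r; lia.
  by have [a1 a2] := sq2 _ _ ep a; have [a3 a4] := sq2 _ _ eq b; apply: Or31; split; lia.
- by exfalso; lia.
Qed.

Lemma vec3_dot_gt0 x y z : dot (vec3 x y z) (vec3 x y z) != 0 -> 0 < dot (vec3 x y z) (vec3 x y z).
Proof.
by move=> h; rewrite lt_neqAle eq_sym h dot_vec3 -!expr2 !addr_ge0 ?sqr_ge0.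
Qed.

(** As x < y < 1, no two axes have the same length, so [oI_cases] leaves only vectors on an axis,
    and primitivity makes these the axis generators up to sign. *)
Lemma root_oI x y v : 0 < x -> x < y -> y < 1 -> root_vector (lattice_oI x y) v ->
  [\/ dot v v = x ^+ 2, dot v v = y ^+ 2 | dot v v = 1].
Proof.
move=> x0 xy y1 [/lattice_oIP[p [q [r [[e pe] [f qf] ->]]]]] /vec3_dot_gt0.
set v' := vec3 _ _ _; set N := dot _ _ => N0 hw hp.
have y0 : 0 < y by apply: lt_trans xy.
pose X := x ^+ 2; pose Y := y ^+ 2.
have X0 : 0 < X by rewrite exprn_gt0. have Y0 : 0 < Y by rewrite exprn_gt0.
have XY : X < Y by rewrite ltr_pXn2r ?nnegrE ?ltW.
have Y1 : Y < 1 by rewrite expr_lt1 ?ltW.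
have NE : N = (p%:~R * (p%:~R * X) + q%:~R * (q%:~R * Y) + r%:~R * r%:~R) / 4.
  by rewrite /N dot_vec3 /X /Y; by field.
have [s hs] : exists s : int, p%:~R * X = s%:~R * N.
  have [|s hs] := hw (vec3 x 0 0); last by exists s; rewrite -hs dot_vec3 /X; by field.
  apply/lattice_oIP; exists 2, 0, 0; split; [by exists 1|by exists 0|congr vec3; by field].
have [t ht] : exists s : int, q%:~R * Y = s%:~R * N.
  have [|m hm] := hw (vec3 0 y 0); last by exists m; rewrite -hm dot_vec3 /Y; by field.
  apply/lattice_oIP; exists 0, 2, 0; split; [by exists 0|by exists 1|congr vec3; by field].
have [u hu] : exists s : int, r%:~R * 1 = s%:~R * N.
  have [|m hm] := hw (vec3 0 0 1); last by exists m; rewrite -hm dot_vec3; by field.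
  apply/lattice_oIP; exists 0, 0, 2; split; [by exists (-1)|by exists (-1)|congr vec3; by field].
have [k hk] : exists k : int, s + t + u = 2 * k.
  have [|k hk] := hw (vec3 (x / 2) (y / 2) (1 / 2)).
    apply/lattice_oIP; exists 1, 1, 1; split; [by exists 0|by exists 0|congr vec3; by field].
  exists k; apply: (@intr_inj R); apply: (mulIf (lt0r_neq0 N0)).
  rewrite !(rmorphD, rmorphM) /= !mulrDl -hs -ht -hu -mulrA -hk dot_vec3 /X /Y; by field.
have sum : p * s + q * t + r * u = 4.
  apply: (@intr_inj R); apply: (mulIf (lt0r_neq0 N0)).
  rewrite !(rmorphD, rmorphM) /= !mulrDl -!mulrA -hs -ht -hu; move: NE; lra.
have hX (X1 X2 : R) (p1 s1 p2 s2 : int) : p1%:~R * X1 = s1%:~R * N -> p2%:~R * X2 = s2%:~R * N ->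
    [/\ p1 * p1 = p2 * p2, p1 * s1 = p2 * s2 & p1 != 0] -> X1 = X2.
  move=> h1 h2 [h3 h4 h5]; have h6 : ((p1 * p1)%:~R : R) != 0 by rewrite intr_eq0 mulf_neq0.
  apply: (mulfI h6); rewrite {2}h3 !rmorphM /= -!mulrA h1 h2 !mulrA -!rmorphM /= h4 //.
have axis (n m : int) (w : 'rV[R]_3) : n = 2 * m -> lattice_oI x y w -> v' = m%:~R *: w -> n * n = 4.
  by move=> -> hw2 hv2; case: (hp m w hw2 hv2) => ->.
have lat1 : lattice_oI x y (vec3 x 0 0).
  by apply/lattice_oIP; exists 2, 0, 0; split; [by exists 1|by exists 0|congr vec3; by field].
have lat2 : lattice_oI x y (vec3 0 y 0).
  by apply/lattice_oIP; exists 0, 2, 0; split; [by exists 0|by exists 1|congr vec3; by field].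
have lat3 : lattice_oI x y (vec3 0 0 1).
  by apply/lattice_oIP; exists 0, 0, 2; split; [by exists (-1)|by exists (-1)|congr vec3; by field].
have [[[q0 r0]|[p0 r0]|[p0 q0]]|hc] := oI_cases (ex_intro _ e pe) (ex_intro _ f qf)
  (sign_int X0 N0 hs) (sign_int Y0 N0 ht) (sign_int ltr01 N0 hu) sum.
- have pp : p * p = 4.
    apply: (axis _ e _ _ lat1); first by rewrite pe r0 add0r.
    by rewrite /v' scale_vec3 q0 pe r0 !add0r rmorphM /=; congr vec3; by field.
  apply: Or31; rewrite NE q0 r0; transitivity ((p * p)%:~R * X / 4 : R); last by rewrite pp /X; by field.
  by rewrite rmorphM /=; by field.
- have qq : q * q = 4.
    apply: (axis _ f _ _ lat2); first by rewrite qf r0 add0r.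
    by rewrite /v' scale_vec3 p0 qf r0 !add0r rmorphM /=; congr vec3; by field.
  apply: Or32; rewrite NE p0 r0; transitivity ((q * q)%:~R * Y / 4 : R); last by rewrite qq /Y; by field.
  by rewrite rmorphM /=; by field.
- have re : r = 2 * (- e) by rewrite p0 in pe; rewrite mulrN; apply/eqP; rewrite -addr_eq0 -pe.
  have rr : r * r = 4.
    apply: (axis _ _ _ re lat3).
    by rewrite /v' scale_vec3 p0 q0 re rmorphM /=; congr vec3; by field.
  apply: Or33; rewrite NE p0 q0; transitivity ((r * r)%:~R / 4 : R); last by rewrite rr; by field.
  by rewrite rmorphM /=; by field.
exfalso; case: hc => h.
- by move: XY; rewrite (hX _ _ _ _ _ _ hs ht h) ltxx.
- by move: (lt_trans XY Y1); rewrite (hX _ _ _ _ _ _ hs hu h) ltxx.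
- by move: Y1; rewrite (hX _ _ _ _ _ _ ht hu h) ltxx.
Qed.

Lemma axis_root_oI x y : 0 < x -> 0 < y ->
  [/\ root_vector (lattice_oI x y) (vec3 x 0 0), root_vector (lattice_oI x y) (vec3 0 y 0)
    & root_vector (lattice_oI x y) (vec3 0 0 1)].
Proof.
move=> x0 y0.
have nx : x != 0 by rewrite gt_eqF. have ny : y != 0 by rewrite gt_eqF.
have half (n p : int) (z : R) : z != 0 -> z = n%:~R * (p%:~R / 2 * z) -> n * p = 2.
  move=> z0 h; apply: (@intr_inj R); apply: (mulIf z0); rewrite rmorphM /=.
  by rewrite [in RHS]h; by field.
have zero (n p : int) (z : R) : z != 0 -> 0 = n%:~R * (p%:~R / 2 * z) -> n != 0 -> p = 0.
  move=> z0 /esym/eqP; rewrite !mulf_eq0 (negbTE z0) invr_eq0 pnatr_eq0 /= !orbF !intr_eq0.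
  by move=> /orP[/eqP ->|/eqP ->].
have nn (n p : int) : n * p = 2 -> n != 0 by move=> h; apply/eqP => n0; rewrite n0 mul0r in h.
have two (n e : int) : n * (2 * e) = 2 -> n = 1 \/ n = -1.
  move=> h; have /mul_eq1[_ hh] : n * e = 1 by lia.
  have : (n - 1) * (n + 1) = 0 by lia.
  by move=> /eqP; rewrite mulf_eq0 => /orP[] /eqP; lia.
split; split.
- by apply/lattice_oIP; exists 2, 0, 0; split; [by exists 1|by exists 0|congr vec3; by field].
- by rewrite dot_vec3 !mul0r !addr0 mulf_neq0.
- move=> w /lattice_oIP[p [q [r [_ _ ->]]]]; exists p; rewrite !dot_vec3; by field.
- move=> n w /lattice_oIP[p [q [r [[e he] [f hf] ->]]]]; rewrite scale_vec3 => /vec3_inj[h1 h2 h3].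
  have h := half _ _ _ nx h1; have n0 := nn _ _ h; have q0 := zero _ _ _ ny h2 n0.
  have pe : p = 2 * (e - f) by lia.
  by apply: (two n (e - f)); rewrite -pe.
- by apply/lattice_oIP; exists 0, 2, 0; split; [by exists 0|by exists 1|congr vec3; by field].
- by rewrite dot_vec3 !mul0r !addr0 add0r mulf_neq0.
- move=> w /lattice_oIP[p [q [r [_ _ ->]]]]; exists q; rewrite !dot_vec3; by field.
- move=> n w /lattice_oIP[p [q [r [[e he] [f hf] ->]]]]; rewrite scale_vec3 => /vec3_inj[h1 h2 h3].
  have h := half _ _ _ ny h2; have n0 := nn _ _ h; have q0 := zero _ _ _ nx h1 n0.
  have pe : q = 2 * (f - e) by lia.
  by apply: (two n (f - e)); rewrite -pe.
- by apply/lattice_oIP; exists 0, 0, 2; split; [by exists (-1)|by exists (-1)|congr vec3; by field].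
- by rewrite dot_vec3 !mul0r !add0r mulf_neq0 // oner_neq0.
- move=> w /lattice_oIP[p [q [r [_ _ ->]]]]; exists r; rewrite !dot_vec3; by field.
- move=> n w /lattice_oIP[p [q [r [[e he] [f hf] ->]]]]; rewrite scale_vec3 => /vec3_inj[h1 h2 h3].
  have h : n * r = 2 by apply: (half _ _ 1); rewrite ?oner_neq0 // mulr1.
  have n0 := nn _ _ h; have q0 := zero _ _ _ nx h1 n0.
  have pe : r = 2 * (- e) by lia.
  by apply: (two n (- e)); rewrite -pe.
Qed.

Lemma shape_self n (L : set 'rV[R]_n) : shape_of_lattice L L.
Proof.
exists 1, 1%:M; split; [exact: oner_neq0|by rewrite trmx1 mulmx1|].
by apply/seteqP; split=> [v hv|_ [v hv <-]]; [exists v|]; rewrite ?mulmx1 ?scale1r.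
Qed.

Lemma three_sorted (a b c a' b' c' : R) : a < b -> b < c -> a' < b' -> b' < c' ->
  [\/ a = a', a = b' | a = c'] -> [\/ b = a', b = b' | b = c'] -> [\/ c = a', c = b' | c = c'] ->
  [/\ a = a', b = b' & c = c'].
Proof.
move=> ab bc ab' bc' [ha|ha|ha] [hb|hb|hb] [hc|hc|hc]; first [by split|exfalso; lra].
Qed.

(** A similarity maps roots to roots. On both sides the roots have exactly three lengths, so these
    correspond in order, and the largest being 1 on both sides fixes the scaling. *)
Lemma sh_oI_inj x y x' y' : 0 < x -> x < y -> y < 1 -> 0 < x' -> x' < y' -> y' < 1 ->
  sh_oI x y = sh_oI x' y' -> x = x' /\ y = y'.
Proof.
move=> x0 xy y1 x0' xy' y1' e.
have : sh_oI x y (lattice_oI x' y') by rewrite e; exact: shape_self.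
move=> [c [Q [c0 QQ LL]]].
have y0 : 0 < y by apply: lt_trans xy.
have y0' : 0 < y' by apply: lt_trans xy'.
have [r1 r2 r3] := axis_root_oI x0 y0.
have h1 := root_oI x0' xy' y1' (sim_root c0 QQ LL r1).
have h2 := root_oI x0' xy' y1' (sim_root c0 QQ LL r2).
have h3 := root_oI x0' xy' y1' (sim_root c0 QQ LL r3).
rewrite (sim_dot _ QQ) dot_vec3 !mul0r !addr0 in h1.
rewrite (sim_dot _ QQ) dot_vec3 !mul0r !addr0 add0r in h2.
rewrite (sim_dot _ QQ) dot_vec3 !mul0r !add0r !mulr1 in h3.
have cc : 0 < c * c by rewrite lt_neqAle eq_sym mulf_neq0 // -expr2 sqr_ge0.
have sq (u v : R) : 0 < u -> 0 < v -> u ^+ 2 = v ^+ 2 -> u = v.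
  by move=> u0 v0 /eqP; rewrite eqrXn2 ?ltW // => /eqP.
have [] := three_sorted _ _ _ _ h1 h2 h3.
- by rewrite ltr_pM2l // -!expr2 ltr_pXn2r ?nnegrE ?ltW.
- by rewrite -[X in _ < X]mulr1 ltr_pM2l // -expr2 expr_lt1 ?ltW.
- by rewrite ltr_pXn2r ?nnegrE ?ltW.
- by rewrite expr_lt1 ?ltW.
move=> e1 e2 e3; rewrite e3 !mul1r -!expr2 in e1 e2.
by split; apply: sq.
Qed.

(** p and q are in half units, r in units. The lattice vector (x/2, y/2, 0) makes s + t even, which
    excludes vectors along the first two axes. *)
Lemma oC_summand_cases (p q r s t u : int) :
  (exists e, p = q + 2 * e) -> (exists k, s + t = 2 * k) ->
  [/\ 0 <= p * s, p = 0 -> s = 0 & s = 0 -> p = 0] ->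
  [/\ 0 <= q * t, q = 0 -> t = 0 & t = 0 -> q = 0] ->
  [/\ 0 <= r * u, r = 0 -> u = 0 & u = 0 -> r = 0] ->
  p * s + q * t + 2 * (r * u) = 2 ->
  [/\ p = 0, q = 0 & r = 1 \/ r = -1] \/ [/\ p * s = 1, q * t = 1 & r = 0].
Proof.
move=> [e pe] [k hk] [h1 h2 h3] [k1 k2 k3] [l1 l2 l3] sum.
have hs := prod_pos h1 h2 h3; have ht := prod_pos k1 k2 k3; have hu := prod_pos l1 l2 l3.
clear h2 h3 k2 k3 l2 l3.
have [q' [eq|eq]] := int_parity q.
  have [t' [et|et]] := int_parity t; last first.
    exfalso; have [m hm] : exists m, q * t = 2 * m by rewrite eq; exists (q' * t); lia.
    have [n hn] : exists m, p * s = 2 * m by rewrite pe eq; exists ((q' + e) * s); lia.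
    case: hs => [[p0 s0]|hs]; first by clear pe sum; lia.
    by case: ht => [[q0 t0]|ht]; clear pe eq hk; lia.
  have [m hm] : exists m, q * t = 4 * m by rewrite eq et; exists (q' * t'); lia.
  have [n hn] : exists m, p * s = 4 * m.
    have [s' es] : exists s', s = 2 * s' by exists (k - t'); lia.
    by rewrite pe eq es; exists ((q' + e) * s'); lia.
  left; case: hs => [[p0 s0]|hs]; last by exfalso; clear pe eq hk hu; lia.
  case: ht => [[q0 t0]|ht]; last by exfalso; clear pe eq hk hu; lia.
  have ru : r * u = 1 by clear pe eq hk; lia.
  split=> //; have [_ rr] := mul_eq1 ru.
  have : (r - 1) * (r + 1) = 0 by clear -rr; lia.
  by move=> /eqP; rewrite mulf_eq0 => /orP[] /eqP h; [left|right]; clear -h; lia.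
have p0 : p <> 0 by move=> p0; lia.
have q0 : q <> 0 by move=> q0; lia.
right; clear pe eq hk; case: hs => [[]|hs] //; case: ht => [[]|ht] //.
by case: hu => [[r0 _]|hu]; split=> //; lia.
Qed.

(** A root off the axes is possible here, for instance in a hexagonal plane lattice; but then p s =
    1 or q t = 1 makes its length that of an axis, so the set of root lengths is still the expected
    one. *)
Lemma oC_root_cases (p q s t : int) :
  (exists e, p = q + 2 * e) -> (exists k, s + t = 2 * k) ->
  [/\ 0 <= p * s, p = 0 -> s = 0 & s = 0 -> p = 0] ->
  [/\ 0 <= q * t, q = 0 -> t = 0 & t = 0 -> q = 0] ->
  p * s + q * t = 4 ->
  [\/ p = 0, q = 0 | [\/ p * s = 1, q * t = 1 | [/\ p * p = q * q, p * s = q * t & p != 0]]].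
Proof.
move=> [e pe] [k hk] [h1 h2 h3] [k1 k2 k3] sum.
have hs := prod_pos h1 h2 h3; have ht := prod_pos k1 k2 k3.
clear h1 h2 h3 k1 k2 k3.
case: hs => [[p0 _]|hs]; first exact: Or31.
case: ht => [[q0 _]|ht]; first exact: Or32.
apply: Or33.
have [ps|ps] := eqVneq (p * s) 1; first exact: Or31.
have [qt|qt] := eqVneq (q * t) 1; first exact: Or32.
apply: Or33; have ps2 : p * s = 2 by clear pe hk; lia.
have qt2 : q * t = 2 by clear pe hk; lia.
have sq2 (a b : int) : a * b = 2 -> (exists a', a = 2 * a' + 1) -> a * a = 1.
  move=> h [a' ha]; have : (absz a * absz b = 2)%N by rewrite -abszM h.
  move=> h'; have : (absz a %| 2)%N by rewrite -h' dvdn_mulr.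
  rewrite dvdn_divisors // => ha'; have {}ha' : absz a = 1%N \/ absz a = 2%N.
    by move: ha'; rewrite /= !inE => /orP[] /eqP; [left|right].
  by case: ha' => ha'; clear h h' ps2 qt2 ps qt hs ht sum pe hk; lia.
have sq4 (a b : int) : a * b = 2 -> (exists a', a = 2 * a') -> a * a = 4.
  move=> h [a' ha]; have h1 : a' * b = 1 by rewrite ha in h; clear -h; lia.
  by have [_ h2] := mul_eq1 h1; rewrite ha; clear -h2; lia.
have pn0 : p != 0 by apply/eqP => p0; rewrite p0 mul0r in ps2.
have [q' [eq|eq]] := int_parity q.
  have qq := sq4 _ _ qt2 (ex_intro _ q' eq).
  have pp : p * p = 4 by apply: (sq4 _ _ ps2); exists (q' + e); clear -eq pe; lia.
  by split=> //; rewrite ?pp ?qq ?ps2 ?qt2.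
have qq := sq2 _ _ qt2 (ex_intro _ q' eq).
have pp : p * p = 1 by apply: (sq2 _ _ ps2); exists (q' + e); clear -eq pe; lia.
by split=> //; rewrite ?pp ?qq ?ps2 ?qt2.
Qed.

(** The third axis is the only summand direction unless x = y, when the plane part is a square
    lattice with two orthogonal generators of squared length x^2 / 2. *)
Lemma summand_oC x y v : 0 < x -> 0 < y -> summand_vector (lattice_oC x y) v ->
  [\/ v = vec3 0 0 1, v = - vec3 0 0 1 | x = y /\ dot v v = x ^+ 2 / 2].
Proof.
move=> x0 y0 [/lattice_oCP[p [q [r [pe ->]]]]] /vec3_dot_gt0.
set v' := vec3 _ _ _; set N := dot _ _ => N0 hw.
pose X := x ^+ 2; pose Y := y ^+ 2.
have X0 : 0 < X by rewrite exprn_gt0.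
have Y0 : 0 < Y by rewrite exprn_gt0.
have NE : N = (p%:~R * (p%:~R * X) + q%:~R * (q%:~R * Y)) / 4 + r%:~R * r%:~R.
  by rewrite /N dot_vec3 /X /Y; field.
have [s hs] : exists s : int, p%:~R * X = s%:~R * (2 * N).
  have [|s hs] := hw (vec3 x 0 0); last by exists s; rewrite [RHS]mulrCA -hs dot_vec3 /X; field.
  by apply/lattice_oCP; exists 2, 0, 0; split; [exists 1|congr vec3; by field].
have [t ht] : exists s : int, q%:~R * Y = s%:~R * (2 * N).
  have [|m hm] := hw (vec3 0 y 0); last by exists m; rewrite [RHS]mulrCA -hm dot_vec3 /Y; field.
  by apply/lattice_oCP; exists 0, 2, 0; split; [exists (-1)|congr vec3; by field].
have [u hu] : exists s : int, r%:~R * 1 = s%:~R * N.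
  have [|m hm] := hw (vec3 0 0 1); last by exists m; rewrite -hm dot_vec3; field.
  by apply/lattice_oCP; exists 0, 0, 1; split; [exists 0|congr vec3; by field].
have N2 : 0 < 2 * N by rewrite mulr_gt0.
have hk : exists k : int, s + t = 2 * k.
  have [|k hk] := hw (vec3 (x / 2) (y / 2) 0).
    by apply/lattice_oCP; exists 1, 1, 0; split; [exists 0|congr vec3; by field].
  exists k; apply: (@intr_inj R); apply: (mulIf (lt0r_neq0 N2)).
  transitivity (p%:~R * X + q%:~R * Y); first by rewrite hs ht; ring.
  transitivity (4 * (k%:~R * N)); last by ring.
  by rewrite -hk dot_vec3 /X /Y; field.
have sum : p * s + q * t + 2 * (r * u) = 2.
  apply: (@intr_inj R); apply: (mulIf (lt0r_neq0 N2)).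
  transitivity (p%:~R * (s%:~R * (2 * N)) + q%:~R * (t%:~R * (2 * N)) + 4 * (r%:~R * (u%:~R * N))).
    by ring.
  by rewrite -hs -ht -hu [in RHS]NE; field.
case: (oC_summand_cases pe hk (sign_int X0 N2 hs) (sign_int Y0 N2 ht) (sign_int ltr01 N0 hu) sum).
  move=> [p0 q0 hr]; rewrite /v' p0 q0 !mul0r; case: hr => ->; first exact: Or31.
  by apply: Or32; rewrite -scaleN1r scale_vec3; congr vec3; ring.
move=> [h1 h2 _]; apply: Or33.
have e1 := unit_scale h1 hs; have e2 := unit_scale h2 ht.
split; last by move: e1; rewrite /X => ->; field.
apply/eqP; rewrite -(eqrXn2 (n := 2)) ?ltW //; apply/eqP.
by rewrite -/X -/Y e1 e2.
Qed.

Lemma root_oC x y v : 0 < x -> x < y -> root_vector (lattice_oC x y) v ->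
  dot v (vec3 0 0 1) = 0 -> dot v v = x ^+ 2 \/ dot v v = y ^+ 2.
Proof.
move=> x0 xy [/lattice_oCP[p [q [r [[e pe] ->]]]]] /vec3_dot_gt0.
set v' := vec3 _ _ _; set N := dot _ _ => N0 hw hp.
rewrite {1}/v' dot_vec3 !mulr0 !add0r mulr1 => r0.
have y0 : 0 < y by apply: lt_trans xy.
pose X := x ^+ 2; pose Y := y ^+ 2.
have X0 : 0 < X by rewrite exprn_gt0.
have Y0 : 0 < Y by rewrite exprn_gt0.
have XY : X < Y by rewrite ltr_pXn2r ?nnegrE ?ltW.
have NE : N = (p%:~R * (p%:~R * X) + q%:~R * (q%:~R * Y)) / 4.
  by rewrite /N dot_vec3 r0 /X /Y; field.
have lat1 : lattice_oC x y (vec3 x 0 0).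
  by apply/lattice_oCP; exists 2, 0, 0; split; [exists 1|congr vec3; by field].
have lat2 : lattice_oC x y (vec3 0 y 0).
  by apply/lattice_oCP; exists 0, 2, 0; split; [exists (-1)|congr vec3; by field].
have [s hs] : exists s : int, p%:~R * X = s%:~R * N.
  by have [s hs] := hw _ lat1; exists s; rewrite -hs dot_vec3 /X; field.
have [t ht] : exists s : int, q%:~R * Y = s%:~R * N.
  by have [t ht] := hw _ lat2; exists t; rewrite -ht dot_vec3 /Y; field.
have hk : exists k : int, s + t = 2 * k.
  have [|k hk] := hw (vec3 (x / 2) (y / 2) 0).
    by apply/lattice_oCP; exists 1, 1, 0; split; [exists 0|congr vec3; by field].
  exists k; apply: (@intr_inj R); apply: (mulIf (lt0r_neq0 N0)).
  rewrite !(rmorphD, rmorphM) /= !mulrDl -hs -ht -mulrA -hk dot_vec3 /X /Y; by field.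
have sum : p * s + q * t = 4.
  apply: (@intr_inj R); apply: (mulIf (lt0r_neq0 N0)).
  rewrite !(rmorphD, rmorphM) /= !mulrDl -!mulrA -hs -ht; move: NE; lra.
have axis (n m : int) (w : 'rV[R]_3) : n = 2 * m -> lattice_oC x y w -> v' = m%:~R *: w -> n * n = 4.
  by move=> -> hw2 hv2; case: (hp m w hw2 hv2) => ->.
case: (oC_root_cases (ex_intro _ e pe) hk (sign_int X0 N0 hs) (sign_int Y0 N0 ht) sum) => [p0|q0|].
- right; have qe : q = 2 * (- e) by lia.
  have qq : q * q = 4.
    apply: (axis _ _ _ qe lat2).
    by rewrite /v' scale_vec3 p0 qe r0 rmorphM /=; congr vec3; field.
  rewrite NE p0; transitivity ((q * q)%:~R * Y / 4 : R); last by rewrite qq /Y; field.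
  by rewrite rmorphM /=; field.
- left; have ep : p = 2 * e by lia.
  have pp : p * p = 4.
    apply: (axis _ _ _ ep lat1).
    by rewrite /v' scale_vec3 q0 ep r0 rmorphM /=; congr vec3; field.
  rewrite NE q0; transitivity ((p * p)%:~R * X / 4 : R); last by rewrite pp /X; field.
  by rewrite rmorphM /=; field.
case=> [h|h|[h3 h4 h5]]; [left|right|exfalso].
- by rewrite -/X (unit_scale h hs).
- by rewrite -/Y (unit_scale h ht).
have h6 : ((p * p)%:~R : R) != 0 by rewrite intr_eq0 mulf_neq0.
move: XY; suff -> : X = Y by rewrite ltxx.
by apply: (mulfI h6); rewrite {2}h3 !rmorphM /= -!mulrA hs ht !mulrA -!rmorphM /= h4.
Qed.

Lemma axis_root_oC x y : 0 < x -> 0 < y ->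
  root_vector (lattice_oC x y) (vec3 x 0 0) /\ root_vector (lattice_oC x y) (vec3 0 y 0).
Proof.
move=> x0 y0.
have nx : x != 0 by rewrite gt_eqF. have ny : y != 0 by rewrite gt_eqF.
have half (n p : int) (z : R) : z != 0 -> z = n%:~R * (p%:~R / 2 * z) -> n * p = 2.
  move=> z0 h; apply: (@intr_inj R); apply: (mulIf z0); rewrite rmorphM /=.
  by rewrite [in RHS]h; field.
have zero (n p : int) (z : R) : z != 0 -> 0 = n%:~R * (p%:~R / 2 * z) -> n != 0 -> p = 0.
  move=> z0 /esym/eqP; rewrite !mulf_eq0 (negbTE z0) invr_eq0 pnatr_eq0 /= !orbF !intr_eq0.
  by move=> /orP[/eqP ->|/eqP ->].
have nn (n p : int) : n * p = 2 -> n != 0 by move=> h; apply/eqP => n0; rewrite n0 mul0r in h.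
have two (n e : int) : n * (2 * e) = 2 -> n = 1 \/ n = -1.
  move=> h; have /mul_eq1[_ hh] : n * e = 1 by lia.
  have : (n - 1) * (n + 1) = 0 by lia.
  by move=> /eqP; rewrite mulf_eq0 => /orP[] /eqP; lia.
split; split.
- by apply/lattice_oCP; exists 2, 0, 0; split; [exists 1|congr vec3; by field].
- by rewrite dot_vec3 !mul0r !addr0 mulf_neq0.
- move=> w /lattice_oCP[p [q [r [_ ->]]]]; exists p; rewrite !dot_vec3; by field.
- move=> n w /lattice_oCP[p [q [r [[e he] ->]]]]; rewrite scale_vec3 => /vec3_inj[h1 h2 h3].
  have h := half _ _ _ nx h1; have n0 := nn _ _ h; have q0 := zero _ _ _ ny h2 n0.
  have pe : p = 2 * e by lia.
  by apply: (two n e); rewrite -pe.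
- by apply/lattice_oCP; exists 0, 2, 0; split; [exists (-1)|congr vec3; by field].
- by rewrite dot_vec3 !mul0r !addr0 add0r mulf_neq0.
- move=> w /lattice_oCP[p [q [r [_ ->]]]]; exists q; rewrite !dot_vec3; by field.
- move=> n w /lattice_oCP[p [q [r [[e he] ->]]]]; rewrite scale_vec3 => /vec3_inj[h1 h2 h3].
  have h := half _ _ _ ny h2; have n0 := nn _ _ h; have q0 := zero _ _ _ nx h1 n0.
  have pe : q = 2 * (- e) by lia.
  by apply: (two n (- e)); rewrite -pe.
Qed.

Lemma axis_summand_oC x y : summand_vector (lattice_oC x y) (vec3 0 0 1).
Proof.
split.
- by apply/lattice_oCP; exists 0, 0, 1; split; [exists 0|congr vec3; by field].
- by rewrite dot_vec3 !mul0r !add0r mulf_neq0 // oner_neq0.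
- move=> w /lattice_oCP[p [q [r [_ ->]]]]; exists r; rewrite !dot_vec3; by field.
Qed.

Lemma diag_summand_oC x : 0 < x ->
  summand_vector (lattice_oC x x) (vec3 (x / 2) (x / 2) 0) /\
  summand_vector (lattice_oC x x) (vec3 (x / 2) (- (x / 2)) 0).
Proof.
move=> x0; have nx : x != 0 by rewrite gt_eqF.
have hd : dot (vec3 (x / 2) (x / 2) 0) (vec3 (x / 2) (x / 2) 0) != 0.
  by rewrite dot_vec3 mulr0 addr0 -mulr2n mulrn_eq0 /= !mulf_eq0 (negbTE nx) invr_eq0 pnatr_eq0.
split; split=> //.
- by apply/lattice_oCP; exists 1, 1, 0; split; [exists 0|congr vec3; by field].
- move=> w /lattice_oCP[p [q [r [[e ->] ->]]]]; exists (q + e).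
  by rewrite !dot_vec3 !rmorphD rmorphM /=; field.
- by apply/lattice_oCP; exists 1, (-1), 0; split; [exists 1|congr vec3; by field].
- by move: hd; rewrite !dot_vec3 mulrNN.
- move=> w /lattice_oCP[p [q [r [[e ->] ->]]]]; exists e.
  by rewrite !dot_vec3 !rmorphD rmorphM /=; field.
Qed.

(** If x < y and x' < y', the third axis is canonical; its length 1 fixes the scaling, and the roots
    orthogonal to it have the lengths x and y. The lattices with x = y are orthogonal sums of three
    lines and are told apart from the others by their additional summands. *)
Lemma sh_oC_inj x y x' y' : 0 < x -> x <= y -> 0 < x' -> x' <= y' ->
  sh_oC x y = sh_oC x' y' -> x = x' /\ y = y'.
Proof.
move=> x0 xy x0' xy' e.
have : sh_oC x y (lattice_oC x' y') by rewrite e; exact: shape_self.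
move=> [c [Q [c0 QQ LL]]].
have y0 : 0 < y by apply: lt_le_trans xy.
have y0' : 0 < y' by apply: lt_le_trans xy'.
pose T (v : 'rV[R]_3) : 'rV[R]_3 := c *: (v *m Q).
have TN v : T (- v) = - T v by rewrite /T mulNmx scalerN.
have Tinj v w : T v = T w -> v = w := @sim_inj c Q c0 QQ v w.
have Tdot v w : dot (T v) (T w) = c * c * dot v w by apply: (@sim_dot c Q QQ v w).
have sq (u v : R) : 0 < u -> 0 < v -> u ^+ 2 = v ^+ 2 -> u = v.
  by move=> u0 v0 /eqP; rewrite eqrXn2 ?ltW // => /eqP.
set e3 := vec3 0 0 (1 : R).
have ne3 (z1 z2 : R) : z1 != 0 -> vec3 z1 z2 0 <> e3 /\ vec3 z1 z2 0 <> - e3.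
  move=> z0; split; first by move=> /vec3_inj[h _ _]; rewrite h eqxx in z0.
  by rewrite -scaleN1r scale_vec3 => /vec3_inj[h _ _]; rewrite h mulr0 eqxx in z0.
have S3 : summand_vector (lattice_oC x' y') (T e3).
  by apply/(sim_summand c0 QQ LL); [case: (axis_summand_oC x y)|exact: axis_summand_oC].
have [w0 Lw0 Tw0] : exists2 w0, lattice_oC x y w0 & e3 = T w0.
  by apply: (sim_out LL); case: (axis_summand_oC x' y').
have Sw0 : summand_vector (lattice_oC x y) w0.
  by apply: (sim_summand c0 QQ LL Lw0).2; rewrite -/(T w0) -Tw0; exact: axis_summand_oC.
have d33 : dot e3 e3 = 1 by rewrite /e3 dot_vec3; ring.
have dN v w : dot (- v) (- w) = dot v w by rewrite /dot linearN /= mulNmx mulmxN opprK.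
have cc : 0 < c * c by rewrite lt_neqAle eq_sym mulf_neq0 // -expr2 sqr_ge0.
have [exy|nxy] := eqVneq x y; have [exy'|nxy'] := eqVneq x' y'.
- subst y y'.
  suff : x ^+ 2 = x' ^+ 2 by move=> /(sq _ _ x0 x0') ->.
  have [S1 S2] := diag_summand_oC x0.
  have xh : x / 2 != 0 by rewrite mulf_neq0 ?gt_eqF // invr_eq0 pnatr_eq0.
  have [n1 n1'] := ne3 _ (x / 2) xh; have [n2 n2'] := ne3 _ (- (x / 2)) xh.
  set f1 := vec3 (x / 2) (x / 2) 0 in S1 n1 n1'.
  set f2 := vec3 (x / 2) (- (x / 2)) 0 in S2 n2 n2'.
  have d1 : dot f1 f1 = x ^+ 2 / 2 by rewrite /f1 dot_vec3; field.
  have d2 : dot f2 f2 = x ^+ 2 / 2 by rewrite /f2 dot_vec3; field.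
  have T1 : summand_vector (lattice_oC x' x') (T f1).
    by apply/(sim_summand c0 QQ LL); [case: S1|].
  have T2 : summand_vector (lattice_oC x' x') (T f2).
    by apply/(sim_summand c0 QQ LL); [case: S2|].
  have A1 := summand_oC x0' x0' T1; have A2 := summand_oC x0' x0' T2.
  have f12 : f1 <> f2 /\ f1 <> - f2.
    split=> [/vec3_inj[_ h _]|].
      by move: xh => /eqP[]; lra.
    rewrite -scaleN1r scale_vec3 => /vec3_inj[h _ _].
    by move: xh => /eqP[]; lra.
  (* Either the third axis is preserved, which makes the scaling trivial, or it goes into the square
     plane; in that case all three generators turn out to have the same length. *)
  have [T3|[c2 h0]] : (T e3 = e3 \/ T e3 = - e3) \/ (c * c = x' ^+ 2 / 2 /\ ~ (T e3 = e3 \/ T e3 = - e3)).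
    have [T3|T3] := EM (T e3 = e3 \/ T e3 = - e3); [by left|right].
    split=> //; case: (summand_oC x0' x0' S3) => [h|h|[_]]; [by case: T3; left|by case: T3; right|].
    by rewrite Tdot d33 mulr1.
  - have c1 : c * c = 1 by rewrite -[LHS]mulr1 -d33 -Tdot; case: T3 => ->; rewrite ?dN.
    case: A1 => [h|h|[_]].
    + by exfalso; case: T3 => T3; [apply: n1; apply: Tinj; rewrite T3
        |apply: n1'; apply: Tinj; rewrite TN T3 opprK].
    + by exfalso; case: T3 => T3; [apply: n1'; apply: Tinj; rewrite TN T3
        |apply: n1; apply: Tinj; rewrite T3].
    + by rewrite Tdot c1 mul1r d1; lra.
  - have hw : 1 = c * c * (x ^+ 2 / 2).
      case: (summand_oC x0 x0 Sw0) => [h|h|[_ h]].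
      + have hh : e3 = T e3 by rewrite {1}Tw0 h.
        by exfalso; apply: h0; left; rewrite -hh.
      + have hh : e3 = - T e3 by rewrite {1}Tw0 h TN.
        by exfalso; apply: h0; right; rewrite [in RHS]hh opprK.
      + by rewrite -h -Tdot -Tw0 d33.
    (* The two diagonal generators are not proportional, so they cannot both be mapped to the third
       axis; the one that is not goes to a diagonal generator. *)
    have hx : c * c * (x ^+ 2 / 2) = x' ^+ 2 / 2.
      case: A1 => [h1|h1|[_ h1]]; last by rewrite -d1 -Tdot h1.
        case: A2 => [h2|h2|[_ h2]]; last by rewrite -d2 -Tdot h2.
          by exfalso; apply: f12.1; apply: Tinj; rewrite h1.
        by exfalso; apply: f12.2; apply: Tinj; rewrite TN h1 h2 opprK.
      case: A2 => [h2|h2|[_ h2]]; last by rewrite -d2 -Tdot h2.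
        by exfalso; apply: f12.2; apply: Tinj; rewrite TN h1 h2.
      by exfalso; apply: f12.1; apply: Tinj; rewrite h1.
    have h1 : c * c = 1 by rewrite c2 -hx -hw.
    by move: hx; rewrite h1; lra.
(* In the mixed cases one lattice has a summand off the third axis, while the other has a single
   summand direction. *)
- exfalso; subst y.
  have [S1 _] := diag_summand_oC x0.
  have xh : x / 2 != 0 by rewrite mulf_neq0 ?gt_eqF // invr_eq0 pnatr_eq0.
  have [n1 n1'] := ne3 _ (x / 2) xh.
  set f1 := vec3 (x / 2) (x / 2) 0 in S1 n1 n1'.
  have T1 : summand_vector (lattice_oC x' y') (T f1).
    by apply/(sim_summand c0 QQ LL); [case: S1|].
  have [h|h] : T f1 = T e3 \/ T f1 = T (- e3).
    rewrite TN; case: (summand_oC x0' y0' T1) => [->|->|[h _]]; last by rewrite h eqxx in nxy'.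
      case: (summand_oC x0' y0' S3) => [->|->|[h _]]; last by rewrite h eqxx in nxy'.
        by left.
      by right; rewrite opprK.
    case: (summand_oC x0' y0' S3) => [->|->|[h _]]; last by rewrite h eqxx in nxy'.
      by right.
    by left.
  + by apply: n1; apply: Tinj.
  + by apply: n1'; apply: Tinj.
- exfalso; subst y'.
  have [S1 _] := diag_summand_oC x0'.
  have xh : x' / 2 != 0 by rewrite mulf_neq0 ?gt_eqF // invr_eq0 pnatr_eq0.
  have [n1 n1'] := ne3 _ (x' / 2) xh.
  set f1 := vec3 (x' / 2) (x' / 2) 0 in S1 n1 n1'.
  have [w1 Lw1 Tw1] : exists2 w1, lattice_oC x y w1 & f1 = T w1.
    by apply: (sim_out LL); case: S1.
  have Sw1 : summand_vector (lattice_oC x y) w1.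
    by apply: (sim_summand c0 QQ LL Lw1).2; rewrite -/(T w1) -Tw1.
  have [h|h] : w1 = w0 \/ w1 = - w0.
    case: (summand_oC x0 y0 Sw1) => [->|->|[h _]]; last by rewrite h eqxx in nxy.
      case: (summand_oC x0 y0 Sw0) => [->|->|[h _]]; last by rewrite h eqxx in nxy.
        by left.
      by right; rewrite opprK.
    case: (summand_oC x0 y0 Sw0) => [->|->|[h _]]; last by rewrite h eqxx in nxy.
      by right.
    by left; rewrite ?opprK.
  + by apply: n1; rewrite Tw1 h -Tw0.
  + by apply: n1'; rewrite Tw1 h TN -Tw0.
(* Each lattice now has a single summand direction, so the third axes correspond and the scaling is
   trivial. *)
have hw0 : w0 = e3 \/ w0 = - e3.
  case: (summand_oC x0 y0 Sw0) => [->|->|[h _]]; [by left|by right|].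
  by rewrite h eqxx in nxy.
have c1 : c * c = 1.
  by rewrite -[RHS]d33 {1}Tw0 [X in dot _ X]Tw0 Tdot; case: hw0 => ->; rewrite ?dN d33 mulr1.
have lt1 : x < y by rewrite lt_neqAle nxy.
have lt2 : x' < y' by rewrite lt_neqAle nxy'.
have [r1 r2] := axis_root_oC x0 y0.
have dotr v : dot v e3 = 0 -> dot v w0 = 0.
  by case: hw0 => -> // h; rewrite /dot linearN /= mulmxN mxE -/(dot v e3) h oppr0.
have key v : root_vector (lattice_oC x y) v -> dot v e3 = 0 -> dot v v = x' ^+ 2 \/ dot v v = y' ^+ 2.
  move=> rv hv; have := root_oC x0' lt2 (sim_root c0 QQ LL rv).
  rewrite -/(T v) -/e3 {1}Tw0 !Tdot c1 !mul1r; apply.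
  exact: dotr.
have k1 := key _ r1; have k2 := key _ r2.
have sxy : x ^+ 2 < y ^+ 2 by rewrite ltr_pXn2r ?nnegrE ?ltW.
have sxy' : x' ^+ 2 < y' ^+ 2 by rewrite ltr_pXn2r ?nnegrE ?ltW.
have {}k1 : x ^+ 2 = x' ^+ 2 \/ x ^+ 2 = y' ^+ 2.
  have := k1; rewrite !dot_vec3 => -[|h|h]; first (by ring).
    by left; rewrite -h; ring.
  by right; rewrite -h; ring.
have {}k2 : y ^+ 2 = x' ^+ 2 \/ y ^+ 2 = y' ^+ 2.
  have := k2; rewrite !dot_vec3 => -[|h|h]; first (by ring).
    by left; rewrite -h; ring.
  by right; rewrite -h; ring.
have [h1 h2] : x ^+ 2 = x' ^+ 2 /\ y ^+ 2 = y' ^+ 2.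
  case: k1 sxy => ->; case: k2 => -> // h.
  - by rewrite ltxx in h.
  - by have := lt_trans h sxy'; rewrite ltxx.
  - by rewrite ltxx in h.
by split; apply: sq.
Qed.

End ShapeInjectivity.

(** * The Minkowski embedding and the shape of a biquadratic field *)

Lemma conj_sqrt_int (F : numClosedFieldType) (z : F) (n : int) : n != 0 -> z * z = n%:~R ->
  z^* = (sgz n)%:~R * z /\ z * z^* = (`|n|%N)%:R.
Proof.
move=> n0 zz; have h0 : 0 <= z * z^* by rewrite -normCK exprn_ge0.
have : (z^* - z) * (z^* + z) = 0.
  transitivity (z^* * z^* - z * z); first by ring.
  by rewrite -rmorphM /= zz rmorph_int subrr.
move=> /eqP; rewrite mulf_eq0 => /orP[].
  rewrite subr_eq0 => /eqP e; rewrite e zz ler0z in h0 *.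
  have ngt : 0 < n by rewrite lt_neqAle eq_sym n0.
  rewrite gtr0_sgz // mul1r; split=> //.
  by rewrite pmulrn; congr (_%:~R); lia.
rewrite addr_eq0 => /eqP e; rewrite e mulrN zz oppr_ge0 lerz0 in h0 *.
have nlt : n < 0 by rewrite lt_neqAle n0.
rewrite ltr0_sgz // rmorphN mulN1r; split=> //.
by rewrite -rmorphN pmulrn; congr (_%:~R); lia.
Qed.

Section ShapeOfField.
Variables (R : realType) (K : fieldExtType rat) (A B C : int) (a b c : K).
Hypotheses (hK : biq_field A B C a b c) (adm : admissible A B C).
Local Notation Cx := R[i].

Lemma embeddings_exist : exists s : 'I_4 -> {rmorphism K -> R[i]}, is_enum_of_embeddings s.
Proof.
have [nA nB nC] := admissible_neq0 adm.
pose a' : Cx := sqrtC (B * C)%:~R; pose b' : Cx := sqrtC (A * C)%:~R.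
have C0 : (C%:~R : Cx) != 0 by rewrite intr_eq0.
have aa : a' * a' = (B * C)%:~R by rewrite -expr2 sqrtCK.
have bb : b' * b' = (A * C)%:~R by rewrite -expr2 sqrtCK.
have a0 : a' != 0 by rewrite sqrtC_eq0 intr_eq0 mulf_neq0.
have b0 : b' != 0 by rewrite sqrtC_eq0 intr_eq0 mulf_neq0.
have hb : biq A B C a' b' (a' * b' / C%:~R).
  split=> //.
  - transitivity ((a' * a') * (b' * b') / (C%:~R * C%:~R)); first by field.
    by rewrite aa bb; field.
  - by field.
  - by transitivity ((a' * a') * b' / C%:~R); [field|rewrite aa; field].
  - by transitivity ((b' * b') * a' / C%:~R); [field|rewrite bb; field].
(* The two binary digits of k choose the signs of the images of a and b. *)
have h (k : 'I_4) : exists f : {rmorphism K -> Cx},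
    f a = (-1) ^+ odd k * a' /\ f b = (-1) ^+ (1 < k)%N * b'.
  have [f hf] := biq_extend hK (ratr : {rmorphism rat -> Cx}) (biq_conj (odd k) (1 < k)%N hb).
  exists f; split.
    by have := hf 0 1 0 0; rewrite -a_lin /lin4 rmorph0 rmorph1 !mul0r mul1r !addr0 add0r.
  by have := hf 0 0 1 0; rewrite -b_lin /lin4 rmorph0 rmorph1 !mul0r mul1r !addr0 !add0r.
have [s hs] := boolp.choice h; exists s; split.
  have sgn (e e' : bool) (z : Cx) : z != 0 -> (-1) ^+ e * z = (-1) ^+ e' * z -> e = e'.
    move=> z0 /(mulIf z0); case: e; case: e' => //= /eqP; rewrite expr0 expr1.
      by rewrite -subr_eq0 -opprD oppr_eq0 -mulr2n pnatr_eq0.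
    by rewrite -subr_eq0 opprK -mulr2n pnatr_eq0.
  move=> i j e; have [ia ib] := hs i; have [ja jb] := hs j.
  have o1 : odd i = odd j by apply: (sgn _ _ _ a0); rewrite -ia -ja e.
  have o2 : (1 < i)%N = (1 < j)%N by apply: (sgn _ _ _ b0); rewrite -ib -jb e.
  by apply: val_inj; move: i j o1 o2 {e ia ib ja jb} => [[|[|[|[|i]]]] hi] [[|[|[|[|j]]]] hj].
move=> t.
have sq (u : K) (z : Cx) (n : int) : u * u = n%:~R -> z * z = n%:~R -> exists e : bool, t u = (-1) ^+ e * z.
  move=> hu hz; have : (t u - z) * (t u + z) = 0.
    transitivity (t u * t u - z * z); first by ring.
    by rewrite -rmorphM hu rmorph_int hz subrr.
  move=> /eqP; rewrite mulf_eq0 => /orP[].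
    by rewrite subr_eq0 => /eqP ->; exists false; rewrite expr0 mul1r.
  by rewrite addr_eq0 => /eqP ->; exists true; rewrite expr1 mulN1r.
have [e ta] := sq a a' _ (biq_aa hK.1) aa; have [f tb] := sq b b' _ (biq_bb hK.1) bb.
have lt4 : (e + 2 * f < 4)%N by case: e {ta}; case: f {tb}.
exists (Ordinal lt4); set k := Ordinal lt4.
have [ka kb] := hs k.
have oe : odd k = e by rewrite /k /=; case: e {ta lt4 k ka kb}; case: f {tb}.
have of' : (1 < k)%N = f by rewrite /k /=; case: e {ta lt4 k ka kb oe}; case: f {tb}.
have tka : t a = s k a by rewrite ka oe ta.
have tkb : t b = s k b by rewrite kb of' tb.
have tkc : t c = s k c.
  apply: (mulfI C0); rewrite -{1}(rmorph_int t) -(rmorph_int (s k)) -!rmorphM -(biq_ab hK.1).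
  by rewrite !rmorphM /= tka tkb.
move=> v; have [w [x [y [z ->]]]] := biq_span hK v.
by rewrite !(biq_rmorph_lin _ _ _ (ratr : {rmorphism rat -> Cx})) tka tkb tkc.
Qed.

Variable s : 'I_4 -> {rmorphism K -> R[i]}.
Hypothesis hs : is_enum_of_embeddings s.

(** Composition with tau permutes the embeddings, so the sum is equal to its negative. *)
Lemma embeddings_sum (tau : {rmorphism K -> K}) u :
  (forall v, tau (tau v) = v) -> tau u = - u -> \sum_(k < 4) s k u = 0.
Proof.
move=> tt tu.
have h (k : 'I_4) : exists j, (s k \o tau : {rmorphism K -> Cx}) =1 s j by apply: hs.2.
have [p hp] := boolp.choice h.
have pinj : injective p.
  move=> i j e; apply: hs.1 => v; rewrite -(tt v).
  by rewrite -[LHS]/((s i \o tau) (tau v)) (hp i) e -(hp j).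
have : \sum_(k < 4) s k u = - \sum_(k < 4) s k u.
  rewrite {1}(reindex_inj pinj) /= -sumrN; apply: eq_bigr => k _.
  by rewrite -hp /= tu rmorphN.
move=> /eqP; rewrite -addr_eq0 -mulr2n -mulr_natr mulf_eq0 pnatr_eq0 orbF.
by move/eqP.
Qed.

Lemma embeddings_sum_abc :
  [/\ \sum_(k < 4) s k a = 0, \sum_(k < 4) s k b = 0 & \sum_(k < 4) s k c = 0].
Proof.
have key (e f : bool) : exists tau : {rmorphism K -> K},
    [/\ forall v, tau (tau v) = v, tau a = (-1) ^+ e * a, tau b = (-1) ^+ f * b
      & tau c = (-1) ^+ (e (+) f) * c].
  have [tau ht] := biq_extend hK (in_alg K) (biq_conj e f hK.1).
  have e1 : tau a = (-1) ^+ e * a.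
    by have := ht 0 1 0 0; rewrite -a_lin /lin4 rmorph0 rmorph1 !mul0r mul1r !addr0 add0r.
  have e2 : tau b = (-1) ^+ f * b.
    by have := ht 0 0 1 0; rewrite -b_lin /lin4 rmorph0 rmorph1 !mul0r mul1r !addr0 !add0r.
  have e3 : tau c = (-1) ^+ (e (+) f) * c.
    have := ht 0 0 0 1; rewrite {1}/lin4 rmorph0 rmorph1 !mul0r mul1r !add0r => ->.
    by rewrite /lin4 rmorph0 rmorph1 !mul0r mul1r !add0r.
  exists tau; split=> // v; have [w [x [y [z ->]]]] := biq_span hK v.
  rewrite !(biq_rmorph_lin _ _ _ (in_alg K)) e1 e2 e3 !rmorphM /= e1 e2 e3 !rmorph_sign !mulrA.
  by rewrite -!signr_addb !addbb !expr0 !mul1r.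
split.
- have [t [tt ta _ _]] := key true false; apply: (embeddings_sum tt).
  by rewrite ta expr1 mulN1r.
- have [t [tt _ tb _]] := key false true; apply: (embeddings_sum tt).
  by rewrite tb expr1 mulN1r.
- have [t [tt _ _ tc]] := key true false; apply: (embeddings_sum tt).
  by rewrite tc expr1 mulN1r.
Qed.

(** The order b, c, a is chosen so that the norms divided by that of a are x, y and 1, as in the
    lattices of the statement. *)
Definition frame_gen (i : 'I_3) : K := [:: b; c; a]`_i.
Definition frame_sq (i : 'I_3) : int := [:: A * C; A * B; B * C]`_i.
Definition frame_norm (i : 'I_3) : R := Num.sqrt (`|frame_sq i|%N)%:R.

(* Rows: the normalized images of b, c and a under the Minkowski embedding. *)
Definition frame : 'M[Cx]_(3, 4) :=
  \matrix_(i < 3, k < 4) (s k (frame_gen i) / real_complex R (2 * frame_norm i)).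

Lemma frame_sq_neq0 i : frame_sq i != 0.
Proof.
have [nA nB nC] := admissible_neq0 adm.
by case: i => -[|[|[|i]]] hi //; rewrite /frame_sq /= mulf_neq0.
Qed.

Lemma frame_norm_gt0 i : 0 < frame_norm i.
Proof. by rewrite sqrtr_gt0 ltr0n absz_gt0 frame_sq_neq0. Qed.

Lemma frame_genM i : frame_gen i * frame_gen i = (frame_sq i)%:~R.
Proof.
have [aa bb cc _ _ _] := hK.1.
by case: i => -[|[|[|i]]] hi.
Qed.

Lemma frame_gen_sum i j : i != j -> \sum_(k < 4) s k (frame_gen i * frame_gen j) = 0.
Proof.
have [aa bb cc ab ac bc] := hK.1; have [sa sb sc] := embeddings_sum_abc.
have ba : b * a = C%:~R * c by rewrite mulrC.
have ca : c * a = B%:~R * b by rewrite mulrC.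
have cb : c * b = A%:~R * a by rewrite mulrC.
have h (n : int) (u : K) : \sum_(k < 4) s k u = 0 -> \sum_(k < 4) s k (n%:~R * u) = 0.
  move=> hu; under eq_bigr do rewrite rmorphM rmorph_int.
  by rewrite -mulr_sumr hu mulr0.
case: i => -[|[|[|i]]] hi //; case: j => -[|[|[|j]]] hj //= _; rewrite /frame_gen /=.
- by rewrite bc; exact: h.
- by rewrite ba; exact: h.
- by rewrite cb; exact: h.
- by rewrite ca; exact: h.
- by rewrite ab; exact: h.
- by rewrite ac; exact: h.
Qed.

Lemma conj_real_complex (x : R) : (real_complex R x)^* = real_complex R x.
Proof. by apply/CrealP; apply/complex_realP; exists x. Qed.

(** Conjugation changes each s k (frame_gen j) by a sign that does not depend on k. The product of
    two different generators is a multiple of the third, whose images sum to 0; a single generator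
    has four images of the same modulus, whence the factor 2 in the normalization. *)
Lemma frame_unitary : frame \is unitarymx.
Proof.
apply/unitarymxP/matrixP => i j; rewrite !mxE.
have sq k i' : s k (frame_gen i') * s k (frame_gen i') = (frame_sq i')%:~R.
  by rewrite -rmorphM frame_genM rmorph_int.
transitivity (\sum_(k < 4) (s k (frame_gen i) * (s k (frame_gen j))^*) /
    (real_complex R (2 * frame_norm i) * real_complex R (2 * frame_norm j))).
  have cd (u : Cx) (x : R) : (u / real_complex R x)^* = u^* / real_complex R x.
    by rewrite [LHS]rmorphM fmorphV /= conj_real_complex.
  by apply: eq_bigr => k _; rewrite !mxE cd invfM mulrACA.
rewrite -mulr_suml; have [->|ij] := eqVneq i j.
  under eq_bigr do rewrite (conj_sqrt_int (frame_sq_neq0 j) (sq _ j)).2.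
  rewrite sumr_const card_ord.
  have e : real_complex R (2 * frame_norm j) * real_complex R (2 * frame_norm j) =
      (`|frame_sq j|%N)%:R *+ 4.
    rewrite -rmorphM /= mulrACA -[frame_norm j * _]expr2 sqr_sqrtr ?ler0n //.
    by rewrite rmorphM rmorph_nat /= -natrM rmorph_nat mulr_natl.
  rewrite e mulfV //; rewrite mulrn_eq0 /= pnatr_eq0 -lt0n absz_gt0.
  exact: frame_sq_neq0.
under eq_bigr do rewrite (conj_sqrt_int (frame_sq_neq0 j) (sq _ j)).1 mulrCA -rmorphM.
by rewrite -mulr_sumr frame_gen_sum // mulr0 mul0r.
Qed.

Lemma minkowski_frame (X Y Z : int) :
  minkowski_embedding s (X%:~R * a + Y%:~R * b + Z%:~R * c) =
  map_mx (real_complex R) (2 *: vec3 (Y%:~R * frame_norm 0) (Z%:~R * frame_norm 1)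
    (X%:~R * frame_norm 2)) *m frame.
Proof.
apply/rowP => k; rewrite !mxE !big_ord_recl big_ord0 !mxE /= addr0.
have -> : lift ord0 ord0 = 1 :> 'I_3 by apply: val_inj.
have -> : lift ord0 (lift ord0 ord0) = 2 :> 'I_3 by apply: val_inj.
have h (n : int) (i : 'I_3) : real_complex R (2 * (n%:~R * frame_norm i)) *
    (s k (frame_gen i) / real_complex R (2 * frame_norm i)) = n%:~R * s k (frame_gen i).
  have nz : real_complex R (2 * frame_norm i) != 0.
    by rewrite fmorph_eq0 mulf_neq0 ?pnatr_eq0 // gt_eqF // frame_norm_gt0.
  have -> : 2 * (n%:~R * frame_norm i) = n%:~R * (2 * frame_norm i) by ring.
  by rewrite rmorphM rmorph_int -mulrA [X in _ * X]mulrC divfK.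
rewrite /= !h !rmorphD !rmorphM !rmorph_int /frame_gen /=; ring.
Qed.

End ShapeOfField.

Lemma map_complex_inj (R : realType) m n (u v : 'M[R]_(m, n)) :
  map_mx (real_complex R) u = map_mx (real_complex R) v -> u = v.
Proof.
move=> /matrixP e; apply/matrixP => i j; have := e i j; rewrite !mxE.
by move/complexI.
Qed.

(** The shape quantifies over all isometric identifications of the span with R^3. Any of them
    differs from [frame] by a real orthogonal matrix, because both parametrize the same real span;
    the three hypotheses on [Lam] say that the lattice does span. *)
Lemma shape_of_fieldE (R : realType) (K : fieldExtType rat) (A B C : int) (a b c : K)
    (Lam : int -> int -> int -> Prop) (L0 : set 'rV[R]_3) (kappa : R) :
  biq_field A B C a b c -> admissible A B C ->
  (forall u, O_perp u <-> exists X Y Z, Lam X Y Z /\ u = X%:~R * a + Y%:~R * b + Z%:~R * c) ->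
  Lam 4 0 0 -> Lam 0 4 0 -> Lam 0 0 4 -> kappa != 0 ->
  (forall v, L0 v <-> exists X Y Z, Lam X Y Z /\ v = kappa *:
     vec3 (Y%:~R * frame_norm R A B C 0) (Z%:~R * frame_norm R A B C 1)
          (X%:~R * frame_norm R A B C 2)) ->
  shape_of_field R 3 K = shape_of_lattice L0.
Proof.
move=> hK adm hO L1 L2 L3 k0 hL0.
pose rC := real_complex R.
have mapZ (x : R) (v : 'rV[R]_3) : map_mx rC (x *: v) = rC x *: map_mx rC v by rewrite map_mxZ.
have img s : is_enum_of_embeddings s -> forall cc : R,
   [set rC cc *: minkowski_embedding s u | u in @O_perp K] =
   [set map_mx rC ((cc * 2 / kappa) *: v) *m frame A B C a b c s | v in L0].
  move=> hs cc; apply/seteqP; split=> [_ [u /hO[X [Y [Z [hl ->]]]] <-]|_ [v /hL0[X [Y [Z [hl ->]]]] <-]].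
    rewrite (minkowski_frame _ _ _ adm); set w := vec3 _ _ _.
    exists (kappa *: w); first by apply/hL0; exists X, Y, Z.
    by rewrite scalerA mulfVK // -scalerA mapZ -scalemxAl.
  set w := vec3 _ _ _.
  exists (X%:~R * a + Y%:~R * b + Z%:~R * c); first by apply/hO; exists X, Y, Z.
  by rewrite (minkowski_frame _ _ _ adm) -/w scalerA mulfVK // -scalerA mapZ -scalemxAl.
apply/seteqP; split=> [L [s [Bm [cc [hs uB c0 e]]]]|L [cc [Om [c0 OO ->]]]]; last first.
  (* Conversely, a rotated and scaled lattice is obtained from the same field by rotating
     [frame]. *)
  have [s hs] := embeddings_exist R hK adm.
  have uU := frame_unitary hK adm hs; set U := frame _ _ _ _ _ _ _ in uU.
  have OO' : Om^T *m Om = 1%:M by apply: mulmx1C.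
  exists s, (map_mx rC Om^T *m U), (cc * kappa / 2); split; [exact: hs| | |].
  - apply: mul_unitarymx => //; apply/unitarymxP.
    have -> : ((map_mx rC Om^T)^t*)%sesqui = map_mx rC Om.
      by apply/matrixP => i j; rewrite !mxE conj_real_complex.
    by rewrite -map_mxM OO' map_mx1.
  - by rewrite !mulf_neq0 // invr_eq0 pnatr_eq0.
  rewrite img // -/U; have -> : cc * kappa / 2 * 2 / kappa = cc by field.
  apply/seteqP; split=> [_ [_ [v hv <-] <-]|_ [v hv <-]].
    exists v => //; rewrite mulmxA -map_mxM -scalemxAl -mulmxA OO mulmx1 //.
  exists (cc *: (v *m Om)); first by exists v.
  by rewrite mulmxA -map_mxM -scalemxAl -mulmxA OO mulmx1.
have uU := frame_unitary hK adm hs; set U := frame A B C a b c s in uU.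
move: e; rewrite img // -/U => e; set d := cc * 2 / kappa in e.
have d0 : d != 0 by rewrite !mulf_neq0 ?invr_eq0 // pnatr_eq0.
have /unitarymxP BB := uB; have /unitarymxP UU := uU.
(* A nonzero multiple of each axis lies in the lattice, so each row of [U] is a real combination of
   the rows of [Bm]; the coefficients form the orthogonal matrix [M]. *)
have row_in (i : 'I_3) : exists t : R, t != 0 /\ L0 (t *: delta_mx 0 i).
  have n0 := frame_norm_gt0 R adm.
  have v3 (x y z : R) : vec3 x y z = x *: delta_mx 0 0 + y *: delta_mx 0 1 + z *: delta_mx 0 2.
    apply/rowP => j; rewrite !mxE /=.
    by case: j => -[|[|[|j]]] hj //; rewrite ?mulr1 ?mulr0 ?addr0 ?add0r.
  case: i => -[|[|[|i]]] hi //.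
  - exists (kappa * (4%:~R * frame_norm R A B C 0)); split.
      by rewrite !mulf_neq0 // ?intr_eq0 // gt_eqF.
    apply/hL0; exists 0, 4, 0; split=> //.
    rewrite v3 !mul0r !scale0r !addr0 scalerA; congr (_ *: delta_mx _ _); exact: val_inj.
  - exists (kappa * (4%:~R * frame_norm R A B C 1)); split.
      by rewrite !mulf_neq0 // ?intr_eq0 // gt_eqF.
    apply/hL0; exists 0, 0, 4; split=> //.
    rewrite v3 !mul0r !scale0r !addr0 add0r scalerA; congr (_ *: delta_mx _ _); exact: val_inj.
  - exists (kappa * (4%:~R * frame_norm R A B C 2)); split.
      by rewrite !mulf_neq0 // ?intr_eq0 // gt_eqF.
    apply/hL0; exists 4, 0, 0; split=> //.
    rewrite v3 !mul0r !scale0r !add0r scalerA; congr (_ *: delta_mx _ _); exact: val_inj.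
have [t ht] := boolp.choice row_in.
have row_B (i : 'I_3) : exists v : 'rV[R]_3, row i U = map_mx rC v *m Bm.
  have : [set map_mx rC (d *: v) *m U | v in L0] (map_mx rC (d *: (t i *: delta_mx 0 i)) *m U).
    by exists (t i *: delta_mx 0 i) => //; case: (ht i).
  rewrite -e => -[v _ hv]; exists ((d * t i)^-1 *: v).
  have dt0 : d * t i != 0 by rewrite mulf_neq0 //; case: (ht i).
  rewrite mapZ -scalemxAl hv scalerA mapZ -scalemxAl scalerA.
  have -> : rC (d * t i)^-1 * rC (d * t i) = 1 by rewrite /rC -rmorphM mulVf ?rmorph1.
  by rewrite scale1r map_delta_mx -rowE.
have [f hf] := boolp.choice row_B.
pose M : 'M[R]_3 := \matrix_(i < 3) f i.
have UM : U = map_mx rC M *m Bm.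
  by apply/row_matrixP => i; rewrite row_mul -map_row rowK hf.
have MM : M *m M^T = 1%:M.
  apply: (@map_complex_inj R); rewrite map_mxM map_mx1 -/rC.
  have -> : map_mx rC M^T = ((map_mx rC M)^t*)%sesqui.
    by apply/matrixP => i j; rewrite !mxE conj_real_complex.
  rewrite -UU UM trmx_mul map_mxM mulmxA -[_ *m Bm *m _]mulmxA BB mulmx1 //.
exists d, M; split=> //.
have Binj (v w : 'rV[R]_3) : map_mx rC v *m Bm = map_mx rC w *m Bm -> v = w.
  move=> h; apply: (@map_complex_inj R).
  by rewrite -[LHS]mulmx1 -[RHS]mulmx1 -BB !mulmxA h.
apply/seteqP; split=> [v hv|_ [v hv <-]].
  have : [set map_mx rC v *m Bm | v in L] (map_mx rC v *m Bm) by exists v.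
  rewrite e => -[w hw hwv]; exists w => //; apply: Binj; rewrite -hwv UM mulmxA -map_mxM.
  by rewrite -scalemxAl.
have : [set map_mx rC (d *: v) *m U | v in L0] (map_mx rC (d *: v) *m U) by exists v.
rewrite -e => -[w hw hwv]; have -> : d *: (v *m M) = w; last by [].
by apply: Binj; rewrite hwv UM mulmxA -map_mxM -scalemxAl.
Qed.

Section TypedShapes.
Variables (R : realType) (K : fieldExtType rat) (A B C : int).
Hypothesis hK : biquadratic K A B C.
Let adm := hK.1.
Let x : R := Num.sqrt ((`|A|%N)%:R / (`|B|%N)%:R).
Let y : R := Num.sqrt ((`|A|%N)%:R / (`|C|%N)%:R).

Lemma frame_norm_ratio : frame_norm R A B C 0 = x * frame_norm R A B C 2 /\
  frame_norm R A B C 1 = y * frame_norm R A B C 2.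
Proof.
have [nA nB nC] := admissible_neq0 adm.
have B0 : (`|B|%N)%:R != 0 :> R by rewrite pnatr_eq0 -lt0n absz_gt0.
have C0 : (`|C|%N)%:R != 0 :> R by rewrite pnatr_eq0 -lt0n absz_gt0.
have p0 (m n : nat) : 0 <= m%:R / n%:R :> R by rewrite divr_ge0 ?ler0n.
rewrite /frame_norm /x /y -!sqrtrM ?p0 // /frame_sq /= !abszM !natrM.
by split; congr Num.sqrt; field.
Qed.

Lemma vec_frame (X Y Z : int) (k : R) : k *: vec3 (Y%:~R * frame_norm R A B C 0)
    (Z%:~R * frame_norm R A B C 1) (X%:~R * frame_norm R A B C 2) =
  vec3 (k * frame_norm R A B C 2 * (Y%:~R * x)) (k * frame_norm R A B C 2 * (Z%:~R * y))
    (k * frame_norm R A B C 2 * X%:~R).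
Proof.
have [-> ->] := frame_norm_ratio; rewrite scale_vec3; congr vec3; ring.
Qed.

Lemma shapeU : typeU A B C -> shape_of_field R 3 K = sh_oI x y.
Proof.
move=> tU; have [_ [a [b [c hb]]]] := hK.
have n0 : frame_norm R A B C 2 != 0 by rewrite gt_eqF // frame_norm_gt0.
apply: (@shape_of_fieldE R K A B C a b c
  (fun X Y Z => exists j k l : int, [/\ X = j * 2 + l, Y = k * 2 + l & Z = l]) _
  (1 / (2 * frame_norm R A B C 2)) hb adm).
- move=> u; rewrite (O_perpU hb adm tU); split.
    by move=> [j [k [l ->]]]; do 3!eexists; split; last reflexivity; exists j, k, l.
  by move=> [X [Y [Z [[j [k [l [-> -> ->]]]] ->]]]]; exists j, k, l.
- by exists 2, 0, 0.
- by exists 0, 2, 0.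
- by exists (-2), (-2), 4.
- by rewrite mulf_neq0 ?oner_neq0 // invr_eq0 mulf_neq0 ?pnatr_eq0.
- move=> v; rewrite lattice_oIP; split.
    move=> [p [q [r [[e ->] [f ->] ->]]]]; exists r, (r + 2 * e), (r + 2 * f); split.
      by exists (- f), (e - f), (r + 2 * f); split; ring.
    rewrite vec_frame; congr vec3; by field.
  move=> [X [Y [Z [[j [k [l [-> -> ->]]]] ->]]]].
  exists (k * 2 + l), l, (j * 2 + l); split; [by exists (k - j); ring|by exists (- j); ring|].
  rewrite vec_frame; congr vec3; by field.
Qed.

(** The projection of the integers contains 2a here but only 4a for [typeR1], with the same
    multiples of b and c. Normalizing the third axis to length 1 therefore doubles x and y. *)
Lemma shapeR2 : typeR2 A B C -> shape_of_field R 3 K = sh_oC (2 * x) (2 * y).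
Proof.
move=> tR; have [_ [a [b [c hb]]]] := hK.
have n0 : frame_norm R A B C 2 != 0 by rewrite gt_eqF // frame_norm_gt0.
apply: (@shape_of_fieldE R K A B C a b c
  (fun X Y Z => exists j k l : int, [/\ X = j * 2, Y = k * 4 + l * 2 & Z = l * 2]) _
  (1 / (2 * frame_norm R A B C 2)) hb adm).
- move=> u; rewrite (O_perpR2 hb adm tR); split.
    by move=> [j [k [l ->]]]; do 3!eexists; split; last reflexivity; exists j, k, l.
  by move=> [X [Y [Z [[j [k [l [-> -> ->]]]] ->]]]]; exists j, k, l.
- by exists 2, 0, 0.
- by exists 0, 1, 0.
- by exists 0, (-1), 2.
- by rewrite mulf_neq0 ?oner_neq0 // invr_eq0 mulf_neq0 ?pnatr_eq0.
- move=> v; rewrite lattice_oCP; split.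
    move=> [p [q [r [[e ->] ->]]]]; exists (r * 2), (e * 4 + q * 2), (q * 2); split.
      by exists r, e, q.
    rewrite vec_frame; congr vec3; rewrite ?(rmorphD, rmorphM) /=; by field.
  move=> [X [Y [Z [[j [k [l [-> -> ->]]]] ->]]]].
  exists (l + 2 * k), l, j; split; first by exists k.
  rewrite vec_frame; congr vec3; rewrite ?(rmorphD, rmorphM) /=; by field.
Qed.

Lemma shapeR1 : typeR1 A B C -> shape_of_field R 3 K = sh_oC x y.
Proof.
move=> tR; have [_ [a [b [c hb]]]] := hK.
have n0 : frame_norm R A B C 2 != 0 by rewrite gt_eqF // frame_norm_gt0.
apply: (@shape_of_fieldE R K A B C a b c
  (fun X Y Z => exists j k l : int, [/\ X = j * 4, Y = k * 4 + l * 2 & Z = l * 2]) _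
  (1 / (4 * frame_norm R A B C 2)) hb adm).
- move=> u; rewrite (O_perpR1 hb adm tR); split.
    by move=> [j [k [l ->]]]; do 3!eexists; split; last reflexivity; exists j, k, l.
  by move=> [X [Y [Z [[j [k [l [-> -> ->]]]] ->]]]]; exists j, k, l.
- by exists 1, 0, 0.
- by exists 0, 1, 0.
- by exists 0, (-1), 2.
- by rewrite mulf_neq0 ?oner_neq0 // invr_eq0 mulf_neq0 ?pnatr_eq0.
- move=> v; rewrite lattice_oCP; split.
    move=> [p [q [r [[e ->] ->]]]]; exists (r * 4), (e * 4 + q * 2), (q * 2); split.
      by exists r, e, q.
    rewrite vec_frame; congr vec3; rewrite ?(rmorphD, rmorphM) /=; by field.
  move=> [X [Y [Z [[j [k [l [-> -> ->]]]] ->]]]].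
  exists (l + 2 * k), l, j; split; first by exists k.
  rewrite vec_frame; congr vec3; rewrite ?(rmorphD, rmorphM) /=; by field.
Qed.

End TypedShapes.

(** * Counting points in a region by boxes *)

Section RealLemmas.
Variable R : realType.

Lemma cvg_fsum (T : Type) (F : set_system T) (FF : Filter F) (I : Type) (r : seq I) (P : pred I)
    (f : I -> T -> R) (l : I -> R) :
  (forall i, f i t @[t --> F] --> l i) ->
  (\sum_(i <- r | P i) f i t) @[t --> F] --> \sum_(i <- r | P i) l i.
Proof.
move=> h; elim: r => [|i r IH].
  under eq_fun do rewrite big_nil; rewrite big_nil; exact: cvg_cst.
under eq_fun do rewrite big_cons; rewrite big_cons; case: (P i) => //.
by apply: cvgD.
Qed.

(** The bounding functions may depend on e and need only have limits within e of l; this fits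
    approximation by finitely many boxes. *)
Lemma cvg_sandwich (f : R -> R) (l : R) :
  (forall e, 0 < e -> exists g h l1 l2, [/\ \forall t \near +oo, g t <= f t <= h t,
     g t @[t --> +oo] --> l1, h t @[t --> +oo] --> l2, l - e <= l1 & l2 <= l + e]) ->
  f t @[t --> +oo] --> l.
Proof.
move=> H; apply/cvgrPdist_le => /= e e0.
have e2 : 0 < e / 2 by rewrite divr_gt0.
have [g [h [l1 [l2 [hgh cg ch h1 h2]]]]] := H _ e2.
have hg : l - e < l1 by lra.
have hh : l2 < l + e by lra.
have n1 := cvgr_gt l1 cg _ hg; have n2 := cvgr_lt l2 ch _ hh.
near=> t; rewrite ler_norml.
have /andP[a1 a2] : g t <= f t <= h t by near: t.
have b1 : l - e < g t by near: t; exact: n1.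
have b2 : h t < l + e by near: t; exact: n2.
by apply/andP; split; lra.
Unshelve. all: by end_near. Qed.

Lemma geometric_sum (x : R) n : (1 - x) * \sum_(i < n) x ^+ i = 1 - x ^+ n.
Proof.
elim: n => [|n IH]; first by rewrite big_ord0 mulr0 expr0 subrr.
by rewrite big_ord_recr /= mulrDr IH exprS; ring.
Qed.

Lemma grid_point (lam z x : R) m : 1 < lam -> 0 < z -> z <= x -> x < z * lam ^+ m ->
  exists2 j, (j < m)%N & z * lam ^+ j <= x < z * lam ^+ j.+1.
Proof.
move=> l1 z0 zx; elim: m => [|m IH]; first by rewrite expr0 mulr1 ltNge zx.
move=> h; have [lt|ge] := ltP x (z * lam ^+ m).
  by have [j jm hj] := IH lt; exists j => //; rewrite ltnW.
by exists m => //; rewrite ge h.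
Qed.

Lemma count_ltn N m : (\sum_(e < N) (e < m))%N = minn m N.
Proof.
elim: N => [|N IH]; first by rewrite big_ord0 minn0.
by rewrite big_ord_recr /= IH; case: ltnP => h; lia.
Qed.

Lemma count_pairs n : (2 * \sum_(d < n.+1) \sum_(e < n.+1) (d + e <= n))%N = (n.+1 * n.+2)%N.
Proof.
have -> : (\sum_(d < n.+1) \sum_(e < n.+1) (d + e <= n) = \sum_(d < n.+1) d.+1)%N.
  rewrite (reindex_inj rev_ord_inj) /=; apply: eq_bigr => d _.
  transitivity (\sum_(e < n.+1) (e < d.+1))%N; last by rewrite count_ltn; have := ltn_ord d; lia.
  by apply: eq_bigr => e _; congr nat_of_bool; have := ltn_ord d; have := ltn_ord e; lia.
elim: n => [|n IH]; first by rewrite big_ord_recr big_ord0.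
by rewrite big_ord_recr /= mulnDr IH; lia.
Qed.

(** The pairs lost lie on the sides d = 0, e = 0 and d + e = n, with at most n + 1 points each; the
    factor 2 turns this into 6 (n + 1). *)
Lemma count_inner_pairs n :
  (n.+1 * n.+2 <= 2 * \sum_(d < n.+1) \sum_(e < n.+1) [&& 0 < d, 0 < e & d + e < n] + 6 * n.+1)%N.
Proof.
rewrite -count_pairs.
have h1 : (\sum_(d < n.+1) (d == 0 :> nat) <= 1)%N.
  by rewrite big_ord_recl big1 // => i _.
have h2 (m : nat) : (\sum_(e < n.+1) (e == m :> nat) <= 1)%N.
  elim: (n.+1) => [|N IH]; first by rewrite big_ord0.
  rewrite big_ord_recr /=; have [e|ne] := eqVneq N m; last by rewrite addn0.
  rewrite big1 // => i _; apply/eqP; rewrite eqb0; have := ltn_ord i; lia.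
have -> : (6 * n.+1 = 2 * (\sum_(d < n.+1) 1 + \sum_(e < n.+1) 1 + \sum_(d < n.+1) 1))%N.
  by rewrite sum1_card card_ord; lia.
rewrite -mulnDr leq_mul2l /=.
have hS : (\sum_(d < n.+1) \sum_(e < n.+1) (d + e <= n) <=
  \sum_(d < n.+1) \sum_(e < n.+1) ([&& 0 < d, 0 < e & d + e < n] + ((d == 0 :> nat) + (e == 0 :> nat) + (e == (n - d)%N :> nat))))%N.
  apply: leq_sum => d _; apply: leq_sum => e _.
  have := ltn_ord d; have := ltn_ord e.
  by case: (posnP d) => ?; case: (posnP e) => ?; lia.
apply: (leq_trans hS).
have -> (x y z w : 'I_n.+1 -> 'I_n.+1 -> nat) : (\sum_d \sum_e (x d e + (y d e + z d e + w d e)) =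
    \sum_d \sum_e x d e + (\sum_d \sum_e y d e + \sum_d \sum_e z d e + \sum_d \sum_e w d e))%N.
  by rewrite -!big_split; apply: eq_bigr => d _; rewrite -!big_split.
rewrite leq_add2l leq_add ?leq_add //.
- rewrite exchange_big /=; apply: leq_sum => i _; exact: h1.
- by apply: leq_sum => i _; exact: h2.
- by apply: leq_sum => i _; exact: h2.
Qed.

Section Geometric.
Variables (iota : R).
Hypotheses (i0 : 0 < iota) (i1 : iota < 1).
Local Notation lam := iota^-1.

Lemma geo_level m q : let k0 := (m %/ 3)%N in
  \sum_(k < q | (m < 3 * k.+1)%N) lam ^+ m * iota ^+ (3 * k.+1) * (1 - iota ^+ 3) =
  lam ^+ m * iota ^+ (3 * k0.+1) * (1 - iota ^+ (3 * (q - k0))).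
Proof.
move=> k0; have hk (k : nat) : (m < 3 * k.+1)%N = (k0 <= k)%N.
  by rewrite /k0 mulnC -ltn_divLR // ltnS.
under eq_bigl do rewrite hk.
rewrite -mulr_suml; have [qk|kq] := leqP q k0.
  rewrite (_ : (q - k0 = 0)%N) ?muln0 ?expr0 ?subrr ?mulr0; last by apply/eqP.
  rewrite big1 ?mul0r // => k hk'; have := ltn_ord k; lia.
have -> : \sum_(k < q | (k0 <= k)%N) lam ^+ m * iota ^+ (3 * k.+1) =
   \sum_(i < q - k0) lam ^+ m * iota ^+ (3 * k0.+1) * (iota ^+ 3) ^+ i.
  rewrite -(big_mkord (fun k => k0 <= k)%N (fun k => lam ^+ m * iota ^+ (3 * k.+1))).
  rewrite (@big_cat_nat _ _ _ k0) //=; last exact: ltnW.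
  rewrite big_nat_cond big1 ?add0r; last by move=> i; lia.
  rewrite -{1}[k0]add0n big_addn big_mkord.
  apply: eq_big => [i|i _]; first by rewrite leq_addl.
  rewrite -exprM -mulrA -exprD; congr (_ * _ ^+ _); lia.
by rewrite -mulr_sumr -mulrA [X in _ * X]mulrC geometric_sum -exprM.
Qed.

Lemma lam_iota m k : (m <= k)%N -> lam ^+ m * iota ^+ k = iota ^+ (k - m).
Proof.
move=> mk; rewrite -{1}(subnK mk) exprD mulrCA -exprMn mulVf ?gt_eqF // expr1n mulr1 //.
Qed.

(** The first exponent 3 (k0 + 1) exceeds m by 1, 2 or 3, which accounts for iota here and iota^3 in
    [geo_lower]. *)
Lemma geo_upper m q :
  \sum_(k < q | (m < 3 * k.+1)%N) lam ^+ m * iota ^+ (3 * k.+1) * (1 - iota ^+ 3) <= iota.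
Proof.
have i3 (n : nat) : 0 <= iota ^+ n <= 1 by rewrite exprn_ge0 ?exprn_ile1 ?ltW.
rewrite geo_level; set k0 := (m %/ 3)%N.
have h3 : (m < 3 * k0.+1)%N by rewrite /k0 mulnC -ltn_divLR.
rewrite lam_iota ?(ltnW h3) //.
apply: (le_trans (y := iota ^+ (3 * k0.+1 - m) * 1)).
  apply: ler_wpM2l; first by case/andP: (i3 (3 * k0.+1 - m)%N).
  by have /andP[] := i3 (3 * (q - k0))%N; lra.
rewrite mulr1 -{2}[iota]expr1 ler_wiXn2l ?ltW //; lia.
Qed.

Lemma geo_lower m q : iota ^+ 3 * (1 - iota ^+ (3 * (q - m))) <=
  \sum_(k < q | (m < 3 * k.+1)%N) lam ^+ m * iota ^+ (3 * k.+1) * (1 - iota ^+ 3).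
Proof.
have i3 (n : nat) : 0 <= iota ^+ n <= 1 by rewrite exprn_ge0 ?exprn_ile1 ?ltW.
rewrite geo_level; set k0 := (m %/ 3)%N.
have h3 : (m < 3 * k0.+1)%N by rewrite /k0 mulnC -ltn_divLR.
have h4 : (3 * k0 <= m)%N by rewrite mulnC leq_divM.
rewrite lam_iota ?(ltnW h3) //.
apply: ler_pM; rewrite ?exprn_ge0 ?(ltW i0) //.
- by have /andP[] := i3 (3 * (q - m))%N; lra.
- by apply: ler_wiXn2l; rewrite ?ltW //; lia.
- by rewrite lerB // ler_wiXn2l ?ltW //; lia.
Qed.

End Geometric.

End RealLemmas.

(** * Covering the region by cells of a multiplicative grid *)

Section RegionCount.
Variable R : realType.

Definition wsum (w : nat -> nat -> nat -> R) N (P : nat -> nat -> nat -> bool) : R :=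
  \sum_(p : 'I_N * 'I_N * 'I_N) (P p.1.1 p.1.2 p.2)%:R * w p.1.1 p.1.2 p.2.

Definition inbox (u u' v v' s s' t : R) (a b c : nat) : bool :=
  [&& u * t <= a%:R < u' * t, v * t <= b%:R < v' * t & s * t <= c%:R < s' * t].

Definition region (r1 r2 T : R) (a b c : nat) : bool :=
  [&& r1 * b%:R <= a%:R, (c <= b)%N, a%:R < r2 * c%:R & (a * b * c)%:R < T].

Section Grid.
Variables (lam r1 : R) (n : nat).
Hypotheses (lam1 : 1 < lam) (r10 : 0 < r1).
Local Notation iota := (lam^-1).
Local Notation r2 := (r1 * lam ^+ n).

(* c lies at scale lam^-k t, while e and d locate b / c and a / (r1 b) on the grid
   of powers of lam. *)
Definition cell (k d e : nat) (t : R) : nat -> nat -> nat -> bool :=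
  inbox (r1 * lam ^+ (d + e) * iota ^+ k.+1) (r1 * lam ^+ (d + e).+1 * iota ^+ k.+1)
    (lam ^+ e * iota ^+ k.+1) (lam ^+ e.+1 * iota ^+ k.+1) (iota ^+ k.+1) (lam * iota ^+ k.+1) t.

Let lam0 : 0 < lam. Proof. exact: lt_trans lam1. Qed.
Let iota0 : 0 < iota. Proof. by rewrite invr_gt0. Qed.
Let iota1 : iota < 1. Proof. by rewrite invf_lt1. Qed.
Let li : lam * iota = 1. Proof. by rewrite mulfV // gt_eqF. Qed.

Lemma lam_mono i j : (lam ^+ i < lam ^+ j) = (i < j)%N.
Proof. by rewrite ltr_eXn2l. Qed.

Lemma grid_uniq (z x : R) i j : 0 < z -> z * lam ^+ i <= x < z * lam ^+ i.+1 ->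
  z * lam ^+ j <= x < z * lam ^+ j.+1 -> i = j.
Proof.
move=> z0 /andP[i1 i2] /andP[j1 j2].
have := le_lt_trans i1 j2; have := le_lt_trans j1 i2.
by rewrite !ltr_pM2l // !lam_mono; clear; lia.
Qed.

Lemma region_pos t a b c : region r1 r2 (r1 * t ^+ 3) a b c ->
  [/\ (0 < c)%N, (0 < b)%N & (0 < a)%N].
Proof.
move=> /and4P[h1 h2 h3 h4]; have c0 : (0 < c)%N.
  by rewrite lt0n; apply/eqP => c0; move: h3; rewrite c0 mulr0 ltNge ler0n.
have b0 : (0 < b)%N by apply: leq_trans h2.
split=> //; rewrite -(ltr0n R); apply: lt_le_trans h1.
by rewrite mulr_gt0 ?ltr0n.
Qed.

(** From c <= b and r1 b <= a the product is at least r1 c^3, whence c < t; the cone then bounds a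
    and b by multiples of c. *)
Lemma region_bounds t a b c : 0 < t -> region r1 r2 (r1 * t ^+ 3) a b c ->
  [/\ c%:R < t, b%:R < lam ^+ n * c%:R & a%:R < r2 * c%:R].
Proof.
move=> t0 h; have [c0 b0 a0] := region_pos h; move: h => /and4P[h1 h2 h3 h4].
have hb : b%:R < lam ^+ n * c%:R.
  by rewrite -(ltr_pM2l r10) mulrA; apply: le_lt_trans h3.
split=> //; rewrite ltNge; apply/negP => tc.
have : r1 * t ^+ 3 <= (a * b * c)%:R.
  rewrite !natrM; apply: (le_trans (y := (r1 * b%:R) * b%:R * c%:R)); last first.
    by rewrite !ler_wpM2r ?ler0n.
  rewrite -!mulrA ler_pM2l // !exprS expr0 mulr1.
  have tb : t <= b%:R by apply: le_trans tc _; rewrite ler_nat.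
  have t0' := ltW t0.
  by rewrite ler_pM ?mulr_ge0 // ler_pM.
by rewrite leNgt h4.
Qed.

(** Place c on the grid, then b relative to the lower end of the cell of c, then a relative to that
    of b. The lower corner of the cell has product r1 t^3 lam^(d + 2e - 3(k + 1)), which gives the
    third inequality. *)
Lemma cell_cover t q a b c : 0 < t -> region r1 r2 (r1 * t ^+ 3) a b c ->
  iota ^+ q * t <= c%:R ->
  exists k d e, [/\ (k < q)%N, (d + e <= n)%N, (d + 2 * e < 3 * k.+1)%N & cell k d e t a b c].
Proof.
move=> t0 hr hc; have [ct bn an] := region_bounds t0 hr.
have [c0 b0 a0] := region_pos hr.
move: hr => /and4P[h1 h2 h3 h4].
have iq (m : nat) : 0 < iota ^+ m by rewrite exprn_gt0.
have [j jq /andP[cj1 cj2]] : exists2 j, (j < q)%N &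
    iota ^+ q * t * lam ^+ j <= c%:R < iota ^+ q * t * lam ^+ j.+1.
  apply: grid_point => //; first by rewrite mulr_gt0.
  by rewrite mulrAC -exprMn mulVf ?gt_eqF // expr1n mul1r.
have [k kq hq] : exists2 k, (k < q)%N & q = (k.+1 + j)%N.
  by move: jq; clear; exists (q - j.+1)%N; lia.
have [z zE] : exists z, z = iota ^+ k.+1 * t by eexists.
have z0 : 0 < z by rewrite zE mulr_gt0.
have hz : iota ^+ q * t * lam ^+ j = z.
  have e1 : iota ^+ j * lam ^+ j = 1 by rewrite -exprMn mulVf ?gt_eqF // expr1n.
  transitivity (iota ^+ k.+1 * t * (iota ^+ j * lam ^+ j)); last by rewrite e1 mulr1.
  by rewrite hq exprD [RHS]mulrA; congr (_ * _); rewrite mulrAC.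
have cz1 : z <= c%:R by rewrite -hz.
have cz2 : c%:R < z * lam by move: cj2; rewrite exprSr mulrA hz.
have [e en /andP[be1 be2]] : exists2 e, (e < n.+1)%N & z * lam ^+ e <= b%:R < z * lam ^+ e.+1.
  apply: grid_point => //; first by apply: le_trans cz1 _; rewrite ler_nat.
  by apply: (lt_trans bn); rewrite exprS mulrA [ltLHS]mulrC ltr_pM2r ?exprn_gt0.
have zz0 : 0 < r1 * z * lam ^+ e by rewrite !mulr_gt0 ?exprn_gt0.
have [d dn /andP[ad1 ad2]] : exists2 d, (d < n.+1 - e)%N &
    r1 * z * lam ^+ e * lam ^+ d <= a%:R < r1 * z * lam ^+ e * lam ^+ d.+1.
  apply: grid_point => //.
    by apply: le_trans h1; rewrite -mulrA ler_pM2l.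
  rewrite -mulrA -exprD subnKC; last by rewrite ltnW.
  have cl : lam ^+ n * c%:R < z * lam ^+ n.+1.
    by rewrite exprS mulrA [ltLHS]mulrC ltr_pM2r ?exprn_gt0.
  by apply: (lt_trans an); rewrite -!mulrA ltr_pM2l.
exists k, d, e; split; [exact: kq|by move: dn en; clear; lia| |].
- rewrite -lam_mono; move: h4; rewrite !natrM => h4.
  have : (r1 * z * lam ^+ e * lam ^+ d) * (z * lam ^+ e) * z < r1 * t ^+ 3.
    have z0' := ltW z0; have r0' := ltW r10; have l0' m : 0 <= lam ^+ m by rewrite exprn_ge0 // ltW.
    by apply: le_lt_trans h4; rewrite ler_pM ?ler_pM ?mulr_ge0.
  have -> : (r1 * z * lam ^+ e * lam ^+ d) * (z * lam ^+ e) * z =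
     (r1 * t ^+ 3) * (lam ^+ (d + 2 * e) * iota ^+ (3 * k.+1)).
    by rewrite zE mulnC [(3 * _)%N]mulnC [in iota ^+ (_ * 3)]exprM exprD muln2 -addnn exprD; ring.
  rewrite gtr_pMr; last by rewrite mulr_gt0 ?exprn_gt0.
  by rewrite exprVn ltr_pdivrMr ?exprn_gt0 // mul1r.
- rewrite /cell /inbox -!mulrA -zE.
  rewrite cz1 [lam * z]mulrC cz2 /= [lam ^+ e * z]mulrC be1 [lam ^+ e.+1 * z]mulrC be2 !andbT /=.
  apply/andP; split.
    have -> : r1 * (lam ^+ (d + e) * z) = r1 * z * lam ^+ e * lam ^+ d by rewrite exprD; ring.
    exact: ad1.
  have -> : r1 * (lam ^+ (d + e).+1 * z) = r1 * z * lam ^+ e * lam ^+ d.+1.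
    by rewrite -addSn exprD; ring.
  exact: ad2.
Qed.

Lemma region_small t q a b c : 0 < t -> region r1 r2 (r1 * t ^+ 3) a b c ->
  c%:R < iota ^+ q * t -> inbox 0 (r2 * iota ^+ q) 0 (lam ^+ n * iota ^+ q) 0 (iota ^+ q) t a b c.
Proof.
move=> t0 hr hc; have [ct bn an] := region_bounds t0 hr.
rewrite /inbox !mul0r !ler0n /= hc andbT; apply/andP; split.
  by apply: (lt_trans an); rewrite -[X in _ < X]mulrA ltr_pM2l ?mulr_gt0 ?exprn_gt0.
by apply: (lt_trans bn); rewrite -[X in _ < X]mulrA ltr_pM2l ?exprn_gt0.
Qed.

(** At the upper corner of the cell the exponent is d + 2e + 3, hence the shift by 2 in the strict
    inequality. The conditions on d, e and d + e leave one grid step of room at each face of the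
    cone. *)
Lemma cell_inner t k d e a b c : 0 < t -> (0 < d)%N -> (0 < e)%N -> (d + e < n)%N ->
  (d + 2 * e + 2 < 3 * k.+1)%N -> cell k d e t a b c -> region r1 r2 (r1 * t ^+ 3) a b c.
Proof.
move=> t0 d0 e0 den hk; rewrite /cell /inbox -!mulrA.
have [z zE] : exists z, z = iota ^+ k.+1 * t by eexists.
rewrite -zE; have z0 : 0 < z by rewrite zE mulr_gt0 ?exprn_gt0.
move=> /and3P[/andP[a1 a2] /andP[b1 b2] /andP[c1 c2]].
have lam_le i j : (i <= j)%N -> lam ^+ i <= lam ^+ j by move=> ij; rewrite ler_eXn2l.
apply/and4P; split.
- apply: le_trans a1; rewrite ler_pM2l //; apply: (le_trans (ltW b2)).
  by rewrite ler_pM2r // lam_le //; move: d0 e0 den hk; clear; lia.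
- rewrite -(ler_nat R); apply: (le_trans (ltW c2)); apply: le_trans b1.
  by rewrite ler_pM2r // -{1}[lam]expr1 lam_le.
- apply: (lt_le_trans a2); rewrite -mulrA ler_pM2l //.
  apply: (le_trans (y := lam ^+ n * z)); first by rewrite ler_pM2r // lam_le //; move: d0 e0 den hk; clear; lia.
  by rewrite ler_pM2l // exprn_gt0.
- rewrite !natrM.
  apply: (lt_le_trans (y := (r1 * (lam ^+ (d + e).+1 * z)) * (lam ^+ e.+1 * z) * (lam * z))).
    by apply: ltr_pM; rewrite ?mulr_ge0 ?ler0n //; apply: ltr_pM; rewrite ?ler0n.
  have -> : (r1 * (lam ^+ (d + e).+1 * z)) * (lam ^+ e.+1 * z) * (lam * z) =
    (r1 * t ^+ 3) * (lam ^+ (d + 2 * e + 3) * iota ^+ (3 * k.+1)).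
    rewrite zE [(3 * _)%N]mulnC exprM.
    have -> : (d + 2 * e + 3 = (d + e).+1 + e.+1 + 1)%N by clear; lia.
    by rewrite !exprD expr1; ring.
  rewrite ger_pMr; last by rewrite mulr_gt0 ?exprn_gt0.
  rewrite exprVn ler_pdivrMr ?exprn_gt0 // mul1r lam_le //; move: d0 e0 den hk; clear; lia.
Qed.

Lemma cell_uniq t k d e k' d' e' a b c : 0 < t -> cell k d e t a b c -> cell k' d' e' t a b c ->
  [/\ k = k', d = d' & e = e'].
Proof.
move=> t0; rewrite /cell /inbox -!mulrA.
move=> /and3P[ha hb hc] /and3P[ha' hb' hc'].
have kk : k = k'.
  have key (i j : nat) : (i < j)%N -> iota ^+ i.+1 * t <= c%:R < lam * (iota ^+ i.+1 * t) ->
      iota ^+ j.+1 * t <= c%:R < lam * (iota ^+ j.+1 * t) -> False.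
    move=> ij /andP[h1 _] /andP[_ h2]; have := le_lt_trans h1 h2.
    rewrite [iota ^+ j.+1]exprS !mulrA li mul1r ltr_pM2r //.
    by rewrite ltNge ler_wiXn2l ?ltW.
  by have [lt|lt|->] := ltngtP k k' => //; [have := key _ _ lt hc hc'|have := key _ _ lt hc' hc].
subst k'; have [z zE] : exists z, z = iota ^+ k.+1 * t by eexists.
rewrite -zE in ha hb ha' hb'; have z0 : 0 < z by rewrite zE mulr_gt0 ?exprn_gt0.
have ee : e = e'.
  by apply: (@grid_uniq z b%:R) => //; rewrite ![z * _]mulrC.
subst e'; split=> //; suff /eqP : (d + e = d' + e)%N by rewrite eqn_add2r => /eqP.
by apply: (@grid_uniq (r1 * z) a%:R); rewrite ?mulr_gt0 // -!mulrA ![z * _]mulrC.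
Qed.

Variable w : nat -> nat -> nat -> R.
Hypothesis w0 : forall a b c, 0 <= w a b c.

Lemma region_upper N t q : 0 < t ->
  wsum w N (region r1 r2 (r1 * t ^+ 3)) <=
  \sum_(x : 'I_q * ('I_n.+1 * 'I_n.+1) | (x.2.1 + x.2.2 <= n)%N && (x.2.1 + 2 * x.2.2 < 3 * x.1.+1)%N)
     wsum w N (cell x.1 x.2.1 x.2.2 t) +
  wsum w N (inbox 0 (r2 * iota ^+ q) 0 (lam ^+ n * iota ^+ q) 0 (iota ^+ q) t).
Proof.
move=> t0; rewrite /wsum exchange_big -big_split /=; apply: ler_sum => p _.
rewrite -mulr_suml -mulrDl ler_wpM2r //.
case: (boolP (region _ _ _ _ _ _)) => hr; last by rewrite addr_ge0 ?ler0n ?sumr_ge0.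
have [hc|hc] := ltP (p.2%:R : R) (iota ^+ q * t).
  by rewrite (region_small t0 hr hc) lerDr sumr_ge0.
have [k [d [e [kq den dek hcell]]]] := cell_cover t0 hr hc.
have dn : (d < n.+1)%N by rewrite ltnS (leq_trans (leq_addr e d)).
have en : (e < n.+1)%N by rewrite ltnS (leq_trans (leq_addl d e)).
rewrite (bigD1 (Ordinal kq, (Ordinal dn, Ordinal en))) /=; last by rewrite den dek.
by rewrite hcell -addrA lerDl addr_ge0 ?sumr_ge0 ?ler0n.
Qed.

(** The cells are disjoint by [cell_uniq], so no point is counted twice. *)
Lemma region_lower N t q : 0 < t ->
  \sum_(x : 'I_q * ('I_n.+1 * 'I_n.+1) | [&& 0 < x.2.1, 0 < x.2.2 & x.2.1 + x.2.2 < n]%N &&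
       (x.2.1 + 2 * x.2.2 + 2 < 3 * x.1.+1)%N)
     wsum w N (cell x.1 x.2.1 x.2.2 t) <= wsum w N (region r1 r2 (r1 * t ^+ 3)).
Proof.
move=> t0; rewrite /wsum exchange_big /=; apply: ler_sum => p _.
rewrite -mulr_suml ler_wpM2r //.
pose C (x : 'I_q * ('I_n.+1 * 'I_n.+1)) := [&& 0 < x.2.1, 0 < x.2.2 & x.2.1 + x.2.2 < n]%N &&
       (x.2.1 + 2 * x.2.2 + 2 < 3 * x.1.+1)%N.
rewrite (eq_bigl C) //.
have [[x hx hcell]|h] := pselect (exists2 x, C x & cell x.1 x.2.1 x.2.2 t p.1.1 p.1.2 p.2).
  have hr : region r1 r2 (r1 * t ^+ 3) p.1.1 p.1.2 p.2.
    by move: hx => /andP[/and3P[h1 h2 h3] h4]; apply: (cell_inner t0 h1 h2 h3 h4 hcell).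
  rewrite hr (bigD1 x) //= hcell big1 ?addr0 // => y /andP[_ yx].
  case: (boolP (cell _ _ _ _ _ _ _)) => // hy; case/negP: yx.
  have [e1 e2 e3] := cell_uniq t0 hy hcell.
  case: x y e1 e2 e3 {hx hcell hy} => [x1 [x2 x3]] [y1 [y2 y3]] /= e1 e2 e3.
  by apply/eqP; congr (_, (_, _)); apply: val_inj.
rewrite big1 ?ler0n // => x hx; case: (boolP (cell _ _ _ _ _ _ _)) => // hc.
by exfalso; apply: h; exists x.
Qed.

End Grid.

End RegionCount.

Section RegionLimit.
Variable R : realType.

Section GridLimits.
Variable L : R.
Hypothesis L0 : 0 < L.
Let h (m : nat) : R := (m.+1)%:R^-1.
(** For L = ln (r2 / r1) the power [lam m ^+ m.+1] is r2 / r1, so m + 1 steps of the grid span the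
    cone exactly. *)
Let lam (m : nat) := expR (L * h m).
Let x (m : nat) := (lam m - 1) / h m.

Let h0 m : 0 < h m. Proof. by rewrite invr_gt0 ltr0n. Qed.

Lemma lam_gt1 m : 1 < lam m.
Proof. by rewrite expR_gt1 mulr_gt0. Qed.

Let cvh : h m @[m --> \oo] --> (0 : R). Proof. exact: cvg_harmonic. Qed.

Let cvlam : lam m @[m --> \oo] --> (1 : R).
Proof.
have cv0 : L * h m @[m --> \oo] --> L * 0 by apply: cvgM => //; exact: cvg_cst.
suff : lam m @[m --> \oo] --> expR (L * 0) by rewrite mulr0 expR0.
exact: (@continuous_cvg _ _ _ _ _ (fun m => L * h m) (@expR R) (L * 0) (@continuous_expR R _) cv0).
Qed.

Let cvx : x m @[m --> \oo] --> L.
Proof.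
apply: (@squeeze_cvgr _ _ _ _ (fun=> L) (fun m => L * lam m)).
- near=> m; rewrite /x /lam; have [y yE] : exists y, y = L * h m by eexists.
  have y0 : 0 < y by rewrite yE mulr_gt0.
  rewrite -yE; have -> : L = y / h m by rewrite yE mulfK ?gt_eqF.
  rewrite mulrAC !ler_pM2r ?invr_gt0 //.
  have e1 := expR_ge1Dx y; have e2 := expR_ge1Dx (- y).
  have e0 := expR_gt0 y.
  have : expR y * (1 - y) <= expR y * expR (- y) by rewrite ler_pM2l.
  rewrite expRxMexpNx_1 => e3; apply/andP; split; lra.
- exact: cvg_cst.
- suff : L * lam m @[m --> \oo] --> L * 1 by rewrite mulr1.
  by apply: cvgM => //; exact: cvg_cst.
Unshelve. all: by end_near. Qed.

Let cvden : (1 + lam m + lam m ^+ 2)^-1 @[m --> \oo] --> (3 : R)^-1.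
Proof.
apply: cvgV; first by rewrite pnatr_eq0.
have -> : (3 : R) = 1 + 1 + 1 * 1 by rewrite mulr1 -[3]/(1 + 1 + 1)%:R !natrD.
apply: cvgD; first by apply: cvgD => //; exact: cvg_cst.
by under eq_fun do rewrite expr2; apply: cvgM.
Qed.

Let cvxx : x m ^+ 2 @[m --> \oo] --> L ^+ 2.
Proof. by rewrite (expr2 L); under eq_fun do rewrite expr2; apply: cvgM. Qed.

Let cvlin (c : R) : 1 + c * h m @[m --> \oo] --> (1 : R).
Proof.
suff : 1 + c * h m @[m --> \oo] --> 1 + c * 0 by rewrite mulr0 addr0.
apply: cvgD; first exact: cvg_cst.
by apply: cvgM => //; exact: cvg_cst.
Qed.

Let lam_nz m : [/\ lam m != 0, lam m - 1 != 0, 1 + lam m + lam m ^+ 2 != 0 & h m != 0].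
Proof.
have l1 := lam_gt1 m; have h1 := h0 m.
by split; apply: lt0r_neq0; rewrite // ?expr2; nra.
Qed.

Let hS m : m.+1%:R = (h m)^-1. Proof. by rewrite invrK. Qed.

(** As lam tends to 1, the factor (lam - 1)^3 / (1 - lam^-3) behaves like (lam - 1)^2 / 3, while the
    number of pairs (d, e) behaves like (L / (lam - 1))^2 / 2. *)
Lemma grid_upper_limit :
  (lam m - 1) ^+ 3 * (lam m)^-1 / (1 - (lam m)^-1 ^+ 3) * ((m.+2 * m.+3)%:R / 2)
    @[m --> \oo] --> L ^+ 2 / 6.
Proof.
have -> : L ^+ 2 / 6 = 1 * 1 * 3^-1 * L ^+ 2 * 1 * 1 / 2 by field.
rewrite (_ : (fun _ => _) = fun m =>
   lam m * lam m * (1 + lam m + lam m ^+ 2)^-1 * x m ^+ 2 * (1 + 1 * h m) * (1 + 2 * h m) / 2).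
  apply: cvgM; last exact: cvg_cst.
  by do 5! (apply: cvgM => //).
apply/funext => m; have [n1 n2 n3 n4] := lam_nz m.
rewrite natrM -(addn2 m.+1) -(addn1 m.+1) !natrD hS /x.
field; rewrite n1 n4 /=; move: n2 n3; set l := lam m => n2 n3.
have -> : l ^+ 3 - 1 = (l - 1) * (1 + l + l ^+ 2) by ring.
by rewrite mulf_neq0 ?n3.
Qed.

Lemma grid_lower_limit :
  (lam m - 1) ^+ 3 * (lam m)^-1 ^+ 5 / (1 - (lam m)^-1 ^+ 3) *
    ((m.+2 * m.+3)%:R / 2 - 3 * m.+2%:R) @[m --> \oo] --> L ^+ 2 / 6.
Proof.
have -> : L ^+ 2 / 6 = 1^-1 * 1^-1 * 3^-1 * L ^+ 2 * 1 * 1 / 2 by rewrite invr1; field.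
rewrite (_ : (fun _ => _) = fun m =>
   (lam m)^-1 * (lam m)^-1 * (1 + lam m + lam m ^+ 2)^-1 * x m ^+ 2 * (1 + 1 * h m) * (1 + (- 4) * h m) / 2).
  apply: cvgM; last exact: cvg_cst.
  by do 5! (apply: cvgM => //); apply: cvgV => //; rewrite oner_neq0.
apply/funext => m; have [n1 n2 n3 n4] := lam_nz m.
rewrite natrM -(addn2 m.+1) -(addn1 m.+1) !natrD hS /x.
field; rewrite n1 n4 /=; move: n2 n3; set l := lam m => n2 n3.
have -> : l ^+ 3 - 1 = (l - 1) * (1 + l + l ^+ 2) by ring.
by rewrite mulf_neq0 ?n3.
Qed.

End GridLimits.

Variables (w : nat -> nat -> nat -> R) (delta : R).
Hypotheses (w0 : forall a b c, 0 <= w a b c) (delta0 : 0 <= delta).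

(** The weight w has density delta in every dilated box. N only makes the sum finite, and the law is
    required for every cutoff that contains the box. *)
Definition box_law (w : nat -> nat -> nat -> R) (delta : R) :=
  forall (u u' v v' s s' : R) (N : R -> nat),
  0 <= u <= u' -> 0 <= v <= v' -> 0 <= s <= s' ->
  (forall t, 0 < t -> [/\ u' * t <= (N t)%:R, v' * t <= (N t)%:R & s' * t <= (N t)%:R]) ->
  wsum w (N t) (inbox u u' v v' s s' t) / t ^+ 3 @[t --> +oo] -->
    delta * ((u' - u) * (v' - v) * (s' - s)).

Hypothesis law : box_law w delta.

Variables (r1 lam : R) (n : nat) (N : R -> nat).
Hypotheses (r10 : 0 < r1) (lam1 : 1 < lam).
Local Notation iota := (lam^-1).
Local Notation r2 := (r1 * lam ^+ n).
Hypothesis HN : forall t, 0 < t ->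
  [/\ r2 * t <= (N t)%:R, lam ^+ n * t <= (N t)%:R & t <= (N t)%:R].

Let lam0 : 0 < lam. Proof. exact: lt_trans lam1. Qed.
Let iota0 : 0 < iota. Proof. by rewrite invr_gt0. Qed.
Let iota1 : iota < 1. Proof. by rewrite invf_lt1. Qed.
Let iota3 : 0 < 1 - iota ^+ 3.
Proof. by rewrite subr_gt0 exprn_ilt1 // ltW. Qed.

Let lam_le i j : (i <= j)%N -> lam ^+ i <= lam ^+ j.
Proof. by move=> ij; rewrite ler_eXn2l. Qed.

Let lamS i k : lam ^+ i.+1 * iota ^+ k.+1 = lam ^+ i * iota ^+ k.
Proof. by rewrite exprSr exprS; rewrite -mulrA [lam * _]mulrA mulfV ?mul1r ?gt_eqF. Qed.

Let iota_le1 k : iota ^+ k <= 1.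
Proof. by rewrite exprn_ile1 ?ltW. Qed.

Lemma cell_limit k d e : (d + e <= n)%N ->
  wsum w (N t) (cell lam r1 k d e t) / t ^+ 3 @[t --> +oo] -->
    delta * r1 * (lam - 1) ^+ 3 * (lam ^+ (d + 2 * e) * iota ^+ (3 * k.+1)).
Proof.
move=> den; have -> : delta * r1 * (lam - 1) ^+ 3 * (lam ^+ (d + 2 * e) * iota ^+ (3 * k.+1)) =
  delta * ((r1 * lam ^+ (d + e).+1 * iota ^+ k.+1 - r1 * lam ^+ (d + e) * iota ^+ k.+1) *
    (lam ^+ e.+1 * iota ^+ k.+1 - lam ^+ e * iota ^+ k.+1) * (lam * iota ^+ k.+1 - iota ^+ k.+1)).
  have -> : (d + 2 * e = d + e + e)%N by clear; lia.
  by rewrite [(3 * _)%N]mulnC exprM !exprSr !exprD; ring.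
have lamp m : 0 <= lam ^+ m by rewrite exprn_ge0 ?ltW.
have iop m : 0 <= iota ^+ m by rewrite exprn_ge0 ?ltW.
have r1p := ltW r10.
apply: law.
- by rewrite !mulr_ge0 //= ler_wpM2r // ler_wpM2l // lam_le.
- by rewrite !mulr_ge0 //= ler_wpM2r // lam_le.
- by rewrite iop /= ler_peMl // ltW.
- move=> t t0; have [N1 N2 N3] := HN t0; have tp := ltW t0; split.
  + apply: le_trans N1; rewrite ler_wpM2r // -mulrA ler_wpM2l // lamS.
    rewrite -[leRHS]mulr1 ler_pM // lam_le //.
  + apply: le_trans N2; rewrite ler_wpM2r // lamS.
    rewrite -[leRHS]mulr1 ler_pM // lam_le //.
    by apply: leq_trans den; rewrite leq_addl.
  + apply: le_trans N3; rewrite ler_piMl // -[lam]expr1 lamS expr0 mul1r //.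
Qed.

(** Each of the (n + 1)(n + 2)/2 pairs (d, e) contributes a geometric series of cell volumes,
    bounded by [geo_upper]; the last term is the volume of the box around the tip, where c is below
    lam^-q t. *)
Lemma region_upper_limit q : exists h l,
  [/\ forall t, 0 < t -> wsum w (N t) (region r1 r2 (r1 * t ^+ 3)) / t ^+ 3 <= h t,
      h t @[t --> +oo] --> l &
      l <= delta * r1 * ((lam - 1) ^+ 3 * iota / (1 - iota ^+ 3) * ((n.+1 * n.+2)%:R / 2)) +
           delta * r2 * lam ^+ n * (iota ^+ 3) ^+ q].
Proof.
pose C (x : 'I_q * ('I_n.+1 * 'I_n.+1)) :=
  (x.2.1 + x.2.2 <= n)%N && (x.2.1 + 2 * x.2.2 < 3 * x.1.+1)%N.
(* The dummy branches make every summand converge, as cvg_fsum requires. *)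
exists (fun t => \sum_(x | C x) wsum w (N t) (if C x then cell lam r1 x.1 x.2.1 x.2.2 t else cell lam r1 x.1 0 0 t) / t ^+ 3 +
  wsum w (N t) (inbox 0 (r2 * iota ^+ q) 0 (lam ^+ n * iota ^+ q) 0 (iota ^+ q) t) / t ^+ 3).
exists (\sum_(x | C x) (if C x then delta * r1 * (lam - 1) ^+ 3 * (lam ^+ (x.2.1 + 2 * x.2.2) * iota ^+ (3 * x.1.+1))
   else delta * r1 * (lam - 1) ^+ 3 * (lam ^+ (0 + 2 * 0) * iota ^+ (3 * x.1.+1))) +
  delta * ((r2 * iota ^+ q - 0) * (lam ^+ n * iota ^+ q - 0) * (iota ^+ q - 0))).
have lamp m : 0 <= lam ^+ m by rewrite exprn_ge0 ?ltW.
have iop m : 0 <= iota ^+ m by rewrite exprn_ge0 ?ltW.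
have r1p := ltW r10.
split.
- move=> t t0; rewrite -mulr_suml -mulrDl ler_pM2r ?invr_gt0 ?exprn_gt0 //.
  apply: (le_trans (region_upper n lam1 r10 w0 (N t) q t0)).
  by rewrite lerD2r; apply: ler_sum => x Cx; rewrite [X in if X then _ else _](_ : _ = true).
- apply: cvgD.
    apply: cvg_fsum => x; case: ifP => Cx; apply: cell_limit => //.
    by move/andP: Cx => [].
  apply: law; rewrite ?lexx ?mulr_ge0 ?iop //.
  move=> t t0; have [N1 N2 N3] := HN t0; have tp := ltW t0.
  split; [apply: le_trans N1|apply: le_trans N2|apply: le_trans N3].
  + by rewrite ler_wpM2r // ler_piMr // mulr_ge0.
  + by rewrite ler_wpM2r // ler_piMr.
  + by rewrite ler_piMl.
- apply: lerD; last first.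
    rewrite !subr0 -exprM [(3 * q)%N]mulnC exprM.
    by rewrite le_eqVlt; apply/orP; left; apply/eqP; ring.
  rewrite (eq_bigr (fun x : 'I_q * ('I_n.+1 * 'I_n.+1) => delta * r1 * (lam - 1) ^+ 3 *
     (lam ^+ (x.2.1 + 2 * x.2.2) * iota ^+ (3 * x.1.+1)))); last by move=> x ->.
  rewrite -mulr_sumr.
  have -> : delta * r1 * ((lam - 1) ^+ 3 * iota / (1 - iota ^+ 3) * ((n.+1 * n.+2)%:R / 2)) =
    delta * r1 * (lam - 1) ^+ 3 * (iota / (1 - iota ^+ 3) * ((n.+1 * n.+2)%:R / 2)) by ring.
  apply: ler_wpM2l; first by rewrite !mulr_ge0 ?exprn_ge0 ?subr_ge0 // ltW.
  have -> : (n.+1 * n.+2)%:R / 2 = \sum_(y : 'I_n.+1 * 'I_n.+1 | (y.1 + y.2 <= n)%N) (1 : R).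
    rewrite -count_pairs natrM [2%:R * _]mulrC mulfK ?pnatr_eq0 // pair_big_dep /=.
    by rewrite natr_sum big_mkcond [RHS]big_mkcond; apply: eq_bigr => y _; case: (_ <= _)%N.
  have -> : \sum_(x : 'I_q * ('I_n.+1 * 'I_n.+1) | C x) lam ^+ (x.2.1 + 2 * x.2.2) * iota ^+ (3 * x.1.+1) =
      \sum_(y : 'I_n.+1 * 'I_n.+1 | (y.1 + y.2 <= n)%N) \sum_(k < q | (y.1 + 2 * y.2 < 3 * k.+1)%N)
        lam ^+ (y.1 + 2 * y.2) * iota ^+ (3 * k.+1).
    rewrite (exchange_big_dep xpredT) //= pair_big_dep /=.
    by apply: eq_bigl => x.
  rewrite mulr_sumr.
  apply: ler_sum => y hy; rewrite mulr1 ler_pdivlMr //.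
  by rewrite mulr_suml; have := geo_upper iota0 iota1 (y.1 + 2 * y.2) q; rewrite invrK.
Qed.

Lemma region_lower_limit Q : exists g l,
  [/\ forall t, 0 < t -> g t <= wsum w (N t) (region r1 r2 (r1 * t ^+ 3)) / t ^+ 3,
      g t @[t --> +oo] --> l &
      delta * r1 * ((lam - 1) ^+ 3 * iota ^+ 5 / (1 - iota ^+ 3) *
         ((n.+1 * n.+2)%:R / 2 - 3 * n.+1%:R) * (1 - (iota ^+ 3) ^+ Q)) <= l].
Proof.
(* d + 2e + 2 is at most 2n + 2, so at least Q terms remain in the difference used by
   [geo_lower]. *)
pose q := (2 * n + 2 + Q)%N.
pose C (x : 'I_q * ('I_n.+1 * 'I_n.+1)) :=
  [&& 0 < x.2.1, 0 < x.2.2 & x.2.1 + x.2.2 < n]%N && (x.2.1 + 2 * x.2.2 + 2 < 3 * x.1.+1)%N.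
exists (fun t => \sum_(x | C x) wsum w (N t) (if C x then cell lam r1 x.1 x.2.1 x.2.2 t else cell lam r1 x.1 0 0 t) / t ^+ 3).
exists (\sum_(x | C x) (if C x then delta * r1 * (lam - 1) ^+ 3 * (lam ^+ (x.2.1 + 2 * x.2.2) * iota ^+ (3 * x.1.+1))
   else delta * r1 * (lam - 1) ^+ 3 * (lam ^+ (0 + 2 * 0) * iota ^+ (3 * x.1.+1)))).
have lamp m : 0 <= lam ^+ m by rewrite exprn_ge0 ?ltW.
have iop m : 0 <= iota ^+ m by rewrite exprn_ge0 ?ltW.
have r1p := ltW r10.
split.
- move=> t t0; rewrite -mulr_suml ler_pM2r ?invr_gt0 ?exprn_gt0 //.
  apply: le_trans (region_lower n lam1 r10 w0 (N t) q t0).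
  by apply: ler_sum => x Cx; rewrite [X in if X then _ else _](_ : _ = true).
- apply: cvg_fsum => x; case: ifP => Cx; apply: cell_limit => //.
  by move/andP: Cx => [/and3P[_ _ /ltnW]].
- rewrite (eq_bigr (fun x : 'I_q * ('I_n.+1 * 'I_n.+1) => delta * r1 * (lam - 1) ^+ 3 *
     (lam ^+ (x.2.1 + 2 * x.2.2) * iota ^+ (3 * x.1.+1)))); last by move=> x ->.
  rewrite -mulr_sumr.
  have -> : delta * r1 * ((lam - 1) ^+ 3 * iota ^+ 5 / (1 - iota ^+ 3) *
       ((n.+1 * n.+2)%:R / 2 - 3 * n.+1%:R) * (1 - (iota ^+ 3) ^+ Q)) =
    delta * r1 * (lam - 1) ^+ 3 * (iota ^+ 5 * ((1 - iota ^+ 3)^-1 *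
       (((n.+1 * n.+2)%:R / 2 - 3 * n.+1%:R) * (1 - (iota ^+ 3) ^+ Q)))) by ring.
  apply: ler_wpM2l; first by rewrite !mulr_ge0 ?exprn_ge0 ?subr_ge0 // ltW.
  pose I (y : 'I_n.+1 * 'I_n.+1) := [&& 0 < y.1, 0 < y.2 & y.1 + y.2 < n]%N.
  apply: (le_trans (y := iota ^+ 5 * ((1 - iota ^+ 3)^-1 *
       ((\sum_(y | I y) (1 : R)) * (1 - (iota ^+ 3) ^+ Q))))).
    apply: ler_wpM2l => //; apply: ler_wpM2l; first by rewrite invr_ge0 ltW.
    apply: ler_wpM2r; first by rewrite subr_ge0 exprn_ile1.
    have -> : \sum_(y | I y) (1 : R) = (\sum_(d < n.+1) \sum_(e < n.+1) [&& 0 < d, 0 < e & d + e < n])%:R.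
      by rewrite pair_big_dep /= natr_sum big_mkcond; apply: eq_bigr => y _; rewrite /I; case: ifP.
    have := count_inner_pairs n; rewrite -(ler_nat R) natrD !natrM.
    by lra.
  have -> : \sum_(x : 'I_q * ('I_n.+1 * 'I_n.+1) | C x) lam ^+ (x.2.1 + 2 * x.2.2) * iota ^+ (3 * x.1.+1) =
      \sum_(y | I y) \sum_(k < q | (y.1 + 2 * y.2 + 2 < 3 * k.+1)%N)
        lam ^+ (y.1 + 2 * y.2) * iota ^+ (3 * k.+1).
    rewrite (exchange_big_dep xpredT) //= pair_big_dep /=.
    by apply: eq_bigl => x.
  rewrite mulr_suml !mulr_sumr; apply: ler_sum => y hy.
  have := geo_lower iota0 iota1 (y.1 + 2 * y.2 + 2) q; rewrite invrK -mulr_suml -ler_pdivrMr //.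
  set S := \sum_(k < q | _) _ => hS.
  have -> : \sum_(k < q | (y.1 + 2 * y.2 + 2 < 3 * k.+1)%N) lam ^+ (y.1 + 2 * y.2) * iota ^+ (3 * k.+1) = iota ^+ 2 * S.
    rewrite /S mulr_sumr; apply: eq_bigr => k _; rewrite [in RHS]exprD.
    have e1 : lam ^+ 2 * iota ^+ 2 = 1 by rewrite -exprMn mulfV ?gt_eqF // expr1n.
    by rewrite -[LHS]mul1r -e1; ring.
  (* Two of the five factors come from the shift by 2 in [cell_inner], three from [geo_lower]. *)
  have -> : iota ^+ 5 = iota ^+ 2 * iota ^+ 3 by rewrite -exprD.
  rewrite -mulrA ler_wpM2l // mul1r; apply: le_trans hS.
  rewrite [leRHS]mulrAC -mulrA ler_wpM2l // ler_wpM2l ?invr_ge0 ?(ltW iota3) //.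
  rewrite -exprM lerD2l lerN2 ler_wiXn2l ?ltW //.
  move: hy => /and3P[_ _]; rewrite /q; move: (nat_of_ord y.1) (nat_of_ord y.2).
  by clear; lia.
Qed.

End RegionLimit.

Lemma region_limit (R : realType) (w : nat -> nat -> nat -> R) (delta r1 r2 : R) (N : R -> nat) :
  (forall a b c, 0 <= w a b c) -> 0 <= delta -> box_law w delta -> 0 < r1 -> r1 < r2 ->
  (forall t, 0 < t -> [/\ r2 * t <= (N t)%:R, r2 / r1 * t <= (N t)%:R & t <= (N t)%:R]) ->
  wsum w (N t) (region r1 r2 (r1 * t ^+ 3)) / t ^+ 3 @[t --> +oo] -->
    delta * r1 * (ln (r2 / r1) ^+ 2 / 6).
Proof.
move=> w0 d0 law r10 r12 HN; set L := ln (r2 / r1).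
have rr : 1 < r2 / r1 by rewrite ltr_pdivlMr // mul1r.
have L0 : 0 < L by rewrite ln_gt0.
have cs : (fun=> delta * r1) @ \oo --> delta * r1 by apply: cvg_cst.
have Foo : Filter (\oo : set_system nat) by exact: _.
have cU := @cvgM _ _ _ Foo _ _ _ _ cs (grid_upper_limit L0).
have cV := @cvgM _ _ _ Foo _ _ _ _ cs (grid_lower_limit L0).
apply: cvg_sandwich => e e0.
have e2 : 0 < e / 2 by rewrite divr_gt0.
have bU : delta * r1 * (L ^+ 2 / 6) < delta * r1 * (L ^+ 2 / 6) + e / 2 by rewrite ltrDl.
have bV : delta * r1 * (L ^+ 2 / 6) - e / 2 < delta * r1 * (L ^+ 2 / 6) by rewrite ltrBlDr ltrDl.
have nU := @cvgr_lt _ _ _ Foo _ _ cU _ bU; have nV := @cvgr_gt _ _ _ Foo _ _ cV _ bV.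
(* The grid is refined first, at a cost of e / 2. For this fixed grid q and Q are then chosen so
   that the tip and the truncated geometric tail cost at most e / 2. *)
have [m [hU hV]] : exists m : nat,
   delta * r1 * ((expR (L / m.+1%:R) - 1) ^+ 3 * (expR (L / m.+1%:R))^-1 / (1 - (expR (L / m.+1%:R))^-1 ^+ 3) * ((m.+2 * m.+3)%:R / 2)) < delta * r1 * (L ^+ 2 / 6) + e / 2 /\
   delta * r1 * (L ^+ 2 / 6) - e / 2 < delta * r1 * ((expR (L / m.+1%:R) - 1) ^+ 3 * (expR (L / m.+1%:R))^-1 ^+ 5 / (1 - (expR (L / m.+1%:R))^-1 ^+ 3) *
    ((m.+2 * m.+3)%:R / 2 - 3 * m.+2%:R)).
  have [M _ hM] := nU; have [M' _ hM'] := nV.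
  exists (maxn M M'); split; [apply: hM|apply: hM'] => /=; [exact: leq_maxl|exact: leq_maxr].
have lam1 := lam_gt1 L0 m; move: hU hV lam1; rewrite -/(_ / _).
have [lam lamE] : exists lam, lam = expR (L / m.+1%:R) by eexists.
rewrite -lamE => hU hV lam1.
have lamn : r1 * lam ^+ m.+1 = r2.
  rewrite lamE -expRM_natr divfK ?pnatr_eq0 // lnK ?posrE ?(lt_trans _ rr) //.
  by rewrite mulrC divfK ?gt_eqF.
have lamn' : lam ^+ m.+1 = r2 / r1 by rewrite -lamn mulrAC mulfV ?mul1r ?gt_eqF.
have lam0 : 0 < lam by apply: lt_trans lam1.
have x0 : 0 <= lam^-1 ^+ 3 by rewrite exprn_ge0 // invr_ge0 ltW.
have x1 : lam^-1 ^+ 3 < 1 by rewrite exprn_ilt1 // ?invr_ge0 ?(ltW lam0) // invf_lt1.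
have small (C : R) : exists q, C * (lam^-1 ^+ 3) ^+ q <= e / 2.
  have cq : C * (lam^-1 ^+ 3) ^+ q @[q --> \oo] --> C * 0.
    by apply: cvgM; [exact: cvg_cst|apply: cvg_expr; rewrite ger0_norm].
  rewrite mulr0 in cq; have [M _ hM] := @cvgr_lt _ _ _ Foo _ _ cq _ e2.
  by exists M; apply: ltW; apply: hM => /=.
have HN' t : 0 < t -> [/\ r1 * lam ^+ m.+1 * t <= (N t)%:R, lam ^+ m.+1 * t <= (N t)%:R & t <= (N t)%:R].
  by rewrite lamn lamn'; exact: HN.
have [q hq] := small (delta * (r1 * lam ^+ m.+1) * lam ^+ m.+1).
have [Q hQ] := small (delta * r1 * ((lam - 1) ^+ 3 * lam^-1 ^+ 5 / (1 - lam^-1 ^+ 3) *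
    ((m.+2 * m.+3)%:R / 2 - 3 * m.+2%:R))).
have [h [l2 [h1 h2 h3]]] := region_upper_limit w0 d0 law r10 lam1 HN' q.
have [g [l1 [g1 g2 g3]]] := region_lower_limit w0 d0 law r10 lam1 HN' Q.
exists g, h, l1, l2; split=> //.
- near=> t; have t0 : 0 < t by near: t; exact: nbhs_pinfty_gt.
  by have := g1 t t0; have := h1 t t0; rewrite lamn => -> ->.
- apply: le_trans g3; rewrite [leRHS]mulrA [leRHS]mulrBr [_ * 1]mulr1; by lra.
- by apply: (le_trans h3); lra.
Unshelve. all: by end_near. Qed.

(** * The sieve *)

Section Sieve.
Variable R : realType.

Lemma sum3 (I J K : finType) (f : I -> R) (g : J -> R) (h : K -> R) :
  (\sum_i f i) * (\sum_j g j) * (\sum_k h k) = \sum_(p : I * J * K) f p.1.1 * g p.1.2 * h p.2.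
Proof. by rewrite big_distrlr /= pair_big /= big_distrlr /= pair_big. Qed.

Lemma res_count (M alpha n : nat) : (alpha < M)%N ->
  (\sum_(a < n) (a %% M == alpha)%N)%N = ((n + (M - alpha.+1)) %/ M)%N.
Proof.
move=> aM; elim: n => [|n IH].
  by rewrite big_ord0 divn_small //; lia.
rewrite big_ord_recr /= IH addSn divnS; last by apply: leq_trans aM.
rewrite addnC; congr (nat_of_bool _ + _)%N.
have -> : (n + (M - alpha.+1)).+1 = (n + (M - alpha))%N by lia.
apply/eqP/idP => [<-|].
  have -> : (n + (M - n %% M) = (n %/ M).+1 * M)%N.
    by rewrite {1}(divn_eq n M) mulSn; have := ltn_pmod n (leq_trans (ltn0Sn _) aM); lia.
  exact: dvdn_mull.
move=> h; rewrite -(modn_small aM); apply/eqP.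
have -> : (n == alpha %[mod M])%N = (n + (M - alpha) == alpha + (M - alpha) %[mod M])%N by rewrite eqn_modDr.
by rewrite subnKC ?(ltnW aM) // modnn.
Qed.

Lemma res_count_bounds (M alpha n : nat) : (alpha < M)%N ->
  n%:R / M%:R - 1 <= ((\sum_(a < n) (a %% M == alpha)%N)%N)%:R :> R /\
  ((\sum_(a < n) (a %% M == alpha)%N)%N)%:R <= n%:R / M%:R + 1 :> R.
Proof.
move=> aM; rewrite res_count //; set q := (_ %/ M)%N.
have M0 : 0 < M%:R :> R by rewrite ltr0n; apply: leq_trans aM.
have e := divn_eq (n + (M - alpha.+1)) M; have l := ltn_pmod (n + (M - alpha.+1)) (leq_trans (ltn0Sn _) aM).
have h1 : (n <= q * M + M)%N by rewrite /q; lia.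
have h2 : (q * M <= n + M)%N by rewrite /q; lia.
split.
  rewrite lerBlDr ler_pdivrMr // mulrDl mul1r -natrM -natrD ler_nat //.
rewrite -(ler_pM2r M0) mulrDl mul1r divfK ?gt_eqF // -natrM -natrD ler_nat //.
Qed.

Lemma ceil_nat (x : R) : 0 <= x -> exists p : nat,
  [/\ forall a : nat, (a%:R < x) = (a < p)%N, x <= p%:R & p%:R < x + 1].
Proof.
move=> x0; have ex : exists p : nat, x <= p%:R.
  by exists (Num.truncn x).+1; rewrite ltW // truncnS_gt.
case: (ex_minnP ex) => p xp pmin; exists p; split=> //.
  move=> a; apply/idP/idP => [ax|ap].
    by rewrite -(ltr_nat R); apply: lt_le_trans xp.
  by rewrite ltNge; apply/negP => /pmin; rewrite leqNgt ap.
case: p xp pmin => [|p] xp pmin; first by rewrite ltr_wpDl.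
by rewrite -natr1 ltrD2r ltNge; apply/negP => /pmin; rewrite ltnn.
Qed.

Lemma progression_limit (M alpha : nat) (u u' : R) (N : R -> nat) : (alpha < M)%N ->
  0 <= u <= u' -> (forall t, 0 < t -> u' * t <= (N t)%:R) ->
  (\sum_(a < N t) (u * t <= a%:R < u' * t)%R%:R * (a %% M == alpha)%N%:R) / t @[t --> +oo]
     --> (u' - u) / M%:R.
Proof.
move=> aM /andP[u0 uu'] HN.
have M0 : 0 < M%:R :> R by rewrite ltr0n; apply: leq_trans aM.
set f := fun _ => _.
(* Each endpoint costs at most 1 for rounding and 1 for an incomplete period. *)
have bound t : 0 < t -> `|f t * t - (u' - u) / M%:R * t| <= 4.
  move=> t0; rewrite /f divfK ?gt_eqF //.
  have [p [hp p1 p2]] := ceil_nat (mulr_ge0 u0 (ltW t0)).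
  have [q [hq q1 q2]] := ceil_nat (mulr_ge0 (le_trans u0 uu') (ltW t0)).
  have pq : (p <= q)%N.
    rewrite leqNgt; apply/negP; rewrite -hp => h.
    by have : u * t <= u' * t; [rewrite ler_pM2r|lra].
  have qN : (q <= N t)%N.
    by rewrite leqNgt -hq -leNgt; exact: HN.
  have -> : \sum_(a < N t) (u * t <= a%:R < u' * t)%R%:R * (a %% M == alpha)%N%:R =
     ((\sum_(a < q) (a %% M == alpha)%N)%N)%:R - ((\sum_(a < p) (a %% M == alpha)%N)%N)%:R :> R.
    rewrite (big_ord_widen _ (fun a => nat_of_bool (a %% M == alpha)%N) qN).
    rewrite (big_ord_widen _ (fun a => nat_of_bool (a %% M == alpha)%N) (leq_trans pq qN)).
    rewrite !natr_sum [X in X - _]big_mkcond [X in _ - X]big_mkcond -sumrB /=; apply: eq_bigr => a _.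
    rewrite leNgt hp hq; move: (a %% M == alpha)%N => b.
    case: (ltnP a p) => hap; case: (ltnP a q) => haq /=; rewrite ?mul0r ?mul1r ?subrr ?subr0 //.
    by exfalso; move: hap haq pq; clear; lia.
  have [a1 a2] := res_count_bounds p aM; have [b1 b2] := res_count_bounds q aM.
  move: a1 a2 b1 b2; set x := (_)%:R; set y := (_)%:R => a1 a2 b1 b2.
  have M1 : M%:R^-1 <= 1 :> R by rewrite invf_le1 // ler1n; apply: leq_trans aM.
  have Mi : 0 < M%:R^-1 :> R by rewrite invr_gt0.
  have P1 : u * t / M%:R <= p%:R / M%:R by rewrite ler_pM2r.
  have P2 : p%:R / M%:R <= u * t / M%:R + 1.
    by apply: (le_trans (y := (u * t + 1) / M%:R)); [rewrite ler_pM2r // ltW|rewrite mulrDl mul1r lerD2l].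
  have Q1 : u' * t / M%:R <= q%:R / M%:R by rewrite ler_pM2r.
  have Q2 : q%:R / M%:R <= u' * t / M%:R + 1.
    by apply: (le_trans (y := (u' * t + 1) / M%:R)); [rewrite ler_pM2r // ltW|rewrite mulrDl mul1r lerD2l].
  have -> : (u' - u) / M%:R * t = u' * t / M%:R - u * t / M%:R by ring.
  by rewrite ler_norml; apply/andP; split; lra.
apply/cvgrPdist_le => /= e e0; near=> t.
have t0 : 0 < t by near: t; exact: nbhs_pinfty_gt.
have t4 : 4 / e <= t by near: t; apply: nbhs_pinfty_ge; rewrite num_real.
rewrite -(ler_pM2r t0) -[X in _ * X](gtr0_norm t0) -normrM mulrBl distrC.
by apply: le_trans (bound t t0) _; rewrite mulrC -ler_pdivrMr.
Unshelve. all: by end_near. Qed.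

Definition periodic M (G : nat -> nat -> nat -> bool) :=
  forall a b c, G a b c = G (a %% M)%N (b %% M)%N (c %% M)%N.

Definition dens M (G : nat -> nat -> nat -> bool) : R :=
  (\sum_(p : 'I_M * 'I_M * 'I_M) (G p.1.1 p.1.2 p.2)%:R) / M%:R ^+ 3.

(** The weight is split into residue classes modulo M; on each class the count is a product of three
    counts in arithmetic progressions. *)
Lemma periodic_box_law M G : (0 < M)%N -> periodic M G ->
  box_law (fun a b c => (G a b c)%:R : R) (dens M G).
Proof.
move=> M0 per u u' v v' s s' N hu hv hs HN.
have M0' : M%:R != 0 :> R by rewrite pnatr_eq0 -lt0n.
pose cnt (x x' : R) (al : nat) t : R :=
  \sum_(a < N t) (x * t <= a%:R < x' * t)%R%:R * (a %% M == al)%N%:R.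
have wE t : wsum (fun a b c => (G a b c)%:R) (N t) (inbox u u' v v' s s' t) =
  \sum_(p : 'I_M * 'I_M * 'I_M) (G p.1.1 p.1.2 p.2)%:R *
    (cnt u u' p.1.1 t * cnt v v' p.1.2 t * cnt s s' p.2 t).
  under [RHS]eq_bigr do rewrite sum3 mulr_sumr.
  rewrite exchange_big /=; apply: eq_bigr => -[[a b] c] _ /=.
  pose r (x : nat) : 'I_M := Ordinal (ltn_pmod x M0).
  rewrite (bigD1 (r a, r b, r c)) //= [X in _ + X]big1 ?addr0.
    rewrite !eqxx !mulr1 -per mulrC; congr (_ * _).
    by rewrite /inbox; do 3! case: (_ <= _ < _); rewrite /= ?mulr0 ?mul0r ?mulr1.
  move=> [[x y] z] /=; rewrite !xpair_eqE -!val_eqE /= !(eq_sym (_ %% M)%N).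
  by case: eqP; case: eqP; case: eqP => //= *; rewrite ?(mulr0, mul0r).
pose l (p : 'I_M * 'I_M * 'I_M) : R := (G p.1.1 p.1.2 p.2)%:R *
  ((u' - u) / M%:R * ((v' - v) / M%:R) * ((s' - s) / M%:R)).
have -> : dens M G * ((u' - u) * (v' - v) * (s' - s)) = \sum_p l p.
  by rewrite /l -mulr_suml /dens; field.
rewrite (_ : (fun _ => _) = fun t => \sum_(p : 'I_M * 'I_M * 'I_M) (G p.1.1 p.1.2 p.2)%:R *
    ((cnt u u' p.1.1 t / t) * (cnt v v' p.1.2 t / t) * (cnt s s' p.2 t / t))); last first.
  apply/funext => t; rewrite wE mulr_suml; apply: eq_bigr => p _.
  by rewrite !exprS expr0 mulr1 !invfM; ring.
apply: cvg_fsum => p; apply: cvgM; first exact: cvg_cst.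
apply: cvgM; [apply: cvgM|]; apply: progression_limit => //; move=> t t0; by case: (HN t t0).
Qed.

Lemma crt_sum (M M' : nat) (F : nat -> nat -> R) : (0 < M)%N -> (0 < M')%N -> coprime M M' ->
  \sum_(x < M * M') F (x %% M)%N (x %% M')%N = \sum_(i < M) \sum_(j < M') F i j.
Proof.
move=> M0 M'0 co; rewrite pair_big /=.
pose h (x : 'I_(M * M')) := (Ordinal (ltn_pmod x M0), Ordinal (ltn_pmod x M'0)).
have hinj : injective h.
  move=> x y [e1 e2]; apply: val_inj => /=.
  rewrite -(modn_small (ltn_ord x)) -(modn_small (ltn_ord y)).
  by apply/eqP; rewrite chinese_remainder // e1 e2 !eqxx.
have hbij : bijective h by apply: inj_card_bij => //; rewrite card_prod !card_ord.
by rewrite (reindex h) //=; apply: onW_bij.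
Qed.

Lemma dens_mul M M' G G' : (0 < M)%N -> (0 < M')%N -> coprime M M' ->
  periodic M G -> periodic M' G' ->
  dens (M * M') (fun a b c => G a b c && G' a b c) = dens M G * dens M' G'.
Proof.
move=> M0 M'0 co per per'; rewrite /dens natrM exprMn invfM.
have sum3E (m : nat) (F : nat -> nat -> nat -> R) :
    \sum_(p : 'I_m * 'I_m * 'I_m) F p.1.1 p.1.2 p.2 = \sum_(a < m) \sum_(b < m) \sum_(c < m) F a b c.
  by rewrite pair_big /= pair_big.
rewrite (sum3E _ (fun a b c => (G a b c && G' a b c)%:R)) (sum3E _ (fun a b c => (G a b c)%:R)).
rewrite (sum3E _ (fun a b c => (G' a b c)%:R)).
suff -> : \sum_(a < M * M') \sum_(b < M * M') \sum_(c < M * M') (G a b c && G' a b c)%:R =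
  (\sum_(a < M) \sum_(b < M) \sum_(c < M) (G a b c)%:R) *
  (\sum_(a < M') \sum_(b < M') \sum_(c < M') (G' a b c)%:R) :> R by ring.
pose F3 (i j k : nat) (i' j' k' : nat) : R := (G i j k)%:R * (G' i' j' k')%:R.
transitivity (\sum_(a < M * M') \sum_(b < M * M') \sum_(c < M * M')
    F3 (a %% M)%N (b %% M)%N (c %% M)%N (a %% M')%N (b %% M')%N (c %% M')%N).
  apply: eq_bigr => a _; apply: eq_bigr => b _; apply: eq_bigr => c _.
  by rewrite /F3 -per -per'; case: (G _ _ _); rewrite /= ?mul1r ?mul0r.
(* The Chinese remainder theorem is applied to one coordinate at a time, starting from the innermost
   sum. *)
transitivity (\sum_(a < M * M') \sum_(b < M * M') \sum_(k < M) \sum_(k' < M')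
    F3 (a %% M)%N (b %% M)%N k (a %% M')%N (b %% M')%N k').
  apply: eq_bigr => a _; apply: eq_bigr => b _.
  exact: (crt_sum (fun k k' => F3 (a %% M)%N (b %% M)%N k (a %% M')%N (b %% M')%N k')).
transitivity (\sum_(a < M * M') \sum_(j < M) \sum_(j' < M') \sum_(k < M) \sum_(k' < M')
    F3 (a %% M)%N j k (a %% M')%N j' k').
  apply: eq_bigr => a _.
  exact: (crt_sum (fun j j' => \sum_(k < M) \sum_(k' < M') F3 (a %% M)%N j k (a %% M')%N j' k')).
rewrite (crt_sum (fun i i' => \sum_(j < M) \sum_(j' < M') \sum_(k < M) \sum_(k' < M') F3 i j k i' j' k')) //.
rewrite big_distrlr /=; apply: eq_bigr => i _; apply: eq_bigr => i' _.
rewrite big_distrlr /=; apply: eq_bigr => j _; apply: eq_bigr => j' _.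
by rewrite big_distrlr /=.
Qed.

End Sieve.

(** * The sieve by odd primes *)

Section OddSieve.
Variable R : realType.

Definition bad (p a b c : nat) : bool :=
  [|| p ^ 2 %| a, p ^ 2 %| b, p ^ 2 %| c, (p %| a) && (p %| b), (p %| a) && (p %| c)
    | (p %| b) && (p %| c)]%N.

Definition oddgood (a b c : nat) : bool :=
  `[< forall p, prime p -> odd p -> ~~ bad p a b c >].

Definition loc (p : nat) : R := 1 - 6 * p%:R ^- 2 + 8 * p%:R ^- 3 - 3 * p%:R ^- 4.

Lemma periodic_mul M M' G : periodic M G -> periodic (M * M') G.
Proof. by move=> h a b c; rewrite h [RHS]h !modn_dvdm ?dvdn_mulr. Qed.

Lemma bad_periodic p : periodic (p ^ 2) (fun a b c => ~~ bad p a b c).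
Proof.
move=> a b c; have h1 x : (p ^ 2 %| x %% p ^ 2)%N = (p ^ 2 %| x)%N by rewrite /dvdn modn_mod.
have h2 x : (p %| x %% p ^ 2)%N = (p %| x)%N by rewrite /dvdn modn_dvdm // dvdn_exp.
by rewrite /bad !h1 !h2.
Qed.

(** In a good triple at most one entry is divisible by p, and then exactly once. With n for prime to
    p and o for exactly one factor p this gives ((p^2 - p)^3 + 3 (p - 1)(p^2 - p)^2) / p^6. *)
Lemma local_density p : prime p -> dens R (p ^ 2) (fun a b c => ~~ bad p a b c) = loc p.
Proof.
move=> pp; have p0 : p%:R != 0 :> R by rewrite pnatr_eq0 -lt0n prime_gt0.
pose n (x : nat) : R := (~~ (p %| x)%N)%:R.
pose o (x : nat) : R := ((p %| x) && ~~ (p ^ 2 %| x))%N%:R.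
have dp x : (p ^ 2 %| x)%N -> (p %| x)%N by apply: dvdn_trans; rewrite dvdn_exp.
have s1 : \sum_(x < p ^ 2) ((p %| x)%N)%:R = p%:R :> R.
  rewrite -natr_sum; congr (_%:R); transitivity (\sum_(x < p ^ 2) (x %% p == 0)%N)%N => //.
  rewrite res_count ?prime_gt0 // expnS expn1 divnMDl ?prime_gt0 // divn_small ?addn0 //.
  by rewrite subn1 prednK ?prime_gt0.
have s2 : \sum_(x < p ^ 2) ((p ^ 2 %| x)%N)%:R = 1 :> R.
  rewrite -natr_sum; transitivity ((\sum_(x < p ^ 2) (x %% p ^ 2 == 0)%N)%N%:R : R) => //.
  have pp0 : (0 < p ^ 2)%N by rewrite expn_gt0 prime_gt0.
  rewrite res_count // -{1}[(p ^ 2)%N]mul1n divnMDl // divn_small ?addn0 //.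
  by rewrite subn1 prednK.
have so : \sum_(x < p ^ 2) o x = p%:R - 1.
  rewrite -[X in _ - X]s2 -s1 -sumrB; apply: eq_bigr => x _; rewrite /o.
  by case h: (p ^ 2 %| x)%N; [rewrite (dp _ h) andbF subrr|rewrite andbT subr0].
have sn : \sum_(x < p ^ 2) n x = p%:R ^+ 2 - p%:R.
  rewrite -[X in _ - X]s1 -natrX -[X in X%:R - _](card_ord (p ^ 2)) -sum1_card natr_sum -sumrB.
  by apply: eq_bigr => x _; rewrite /n; case: (p %| x)%N; rewrite /= ?subrr ?subr0.
rewrite /dens (eq_bigr (fun q : 'I_(p ^ 2) * 'I_(p ^ 2) * 'I_(p ^ 2) =>
  n q.1.1 * n q.1.2 * n q.2 + o q.1.1 * n q.1.2 * n q.2 +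
  n q.1.1 * o q.1.2 * n q.2 + n q.1.1 * n q.1.2 * o q.2)); last first.
  move=> [[a b] c] _ /=; rewrite /bad /n /o.
  have ha : (p ^ 2 %| a)%N ==> (p %| a)%N by apply/implyP; exact: dp.
  have hb : (p ^ 2 %| b)%N ==> (p %| b)%N by apply/implyP; exact: dp.
  have hc : (p ^ 2 %| c)%N ==> (p %| c)%N by apply/implyP; exact: dp.
  move: ha hb hc; case: (p ^ 2 %| a)%N; case: (p ^ 2 %| b)%N; case: (p ^ 2 %| c)%N;
  case: (p %| a)%N; case: (p %| b)%N; case: (p %| c)%N => //= _ _ _;
   by rewrite ?(mulr0, mul0r, mulr1, addr0, add0r).
rewrite !big_split /= -(sum3 (fun x : 'I_(p ^ 2) => n x) (fun x : 'I_(p ^ 2) => n x) (fun x : 'I_(p ^ 2) => n x)).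
rewrite -(sum3 (fun x : 'I_(p ^ 2) => o x) (fun x : 'I_(p ^ 2) => n x) (fun x : 'I_(p ^ 2) => n x)).
rewrite -(sum3 (fun x : 'I_(p ^ 2) => n x) (fun x : 'I_(p ^ 2) => o x) (fun x : 'I_(p ^ 2) => n x)).
rewrite -(sum3 (fun x : 'I_(p ^ 2) => n x) (fun x : 'I_(p ^ 2) => n x) (fun x : 'I_(p ^ 2) => o x)).
by rewrite so sn /loc natrX; field.
Qed.

Lemma loc_bounds p : prime p -> 0 <= loc p <= 1.
Proof.
move=> pp; have p0 : 0 < p%:R :> R by rewrite ltr0n prime_gt0.
rewrite /loc -!exprVn; set x : R := p%:R^-1.
have x0 : 0 <= x by rewrite invr_ge0 ltW.
have x1 : x <= 1 by rewrite invf_le1 // ler1n prime_gt0.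
have -> : 1 - 6 * x ^+ 2 + 8 * x ^+ 3 - 3 * x ^+ 4 = (1 - x) ^+ 3 * (1 + 3 * x) by ring.
have e : 1 - (1 - x) ^+ 3 * (1 + 3 * x) = x ^+ 2 * (2 * (1 - x) ^+ 2 + (2 - x) ^+ 2) by ring.
apply/andP; split; first by rewrite mulr_ge0 ?exprn_ge0 ?subr_ge0 //; lra.
rewrite -subr_ge0 e; apply: mulr_ge0; first exact: sqr_ge0.
apply: addr_ge0; last exact: sqr_ge0.
by apply: mulr_ge0; rewrite ?sqr_ge0.
Qed.

Definition Pz (z : nat) : R := \prod_(p < z | prime p && odd p) loc p.

Lemma PzS z : Pz z.+1 = Pz z * (if prime z && odd z then loc z else 1).
Proof. by rewrite /Pz big_mkcond big_ord_recr /= -big_mkcond. Qed.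

Lemma Pz_ge0 z : 0 <= Pz z.
Proof.
rewrite /Pz; elim/big_ind: _ => // [x y|p /andP[pp _]]; first exact: mulr_ge0.
by have /andP[] := loc_bounds pp.
Qed.

Lemma Pz_noninc : nonincreasing_seq Pz.
Proof.
apply/nonincreasing_seqP => z; rewrite PzS ler_piMr ?Pz_ge0 //.
by case: ifP => // /andP[/loc_bounds /andP[]].
Qed.

Lemma Pz_cvg : Pz z @[z --> \oo] --> P_const R.
Proof.
apply: nonincreasing_is_cvgn; first exact: Pz_noninc.
by exists 0 => _ [z _ <-]; exact: Pz_ge0.
Qed.

Lemma P_const_le z : P_const R <= Pz z.
Proof. by apply: nonincreasing_cvgn_ge; [exact: Pz_noninc|exact: (cvgP _ Pz_cvg)]. Qed.

Lemma P_const_ge0 : 0 <= P_const R.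
Proof. by apply: limr_ge; [exact: (cvgP _ Pz_cvg)|near=> z; exact: Pz_ge0].
Unshelve. all: by end_near. Qed.

Section Par.
Variable par : nat -> nat -> nat -> bool.
Hypothesis par4 : periodic 4 par.

Definition sift z a b c : bool :=
  par a b c && all (fun p => ~~ bad p a b c) [seq p <- iota 0 z | prime p && odd p].

Lemma siftS z a b c : sift z.+1 a b c =
  sift z a b c && (if prime z && odd z then ~~ bad z a b c else true).
Proof.
rewrite /sift -addn1 iotaD filter_cat all_cat /= add0n; case: ifP => _ /=; rewrite ?andbT //.
by rewrite andbA.
Qed.

(** The period is kept coprime to the odd primes not yet sieved; this is what lets [dens_mul] split
    off the next one. *)
Lemma sift_density z : exists M, [/\ (0 < M)%N, forall p, prime p -> odd p -> (z <= p)%N -> coprime M p,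
  periodic M (sift z) & dens R M (sift z) = dens R 4 par * Pz z].
Proof.
elim: z => [|z [M [M0 co per IH]]].
  exists 4%N; split=> //.
  - by move=> p pp po _; rewrite (_ : 4 = 2 ^ 2)%N // coprimeXl // coprime2n.
  - by move=> a b c; rewrite /sift /= !andbT -par4.
  - by rewrite /Pz big_ord0 mulr1 /dens; congr (_ / _); apply: eq_bigr => p _; rewrite /sift /= andbT.
have E : sift z.+1 = fun a b c => sift z a b c && (if prime z && odd z then ~~ bad z a b c else true).
  by apply/funext => a; apply/funext => b; apply/funext => c; rewrite siftS.
rewrite E PzS; case: ifP => [/andP[pz oz]|_]; last first.
  exists M; split=> //; first by move=> p pp po /ltnW; exact: co.
    by move=> a b c; rewrite !andbT.
  rewrite mulr1 -IH; congr (dens _ _ _).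
  by apply/funext => a; apply/funext => b; apply/funext => c; rewrite andbT.
have cz : coprime M (z ^ 2) by rewrite coprimeXr // co.
have z0 : (0 < z ^ 2)%N by rewrite expn_gt0 prime_gt0.
exists (M * z ^ 2)%N; split.
- by rewrite muln_gt0 M0.
- move=> p pp po zp; rewrite coprimeMl (co p pp po (ltnW zp)) /= coprimeXl //.
  by rewrite prime_coprime // dvdn_prime2 // neq_ltn zp.
- move=> a b c; rewrite (periodic_mul (z ^ 2) per a b c).
  by rewrite [in LHS](periodic_mul M (@bad_periodic z) a b c) [(z ^ 2 * M)%N]mulnC.
- by rewrite dens_mul ?IH ?local_density ?mulrA //; exact: bad_periodic.
Qed.

End Par.

Lemma shrink_sum (N q : nat) (f : nat -> R) : (forall x, 0 <= f x) ->
  \sum_(x < N) (x < q)%N%:R * f x <= \sum_(x < q) f x.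
Proof.
move=> f0; have [Nq|qN] := leqP N q.
  rewrite (big_ord_widen _ (fun x => (x < q)%N%:R * f x) Nq) big_mkcond; apply: ler_sum => x _.
  by rewrite ltn_ord mul1r; case: ifP.
rewrite (big_ord_widen _ f (ltnW qN)) [leRHS]big_mkcond; apply: ler_sum => x _.
by case: ifP; rewrite ?mul1r ?mul0r.
Qed.

Lemma count_lt (N q : nat) : \sum_(x < N) (x < q)%N%:R <= q%:R :> R.
Proof.
have := @shrink_sum N q (fun=> 1) (fun=> ler01).
by under eq_bigr do rewrite mulr1; rewrite sumr_const card_ord.
Qed.

Lemma count_zero (N q : nat) : \sum_(x < N) (x < q)%N%:R * (x == 0 :> nat)%:R <= 1 :> R.
Proof.
case: N => [|N]; first by rewrite big_ord0.
rewrite big_ord_recl big1 ?addr0; last by move=> i _; rewrite mulr0.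
by rewrite mulr1 lern1 leq_b1.
Qed.

Lemma count_multiples (N q m : nat) : (0 < m)%N ->
  \sum_(x < N) (x < q)%N%:R * ((0 < x) && (m %| x))%N%:R <= q%:R / m%:R :> R.
Proof.
move=> m0; apply: (le_trans (@shrink_sum _ _ (fun x => ((0 < x) && (m %| x))%N%:R) _)) => //.
case: q => [|q]; first by rewrite big_ord0 mul0r.
have m0' : 0 < m%:R :> R by rewrite ltr0n.
rewrite ler_pdivlMr // -natr_sum -natrM ler_nat.
have := @res_count m 0 q.+1 m0; rewrite big_ord_recl mod0n eqxx /=.
rewrite big_ord_recl /= add0n => h.
have e : (\sum_(i < q) ((0 < lift ord0 i) && (m %| lift ord0 i)) = \sum_(i < q) (lift ord0 i %% m == 0))%N.
  by apply: eq_bigr => i _.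
rewrite e; move: h; have -> : (q.+1 + (m - 1) = q + m)%N by move: m0; clear; lia.
rewrite divnDr // divnn m0 addn1 add1n => -[->].
by apply: leq_trans (leqnSn q); exact: leq_divM.
Qed.

(** Telescoping, from 1/(m + 1)^2 <= 1/m - 1/(m + 1). *)
Lemma square_tail y k : (0 < y)%N ->
  \sum_(i < k) ((y.+1 + i)%:R ^+ 2)^-1 <= y%:R^-1 - (y + k)%:R^-1 :> R.
Proof.
move=> y0; elim: k => [|k IH]; first by rewrite big_ord0 addn0 subrr.
rewrite big_ord_recr /=; apply: (le_trans (lerD IH (lexx _))).
have m0 : 0 < (y + k)%:R :> R by rewrite ltr0n addn_gt0 y0.
rewrite addSn addnS -natr1; move: m0; move: ((y + k)%:R : R) => m m0.
have m1 : 0 < m + 1 by lra.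
suff : ((m + 1) ^+ 2)^-1 <= m^-1 - (m + 1)^-1 by move=> h; lra.
have -> : m^-1 - (m + 1)^-1 = (m * (m + 1))^-1 by field; rewrite !gt_eqF.
rewrite lef_pV2 ?posrE ?exprn_gt0 ?mulr_gt0 // expr2 ler_pM2r //; lra.
Qed.

(** Triples with a zero entry are counted apart, since 0 is divisible by everything; they give 3
    q^2. Otherwise d divides a positive entry below q, so only d < q matter, and each of the six
    ways of being bad at d accounts for at most q^3 / d^2 triples. *)
Lemma bad_tail (N q z : nat) : (0 < z)%N ->
  \sum_(p : 'I_N * 'I_N * 'I_N) (((p.1.1 < q) && (p.1.2 < q) && (p.2 < q))%N &&
     `[< exists d, (z < d)%N /\ bad d p.1.1 p.1.2 p.2 >])%:R <=
  3 * q%:R ^+ 2 + 6 * q%:R ^+ 3 / z%:R :> R.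
Proof.
move=> z0.
pose A (x : nat) : R := (x < q)%N%:R.
pose Z (x : nat) : R := (x < q)%N%:R * (x == 0)%N%:R.
pose D (m x : nat) : R := (x < q)%N%:R * ((0 < x) && (m %| x))%N%:R.
have A0 x : 0 <= A x by [].
have Z0 x : 0 <= Z x by rewrite mulr_ge0.
have D0 m x : 0 <= D m x by rewrite mulr_ge0.
pose E (d a b c : nat) : R := D (d ^ 2)%N a * A b * A c + A a * D (d ^ 2)%N b * A c + A a * A b * D (d ^ 2)%N c +
  D d a * D d b * A c + D d a * A b * D d c + A a * D d b * D d c.
have E0 d a b c : 0 <= E d a b c by rewrite /E !addr_ge0 // !mulr_ge0.
apply: (le_trans (y := \sum_(p : 'I_N * 'I_N * 'I_N)
   ((Z p.1.1 * A p.1.2 * A p.2 + A p.1.1 * Z p.1.2 * A p.2 + A p.1.1 * A p.1.2 * Z p.2) +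
    \sum_(i < q) E (z.+1 + i)%N p.1.1 p.1.2 p.2))).
  apply: ler_sum => -[[a b] c] _ /=; set Zs := _ + _ + A a * _ * _.
  have Zs0 : 0 <= Zs by rewrite /Zs !addr_ge0 // !mulr_ge0.
  case: (boolP (_ && `[< _ >])) => [/andP[/andP[/andP[aq bq] cq] /asboolP[d [zd hd]]]|_]; last first.
    by rewrite addr_ge0 // sumr_ge0.
  have Aa : A a = 1 by rewrite /A aq.
  have Ab : A b = 1 by rewrite /A bq.
  have Ac : A c = 1 by rewrite /A cq.
  rewrite [leLHS](_ : _ = 1) //; have S0 : 0 <= \sum_(i < q) E (z.+1 + i)%N a b c by apply: sumr_ge0.
  have Za := Z0 a; have Zb := Z0 b; have Zc := Z0 c.
  have ZsE : Zs = Z a + Z b + Z c by rewrite /Zs Aa Ab Ac !mulr1 !mul1r.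
  case: (posnP a) => [a0|a0].
    have : Z a = 1 by rewrite /Z aq a0 mulr1.
    rewrite ZsE; lra.
  case: (posnP b) => [b0|b0].
    have : Z b = 1 by rewrite /Z bq b0 mulr1.
    rewrite ZsE; lra.
  case: (posnP c) => [c0|c0].
    have : Z c = 1 by rewrite /Z cq c0 mulr1.
    rewrite ZsE; lra.
  have dd : (d <= d ^ 2)%N by rewrite -{1}[d]expn1 leq_pexp2l //; apply: leq_ltn_trans zd.
  have dq : (d - z.+1 < q)%N.
    apply: leq_ltn_trans (leq_subr _ _) _.
    case/or3P: hd => [h|h|]; [exact: leq_ltn_trans (leq_trans dd (dvdn_leq a0 h)) aq|
      exact: leq_ltn_trans (leq_trans dd (dvdn_leq b0 h)) bq|].
    case/or4P => [h|/andP[h _]|/andP[h _]|/andP[h _]];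
      [exact: leq_ltn_trans (leq_trans dd (dvdn_leq c0 h)) cq| | | ].
    - exact: leq_ltn_trans (dvdn_leq a0 h) aq.
    - exact: leq_ltn_trans (dvdn_leq a0 h) aq.
    - exact: leq_ltn_trans (dvdn_leq b0 h) bq.
  apply: (le_trans (y := E d a b c)); last first.
    rewrite -[leLHS]add0r lerD // (bigD1 (Ordinal dq)) //= subnKC // lerDl.
    by apply: sumr_ge0.
  have D1 (m x : nat) : (x < q)%N -> (0 < x)%N -> (m %| x)%N -> D m x = 1.
    by move=> h1 h2 h3; rewrite /D h1 h2 h3 mulr1.
  rewrite /E Aa Ab Ac !mulr1 !mul1r.
  have p1 := D0 (d ^ 2)%N a; have p2 := D0 (d ^ 2)%N b; have p3 := D0 (d ^ 2)%N c.
  have p4 := mulr_ge0 (D0 d a) (D0 d b); have p5 := mulr_ge0 (D0 d a) (D0 d c).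
  have p6 := mulr_ge0 (D0 d b) (D0 d c).
  case/or3P: hd => [h|h|].
  - by have := D1 _ _ aq a0 h; lra.
  - by have := D1 _ _ bq b0 h; lra.
  case/or4P => [h|/andP[h h']|/andP[h h']|/andP[h h']].
  - by have := D1 _ _ cq c0 h; lra.
  - have : D d a * D d b = 1 by rewrite (D1 d a) // (D1 d b) // mul1r.
    by lra.
  - have : D d a * D d c = 1 by rewrite (D1 d a) // (D1 d c) // mul1r.
    by lra.
  - have : D d b * D d c = 1 by rewrite (D1 d b) // (D1 d c) // mul1r.
    by lra.
have Q0 : 0 <= q%:R :> R by [].
have sA : \sum_(x < N) A x <= q%:R by exact: count_lt.
have sZ : \sum_(x < N) Z x <= 1 by exact: count_zero.
have sD m : (0 < m)%N -> \sum_(x < N) D m x <= q%:R / m%:R by exact: count_multiples.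
have sA0 : 0 <= \sum_(x < N) A x by apply: sumr_ge0.
have sZ0 : 0 <= \sum_(x < N) Z x by apply: sumr_ge0.
have sD0 m : 0 <= \sum_(x < N) D m x by apply: sumr_ge0.
have s3 (f g h : nat -> R) : \sum_(p : 'I_N * 'I_N * 'I_N) f p.1.1 * g p.1.2 * h p.2 =
    (\sum_(x < N) f x) * (\sum_(x < N) g x) * (\sum_(x < N) h x) by rewrite sum3.
rewrite big_split /= exchange_big /=; apply: lerD.
  rewrite !big_split /= (s3 Z A A) (s3 A Z A) (s3 A A Z).
  have -> : 3 * q%:R ^+ 2 = 1 * q%:R * q%:R + q%:R * 1 * q%:R + q%:R * q%:R * 1 :> R by ring.
  by apply: lerD; [apply: lerD|]; rewrite ler_pM ?mulr_ge0 // ler_pM.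
apply: (le_trans (y := \sum_(i < q) 6 * q%:R ^+ 3 * ((z.+1 + i)%:R ^+ 2)^-1)).
  apply: ler_sum => i _; set d := (z.+1 + i)%N.
  rewrite /E !big_split /= (s3 (D (d ^ 2)%N) A A) (s3 A (D (d ^ 2)%N) A) (s3 A A (D (d ^ 2)%N)).
  rewrite (s3 (D d) (D d) A) (s3 (D d) A (D d)) (s3 A (D d) (D d)).
  have d0 : 0 < d%:R :> R by rewrite ltr0n.
  have -> : 6 * q%:R ^+ 3 * (d%:R ^+ 2)^-1 = q%:R / (d ^ 2)%:R * q%:R * q%:R +
     q%:R * (q%:R / (d ^ 2)%:R) * q%:R + q%:R * q%:R * (q%:R / (d ^ 2)%:R) +
     q%:R / d%:R * (q%:R / d%:R) * q%:R + q%:R / d%:R * q%:R * (q%:R / d%:R) + q%:R * (q%:R / d%:R) * (q%:R / d%:R) :> R.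
    by rewrite natrX; field; rewrite gt_eqF.
  have d2 : (0 < d ^ 2)%N by rewrite expn_gt0.
  have prod3 (x y w x' y' w' : R) : 0 <= x <= x' -> 0 <= y <= y' -> 0 <= w <= w' -> x * y * w <= x' * y' * w'.
    by move=> /andP[x0 xx] /andP[y0 yy] /andP[w0 ww]; rewrite ler_pM ?mulr_ge0 // ler_pM.
  have b1 : 0 <= \sum_(x < N) A x <= q%:R by rewrite sA0.
  have b2 m : (0 < m)%N -> 0 <= \sum_(x < N) D m x <= q%:R / m%:R by move=> m0; rewrite sD0 sD.
  by do 5! (apply: lerD; last by apply: prod3; rewrite ?b1 ?b2); apply: prod3; rewrite ?b1 ?b2.
rewrite -mulr_sumr ler_wpM2l ?mulr_ge0 ?exprn_ge0 //.
apply: le_trans (square_tail q z0) _.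
by rewrite lerBlDr lerDl invr_ge0.
Qed.

End OddSieve.

Section SieveLaw.
Variable R : realType.
Variable par : nat -> nat -> nat -> bool.
Hypothesis par4 : periodic 4 par.

Lemma dens_ge0 M G : 0 <= dens R M G.
Proof. by rewrite /dens divr_ge0 ?exprn_ge0 // sumr_ge0. Qed.

Lemma wsum_sift_le (P : nat -> nat -> nat -> bool) N z :
  wsum (fun a b c => (par a b c && oddgood a b c)%:R : R) N P <=
  wsum (fun a b c => (sift par z a b c)%:R) N P.
Proof.
apply: ler_sum => -[[a b] c] _ /=; apply: ler_wpM2l => //.
case: (boolP (par a b c && oddgood a b c)) => // /andP[hp /asboolP hg].
rewrite /sift hp /= (_ : all _ _ = true) //; apply/allP => p.
by rewrite mem_filter => /andP[/andP[pp po] _]; exact: hg.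
Qed.

Lemma wsum_sift_ge (P : nat -> nat -> nat -> bool) N z q : (0 < z)%N ->
  (forall a b c, P a b c -> (a < q) && (b < q) && (c < q))%N ->
  wsum (fun a b c => (sift par z.+1 a b c)%:R) N P <=
  wsum (fun a b c => (par a b c && oddgood a b c)%:R : R) N P + (3 * q%:R ^+ 2 + 6 * q%:R ^+ 3 / z%:R).
Proof.
move=> z0 hP; apply: le_trans (lerD (lexx _) (bad_tail R N q z0)).
rewrite -big_split /=; apply: ler_sum => -[[a b] c] _ /=.
case: (boolP (P a b c)) => hp; last by rewrite !mul0r add0r.
rewrite (hP _ _ _ hp) !mul1r /=.
case: (boolP (sift _ _ _ _ _)) => [/andP[ha /allP hall]|_]; last by rewrite addr_ge0.
rewrite ha /=; case: (boolP (oddgood a b c)) => [_|hg]; first by rewrite lerDl.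
rewrite add0r (_ : `[< _ >] = true) //; apply/asboolP.
apply: contrapT => hn; case/negP: hg; apply/asboolP => p pp po.
apply/negP => hb; have [pz|zp] := leqP p z; last by apply: hn; exists p.
by have := hall p; rewrite mem_filter pp po mem_iota /= add0n ltnS pz hb => /(_ isT).
Qed.

(** The box at t lies in a cube of side K t, so after division by t^3 the primes beyond z remove at
    most 6 K^3 / z in the limit. For a given error z is fixed first, then t tends to infinity. *)
Lemma sieve_law : box_law (fun a b c => (par a b c && oddgood a b c)%:R : R)
  (dens R 4 par * P_const R).
Proof.
move=> u u' v v' s s' N hu hv hs HN.
set vol := _ * _ * (_ - _).
have vol0 : 0 <= vol by move: hu hv hs => /andP[? ?] /andP[? ?] /andP[? ?]; rewrite !mulr_ge0 ?subr_ge0.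
pose K := u' + v' + s'.
have u'0 : 0 <= u' by case/andP: hu; exact: le_trans.
have v'0 : 0 <= v' by case/andP: hv; exact: le_trans.
have s'0 : 0 <= s' by case/andP: hs; exact: le_trans.
have K0 : 0 <= K by rewrite !addr_ge0.
pose bnd z (t : R) : R := (3 * (K * t + 1) ^+ 2 + 6 * (K * t + 1) ^+ 3 / z%:R) / t ^+ 3.
have lim_sift z : exists l, l = dens R 4 par * Pz R z * vol /\
    wsum (fun a b c => (sift par z a b c)%:R : R) (N t) (inbox u u' v v' s s' t) / t ^+ 3 @[t --> +oo] --> l.
  exists (dens R 4 par * Pz R z * vol); split=> //.
  have [M [M0 _ per <-]] := sift_density R par4 z.
  exact: (@periodic_box_law R M _ M0 per).
have inv0 : t^-1 @[t --> +oo] --> (0 : R).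
  apply/cvgrPdist_le => /= e e0; near=> t.
  have t0 : 0 < t by near: t; exact: nbhs_pinfty_gt.
  have te : e^-1 <= t by near: t; apply: nbhs_pinfty_ge; rewrite num_real.
  by rewrite sub0r normrN gtr0_norm ?invr_gt0 // -[e]invrK lef_pV2 ?posrE ?invr_gt0.
have lim_bnd z : bnd z t @[t --> +oo] --> 6 * K ^+ 3 / z%:R.
  have -> : 6 * K ^+ 3 / z%:R = 3 * (K + 0) * (K + 0) * 0 + 6 * (K + 0) * (K + 0) * (K + 0) / z%:R.
    by rewrite mulr0 add0r addr0 !exprS expr0; ring.
  have e : {near +oo, (fun t => 3 * (K + t^-1) * (K + t^-1) * t^-1 + 6 * (K + t^-1) * (K + t^-1) * (K + t^-1) / z%:R) =1 bnd z}.
    near=> t; have t0 : t != 0 by apply: lt0r_neq0; near: t; exact: nbhs_pinfty_gt.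
    have e1 : K + t^-1 = (K * t + 1) / t by rewrite mulrDl mulfK // mul1r.
    by rewrite /bnd e1; set y := K * t + 1; set iz := z%:R^-1; field.
  apply: cvg_trans; first exact: near_eq_cvg e.
  have ck : K + t^-1 @[t --> +oo] --> K + 0 by apply: cvgD => //; exact: cvg_cst.
  by apply: cvgD; [do 3! (apply: cvgM => //)|apply: cvgM; [do 3! (apply: cvgM => //)|]]; exact: cvg_cst.
apply: cvg_sandwich => e e0.
have [z [z0 hz1 hz2]] : exists z : nat, [/\ (0 < z)%N, dens R 4 par * Pz R z.+1 * vol <= dens R 4 par * P_const R * vol + e &
     6 * K ^+ 3 / z%:R <= e].
  have Foo : Filter (\oo : set_system nat) by exact: _.
  have c1 : dens R 4 par * Pz R z * vol @[z --> \oo] --> dens R 4 par * P_const R * vol.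
    by apply: cvgM; [apply: cvgM; [exact: cvg_cst|exact: Pz_cvg]|exact: cvg_cst].
  have c2 : 6 * K ^+ 3 * (z.+1)%:R^-1 @[z --> \oo] --> 6 * K ^+ 3 * 0.
    by apply: cvgM; [exact: cvg_cst|exact: cvg_harmonic].
  rewrite mulr0 in c2.
  have b1 : dens R 4 par * P_const R * vol < dens R 4 par * P_const R * vol + e by rewrite ltrDl.
  have [M1 _ h1] := @cvgr_lt _ _ _ Foo _ _ c1 _ b1.
  have [M2 _ h2] := @cvgr_lt _ _ _ Foo _ _ c2 _ e0.
  exists (maxn M1 M2).+1; split=> //.
    by apply: ltW; apply: h1 => /=; rewrite (leq_trans (leq_maxl M1 M2)) // -addn2 leq_addr.
  by apply: ltW; apply: h2 => /=; exact: leq_maxr.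
have [l1 [l1E c1]] := lim_sift z.+1.
exists (fun t => wsum (fun a b c => (sift par z.+1 a b c)%:R : R) (N t) (inbox u u' v v' s s' t) / t ^+ 3 - bnd z t).
exists (fun t => wsum (fun a b c => (sift par z.+1 a b c)%:R : R) (N t) (inbox u u' v v' s s' t) / t ^+ 3).
exists (l1 - 6 * K ^+ 3 / z%:R), l1; split.
- near=> t; have t0 : 0 < t by near: t; exact: nbhs_pinfty_gt.
  have t3 : 0 < t ^+ 3 by rewrite exprn_gt0.
  have [q [hq q1 q2]] := ceil_nat (mulr_ge0 K0 (ltW t0)).
  have hin a b c : inbox u u' v v' s s' t a b c -> ((a < q) && (b < q) && (c < q))%N.
    move=> /and3P[/andP[_ h1] /andP[_ h2] /andP[_ h3]]; rewrite -!hq.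
    have m1 := mulr_ge0 u'0 (ltW t0); have m2 := mulr_ge0 v'0 (ltW t0); have m3 := mulr_ge0 s'0 (ltW t0).
    by rewrite /K !mulrDl; apply/andP; split; [apply/andP; split|]; lra.
  apply/andP; split; last by rewrite ler_pM2r ?invr_gt0 // wsum_sift_le.
  rewrite lerBlDr /bnd -mulrDl ler_pM2r ?invr_gt0 //.
  apply: (le_trans (wsum_sift_ge (N t) z0 hin)); rewrite lerD2l.
  have q0 : 0 <= q%:R :> R by [].
  have qq : q%:R ^+ 2 <= (K * t + 1) ^+ 2 by rewrite !expr2 ler_pM // ltW.
  have qqq : q%:R ^+ 3 <= (K * t + 1) ^+ 3 by rewrite !(exprS _ 2) ler_pM ?exprn_ge0 // ltW.
  by apply: lerD; [rewrite ler_wpM2l|rewrite ler_wpM2r ?invr_ge0 // ler_wpM2l].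
- by apply: cvgB.
- exact: c1.
- rewrite l1E lerB //; apply: ler_wpM2r => //; apply: ler_wpM2l; first exact: dens_ge0.
  exact: P_const_le.
- by rewrite l1E.
Unshelve. all: by end_near. Qed.

End SieveLaw.

(** * Counting fields *)

Lemma coprime_prime m n : (0 < m)%N ->
  (forall p, prime p -> (p %| m)%N -> (p %| n)%N -> False) -> coprime m n.
Proof.
move=> m0 h; rewrite /coprime eqn_leq gcdn_gt0 m0 andbT leqNgt; apply/negP => g1.
have pg := pdiv_dvd (gcdn m n).
by apply: (h _ (pdiv_prime g1)); apply: dvdn_trans pg _; [exact: dvdn_gcdl|exact: dvdn_gcdr].
Qed.

Definition par_odd (a b c : nat) : bool := [&& odd a, odd b & odd c].
Definition par_two (a b c : nat) : bool := [&& (a %% 4 == 2)%N, odd b & odd c].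

(** The odd primes are handled by [oddgood], and the parity conditions alone take care of the prime
    2. *)
Lemma oddgood_sqf a b c : par_odd a b c || par_two a b c -> oddgood a b c ->
  [/\ sqf a, sqf b & sqf c] /\ [/\ coprime a b, coprime a c & coprime b c].
Proof.
move=> hpar /asboolP hg.
have [ob oc a4] : [/\ odd b, odd c & ~~ (4 %| a)%N].
  case/orP: hpar => /and3P[h1 h2 h3]; split=> //; apply/negP => h; move: h1 h; clear; lia.
have a0 : (0 < a)%N by rewrite lt0n; apply: contra a4 => /eqP ->.
have b0 : (0 < b)%N by rewrite odd_gt0.
have c0 : (0 < c)%N by rewrite odd_gt0.
have nb p : prime p -> (p != 2)%N -> ~~ bad p a b c.
  by move=> pp p2; apply: hg => //; case: (even_prime pp) p2 => // ->.
have [b2 c2] : ~~ (2 %| b)%N /\ ~~ (2 %| c)%N by rewrite !dvdn2 !negbK.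
have d4 x : (2 ^ 2 %| x)%N -> (2 %| x)%N by apply: dvdn_trans; rewrite dvdn_exp.
split; split; try (apply/sqfP; split=> // p pp).
- have [->|p2] := eqVneq p 2%N; first exact: a4.
  by apply: contra (nb p pp p2) => h; rewrite /bad h.
- have [->|p2] := eqVneq p 2%N; first by apply: contra b2; exact: d4.
  by apply: contra (nb p pp p2) => h; rewrite /bad h !orbT.
- have [->|p2] := eqVneq p 2%N; first by apply: contra c2; exact: d4.
  by apply: contra (nb p pp p2) => h; rewrite /bad h !orbT.
- apply: coprime_prime => // p pp pa pb; have [p2|p2] := eqVneq p 2%N; first by rewrite -p2 pb in b2.
  by case/negP: (nb p pp p2); rewrite /bad pa pb !orbT.
- apply: coprime_prime => // p pp pa pb; have [p2|p2] := eqVneq p 2%N; first by rewrite -p2 pb in c2.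
  by case/negP: (nb p pp p2); rewrite /bad pa pb !orbT.
- apply: coprime_prime => // p pp pa pb; have [p2|p2] := eqVneq p 2%N; first by rewrite -p2 pb in c2.
  by case/negP: (nb p pp p2); rewrite /bad pa pb !orbT.
Qed.

Lemma sqf_oddgood a b c : sqf a -> sqf b -> sqf c -> coprime a b -> coprime a c -> coprime b c ->
  oddgood a b c.
Proof.
move=> /sqfP[_ sa] /sqfP[_ sb] /sqfP[_ sc] ab ac bc; apply/asboolP => p pp _.
have co m n : coprime m n -> ((p %| m)%N && (p %| n)%N) = false.
  move=> /eqP mn; apply/negP => /andP[h1 h2]; have := dvdn_gcd p m n.
  by rewrite h1 h2 mn dvdn1 => /eqP p1; rewrite p1 in pp.
by rewrite /bad (negbTE (sa _ pp)) (negbTE (sb _ pp)) (negbTE (sc _ pp)) !co.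
Qed.

(** For odd x this is the one of x and -x that is congruent to 1 modulo 4. *)
Definition sg4 (x : nat) : int := if (x %% 4 == 1)%N then x%:Z else - x%:Z.

Lemma absz_sg4 x : `|sg4 x|%N = x.
Proof. by rewrite /sg4; case: ifP; rewrite ?abszN. Qed.

Lemma sg4_mod x : odd x -> exists k : int, sg4 x = 4 * k + 1.
Proof.
move=> ox; exists ((sg4 x) %/ 4)%Z; move: ox; rewrite /sg4; case: ifP; lia.
Qed.

Lemma sg4_absz (n k : int) : n = 4 * k + 1 -> sg4 `|n|%N = n /\ odd `|n|%N.
Proof. by move=> ->; rewrite /sg4; split; [case: ifP|]; lia. Qed.

(* k = 0 is typeR2 with A odd, k = 1, 2 are typeR2 with A even of either sign,
   k = 3, 4 are typeR1 with A of either sign, and k = 5 is typeU. *)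
Definition codeA (k a : nat) : int :=
  match k with 0%N => - sg4 a | 1%N | 3%N => a%:Z | 2%N | 4%N => - a%:Z | _ => sg4 a end.
Definition codeC (k c : nat) : int := match k with 3%N | 4%N => - sg4 c | _ => sg4 c end.
Definition code_par (k : nat) : nat -> nat -> nat -> bool :=
  match k with 0%N => par_odd | 1%N | 2%N | 3%N | 4%N => par_two | _ => par_odd end.

(* The last clause keeps one of (A, 1, -1) and (- A, 1, -1), which describe the same
   field; no other field has two codes. *)
Definition code_adm (k a b c : nat) : bool :=
  [&& codeA k a * sg4 b != 1, codeA k a * codeC k c != 1, sg4 b * codeC k c != 1
    & ~~ [&& k == 4%N, b == 1%N & c == 1%N]].

Definition code_ok (k a b c : nat) : bool :=
  [&& code_par k a b c, oddgood a b c & code_adm k a b c].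

Lemma absz_codeA k a : `|codeA k a|%N = a.
Proof. by case: k => [|[|[|[|[|k]]]]]; rewrite /= ?abszN ?absz_sg4. Qed.

Lemma absz_codeC k c : `|codeC k c|%N = c.
Proof. by case: k => [|[|[|[|[|k]]]]]; rewrite /= ?abszN ?absz_sg4. Qed.

Lemma code_parE k a b c : code_par k a b c -> par_odd a b c || par_two a b c.
Proof. by case: k => [|[|[|[|[|k]]]]] /= ->; rewrite ?orbT. Qed.

Lemma code_admissible k a b c : code_ok k a b c -> admissible (codeA k a) (sg4 b) (codeC k c).
Proof.
move=> /and3P[/code_parE hp hg /and4P[h1 h2 h3 _]].
have [[sa sb sc] [ab ac bc]] := oddgood_sqf hp hg.
by split; rewrite ?absz_codeA ?absz_codeC ?absz_sg4.
Qed.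

Lemma two_mod a : (a %% 4 == 2)%N ->
  (exists k : int, a%:Z = 4 * k + 2) /\ (exists k : int, - a%:Z = 4 * k + 2).
Proof. by move=> h; split; [exists (a %/ 4)%N%:Z|exists (- (a %/ 4)%N%:Z - 1)]; lia. Qed.

Lemma code_typeR2 k a b c : (k < 3)%N -> code_par k a b c -> typeR2 (codeA k a) (sg4 b) (codeC k c).
Proof.
case: k => [|[|[|k]]] // _ /and3P[ha /sg4_mod[B' eB] /sg4_mod[C' eC]] /=.
- have [A' eA] := sg4_mod ha; exists (- A' - 1), B', C', 3; split=> //; [|by right].
  by rewrite eA; ring.
- by have [[A' eA] _] := two_mod ha; exists A', B', C', 2; split=> //; left.
- by have [_ [A' eA]] := two_mod ha; exists A', B', C', 2; split=> //; left.
Qed.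

Lemma code_typeR1 k a b c : (3 <= k < 5)%N -> code_par k a b c ->
  typeR1 (codeA k a) (sg4 b) (codeC k c).
Proof.
case: k => [|[|[|[|[|k]]]]] // _ /and3P[ha /sg4_mod[B' eB] /sg4_mod[C' eC]] /=.
- have [[A' eA] _] := two_mod ha; exists A', B', (- C' - 1); split=> //; rewrite eC; ring.
- have [_ [A' eA]] := two_mod ha; exists A', B', (- C' - 1); split=> //; rewrite eC; ring.
Qed.

Lemma code_typeU a b c : code_par 5 a b c -> typeU (codeA 5 a) (sg4 b) (codeC 5 c).
Proof.
move=> /and3P[/sg4_mod[A' eA] /sg4_mod[B' eB] /sg4_mod[C' eC]]; exists A', B', C'; split=> //.
Qed.

Lemma typeR2_code A B C : typeR2 A B C -> exists k, [/\ (k < 3)%N, code_par k `|A| `|B| `|C|,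
  codeA k `|A| = A, sg4 `|B| = B & codeC k `|C| = C].
Proof.
move=> [A' [B' [C' [r [eA /sg4_absz[eB oB] /sg4_absz[eC oC] [r2|r3]]]]]]; subst r.
  have ha : (`|A| %% 4 == 2)%N by rewrite eA; clear; lia.
  have [A0|A0] := leP 0 A.
    exists 1%N; rewrite /= /par_two ha oB oC; split=> //; lia.
  exists 2%N; rewrite /= /par_two ha oB oC; split=> //; lia.
have [eA1 oA] : sg4 `|- A|%N = - A /\ odd `|- A|%N by apply: (@sg4_absz _ (- A' - 1)); rewrite eA; ring.
rewrite abszN in eA1 oA; exists 0%N; rewrite /= /par_odd oA oB oC eA1 opprK; split=> //.
Qed.

Lemma typeR1_code A B C : typeR1 A B C -> exists k, [/\ (3 <= k < 5)%N, code_par k `|A| `|B| `|C|,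
  codeA k `|A| = A, sg4 `|B| = B & codeC k `|C| = C].
Proof.
move=> [A' [B' [C' [eA /sg4_absz[eB oB] eC]]]].
have [eC1 oC] : sg4 `|- C|%N = - C /\ odd `|- C|%N by apply: (@sg4_absz _ (- C' - 1)); rewrite eC; ring.
rewrite abszN in eC1 oC.
have ha : (`|A| %% 4 == 2)%N by rewrite eA; clear; lia.
have [A0|A0] := leP 0 A.
  exists 3%N; rewrite /= /par_two ha oB oC eC1 opprK; split=> //; lia.
exists 4%N; rewrite /= /par_two ha oB oC eC1 opprK; split=> //; lia.
Qed.

Lemma typeU_code A B C : typeU A B C -> [/\ code_par 5 `|A| `|B| `|C|,
  codeA 5 `|A| = A, sg4 `|B| = B & codeC 5 `|C| = C].
Proof.
move=> [A' [B' [C' [/sg4_absz[eA oA] /sg4_absz[eB oB] /sg4_absz[eC oC]]]]].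
by rewrite /= /par_odd oA oB oC.
Qed.

Lemma admissible_oddgood A B C : admissible A B C -> oddgood `|A| `|B| `|C|.
Proof. by case=> *; apply: sqf_oddgood. Qed.

(** AB differs from (BC)(AC) by a square, so it is determined as well by being squarefree; then C^2
    = (AC)(BC) / (AB). *)
Lemma same_products A B C A' B' C' : admissible A B C -> admissible A' B' C' ->
  B' * C' = B * C -> A' * C' = A * C -> `|C'|%N = `|C|%N.
Proof.
move=> adm adm' e1 e2; have [A0 B0 C0] := admissible_neq0 adm; have [A0' B0' C0'] := admissible_neq0 adm'.
have eAB : A' * B' = A * B.
  apply: (@sqf_eq _ _ (C%:~R / C'%:~R)).
  - by case: adm' => *; rewrite abszM; apply: sqfM.
  - by case: adm => *; rewrite abszM; apply: sqfM.
  have c0 : C'%:~R != 0 :> rat by rewrite intr_eq0.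
  apply: (@mulfI _ (C'%:~R * C'%:~R)); first by rewrite mulf_neq0.
  have -> : C'%:~R * C'%:~R * (A' * B')%:~R = ((A' * C') * (B' * C'))%:~R :> rat by rewrite !rmorphM /=; ring.
  by rewrite e1 e2 !rmorphM /=; field.
have : C' ^+ 2 == C ^+ 2.
  apply/eqP; apply: (@mulfI _ (A * B)); first by rewrite mulf_neq0.
  rewrite -{1}eAB; have -> : A' * B' * C' ^+ 2 = (A' * C') * (B' * C') by ring.
  by rewrite e1 e2; ring.
by rewrite eqf_sqr => /orP[/eqP ->|/eqP ->]; rewrite ?abszN.
Qed.

Lemma same_residue (m n k l r : int) : `|m|%N = `|n|%N -> m = 4 * k + r -> n = 4 * l + r ->
  r = 1 \/ r = 3 -> m = n.
Proof. by move=> h1 h2 h3 [h4|h4]; lia. Qed.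

Lemma biq_squares3 (K : fieldExtType rat) A B C A' B' C' :
  biquadratic K A B C -> biquadratic K A' B' C' ->
  [/\ [\/ B' * C' = B * C, B' * C' = A * C | B' * C' = A * B],
      [\/ A' * C' = B * C, A' * C' = A * C | A' * C' = A * B] &
      [\/ A' * B' = B * C, A' * B' = A * C | A' * B' = A * B]].
Proof.
move=> h h'; split.
- by have [?|[?|?]] := biq_squares h h'; [constructor 1|constructor 2|constructor 3].
- by have [?|[?|?]] := biq_squares h (biquadratic_swap12 h'); [constructor 1|constructor 2|constructor 3].
- rewrite mulrC.
  by have := biq_squares h (biquadratic_swap23 (biquadratic_swap12 (biquadratic_swap23 h'))); 
     rewrite ![B' * A']mulrC; move=> [?|[?|?]]; [constructor 1|constructor 2|constructor 3].
Qed.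

Lemma coprime_same_abs (m n : nat) : coprime m n -> m = n -> m = 1%N.
Proof. by move=> /eqP co e; move: co; rewrite e gcdnn. Qed.

(** AC and AB have the same residue r modulo 4, different from the residue s of BC. This singles out
    Q(a) among the three quadratic subfields. *)
Lemma typed_products A B C : typeR2 A B C \/ typeR1 A B C ->
  exists r s x y z b c : int, [/\ B * C = 4 * x + s, A * C = 4 * y + r, A * B = 4 * z + r, B = 4 * b + 1
   & C = 4 * c + s /\ [\/ s = 1 /\ r = 2, s = 1 /\ r = 3 | s = 3 /\ r = 2]].
Proof.
case=> [[A' [B' [C' [r [-> -> -> hr]]]]]|[A' [B' [C' [-> -> ->]]]]].
  exists r, 1, (4 * B' * C' + B' + C'), (4 * A' * C' + A' + r * C'), (4 * A' * B' + A' + r * B'), B', C'.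
  split; try ring; split=> //; case: hr => ->; [by constructor 1|by constructor 2].
exists 2, 3, (4 * B' * C' + 3 * B' + C'), (4 * A' * C' + 3 * A' + 2 * C' + 1), (4 * A' * B' + A' + 2 * B'), B', C'.
split; try ring; split=> //; by constructor 3.
Qed.

(** BC is recognized by its residue, so two normal forms either agree on AC and AB or exchange them.
    An exchange swaps |B| and |C|; the order makes them equal, coprimality makes them 1, and the
    residue of B with BC <> 1 leaves B = 1 and C = -1. *)
Lemma typed_uniqR (K : fieldExtType rat) A B C A' B' C' :
  biquadratic K A B C -> biquadratic K A' B' C' ->
  typeR2 A B C \/ typeR1 A B C -> typeR2 A' B' C' \/ typeR1 A' B' C' ->
  (`|C| <= `|B|)%N -> (`|C'| <= `|B'|)%N ->
  [/\ A' = A, B' = B & C' = C] \/ [/\ A' = - A, B = 1, C = - 1, B' = 1 & C' = - 1].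
Proof.
move=> hK hK' /typed_products[r [s [x [y [z [b [c [e1 e2 e3 eB [eC hrs]]]]]]]]].
move=> /typed_products[r' [s' [x' [y' [z' [b' [c' [e1' e2' e3' eB' [eC' hrs']]]]]]]]] CB CB'.
have [h1 h2 _] := biq_squares3 hK hK'.
have [adm _] := hK; have [adm' _] := hK'.
have [A0 B0 C0] := admissible_neq0 adm; have [A0' B0' C0'] := admissible_neq0 adm'.
have [es p1] : s' = s /\ B' * C' = B * C.
  move: h1 h2; rewrite e1 e2 e3 e1' e2' => h1 h2.
  move: h1 h2 hrs hrs'; clear; move=> [] ? [] ? [[? ?]|[? ?]|[? ?]] [[? ?]|[? ?]|[? ?]]; lia.
have p2 : A' * C' = A * C \/ A' * C' = A * B.
  move: h2 => [h2|h2|h2]; [exfalso|by left|by right].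
  by move: h2 hrs hrs' p1 es; rewrite e1 e1' e2'; clear; move=> ? [[? ?]|[? ?]|[? ?]] [[? ?]|[? ?]|[? ?]]; lia.
have s13 : s = 1 \/ s = 3 by case: hrs => -[-> _]; [left|left|right].
have absBC : (`|B'| * `|C'| = `|B| * `|C|)%N by rewrite -!abszM p1.
case: p2 => [p2|p2].
  have aC := same_products adm adm' p1 p2.
  have aB : `|B'|%N = `|B|%N.
    by apply/eqP; rewrite -(eqn_pmul2r (m := `|C|)) ?absz_gt0 // -{1}aC absBC.
  have eCC : C' = C by apply: (same_residue aC _ eC s13); rewrite eC' es.
  left; split=> //.
    by apply: (mulIf C0); rewrite -p2 eCC.
  by apply: (same_residue aB eB' eB); left.
right; have aC : `|C'|%N = `|B|%N.
  by apply: (same_products (admissible_swap23 adm) adm' _ p2); rewrite p1 mulrC.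
have aB : `|B'|%N = `|C|%N.
  by apply/eqP; rewrite -(eqn_pmul2r (m := `|B|)) ?absz_gt0 // -{1}aC absBC mulnC.
have eBC : `|B|%N = `|C|%N by apply/eqP; rewrite eqn_leq CB -{1}aC -aB CB'.
have B1 := coprime_same_abs (adm_BC adm) eBC.
have C1 : `|C|%N = 1%N by rewrite -eBC.
have eB1 : B = 1 by move: B1 eB; clear; lia.
have eC1 : C = -1.
  have := adm_BC1 adm; rewrite eB1 mul1r; move: C1; clear; lia.
have s3 : s = 3 by move: eC s13; rewrite eC1; clear; move=> ? [] ?; lia.
have eB1' : B' = 1 by move: aB eB'; rewrite C1; clear; lia.
have eC1' : C' = -1 by move: aC eC'; rewrite B1 es s3; clear; lia.
split=> //; move: p2; rewrite eC1' eB1 mulr1 mulrN1 => <-; by rewrite opprK.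
Qed.

(** Two coprime entries of equal absolute value would be 1 up to sign, hence both 1 by their
    residue, and their product would be 1. *)
Lemma typeU_strict A B C : admissible A B C -> typeU A B C -> (`|A| <= `|C| <= `|B|)%N ->
  (`|A| < `|C| < `|B|)%N.
Proof.
move=> adm [A' [B' [C' [eA eB eC]]]] /andP[AC CB]; apply/andP; split.
- rewrite ltn_neqAle AC andbT; apply/eqP => e; have A1 := coprime_same_abs (adm_AC adm) e.
  have := adm_AC1 adm; rewrite A1 in e.
  have -> : A = 1 by move: A1 eA; clear; lia.
  have -> : C = 1 by move: e eC; clear; lia.
  by rewrite mulr1.
- rewrite ltn_neqAle CB andbT; apply/eqP => e; have B1 := coprime_same_abs (adm_BC adm) (esym e).
  have := adm_BC1 adm; rewrite B1 in e.
  have -> : B = 1 by move: B1 eB; clear; lia.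
  have -> : C = 1 by move: e eC; clear; lia.
  by rewrite mulr1.
Qed.

Lemma three_products (p q r p' q' r' : nat) : (p < q)%N -> (q < r)%N -> (p' < q')%N -> (q' < r')%N ->
  [\/ r' = r, r' = p | r' = q] -> [\/ p' = r, p' = p | p' = q] -> [\/ q' = r, q' = p | q' = q] ->
  r' = r /\ p' = p.
Proof. by move=> ? ? ? ? [] ? [] ? [] ?; lia. Qed.

(** The absolute values of AC, AB and BC are strictly increasing, so the order of size tells the
    three quadratic subfields apart. *)
Lemma typed_uniqU (K : fieldExtType rat) A B C A' B' C' :
  biquadratic K A B C -> biquadratic K A' B' C' -> typeU A B C -> typeU A' B' C' ->
  (`|A| <= `|C| <= `|B|)%N -> (`|A'| <= `|C'| <= `|B'|)%N -> [/\ A' = A, B' = B & C' = C].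
Proof.
move=> hK hK' t t' o o'; have [adm _] := hK; have [adm' _] := hK'.
have [A0 B0 C0] := admissible_neq0 adm; have [A0' B0' C0'] := admissible_neq0 adm'.
have /andP[l1 l2] := typeU_strict adm t o; have /andP[l1' l2'] := typeU_strict adm' t' o'.
have [h1 h2 h3] := biq_squares3 hK hK'.
have ab3 (m n p q : int) : [\/ m = n, m = p | m = q] -> [\/ `|m|%N = `|n|%N, `|m|%N = `|p|%N | `|m|%N = `|q|%N].
  by case=> ->; [constructor 1|constructor 2|constructor 3].
have [q1 q2 q3] := And3 (ab3 _ _ _ _ h1) (ab3 _ _ _ _ h2) (ab3 _ _ _ _ h3).
have lt2 (X Y Z : int) : X != 0 -> (`|Y| < `|Z|)%N -> (`|(X * Y)%R| < `|(X * Z)%R|)%N.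
  by move=> X0 YZ; rewrite !abszM ltn_pmul2l ?absz_gt0.
have k1 : (`|(A * C)%R| < `|(A * B)%R|)%N by apply: lt2.
have k2 : (`|(A * B)%R| < `|(B * C)%R|)%N by rewrite [A * B]mulrC; apply: lt2.
have k1' : (`|(A' * C')%R| < `|(A' * B')%R|)%N by apply: lt2.
have k2' : (`|(A' * B')%R| < `|(B' * C')%R|)%N by rewrite [A' * B']mulrC; apply: lt2.
have [r1 r2] := three_products k1 k2 k1' k2' q1 q2 q3.
have p1 : B' * C' = B * C.
  case: h1 => [//|e|e]; exfalso; move: r1; rewrite e => r1.
    by have := ltn_trans k1 k2; rewrite r1 ltnn.
  by move: k2; rewrite r1 ltnn.
have p2 : A' * C' = A * C.
  case: h2 => [e|//|e]; exfalso; move: r2; rewrite e => r2.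
    by have := ltn_trans k1 k2; rewrite r2 ltnn.
  by move: k1; rewrite r2 ltnn.
have aC := same_products adm adm' p1 p2.
have aB : `|B'|%N = `|B|%N.
  by apply/eqP; rewrite -(eqn_pmul2r (m := `|C|)) ?absz_gt0 // -{1}aC -!abszM p1.
have [x [y [z [eA eB eC]]]] := t; have [x' [y' [z' [eA' eB' eC']]]] := t'.
have eCC : C' = C by apply: (same_residue aC eC' eC); left.
split=> //; last by apply: (same_residue aB eB' eB); left.
by apply: (mulIf C0); rewrite -p2 eCC.
Qed.

Section IsoCount.
Variables (m k0 n : nat) (reg : nat -> nat -> nat -> nat -> bool).
Variable Q : splittingFieldType rat -> Prop.

Definition coded (K : fieldExtType rat) k a b c :=
  [/\ (k0 <= k < k0 + m)%N, code_ok k a b c, reg k a b c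
    & biquadratic K (codeA k a) (sg4 b) (codeC k c)].

(** Codes form a system of representatives: every valid code is realized by a field, isomorphic
    fields have the same code, and fields with the same code are isomorphic. The cutoff n makes the
    set of codes a finite type whose cardinality is the sum. *)
Lemma iso_count :
  (forall (K : splittingFieldType rat) k a b c, coded K k a b c -> Q K) ->
  (forall K k a b c k' a' b' c', coded K k a b c -> coded K k' a' b' c' ->
     [/\ k = k', a = a', b = b' & c = c']) ->
  (forall K : splittingFieldType rat, Q K -> exists k a b c, coded K k a b c) ->
  (forall k a b c, (k0 <= k < k0 + m)%N -> reg k a b c -> [/\ (a < n)%N, (b < n)%N & (c < n)%N]) ->
  num_iso_classes Q (\sum_(i < m) \sum_(p : 'I_n * 'I_n * 'I_n)
     (code_ok (k0 + i) p.1.1 p.1.2 p.2 && reg (k0 + i) p.1.1 p.1.2 p.2)).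
Proof.
move=> HQ Huniq Hex Hn.
pose T := ('I_m * ('I_n * 'I_n * 'I_n))%type.
pose V := [pred x : T | code_ok (k0 + x.1) x.2.1.1 x.2.1.2 x.2.2 && reg (k0 + x.1) x.2.1.1 x.2.1.2 x.2.2].
have -> : (\sum_(i < m) \sum_(p : 'I_n * 'I_n * 'I_n)
     (code_ok (k0 + i) p.1.1 p.1.2 p.2 && reg (k0 + i) p.1.1 p.1.2 p.2) = #|V|)%N.
  by rewrite pair_big /= -sum1_card [RHS]big_mkcond; apply: eq_bigr => x _; rewrite inE; case: ifP.
have rng (i : 'I_m) : (k0 <= k0 + i < k0 + m)%N.
  by rewrite leq_addr ltn_add2l ltn_ord.
have exK (x : T) : V x -> exists K : splittingFieldType rat, coded K (k0 + x.1) x.2.1.1 x.2.1.2 x.2.2.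
  move=> /andP[h1 h2]; have [K hK] := biq_exists (code_admissible h1); by exists K; split.
have vV (i : 'I_#|V|) : V (enum_val i) by have := enum_valP i.
pose F i := projT1 (cid (exK _ (vV i))).
have hF i : coded (F i) (k0 + (enum_val i).1) (enum_val i).2.1.1 (enum_val i).2.1.2 (enum_val i).2.2.
  exact: (projT2 (cid (exK _ (vV i)))).
exists F; split.
- by move=> i; exact: HQ (hF i).
- move=> i j iso; apply: enum_val_inj.
  have [r1 o1 g1 b1] := hF i; have [r2 o2 g2 b2] := hF j.
  have [e1 e2 e3 e4] := Huniq _ _ _ _ _ _ _ _ _ (And4 r1 o1 g1 (biq_transport iso b1)) (hF j).
  move: e1 e2 e3 e4; case: (enum_val i) => [x1 [[x2 x3] x4]]; case: (enum_val j) => [y1 [[y2 y3] y4]] /=.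
  by move=> /addnI e1 e2 e3 e4; congr (_, (_, _, _)); apply: val_inj.
- move=> K /Hex[k [a [b [c [r o g bK]]]]].
  have [an bn cn] := Hn _ _ _ _ r g.
  have km : (k - k0 < m)%N by move: r; clear; lia.
  have ek : (k0 + (k - k0) = k)%N by move: r; clear; lia.
  pose x : T := (Ordinal km, (Ordinal an, Ordinal bn, Ordinal cn)).
  have Vx : x \in V by rewrite inE /= ek o g.
  exists (enum_rank_in Vx x).
  have [_ _ _ b2] := hF (enum_rank_in Vx x); move: b2; rewrite enum_rankK_in //= ek => b2.
  exact: biq_iso bK b2.
Qed.

End IsoCount.

(** * Window and discriminant conditions in terms of codes *)

Section ShapeConditions.
Variables (R : realType) (R1 R2 : R).
Hypotheses (hR1 : 0 < R1) (hR12 : R1 < R2).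

Let hR2 : 0 < R2. Proof. exact: lt_trans hR12. Qed.

Lemma sqr_lt_sqrt (X u : R) : 0 <= u -> (u ^+ 2 < X) = (u < Num.sqrt X).
Proof.
move=> u0; have [X0|X0] := leP X 0.
  by rewrite ler0_sqrtr // !ltNge u0 (le_trans X0) ?sqr_ge0.
by rewrite -[in RHS](ger0_norm u0) -sqrtr_sqr ltr_sqrt.
Qed.

Lemma ratio_lt (m r : R) (a c : nat) : 0 < r -> 0 < m -> (0 < c)%N ->
  (m * Num.sqrt (a%:R / c%:R) < r) = (a%:R < r ^+ 2 / m ^+ 2 * c%:R).
Proof.
move=> r0 m0 c0; have c0' : 0 < c%:R :> R by rewrite ltr0n.
rewrite mulrC -ltr_pdivlMr // -expr_div_n -[in RHS]ltr_pdivrMr //.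
have z0 : 0 <= a%:R / c%:R :> R by rewrite divr_ge0.
have q0 : 0 <= r / m by rewrite divr_ge0 // ltW.
by rewrite -[in RHS](sqr_sqrtr z0) ltr_pXn2r ?nnegrE ?sqrtr_ge0.
Qed.

Lemma ratio_order (m : R) (a b c : nat) : 0 < m -> (0 < a)%N -> (0 < c)%N -> (c <= b)%N ->
  0 < m * Num.sqrt (a%:R / b%:R : R) <= m * Num.sqrt (a%:R / c%:R).
Proof.
move=> m0 a0 c0 cb; have b0 : (0 < b)%N by apply: leq_trans cb.
have [a0' b0' c0'] : [/\ 0 < a%:R :> R, 0 < b%:R :> R & 0 < c%:R :> R] by rewrite !ltr0n.
apply/andP; split; first by rewrite mulr_gt0 // sqrtr_gt0 divr_gt0.
by rewrite ler_pM2l // ler_wsqrtr // ler_pM2l // lef_pV2 ?posrE // ler_nat.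
Qed.

(** The window is a set of similarity classes; injectivity of the parametrization turns membership
    into inequalities between coordinates. *)
Lemma W_oC_sh x y : 0 < x <= y -> W_oC R1 R2 (sh_oC x y) <-> (R1 <= x) && (y < R2).
Proof.
move=> /andP[x0 xy]; split; last by move=> /andP[h1 h2]; exists x, y; rewrite h1 xy.
move=> [x' [y' [/andP[h1 h2] [h3 e]]]].
have [-> ->] := sh_oC_inj x0 xy (lt_le_trans hR1 h1) h2 e.
by rewrite h1 h3.
Qed.

Lemma W_oI_sh x y : R2 < 1 -> 0 < x -> x < y -> y < 1 ->
  W_oI R1 R2 (sh_oI x y) <-> (R1 <= x) && (y < R2).
Proof.
move=> r21 x0 xy y1; split; last by move=> /andP[h1 h2]; exists x, y; rewrite h1 xy.
move=> [x' [y' [/andP[h1 h2] [h3 e]]]].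
have [-> ->] := sh_oI_inj x0 xy y1 (lt_le_trans hR1 h1) h2 (lt_trans h3 r21) e.
by rewrite h1 h3.
Qed.

Lemma disc_lt (d : nat) (A B C : int) (X : R) : (0 < d)%N ->
  (ratr (d%:R ^+ 2 * (A * B * C)%:~R ^+ 2) < X) =
  ((`|A| * `|B| * `|C|)%N%:R < Num.sqrt X / d%:R).
Proof.
move=> d0; have d0' : 0 < d%:R :> R by rewrite ltr0n.
have -> : d%:R ^+ 2 * (A * B * C)%:~R ^+ 2 = (d * (`|A| * `|B| * `|C|))%N%:R ^+ 2 :> rat.
  rewrite natrM exprMn -!abszM; congr (_ * _).
  by case: (A * B * C)%R => n; rewrite ?NegzE ?abszN ?mulrNz ?sqrrN -?pmulrn.
by rewrite rmorphXn /= ratr_nat sqr_lt_sqrt // natrM ltr_pdivlMr // mulrC.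
Qed.

(* For kparam k = (m, d) the shape has coordinates m sqrt(a / b) and m sqrt(a / c),
   and the discriminant is (d a b c)^2. *)
Definition kparam (k : nat) : R * nat :=
  match k with 0%N | 1%N | 2%N => (2, 4%N) | 3%N | 4%N => (1, 8%N) | _ => (1, 1%N) end.

Definition kreg (X : R) (k : nat) : nat -> nat -> nat -> bool :=
  region (R1 ^+ 2 / (kparam k).1 ^+ 2) (R2 ^+ 2 / (kparam k).1 ^+ 2) (Num.sqrt X / (kparam k).2%:R).

Definition fieldC (X : R) (K : splittingFieldType rat) := [/\ is_V4_quartic K, ramified K 2,
  ratr (discriminant K) < X & W_oC R1 R2 (shape_of_field R 3 K)].

Definition fieldI (X : R) (K : splittingFieldType rat) := [/\ is_V4_quartic K, ~ ramified K 2,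
  ratr (discriminant K) < X & W_oI R1 R2 (shape_of_field R 3 K)].

Lemma biquadratic_pos (K : fieldExtType rat) A B C : biquadratic K A B C ->
  [/\ (0 < `|A|)%N, (0 < `|B|)%N & (0 < `|C|)%N].
Proof. by move=> [adm _]; have [A0 B0 C0] := admissible_neq0 adm; rewrite !absz_gt0. Qed.

Lemma region_coneE (m : R) (d : nat) (X : R) (a b c : nat) : 0 < m -> (0 < d)%N -> (0 < a)%N -> (0 < c)%N -> (c <= b)%N ->
  region (R1 ^+ 2 / m ^+ 2) (R2 ^+ 2 / m ^+ 2) (Num.sqrt X / d%:R) a b c =
  ((R1 <= m * Num.sqrt (a%:R / b%:R)) && (m * Num.sqrt (a%:R / c%:R) < R2)) &&
   ((a * b * c)%N%:R < Num.sqrt X / d%:R).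
Proof.
move=> m0 d0 a0 c0 cb; have b0 : (0 < b)%N by apply: leq_trans cb.
rewrite /region cb [R1 <= _]leNgt !ratio_lt // -leNgt /=.
by rewrite andbA.
Qed.

Lemma fieldC_region (X : R) (K : splittingFieldType rat) A B C : biquadratic K A B C ->
  (`|C| <= `|B|)%N ->
  (typeR2 A B C -> fieldC X K <-> kreg X 0 `|A| `|B| `|C|) /\
  (typeR1 A B C -> fieldC X K <-> kreg X 3 `|A| `|B| `|C|).
Proof.
move=> hK CB; have [A0 B0 C0] := biquadratic_pos hK.
have [adm [a [b [c hb]]]] := hK.
have m1 : 0 < 1 :> R by []; have m2 : 0 < 2 :> R by [].
split=> t.
- rewrite /kreg /= region_coneE //; have o := ratio_order m2 A0 C0 CB.
  have W := W_oC_sh o; rewrite -(shapeR2 R hK t) in W.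
  have <- : (ratr (discriminant K) < X) = ((`|A| * `|B| * `|C|)%N%:R < Num.sqrt X / 4%:R).
    by rewrite -(@disc_lt 4) // (discriminantR2 hb adm t) -natrX.
  split; first by move=> [_ _ h /W ->].
  by move=> /andP[/W h1 h2]; split=> //; [exact: biq_V4 hb|exact: ramifiedR2 hb adm t].
- rewrite /kreg /= region_coneE // !mul1r; have := ratio_order m1 A0 C0 CB; rewrite !mul1r => o.
  have W := W_oC_sh o; rewrite -(shapeR1 R hK t) in W.
  have <- : (ratr (discriminant K) < X) = ((`|A| * `|B| * `|C|)%N%:R < Num.sqrt X / 8%:R).
    by rewrite -(@disc_lt 8) // (discriminantR1 hb adm t) -natrX.
  split; first by move=> [_ _ h /W ->].
  by move=> /andP[/W h1 h2]; split=> //; [exact: biq_V4 hb|exact: ramifiedR1 hb adm t].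
Qed.

Lemma fieldI_region (X : R) (K : splittingFieldType rat) A B C : R2 < 1 -> biquadratic K A B C ->
  typeU A B C -> (`|A| <= `|C| <= `|B|)%N -> fieldI X K <-> kreg X 5 `|A| `|B| `|C|.
Proof.
move=> r21 hK t o; have [A0 B0 C0] := biquadratic_pos hK.
have [adm [a [b [c hb]]]] := hK.
have /andP[AC CB] := typeU_strict adm t o.
have [a0 b0 c0] : [/\ 0 < (`|A|%N)%:R :> R, 0 < (`|B|%N)%:R :> R & 0 < (`|C|%N)%:R :> R] by rewrite !ltr0n.
rewrite /kreg /= region_coneE // ?(ltnW CB) // !mul1r.
have x0 : 0 < Num.sqrt ((`|A|%N)%:R / (`|B|%N)%:R) :> R by rewrite sqrtr_gt0 divr_gt0.
have xy : Num.sqrt ((`|A|%N)%:R / (`|B|%N)%:R) < Num.sqrt ((`|A|%N)%:R / (`|C|%N)%:R) :> R.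
  by rewrite ltr_sqrt ?divr_gt0 // ltr_pM2l // ltf_pV2 ?posrE // ltr_nat.
have y1 : Num.sqrt ((`|A|%N)%:R / (`|C|%N)%:R) < 1 :> R.
  by rewrite -[ltRHS]sqrtr1 ltr_sqrt // ltr_pdivrMr // mul1r ltr_nat.
have W := W_oI_sh r21 x0 xy y1; rewrite -(shapeU R hK t) in W.
have <- : (ratr (discriminant K) < X) = ((`|A| * `|B| * `|C|)%N%:R < Num.sqrt X / 1%:R).
  rewrite -(@disc_lt 1) //; congr (ratr _ < _).
  by rewrite (discriminantU hb adm t) -[1%:R]/(1 : rat) expr1n mul1r.
split; first by move=> [_ _ h /W ->].
by move=> /andP[/W h1 h2]; split=> //; [exact: biq_V4 hb|exact: unramifiedU hb adm t].
Qed.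

Lemma kreg_order X k a b c : kreg X k a b c -> (c <= b)%N.
Proof. by case/and4P. Qed.

Lemma kreg_eq X k k' : kparam k = kparam k' -> kreg X k = kreg X k'.
Proof. by rewrite /kreg => ->. Qed.

Lemma kreg_lt X a b c : R2 <= 1 -> (0 < c)%N -> kreg X 5 a b c -> (a < c)%N.
Proof.
move=> r21 c0 /and4P[_ _ h _]; rewrite -(ltr_nat R); apply: (lt_le_trans h) => /=.
have c0' : 0 < c%:R :> R by rewrite ltr0n.
by rewrite expr1n divr1 ler_piMl ?(ltW c0') // exprn_ile1 // ltW.
Qed.

Lemma coded_fieldC X (K : splittingFieldType rat) k a b c :
  coded 5 0 (kreg X) K k a b c -> fieldC X K.
Proof.
move=> [/andP[_ k5] /and3P[hp hg ha] hr hK].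
have CB : (`|codeC k c| <= `|sg4 b|)%N by rewrite absz_codeC absz_sg4; apply: kreg_order hr.
have [h2 h1] := fieldC_region X hK CB; rewrite absz_codeA absz_codeC absz_sg4 in h1 h2.
have [k3|k3] := ltnP k 3.
  apply/h2; first exact: code_typeR2 hp.
  by rewrite (@kreg_eq X 0 k) //; case: k k3 {hp hg ha hr hK CB h1 h2 k5} => [|[|[|]]].
have k35 : (3 <= k < 5)%N by rewrite k3.
apply/h1; first exact: code_typeR1 hp.
by rewrite (@kreg_eq X 3 k) //; case: k k35 {hp hg ha hr hK CB h1 h2 k5 k3} => [|[|[|[|[|]]]]].
Qed.

Lemma code_exists X (K : splittingFieldType rat) A B C : biquadratic K A B C ->
  (`|C| <= `|B|)%N -> typeR2 A B C \/ typeR1 A B C -> fieldC X K ->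
  exists k a b c, coded 5 0 (kreg X) K k a b c.
Proof.
move=> hK CB t hf.
have mk (A' B' C' : int) k : biquadratic K A' B' C' -> (`|C'| <= `|B'|)%N -> typeR2 A' B' C' \/ typeR1 A' B' C' ->
    [/\ (k < 5)%N, code_par k `|A'| `|B'| `|C'|, codeA k `|A'| = A', sg4 `|B'| = B' & codeC k `|C'| = C'] ->
    kparam k = (if (k < 3)%N then kparam 0 else kparam 3) -> (typeR2 A' B' C' -> (k < 3)%N) -> (typeR1 A' B' C' -> (3 <= k)%N) ->
    ~~ [&& k == 4%N, `|B'|%N == 1%N & `|C'|%N == 1%N] -> coded 5 0 (kreg X) K k `|A'| `|B'| `|C'|.
  move=> hK' CB' t' [k5 hp eA eB eC] hk t2 t1 nt; have [adm' _] := hK'.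
  have [r2 r1] := fieldC_region X hK' CB'.
  split; rewrite ?eA ?eB ?eC //.
    rewrite /code_ok hp (admissible_oddgood adm') /code_adm eA eB eC nt andbT /=.
    by case: adm' => *; apply/and3P; split.
  case: t' => t'.
    by rewrite (@kreg_eq X k 0); [apply/(r2 t')|rewrite hk t2].
  by rewrite (@kreg_eq X k 3); [apply/(r1 t')|rewrite hk ltnNge t1].
have excl A' B' C' : typeR2 A' B' C' -> typeR1 A' B' C' -> False.
  by move=> [a1 [b1 [c1 [r1 [_ _ e1 _]]]]] [a2 [b2 [c2 [_ _ e2]]]]; move: e1 e2; clear; lia.
case: (t) => t'.
  have [k [k3 hp eA eB eC]] := typeR2_code t'.
  exists k, `|A|%N, `|B|%N, `|C|%N; apply: mk => //.
  - by split=> //; apply: leq_trans k3 _.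
  - by rewrite k3; case: k k3 {hp eA eC} => [|[|[|]]].
  - by move=> t1; case: (excl _ _ _ t' t1).
  - by case: k k3 {hp eA eC} => [|[|[|]]].
have t1E (A' B' C' : int) k : typeR1 A' B' C' -> (3 <= k < 5)%N -> 
   [/\ kparam k = (if (k < 3)%N then kparam 0 else kparam 3), typeR2 A' B' C' -> (k < 3)%N & typeR1 A' B' C' -> (3 <= k)%N].
  move=> t1 k35; split; [by case: k k35 => [|[|[|[|[|]]]]]|by move=> t2; case: (excl _ _ _ t2 t1)|by case/andP: k35].
have [k [k35 hp eA eB eC]] := typeR1_code t'.
have [k1 k2 k3] := t1E _ _ _ _ t' k35; have /andP[_ k5] := k35.
(* The excluded triple (A, 1, -1) is replaced: negating it and exchanging the last two entries gives
   (-A, 1, -1), which describes the same field and has kind 3. *)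
case: (boolP [&& k == 4%N, `|B|%N == 1%N & `|C|%N == 1%N]) => [/and3P[/eqP k4 /eqP B1 /eqP C1]|nt]; last first.
  by exists k, `|A|%N, `|B|%N, `|C|%N; exact: (mk A B C k hK CB t (And5 k5 hp eA eB eC) k1 k2 k3 nt).
have [a' [b' [c' [eA' eB' eC']]]] := t'.
have eB1 : B = 1 by move: B1 eB'; clear; lia.
have eC1 : C = -1 by move: C1 eC'; clear; lia.
have hK2 := biquadratic_swap23 (biquadraticN hK).
have e1 : - C = B by rewrite eC1 eB1 opprK.
have e2 : - B = C by rewrite eC1 eB1.
rewrite e1 e2 in hK2.
have t2 : typeR1 (- A) B C by exists (- a' - 1), b', c'; split=> //; rewrite eA'; ring.
have e3 : codeA 3 `|- A| = - A by rewrite abszN /=; rewrite k4 /= in eA; rewrite -{2}eA opprK.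
have hp3 : code_par 3 `|- A| `|B| `|C| by move: hp; rewrite k4 abszN.
have eC3 : codeC 3 `|C| = C by move: eC; rewrite k4.
exists 3%N, `|- A|%N, `|B|%N, `|C|%N.
have t23 : typeR2 (- A) B C -> (3 < 3)%N by move=> t3; case: (excl _ _ _ t3 t2).
exact: (mk (- A) B C 3%N hK2 CB (or_intror t2) (And5 isT hp3 e3 eB eC3) erefl t23 (fun=> isT) isT).
Qed.

Lemma code_kind k k' a b c : (k < 5)%N -> (k' < 5)%N -> (0 < a)%N -> (0 < c)%N ->
  code_par k a b c -> code_par k' a b c -> codeA k' a = codeA k a -> codeC k' c = codeC k c -> k = k'.
Proof.
have f3 x : odd x -> (x %% 4 == 2)%N -> False by clear; lia.
have fN (n : int) : n != 0 -> n = - n -> False by clear; lia.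
move=> k5 k5' a0 c0.
have fA : a%:Z = - a%:Z -> False by apply: fN; rewrite -absz_gt0 absz_nat.
have fC : sg4 c = - sg4 c -> False by apply: fN; rewrite -absz_gt0 absz_sg4.
have fC' e : False := fC (esym e); have fA' e : False := fA (esym e).
case: k k5 => [|[|[|[|[|k]]]]] // _; case: k' k5' => [|[|[|[|[|k']]]]] // _;
  rewrite /code_par /codeA /codeC => /and3P[h1 h2 h3] /and3P[h1' _ _] e1 e3 //; exfalso;
  solve [exact: (f3 _ h1 h1') | exact: (f3 _ h1' h1) | exact: fA e1 | exact: fA' e1 | exact: fC e3 | exact: fC' e3].
Qed.

Lemma code_uniqC X K k a b c k' a' b' c' : coded 5 0 (kreg X) K k a b c ->
  coded 5 0 (kreg X) K k' a' b' c' -> [/\ k = k', a = a', b = b' & c = c'].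
Proof.
move=> [/andP[_ k5] /and3P[hp hg ha] hr hK] [/andP[_ k5'] /and3P[hp' hg' ha'] hr' hK'].
have ty j x y z : (j < 5)%N -> code_par j x y z -> typeR2 (codeA j x) (sg4 y) (codeC j z) \/ typeR1 (codeA j x) (sg4 y) (codeC j z).
  move=> j5 hj; have [j3|j3] := ltnP j 3; first by left; exact: code_typeR2 hj.
  by right; apply: code_typeR1 hj; rewrite j3.
have CB : (`|codeC k c| <= `|sg4 b|)%N by rewrite absz_codeC absz_sg4; apply: kreg_order hr.
have CB' : (`|codeC k' c'| <= `|sg4 b'|)%N by rewrite absz_codeC absz_sg4; apply: kreg_order hr'.
have eabs (x y x' y' z z' : nat) j j' : `|codeA j x|%N = `|codeA j' x'|%N -> `|sg4 y|%N = `|sg4 y'|%N ->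
    `|codeC j z|%N = `|codeC j' z'|%N -> [/\ x = x', y = y' & z = z'].
  by rewrite !absz_codeA !absz_sg4 !absz_codeC.
have [A0 B0 C0] := biquadratic_pos hK; rewrite absz_codeA absz_codeC absz_sg4 in A0 B0 C0.
case: (typed_uniqR hK hK' (ty _ _ _ _ k5 hp) (ty _ _ _ _ k5' hp') CB CB') => [[e1 e2 e3]|[e1 e2 e3 e4 e5]].
  have [e4 e5 e6] := eabs _ _ _ _ _ _ _ _ (congr1 absz e1) (congr1 absz e2) (congr1 absz e3).
  subst a' b' c'; split=> //.
  exact: (code_kind k5 k5' A0 C0 hp hp' e1 e3).
(* In the exceptional alternative C = -1, so both codes have kind 3 or 4 with b = c = 1. The last
   clause of [code_adm] excludes kind 4, and kind 3 twice would give A = - A. *)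
have k34 : (3 <= k)%N.
  rewrite leqNgt; apply/negP => k3; move: e3 hp; clear -k3; case: k k3 => [|[|[|k]]] //= _ e /and3P[_ _ h];
  move: e h; rewrite /sg4; case: ifP; lia.
have k34' : (3 <= k')%N.
  rewrite leqNgt; apply/negP => k3; move: e5 hp'; clear -k3; case: k' k3 => [|[|[|k']]] //= _ e /and3P[_ _ h];
  move: e h; rewrite /sg4; case: ifP; lia.
have b1 : b = 1%N by have := congr1 absz e2; rewrite absz_sg4.
have c1 : c = 1%N by have := congr1 absz e3; rewrite absz_codeC.
have b1' : b' = 1%N by have := congr1 absz e4; rewrite absz_sg4.
have c1' : c' = 1%N by have := congr1 absz e5; rewrite absz_codeC.
subst b c b' c'; move: ha ha' => /and4P[_ _ _ n4] /and4P[_ _ _ n4']; rewrite !andbT in n4 n4'.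
have e6 : a = a' by have := congr1 absz e1; rewrite abszN !absz_codeA.
move: e1 A0 n4 n4' k5 k5' k34 k34'; rewrite e6; clear.
case: k => [|[|[|[|[|k]]]]] //; case: k' => [|[|[|[|[|k']]]]] //= e a0 _ _ _ _ _ _; exfalso; move: e a0; lia.
Qed.

Lemma code_uniqI X K k a b c k' a' b' c' : R2 <= 1 -> coded 1 5 (kreg X) K k a b c ->
  coded 1 5 (kreg X) K k' a' b' c' -> [/\ k = k', a = a', b = b' & c = c'].
Proof.
move=> r21 [k5 /and3P[hp hg ha] hr hK] [k5' /and3P[hp' hg' ha'] hr' hK'].
have ek : k = 5%N by move: k5; clear; lia.
have ek' : k' = 5%N by move: k5'; clear; lia.
subst k k'; have [A0 B0 C0] := biquadratic_pos hK; have [A0' B0' C0'] := biquadratic_pos hK'.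
rewrite absz_codeC in C0; rewrite absz_codeC in C0'.
have o x y z : (0 < z)%N -> kreg X 5 x y z -> (`|codeA 5 x| <= `|codeC 5 z| <= `|sg4 y|)%N.
  by move=> z0 h; rewrite absz_codeA absz_codeC absz_sg4 (ltnW (kreg_lt r21 z0 h)) (kreg_order h).
have [e1 e2 e3] := typed_uniqU hK hK' (code_typeU hp) (code_typeU hp') (o _ _ _ C0 hr) (o _ _ _ C0' hr').
have := congr1 absz e1; have := congr1 absz e2; have := congr1 absz e3.
by rewrite !absz_codeA !absz_sg4 ?absz_codeC => -> -> ->.
Qed.

Lemma num_fieldC X n : (forall k a b c, (k < 5)%N -> kreg X k a b c -> [/\ (a < n)%N, (b < n)%N & (c < n)%N]) ->
  num_iso_classes (fieldC X) (\sum_(i < 5) \sum_(p : 'I_n * 'I_n * 'I_n)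
     (code_ok (0 + i) p.1.1 p.1.2 p.2 && kreg X (0 + i) p.1.1 p.1.2 p.2)).
Proof.
move=> hn; apply: iso_count.
- exact: coded_fieldC.
- exact: code_uniqC.
- move=> K hf; have [v4 hram _ _] := hf.
  have [A [B [C [hK [[t _]|[t CB]]]]]] := V4_normal_form v4.
    by have [adm [a [b [c hb]]]] := hK; case: (unramifiedU hb adm t).
  exact: code_exists hK CB t hf.
- by move=> k a b c /andP[_ k5]; exact: hn.
Qed.

Lemma num_fieldI X n : R2 < 1 -> (forall a b c, kreg X 5 a b c -> [/\ (a < n)%N, (b < n)%N & (c < n)%N]) ->
  num_iso_classes (fieldI X) (\sum_(i < 1) \sum_(p : 'I_n * 'I_n * 'I_n)
     (code_ok (5 + i) p.1.1 p.1.2 p.2 && kreg X (5 + i) p.1.1 p.1.2 p.2)).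
Proof.
move=> r21 hn; apply: iso_count.
- move=> K k a b c [k5 /and3P[hp hg ha] hr hK].
  have ek : k = 5%N by move: k5; clear; lia.
  subst k; have [A0 B0 C0] := biquadratic_pos hK; rewrite absz_codeC in C0.
  apply/(fieldI_region X r21 hK (code_typeU hp)).
    by rewrite absz_codeA absz_codeC absz_sg4 (ltnW (kreg_lt (ltW r21) C0 hr)) (kreg_order hr).
  by rewrite absz_codeA absz_codeC absz_sg4.
- by move=> *; apply: code_uniqI (ltW r21) _ _; eassumption.
- move=> K hf; have [v4 hram _ _] := hf.
  have [A [B [C [hK [[t o]|[t CB]]]]]] := V4_normal_form v4; last first.
    have [adm [a [b [c hb]]]] := hK; case: hram.
    by case: t => t; [exact: ramifiedR2 hb adm t|exact: ramifiedR1 hb adm t].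
  have [adm _] := hK; have [hp eA eB eC] := typeU_code t.
  exists 5%N, `|A|%N, `|B|%N, `|C|%N; split; rewrite ?eA ?eB ?eC //.
    rewrite /code_ok hp (admissible_oddgood adm) /code_adm eA eB eC andbT /=.
    by case: adm => *; apply/and3P; split.
  by apply/(fieldI_region X r21 hK t o).
- move=> k a b c k5; have -> : k = 5%N by move: k5; clear; lia.
  exact: hn.
Qed.

End ShapeConditions.

(** * Asymptotics for each kind of code *)

Section CodeAsymptotics.
Variable R : realType.

Lemma cube_root (y : R) : 0 < y -> exists2 t : R, 0 < t & t ^+ 3 = y.
Proof.
move=> y0; exists (y `^ 3^-1); first exact: powR_gt0.
by rewrite -powR_mulrn ?powR_ge0 // -powRrM mulVf ?powRr1 ?ltW.
Qed.

Lemma lt_of_cube (s t : R) : 0 <= t -> s ^+ 3 < t ^+ 3 -> s < t.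
Proof.
move=> t0; rewrite [s < t]ltNge; apply: contraTN => ts; rewrite -leNgt.
by rewrite !(exprS _ 2) ler_pM ?exprn_ge0 // !expr2 ler_pM.
Qed.

(** This is [region_limit] after the substitution sqrt X = q t^3 with q = d r1. The cutoff there
    must exceed multiples of t; since t <= (1 + 1/q)(1 + q t^3), a multiple of 1 + sqrt X is large
    enough, which gives M. *)
Lemma region_law (w : nat -> nat -> nat -> R) (delta r1 r2 : R) (d : nat) :
  (forall a b c, 0 <= w a b c) -> 0 <= delta -> box_law w delta -> 0 < r1 -> r1 < r2 -> (0 < d)%N ->
  exists M : R, 0 < M /\ forall n : R -> nat, (forall X, 0 < X -> M * (1 + Num.sqrt X) <= (n X)%:R) ->
    (forall X a b c, region r1 r2 (Num.sqrt X / d%:R) a b c -> [/\ (a < n X)%N, (b < n X)%N & (c < n X)%N]) /\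
    wsum w (n X) (region r1 r2 (Num.sqrt X / d%:R)) / Num.sqrt X @[X --> +oo] -->
      delta * (ln (r2 / r1) ^+ 2 / 6) / d%:R.
Proof.
move=> w0 delta0 law r10 r12 d0; have d0' : 0 < d%:R :> R by rewrite ltr0n.
have [q qE] : exists q, q = d%:R * r1 by eexists.
have q0 : 0 < q by rewrite qE mulr_gt0.
have r20 : 0 < r2 by apply: lt_trans r12.
have rr0 : 0 < r2 / r1 by rewrite divr_gt0.
exists ((1 + r2 + r2 / r1) * (1 + q^-1)); have q1 : 0 < q^-1 by rewrite invr_gt0.
split; first by rewrite mulr_gt0 // !addr_gt0.
move=> n hn; pose N t := n ((q * t ^+ 3) ^+ 2).
have HN t : 0 < t -> [/\ r2 * t <= (N t)%:R, r2 / r1 * t <= (N t)%:R & t <= (N t)%:R].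
  move=> t0; have t3 : 0 < t ^+ 3 by rewrite exprn_gt0.
  have qt0 := mulr_gt0 q0 t3.
  have h := hn ((q * t ^+ 3) ^+ 2) (exprn_gt0 2 qt0); rewrite sqrtr_sqr gtr0_norm // in h.
  have tt : t <= (1 + q^-1) * (1 + q * t ^+ 3).
    have -> : (1 + q^-1) * (1 + q * t ^+ 3) = 1 + q^-1 + q * t ^+ 3 + t ^+ 3 by field; rewrite gt_eqF.
    have h1 : t <= 1 + t ^+ 3.
      have [t1|t1] := leP t 1; first by rewrite ler_wpDr // ltW.
      by rewrite ler_wpDl // -{1}[t]expr1 ler_weXn2l // ltW.
    have h2 : 0 < q * t ^+ 3 by rewrite mulr_gt0.
    by lra.
  have key s : 0 <= s -> s <= 1 + r2 + r2 / r1 -> s * t <= (N t)%:R.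
    move=> s0 hs; apply: le_trans h; rewrite -mulrA; apply: ler_pM => //; exact: ltW.
  have k1 := key 1 ler01; rewrite mul1r in k1.
  by split; [apply: key|apply: key|apply: k1]; lra.
have root X : 0 < X -> exists t, [/\ 0 < t, Num.sqrt X / d%:R = r1 * t ^+ 3, Num.sqrt X = q * t ^+ 3 & N t = n X].
  move=> X0; have s0 : 0 < Num.sqrt X by rewrite sqrtr_gt0.
  have [t t0 ht] := cube_root (divr_gt0 s0 q0); exists t.
  have e : Num.sqrt X = q * t ^+ 3 by rewrite ht mulrC divfK // gt_eqF.
  split=> //; first by rewrite e qE -mulrA mulrC mulKf // gt_eqF.
  by rewrite /N -e sqr_sqrtr // ltW.
split.
  move=> X a b c hr; have [X0|X0] := leP X 0.
    by move: hr => /and4P[_ _ _]; rewrite ler0_sqrtr // mul0r ltNge ler0n.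
  have [t [t0 e1 _ e3]] := root X X0; have [n1 n2 n3] := HN t t0.
  have lam1 : 1 < r2 / r1 by rewrite ltr_pdivlMr // mul1r.
  have e4 : r1 * (r2 / r1) ^+ 1 = r2 by rewrite expr1 mulrC divfK // gt_eqF.
  rewrite e1 -{1}e4 in hr; have [c1 b1 a1] := region_bounds r10 t0 hr.
  rewrite e4 in a1; rewrite expr1 in b1; rewrite -e3 -!(ltr_nat R); split.
  - by apply: lt_le_trans n1; apply: (lt_trans a1); rewrite ltr_pM2l.
  - by apply: lt_le_trans n2; apply: (lt_trans b1); rewrite ltr_pM2l.
  - exact: lt_le_trans n3.
have lim := region_limit w0 delta0 law r10 r12 HN.
apply/cvgrPdist_le => /= e e0.
have qe0 : 0 < e * q by rewrite mulr_gt0.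
have /cvgrPdist_le/(_ _ qe0)[T0 [_ hT]] := lim.
near=> X; have X0 : 0 < X by near: X; exact: nbhs_pinfty_gt.
have [t [t0 e1 e2 e3]] := root X X0.
have tT : T0 < t.
  have [T00|T00] := ltP T0 0; first by apply: lt_trans t0.
  apply: lt_of_cube; first exact: ltW.
  rewrite -(ltr_pM2l q0) -e2 -sqr_lt_sqrt ?mulr_ge0 ?exprn_ge0 ?(ltW q0) //.
  by near: X; apply: nbhs_pinfty_gt; rewrite num_real.
have := hT _ tT; rewrite /= e1 e2 e3; have t3 : 0 < t ^+ 3 by rewrite exprn_gt0.
set W := wsum _ _ _; move=> h.
have -> : delta * (ln (r2 / r1) ^+ 2 / 6) / d%:R - W / (q * t ^+ 3) =
  (delta * r1 * (ln (r2 / r1) ^+ 2 / 6) - W / t ^+ 3) / q.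
  by rewrite qE; field; rewrite !gt_eqF.
by rewrite normrM (gtr0_norm q1) ler_pdivrMr.
Unshelve. all: by end_near. Qed.

Lemma dens_prod (f g h : nat -> bool) :
  dens R 4 (fun a b c => [&& f a, g b & h c]) =
  (\sum_(a < 4) (f a)%:R) * (\sum_(a < 4) (g a)%:R) * (\sum_(a < 4) (h a)%:R) / 64.
Proof.
rewrite /dens sum3; congr (_ / _); last by rewrite -natrX.
by apply: eq_bigr => -[[a b] c] _ /=; case: (f a); case: (g b); case: (h c); rewrite /= ?(mul0r, mul1r, mulr0).
Qed.

Lemma dens_odd : dens R 4 par_odd = 1 / 8.
Proof. by rewrite dens_prod !big_ord_recl !big_ord0 /=; field. Qed.

Lemma dens_two : dens R 4 par_two = 1 / 16.
Proof. by rewrite (dens_prod (fun a => a %% 4 == 2)%N) !big_ord_recl !big_ord0 /=; field. Qed.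

Lemma code_par_periodic k : periodic 4 (code_par k).
Proof.
have o x : odd (x %% 4) = odd x by clear; lia.
by case: k => [|[|[|[|[|k]]]]] a b c; rewrite /= /par_odd /par_two ?modn_mod !o.
Qed.

Variables (R1 R2 : R).
Hypotheses (hR1 : 0 < R1) (hR12 : R1 < R2).

Let hR2 : 0 < R2. Proof. exact: lt_trans hR12. Qed.

Let kp0 k : 0 < (kparam R k).1 /\ (0 < (kparam R k).2)%N.
Proof. by case: k => [|[|[|[|[|k]]]]]. Qed.

(** A product equal to 1 forces b = 1 or c = 1, and c <= b; the excluded duplicates have c = 1 as
    well. *)
Lemma exceptional_code X k a b c : code_par k a b c -> kreg R1 R2 X k a b c ->
  ~~ code_adm k a b c -> c = 1%N.
Proof.
move=> hp hr; have cb := kreg_order hr.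
have c0 : (0 < c)%N by have /orP[] := code_parE hp => /and3P[_ _]; exact: odd_gt0.
have m1 (m n : int) : m * n = 1 -> (`|m| = 1 /\ `|n| = 1)%N.
  by move=> /(congr1 absz); rewrite abszM => /eqP; rewrite muln_eq1 => /andP[/eqP ? /eqP ?].
move=> had; apply: contrapT => c1; case/negP: had; apply/and4P; split.
- apply/eqP => /m1 []; rewrite absz_sg4 => _ b1; apply: c1.
  by apply/eqP; rewrite eqn_leq c0 -b1 cb.
- by apply/eqP => /m1 []; rewrite absz_codeC.
- by apply/eqP => /m1 []; rewrite absz_codeC.
- by apply/negP => /and3P[_ _ /eqP].
Qed.

Definition kcount (X : R) (k n : nat) : nat :=
  \sum_(p : 'I_n * 'I_n * 'I_n) (code_ok k p.1.1 p.1.2 p.2 && kreg R1 R2 X k p.1.1 p.1.2 p.2).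

(** For c = 1 the cone gives a < r2 and b < r2 / r1, so the triples that fail [code_adm] are bounded
    in number independently of X. *)
Lemma kcount_bounds k : exists E : R, forall X n,
  wsum (fun a b c => (code_par k a b c && oddgood a b c)%:R : R) n (kreg R1 R2 X k) - E <= (kcount X k n)%:R <=
  wsum (fun a b c => (code_par k a b c && oddgood a b c)%:R : R) n (kreg R1 R2 X k).
Proof.
have [m0 d0] := kp0 k.
have [r1 r1E] : exists r, r = R1 ^+ 2 / (kparam R k).1 ^+ 2 by eexists.
have [r2 r2E] : exists r, r = R2 ^+ 2 / (kparam R k).1 ^+ 2 by eexists.
have r10 : 0 < r1 by rewrite r1E divr_gt0 ?exprn_gt0.
have r20 : 0 < r2 by rewrite r2E divr_gt0 ?exprn_gt0.
have [qa [ha _ _]] := ceil_nat (ltW r20).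
have [qb [hb _ _]] := ceil_nat (ltW (divr_gt0 r20 r10)).
exists (qa%:R * qb%:R * 2%:R) => X n; rewrite /kcount natr_sum; apply/andP; split; last first.
  apply: ler_sum => -[[a b] c] _ /=; rewrite /code_ok.
  by case: (kreg _ _ _ _ _ _ _); case: (code_par _ _ _ _); case: (oddgood _ _ _);
    case: (code_adm _ _ _ _); rewrite /= ?mul1r ?mul0r.
rewrite lerBlDr.
apply: (le_trans (y := \sum_(p : 'I_n * 'I_n * 'I_n)
  ((code_ok k p.1.1 p.1.2 p.2 && kreg R1 R2 X k p.1.1 p.1.2 p.2)%:R +
    (p.1.1 < qa)%N%:R * (p.1.2 < qb)%N%:R * (p.2 < 2)%N%:R))).
  apply: ler_sum => -[[a b] c] _ /=.
  have z0 : 0 <= (a < qa)%N%:R * (b < qb)%N%:R * (c < 2)%N%:R :> R by rewrite !mulr_ge0.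
  case hr: (kreg R1 R2 X k a b c); last by rewrite mul0r addr_ge0.
  case hp: (code_par k a b c); last by rewrite mulr0 addr_ge0.
  case hg: (oddgood a b c); last by rewrite mulr0 addr_ge0.
  rewrite /code_ok hp hg /= andbT mul1r; case: (boolP (code_adm k a b c)) => had; first by rewrite lerDl.
  have c1 := exceptional_code hp hr had.
  move: hr => /and4P[h1 _ h2 _]; rewrite -r1E in h1; rewrite -r2E c1 mulr1 in h2.
  have aq : (a < qa)%N by rewrite -ha.
  have bq : (b < qb)%N.
    by rewrite -hb ltr_pdivlMr // mulrC; apply: le_lt_trans h1 h2.
  by rewrite aq bq c1 !mulr1 add0r.
rewrite big_split /= lerD2l.
have -> : \sum_(p : 'I_n * 'I_n * 'I_n) (p.1.1 < qa)%N%:R * (p.1.2 < qb)%N%:R * (p.2 < 2)%N%:R =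
  (\sum_(x < n) (x < qa)%N%:R) * (\sum_(x < n) (x < qb)%N%:R) * (\sum_(x < n) (x < 2)%N%:R) :> R by rewrite sum3.
by rewrite ler_pM ?mulr_ge0 ?sumr_ge0 ?count_lt // ler_pM ?sumr_ge0 ?count_lt.
Qed.

Lemma inv_sqrt_cvg (E : R) : E / Num.sqrt X @[X --> +oo] --> (0 : R).
Proof.
apply/cvgrPdist_le => /= e e0; near=> X.
have X0 : 0 < X by near: X; exact: nbhs_pinfty_gt.
have s0 : 0 < Num.sqrt X by rewrite sqrtr_gt0.
have h : `|E| / e < Num.sqrt X.
  rewrite -sqr_lt_sqrt ?divr_ge0 ?(ltW e0) //.
  by near: X; apply: nbhs_pinfty_gt; rewrite num_real.
rewrite sub0r normrN normrM normfV (gtr0_norm s0) ler_pdivrMr // mulrC -ler_pdivrMr //; exact: ltW.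
Unshelve. all: by end_near. Qed.

Lemma kcount_law k : exists M : R, 0 < M /\
  forall n : R -> nat, (forall X, 0 < X -> M * (1 + Num.sqrt X) <= (n X)%:R) ->
    (forall X a b c, kreg R1 R2 X k a b c -> [/\ (a < n X)%N, (b < n X)%N & (c < n X)%N]) /\
    (kcount X k (n X))%:R / Num.sqrt X @[X --> +oo] -->
      dens R 4 (code_par k) * P_const R * (2 / 3 * ln (R2 / R1) ^+ 2) / (kparam R k).2%:R.
Proof.
have [m0 d0] := kp0 k; have par4 := @code_par_periodic k.
have r10 : 0 < R1 ^+ 2 / (kparam R k).1 ^+ 2 by rewrite divr_gt0 ?exprn_gt0.
have r12 : R1 ^+ 2 / (kparam R k).1 ^+ 2 < R2 ^+ 2 / (kparam R k).1 ^+ 2.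
  by rewrite ltr_pM2r ?invr_gt0 ?exprn_gt0 // ltr_pXn2r ?nnegrE ?ltW.
have dl0 : 0 <= dens R 4 (code_par k) * P_const R by rewrite mulr_ge0 ?dens_ge0 ?P_const_ge0.
have [M [M0 hM]] := region_law (fun a b c => ler0n _ _) dl0 (sieve_law par4) r10 r12 d0.
exists M; split=> // n hn; have [b1 b2] := hM n hn; split=> //.
(* The region is described by squares of the coordinates, so its ratio is (R2 / R1)^2; the logarithm
   doubles, and 4/6 = 2/3. The scaling factor of the kind cancels. *)
have eL : ln (R2 ^+ 2 / (kparam R k).1 ^+ 2 / (R1 ^+ 2 / (kparam R k).1 ^+ 2)) ^+ 2 / 6 =
  2 / 3 * ln (R2 / R1) ^+ 2.
  have -> : R2 ^+ 2 / (kparam R k).1 ^+ 2 / (R1 ^+ 2 / (kparam R k).1 ^+ 2) = (R2 / R1) ^+ 2.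
    by field; rewrite !gt_eqF.
  by rewrite lnXn ?divr_gt0 // -mulr_natl; field.
rewrite eL in b2; have [E hE] := kcount_bounds k.
have b3 := cvgB b2 (inv_sqrt_cvg E); rewrite subr0 in b3.
pose W X := wsum (fun a b c => (code_par k a b c && oddgood a b c)%:R : R) (n X) (kreg R1 R2 X k).
apply: (@squeeze_cvgr _ _ _ _ (fun X => W X / Num.sqrt X - E / Num.sqrt X) (fun X => W X / Num.sqrt X)); [|exact: b3|exact: b2].
near=> X.
have X0 : 0 < X by near: X; exact: nbhs_pinfty_gt.
have s0 : 0 < Num.sqrt X by rewrite sqrtr_gt0.
have /andP[h1 h2] := hE X (n X).
by rewrite /W -mulrBl !ler_pM2r ?invr_gt0 // h1 h2.
Unshelve. all: by end_near. Qed.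

End CodeAsymptotics.

(** * The measure of a window of shapes *)

Section ShapeMeasure.
Variable R : realType.
Local Notation lb := (@lebesgue_measure R).

Lemma FTC_pos (f F : R -> R) (a b : R) : 0 < a -> a <= b ->
  (forall x : R, 0 < x -> is_derive x 1 F (f x)) -> (forall x : R, 0 < x -> {for x, continuous f}) ->
  (\int[lb]_(x in `[a, b]) (f x)%:E)%E = (F b - F a)%:E.
Proof.
move=> a0 ab dF cf; have [e|ne] := eqVneq a b.
  by rewrite -e subrr set_itv1 integral_set1.
have ltab : a < b by rewrite lt_neqAle ne.
have cF (x : R) : 0 < x -> F y @[y --> x] --> F x.
  move=> x0; have [dx _] := dF x x0.
  by apply/differentiable_continuous; rewrite -derivable1_diffP.
rewrite (@continuous_FTC2 _ f F) //.
- apply: continuous_in_subspaceT => x; rewrite inE /= in_itv /= => /andP[ax _].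
  by apply: cf; apply: lt_le_trans ax.
- split.
  + move=> x; rewrite in_itv /= => /andP[ax _].
    by have [] := dF x (lt_trans a0 ax).
  + by apply: cvg_at_right_filter; exact: cF.
  + by apply: cvg_at_left_filter; apply: cF; apply: lt_trans ltab.
- move=> x; rewrite in_itv /= => /andP[ax _]; rewrite derive1E.
  by have [_ ->] := dF x (lt_trans a0 ax).
Qed.

Lemma continuous_inv_pos (x : R) : 0 < x -> {for x, continuous (fun y : R => y^-1)}.
Proof. by move=> x0; apply: inv_continuous; rewrite gt_eqF. Qed.

Variables (R1 R2 : R) (s : bool).
Hypotheses (hR1 : 0 < R1) (hR12 : R1 < R2).

(** [s] selects the strict inequality of the oI shapes or the weak one of the oC shapes, so that one
    computation serves both. *)
Definition cone : set (R * R) :=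
  [set p | (R1 <= p.1) && (if s then p.1 < p.2 else p.1 <= p.2) && (p.2 < R2)].

Let dens2 (p : R * R) : \bar R := ((p.1 * p.2)^-1)%:E.

Let measurable_cone : measurable cone.
Proof.
have m1 : measurable_fun [set: R * R] (fun p : R * R => p.1) by exact: measurable_fst.
have m2 : measurable_fun [set: R * R] (fun p : R * R => p.2) by exact: measurable_snd.
have mb : measurable_fun [set: R * R] (fun p : R * R =>
    (R1 <= p.1) && (if s then p.1 < p.2 else p.1 <= p.2) && (p.2 < R2)).
  apply: measurable_and; last by apply: measurable_fun_ltr => //; exact: measurable_cst.
  apply: measurable_and; first by apply: measurable_fun_ler => //; exact: measurable_cst.
  by case: s; [apply: measurable_fun_ltr|apply: measurable_fun_ler].
have -> : cone = [set: R * R] `&` (fun p : R * R =>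
    (R1 <= p.1) && (if s then p.1 < p.2 else p.1 <= p.2) && (p.2 < R2)) @^-1` [set true].
  by apply/seteqP; split=> p /=; rewrite /cone /=; [move=> ->|case].
exact: mb.
Qed.

Let measurable_dens : measurable_fun [set: R * R] (dens2 \_ cone : R * R -> \bar R).
Proof.
apply/(measurable_restrictT _ measurable_cone).
(* On the cone both coordinates are positive, and writing the density with the exponential and
   logarithms gives measurability on the whole plane. *)
apply: (@eq_measurable_fun _ _ _ _ _ (EFin \o (fun p : R * R => expR (0 - ln p.1 - ln p.2)))).
  move=> p; rewrite inE /= => /andP[/andP[h1 h2] h3].
  have p1 : 0 < p.1 by apply: lt_le_trans h1.
  have p2 : 0 < p.2 by move: h2; case: s => h2; [apply: lt_trans h2|apply: lt_le_trans h2].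
  by rewrite /dens2 /= sub0r expRD !expRN !lnK ?posrE // invfM.
apply: measurable_funTS; apply/measurable_EFinP; apply: measurableT_comp => //.
apply: measurable_funB; last by apply: measurableT_comp; [exact: measurable_ln|exact: measurable_snd].
apply: measurable_funB; first exact: measurable_cst.
by apply: measurableT_comp; [exact: measurable_ln|exact: measurable_fst].
Qed.

Let inner (y : R) : fubini_G lb (dens2 \_ cone) y =
  ((fun y : R => (((ln y - ln R1) / y))%:E) \_ `[R1, R2[) y.
Proof.
rewrite /fubini_G /patch; case: ifPn => [|hy].
  rewrite inE /= in_itv /= => /andP[y1 y2].
  have y0 : 0 < y by apply: lt_le_trans y1.
  transitivity (\int[lb]_(x in [set` Interval (BLeft R1) (BSide s y)]) ((x^-1 / y)%:E))%E.
    rewrite [RHS]integral_mkcond; apply: eq_integral => x _; rewrite /patch.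
    have -> : ((x, y) \in cone) = (x \in [set` Interval (BLeft R1) (BSide s y)]).
      by apply/idP/idP; rewrite !inE /cone /= itv_boundlr /= y2 andbT /Order.le /=; case: s.
    by case: ifP => // _; rewrite /dens2 /= invfM.
  have cinv : forall x : R, 0 < x -> {for x, continuous (fun z : R => z^-1 / y)}.
    by move=> x x0; apply: cvgM; [exact: continuous_inv_pos|exact: cvg_cst].
  transitivity (\int[lb]_(x in `[R1, y]) ((x^-1 / y)%:E))%E.
    case: s => //; rewrite integral_itv_bndo_bndc //.
    apply/measurable_EFinP; apply: subspace_continuous_measurable_fun => //.
    apply: continuous_in_subspaceT => x; rewrite inE /= in_itv /= => /andP[ax _].
    by apply: cinv; apply: lt_le_trans ax.
  have dF : forall x : R, 0 < x -> is_derive x 1 (fun x : R => ln x * y^-1) (x^-1 / y).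
    move=> x x0; have dl := is_derive1_ln x0.
    apply: is_derive_eq.
    by rewrite /= scaler0 add0r /GRing.scale /= mulrC.
  by rewrite (FTC_pos hR1 y1 dF cinv) mulrBl.
rewrite integral0_eq // => x _; case: ifP => //; rewrite inE => /andP[/andP[h1 h2] h3].
case/negP: hy; rewrite inE /= in_itv /= h3 andbT.
by apply: (le_trans h1); move: h2; case: s => // /ltW.
Qed.

(** By Tonelli: integrating dx/x from R1 to y leaves (ln y - ln R1)/y, with primitive (ln y - ln
    R1)^2 / 2. *)
Lemma cone_integral :
  (\int[lb \x lb]_(p in cone) ((p.1 * p.2)^-1)%:E)%E = ((ln (R2 / R1)) ^+ 2 / 2)%:E.
Proof.
rewrite integral_mkcond fubini_tonelli2; first last.
- move=> p; rewrite /patch; case: ifP => //; rewrite inE /= => /andP[/andP[h1 h2] h3].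
  rewrite lee_fin invr_ge0 mulr_ge0 //; first by apply: le_trans h1; exact: ltW.
  by apply: (le_trans (ltW hR1)); apply: (le_trans h1); move: h2; case: s => // /ltW.
- exact: measurable_dens.
transitivity (\int[lb]_(y in `[R1, R2[) (((ln y - ln R1) / y))%:E)%E.
  by rewrite [RHS]integral_mkcond; apply: eq_integral => y _; exact: inner.
have cf : forall x : R, 0 < x -> {for x, continuous (fun y : R => (ln y - ln R1) / y)}.
  move=> x x0; apply: cvgM; last exact: continuous_inv_pos.
  by apply: cvgB; [exact: continuous_ln|exact: cvg_cst].
rewrite integral_itv_bndo_bndc; last first.
  apply/measurable_EFinP; apply: subspace_continuous_measurable_fun => //.
  apply: continuous_in_subspaceT => x; rewrite inE /= in_itv /= => /andP[ax _].
  by apply: cf; apply: lt_le_trans ax.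
have dF : forall x : R, 0 < x ->
    is_derive x 1 (fun y : R => (ln y - ln R1) * (ln y - ln R1) * 2^-1) ((ln x - ln R1) / x).
  move=> x x0; have dl := is_derive1_ln x0.
  apply: is_derive_eq.
  by rewrite /GRing.scale /=; field; rewrite gt_eqF.
rewrite (FTC_pos hR1 (ltW hR12) dF cf) subrr mul0r mul0r subr0 -expr2 ln_div ?posrE //.
exact: lt_trans hR12.
Qed.

End ShapeMeasure.

Section Mu.
Variables (R : realType) (R1 R2 : R).
Hypotheses (hR1 : 0 < R1) (hR12 : R1 < R2).

Lemma mu_oC_W : fine (mu_oC (W_oC R1 R2)) = ln (R2 / R1) ^+ 2 / 2.
Proof.
rewrite /mu_oC (_ : [set p | _] = cone R1 R2 false) ?cone_integral //.
apply/seteqP; split=> -[x y] /=.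
  move=> [h /(W_oC_sh R2 hR1 h)] /andP[h1 h2]; rewrite /cone /= h1 h2 andbT /=.
  by case/andP: h.
rewrite /cone /= => /andP[/andP[h1 h2] h3].
have h : 0 < x <= y by rewrite h2 (lt_le_trans hR1 h1).
by split=> //; apply/(W_oC_sh R2 hR1 h); rewrite h1 h3.
Qed.

Lemma mu_oI_W : R2 < 1 -> fine (mu_oI (W_oI R1 R2)) = ln (R2 / R1) ^+ 2 / 2.
Proof.
move=> r21; rewrite /mu_oI (_ : [set p | _] = cone R1 R2 true) ?cone_integral //.
apply/seteqP; split=> -[x y] /=.
  move=> [/andP[x0 xy] [y1 /(W_oI_sh hR1 r21 x0 xy y1)]] /andP[h1 h2].
  by rewrite /cone /= h1 h2 xy.
rewrite /cone /= => /andP[/andP[h1 h2] h3].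
have x0 := lt_le_trans hR1 h1; have y1 := lt_trans h3 r21.
by split; [rewrite x0|split=> //; apply/(W_oI_sh hR1 r21 x0 h2 y1); rewrite h1 h3].
Qed.

End Mu.

(** * Summing over the kinds of codes *)

Lemma littleo_of_limit (R : realType) (f : R -> R) (c : R) :
  f X / Num.sqrt X @[X --> +oo] --> c ->
  (fun X : R => f X - c * Num.sqrt X : R) =o_ (pinfty_nbhs R) (fun X : R => Num.sqrt X : R).
Proof.
move=> cf; apply/eqoP => e e0.
move/cvgrPdist_le : cf => /(_ _ e0) h; near=> X.
have X0 : 0 < X by near: X; exact: nbhs_pinfty_gt.
have s0 : 0 < Num.sqrt X by rewrite sqrtr_gt0.
have hX : `|c - f X / Num.sqrt X| <= e by near: X; exact: h.
rewrite /= -{1}[f X](divfK (lt0r_neq0 s0)) -mulrBl normrM ler_pM2r ?normr_gt0 ?gt_eqF //.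
by rewrite distrC.
Unshelve. all: by end_near. Qed.

Section Assembly.
Variables (R : realType) (R1 R2 : R).
Hypotheses (hR1 : 0 < R1) (hR12 : R1 < R2).

(** One cutoff n has to serve all kinds at once; the sum of their constants dominates each of
    them. *)
Lemma kcount_sum (m k0 : nat) : exists n : R -> nat,
  (forall X k a b c, (k0 <= k < k0 + m)%N -> kreg R1 R2 X k a b c ->
     [/\ (a < n X)%N, (b < n X)%N & (c < n X)%N]) /\
  (\sum_(i < m) kcount R1 R2 X (k0 + i) (n X))%N%:R / Num.sqrt X @[X --> +oo] -->
    \sum_(i < m) dens R 4 (code_par (k0 + i)) * P_const R * (2 / 3 * ln (R2 / R1) ^+ 2) /
      (kparam R (k0 + i)).2%:R.
Proof.
pose Mf k := projT1 (cid (kcount_law hR1 hR12 k)).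
have [Mf0 hMf] : (forall k, 0 < Mf k) /\ forall k (n : R -> nat),
    (forall X, 0 < X -> Mf k * (1 + Num.sqrt X) <= (n X)%:R) ->
    (forall X a b c, kreg R1 R2 X k a b c -> [/\ (a < n X)%N, (b < n X)%N & (c < n X)%N]) /\
    (kcount R1 R2 X k (n X))%:R / Num.sqrt X @[X --> +oo] -->
      dens R 4 (code_par k) * P_const R * (2 / 3 * ln (R2 / R1) ^+ 2) / (kparam R k).2%:R.
  by split=> k; rewrite /Mf; case: (cid _) => M /= [].
pose M := \sum_(i < m) Mf (k0 + i)%N.
pose n X := (Num.truncn (M * (1 + Num.sqrt X))).+1.
have hn k X : (k0 <= k < k0 + m)%N -> 0 < X -> Mf k * (1 + Num.sqrt X) <= (n X)%:R.
  move=> hk X0; have s0 : 0 <= 1 + Num.sqrt X by rewrite addr_ge0 ?sqrtr_ge0.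
  apply: (le_trans (y := M * (1 + Num.sqrt X))); last by rewrite ltW // truncnS_gt.
  apply: ler_wpM2r => //; have km : (k - k0 < m)%N by move: hk; clear; lia.
  rewrite /M (bigD1 (Ordinal km)) //= subnKC; last by case/andP: hk.
  by rewrite lerDl sumr_ge0 // => i _; exact: ltW.
exists n; split.
  move=> X k a b c hk; have [h _] := hMf k n (fun X => hn k X hk); exact: h.
have e : (fun X => (\sum_(i < m) kcount R1 R2 X (k0 + i) (n X))%N%:R / Num.sqrt X) =
   (fun X => \sum_(i < m) ((kcount R1 R2 X (k0 + i) (n X))%:R / Num.sqrt X)).
  by apply/funext => X; rewrite natr_sum mulr_suml.
rewrite e; apply: cvg_fsum => i.
have hk : (k0 <= k0 + i < k0 + m)%N by rewrite leq_addr ltn_add2l ltn_ord.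
by have [_ h] := hMf (k0 + i)%N n (fun X => hn (k0 + i)%N X hk).
Qed.

End Assembly.

Theorem theorem5p10 (R : realType) (R1 R2 : R) (hR1 : 0 < R1) (hR12 : R1 < R2) :
  (exists N : R -> nat,
     (forall X : R, num_iso_classes
        (fun K => [/\ is_V4_quartic K, ramified K 2,
                      ratr (discriminant K) < X
                    & W_oC R1 R2 (shape_of_field R 3 K)]) (N X)) /\
     (fun X : R => (N X)%:R -
        5 / 48 * P_const R * Num.sqrt X * fine (mu_oC (W_oC R1 R2)) : R)
       =o_ (pinfty_nbhs R) (fun X : R => Num.sqrt X : R)) /\
  (R2 < 1 ->
   exists N : R -> nat,
     (forall X : R, num_iso_classes
        (fun K => [/\ is_V4_quartic K, ~ ramified K 2,
                      ratr (discriminant K) < X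
                    & W_oI R1 R2 (shape_of_field R 3 K)]) (N X)) /\
     (fun X : R => (N X)%:R -
        1 / 6 * P_const R * Num.sqrt X * fine (mu_oI (W_oI R1 R2)) : R)
       =o_ (pinfty_nbhs R) (fun X : R => Num.sqrt X : R)).
Proof.
split.
  have [n [hn lim]] := kcount_sum hR1 hR12 5 0.
  exists (fun X => (\sum_(i < 5) kcount R1 R2 X (0 + i) (n X))%N); split.
    by move=> X; apply: (num_fieldC hR1 hR12) => k a b c k5; apply: hn.
  rewrite (mu_oC_W hR1 hR12).
  rewrite (_ : (fun X : R => _) = fun X : R =>
      (\sum_(i < 5) kcount R1 R2 X (0 + i) (n X))%N%:R -
      5 / 48 * P_const R * (ln (R2 / R1) ^+ 2 / 2) * Num.sqrt X); last first.
    by apply/funext => X; congr (_ - _); ring.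
  apply: littleo_of_limit; move: lim.
  (* The kinds contribute (1/8)/4 + 2 (1/16)/4 + 2 (1/16)/8 = 5/64, and 5/64 times 2/3 is 5/96, half
     of 5/48; the measure of the window carries the other factor 1/2. *)
  by rewrite !big_ord_recl big_ord0 /= dens_odd !dens_two; congr (_ --> _); field.
move=> r21; have [n [hn lim]] := kcount_sum hR1 hR12 1 5.
exists (fun X => (\sum_(i < 1) kcount R1 R2 X (5 + i) (n X))%N); split.
  by move=> X; apply: (num_fieldI hR1 hR12) => // a b c; apply: hn.
rewrite (mu_oI_W hR1 hR12 r21).
rewrite (_ : (fun X : R => _) = fun X : R =>
    (\sum_(i < 1) kcount R1 R2 X (5 + i) (n X))%N%:R -
    1 / 6 * P_const R * (ln (R2 / R1) ^+ 2 / 2) * Num.sqrt X); last first.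
  by apply/funext => X; congr (_ - _); ring.
apply: littleo_of_limit; move: lim.
(* The single kind gives 1/8 times 2/3, that is 1/12, half of 1/6. *)
by rewrite !big_ord_recl big_ord0 /= dens_odd; congr (_ --> _); field.
Qed.
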